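(* Let $\Bbbk$ be a field of characteristic zero and $\lambda$ a nonzero dominant integral weight of $\mathfrak{sl}_\infty$. For all $n\in\mathbb{N}$, the functor $\mathbf F_n:\mathcal{H}^\lambda\to\mathcal{B}_n^\lambda$ is full.
   Context: Weight. $I$ is the image of $\mathbb{Z}$ in $\Bbbk$; $\lambda=\sum_{i\in I}\lambda_i\omega_i$ with $\lambda_i\in\mathbb{N}$, finitely many nonzero, $\lambda\neq 0$; $d=\sum_i\lambda_i$. The category $\tilde{\mathcal{H}}^\lambda$. It is the additive $\Bbbk$-linear strict monoidal category whose objects are formal direct sums of words $Q_\epsilon=Q_{\epsilon_1}\cdots Q_{\epsilon_k}$ in two generating objects $Q_+,Q_-$ (juxtaposition is tensor product, $\mathbf 1$ is the empty word). Morphisms $Q_\epsilon\to Q_{\epsilon'}$ are $\Bbbk$-linear combinations of planar diagrams: oriented compact 1-manifolds immersed in $\mathbb{R}\times[0,1]$ with only double intersections, with boundary $\epsilon$ at the bottom and $\epsilon'$ at the top ($+$ is oriented up, $-$ down), whose strands may carry dots (dots move freely along strands, including over cups and caps, but not through crossings), modulo isotopy fixing the boundary and modulo the local relations below. $f\circ g$ stacks $f$ on top of $g$; $\otimes$ is horizontal juxtaposition. In terms of generators: $x:Q_+\to Q_+$ (a dot on an upward strand), $s:Q_+Q_+\to Q_+Q_+$ (upward crossing), right cup $\eta:\mathbf 1\to Q_-Q_+$, right cap $\varepsilon:Q_+Q_-\to\mathbf 1$, left cup $\eta':\mathbf 1\to Q_+Q_-$, left cap $\varepsilon':Q_-Q_+\to\mathbf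 1$. Isotopy invariance means: $(\varepsilon\otimes 1_{Q_+})(1_{Q_+}\otimes\eta)=1_{Q_+}=(1_{Q_+}\otimes\varepsilon')(\eta'\otimes 1_{Q_+})$, $(1_{Q_-}\otimes\varepsilon)(\eta\otimes 1_{Q_-})=1_{Q_-}=(\varepsilon'\otimes 1_{Q_-})(1_{Q_-}\otimes\eta')$, and the left and right mates (rotations by $180^\circ$) of $x$ coincide (giving the dot $x^-:Q_-\to Q_-$), as do those of $s$ (giving the downward crossing $s^-$). Sideways crossings: $t=(1_{Q_-Q_+}\otimes\varepsilon)(1_{Q_-}\otimes s\otimes 1_{Q_-})(\eta\otimes 1_{Q_+Q_-}):Q_+Q_-\to Q_-Q_+$ and $t'=(\varepsilon'\otimes 1_{Q_+Q_-})(1_{Q_-}\otimes s\otimes 1_{Q_-})(1_{Q_-Q_+}\otimes\eta'):Q_-Q_+\to Q_+Q_-$. Counterclockwise bubbles: $\gamma_j=\varepsilon'(1_{Q_-}\otimes x^j)\eta\in\mathrm{End}(\mathbf 1)$. Put $c_0=1$, $c_s=(-1)^s\det(\gamma_{d+j-i})_{i,j=1,\dots,s}$ for $1\le s\le d$, and for $0\le j\le d-1$ let $x_j^\vee=\sum_{i=j}^{d-1}x^{i-j}\otimes c_{d-1-i}\in\mathrm{End}(Q_+)$ (dual dots). Local relations: $s^2=1$; the braid relation $(s\otimes 1)(1\otimes s)(s\otimes 1)=(1\otimes s)(s\otimes 1)(1\otimes s)$; $s(x\otimes 1)-(1\otimes x)s=1_{Q_+Q_+}=(x\otimes 1)s-s(1\otimes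 x)$; $1_{Q_-Q_+}=t\,t'+\sum_{j=0}^{d-1}(1_{Q_-}\otimes x^j)\,\eta\,\varepsilon'\,(1_{Q_-}\otimes x_j^\vee)$; $t'\,t=1_{Q_+Q_-}$; $\gamma_j=0$ for $j<d-1$, $\gamma_{d-1}=1$, $\gamma_d=\sum_{i\in I}i\lambda_i$; and $(\varepsilon'\otimes 1_{Q_+})(1_{Q_-}\otimes s)(\eta\otimes 1_{Q_+})=0$. $\mathcal{H}^\lambda$ is the idempotent completion (Karoubi envelope) of $\tilde{\mathcal{H}}^\lambda$. Degenerate cyclotomic Hecke algebras. $H_n$ is the $\Bbbk$-algebra generated by $s_1,\dots,s_{n-1},x_1,\dots,x_n$ with relations $s_i^2=1$; $s_is_j=s_js_i$ for $|i-j|>1$; $s_is_{i+1}s_i=s_{i+1}s_is_{i+1}$; $s_jx_i=x_is_j$ for $i\ne j,j+1$; $s_ix_i=x_{i+1}s_i-1$; $x_ix_j=x_jx_i$; $H_0=\Bbbk$. $H_n^\lambda=H_n/\langle\prod_{i\in I}(x_1-i)^{\lambda_i}\rangle$, $H_0^\lambda=\Bbbk$. The natural map $H_n^\lambda\to H_{n+1}^\lambda$ is injective, and $H_n^\lambda$ is viewed as a subalgebra. As $(H_n^\lambda,H_n^\lambda)$-bimodules $H_{n+1}^\lambda=H_n^\lambda s_nH_n^\lambda\oplus\bigoplus_{j=0}^{d-1}H_n^\lambda x_{n+1}^j$ with $H_n^\lambda s_nH_n^\lambda\cong H_n^\lambda\otimes_{H_{n-1}^\lambda}H_n^\lambda$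 ($us_nv\mapsto u\otimes v$) and $H_n^\lambda x_{n+1}^j\cong H_n^\lambda$ ($ux_{n+1}^j\mapsto u$). The trace $\mathrm{tr}_{n+1}:H_{n+1}^\lambda\to H_n^\lambda$ is the projection onto $H_n^\lambda x_{n+1}^{d-1}$ followed by $ux_{n+1}^{d-1}\mapsto u$. For $n\ge1$, $0\le k\le d-1$: $y_{n,k}=\sum_{t=k}^{d-1}(-1)^{d-1-t}x_n^{t-k}\det(\mathrm{tr}_n(x_n^{d+j-i}))_{i,j=1,\dots,d-1-t}$ (the empty determinant is $1$). Bimodules. $(n)$ denotes $H_n^\lambda$ as a bimodule over itself, ${}_n(n+1)$ and $(n+1)_n$ denote $H_{n+1}^\lambda$ as $(H_n^\lambda,H_{n+1}^\lambda)$- and $(H_{n+1}^\lambda,H_n^\lambda)$-bimodule; juxtaposition is tensor product over the common algebra, e.g. $(n+1)_n(n+1)=H_{n+1}^\lambda\otimes_{H_n^\lambda}H_{n+1}^\lambda$. $\mathcal{B}_n^\lambda$ is the category whose objects are direct sums (formal when the left algebras differ) of direct summands of tensor products of bimodules of the form $(k+1)_k$ and ${}_k(k+1)$ (over matching algebras) whose right action is by $H_n^\lambda$ (the empty product being $(n)$); morphisms are bimodule homomorphisms, with only zero morphisms between bimodules with different left algebras. Bimodule maps: $\varepsilon_R:(n+1)_n(n+1)\to(n+1)$, $a\otimes b\mapsto ab$; $\eta_R:(n)\to{}_n(n+1)_n$ the inclusion; $\varepsilon_L=\mathrm{tr}_{n+1}:{}_n(n+1)_n\to(n)$; $\eta_L:(n+1)\to(n+1)_n(n+1)$,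 $\eta_L(a)=a\sum_{i=1}^{n+1}\sum_{k=0}^{d-1}x_i^ks_i\cdots s_n\otimes s_n\cdots s_iy_{i,k}$ (for $i=n+1$ the products of $s$'s are empty). The functor $\mathbf F_n$. On objects: $Q_+\mapsto(k+1)_k$, $Q_-\mapsto{}_k(k+1)$, compatibly with tensor products, the $k$'s being determined by the requirement that the right action is by $H_n^\lambda$; an object for which some index becomes negative goes to $0$. On morphisms: label the rightmost region of a diagram by $n$, and label the other regions so that, moving right to left, labels increase by 1 across upward strands and decrease by 1 across downward strands. Then: right cap $\varepsilon$ with right region $m+1$ $\mapsto\varepsilon_R:(m+1)_m(m+1)\to(m+1)$; right cup $\eta$ with right region $m$ $\mapsto\eta_R$ (into ${}_m(m+1)_m$); left cap $\varepsilon'$ with right region $m$ $\mapsto\varepsilon_L=\mathrm{tr}_{m+1}$; left cup $\eta'$ with right region $m+1$ $\mapsto\eta_L$ (into $(m+1)_m(m+1)$); upward dot with right region $m$ $\mapsto$ right multiplication by $x_{m+1}$ on $(m+1)_m$; downward dot with left region $m$ $\mapsto$ left multiplication by $x_{m+1}$ on ${}_m(m+1)$; upward crossing with right region $m$ $\mapsto$ right multiplication by $s_{m+1}$ on $(m+2)_m$; downward crossing with right region $m$ $\mapsto$ left multiplication by $s_{m-1}$ on ${}_{m-2}(m)$; $t$ with right region $m$ $\mapsto$ the map $(m)_{m-1}(m)\to{}_m(m+1)_m$, $a\otimes a'\mapsto as_ma'$; $t'$ with right region $m$ $\mapsto$ the bimodule map ${}_m(m+1)_m\to(m)_{m-1}(m)$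 with $s_m\mapsto1\otimes1$, $x_{m+1}^j\mapsto0$ for $0\le j\le d-1$. This gives a well-defined additive functor, extended to the idempotent completion $\mathcal{H}^\lambda$. *)

(* Defs.v *)
From HB Require Import structures.
From mathcomp Require Import all_boot all_order all_algebra perm finmap.
From mathcomp Require Import boolp classical_sets.

Set Implicit Arguments.
Unset Strict Implicit.
Unset Printing Implicit Defensive.

Import GRing.Theory.
Local Open Scope ring_scope.
Local Open Scope quotient_scope.

Section PresentedAlgebra.
Variable k : fieldType.

Inductive aterm (G : Type) : Type :=
| AGen of G
| AConst of k
| AAdd of aterm G & aterm G
| AMul of aterm G & aterm G.

HB.instance Definition _ G := gen_eqMixin (aterm G).
HB.instance Definition _ G := gen_choiceMixin (aterm G).

Fixpoint asubst G G' (f : G -> aterm G') (t : aterm G) : aterm G' :=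
  match t with
  | AGen g => f g
  | AConst c => AConst G' c
  | AAdd t u => AAdd (asubst f t) (asubst f u)
  | AMul t u => AMul (asubst f t) (asubst f u)
  end.

(* The congruence generated by R and the axioms of associative unital
   k-algebras; AConst c stands for c times the unit. *)
Inductive aeq G (R : aterm G -> aterm G -> Prop) : aterm G -> aterm G -> Prop :=
| aeq_rel t u : R t u -> aeq R t u
| aeq_refl t : aeq R t t
| aeq_sym t u : aeq R t u -> aeq R u t
| aeq_trans t u v : aeq R t u -> aeq R u v -> aeq R t v
| aeq_add t t' u u' : aeq R t t' -> aeq R u u' -> aeq R (AAdd t u) (AAdd t' u')
| aeq_mul t t' u u' : aeq R t t' -> aeq R u u' -> aeq R (AMul t u) (AMul t' u')
| aeq_addA t u v : aeq R (AAdd t (AAdd u v)) (AAdd (AAdd t u) v)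
| aeq_addC t u : aeq R (AAdd t u) (AAdd u t)
| aeq_add0 t : aeq R (AAdd (AConst G 0) t) t
| aeq_mulA t u v : aeq R (AMul t (AMul u v)) (AMul (AMul t u) v)
| aeq_mul1 t : aeq R (AMul (AConst G 1) t) t
| aeq_mul0 t : aeq R (AMul (AConst G 0) t) (AConst G 0)
| aeq_mulDl t u v : aeq R (AMul (AAdd t u) v) (AAdd (AMul t v) (AMul u v))
| aeq_mulDr t u v : aeq R (AMul t (AAdd u v)) (AAdd (AMul t u) (AMul t v))
| aeq_constD c c' : aeq R (AConst G (c + c')) (AAdd (AConst G c) (AConst G c'))
| aeq_constM c c' : aeq R (AConst G (c * c')) (AMul (AConst G c) (AConst G c'))
| aeq_constC c t : aeq R (AMul (AConst G c) t) (AMul t (AConst G c)).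

Lemma aeq_asubst G G' (R : aterm G -> aterm G -> Prop)
    (R' : aterm G' -> aterm G' -> Prop) (f : G -> aterm G') :
  (forall t u, R t u -> aeq R' (asubst f t) (asubst f u)) ->
  forall t u, aeq R t u -> aeq R' (asubst f t) (asubst f u).
Proof.
move=> fR t u; elim=> /= *; by [apply: fR | apply: aeq_trans; eassumption
  | solve [constructor; assumption]].
Qed.

Section Quotient.
Variables (G : Type) (R : aterm G -> aterm G -> Prop).

Lemma aeq_equiv_refl : reflexive (fun t u => `[< aeq R t u >]).
Proof. by move=> t; apply/asboolP/aeq_refl. Qed.
Lemma aeq_equiv_sym : symmetric (fun t u => `[< aeq R t u >]).
Proof. by move=> t u; apply/asboolP/asboolP => /aeq_sym. Qed.
Lemma aeq_equiv_trans : transitive (fun t u => `[< aeq R t u >]).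
Proof.
by move=> t u v /asboolP tu /asboolP uv; apply/asboolP/(aeq_trans tu uv).
Qed.
Definition aeq_equiv :=
  EquivRel (fun t u => `[< aeq R t u >])
    aeq_equiv_refl aeq_equiv_sym aeq_equiv_trans.

Definition palg := {eq_quot aeq_equiv}.
HB.instance Definition _ := Choice.on palg.

Definition pclass (t : aterm G) : palg := \pi_{eq_quot aeq_equiv} t.

Lemma pclass_eq t u : pclass t = pclass u <-> aeq R t u.
Proof.
split=> [/eqmodP/asboolP //|tu].
by apply/eqmodP/asboolP.
Qed.

Lemma repr_pclass t : aeq R (repr (pclass t)) t.
Proof. by apply/pclass_eq; rewrite /pclass reprK. Qed.

Lemma pclass_repr a : pclass (repr a) = a.
Proof. exact: reprK. Qed.

Definition pconst c : palg := pclass (AConst G c).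
Definition padd (a b : palg) : palg := pclass (AAdd (repr a) (repr b)).
Definition pmul (a b : palg) : palg := pclass (AMul (repr a) (repr b)).
Definition popp (a : palg) : palg := pmul (pconst (-1)) a.

Lemma paddE t u : padd (pclass t) (pclass u) = pclass (AAdd t u).
Proof. by apply/pclass_eq/aeq_add; apply: repr_pclass. Qed.
Lemma pmulE t u : pmul (pclass t) (pclass u) = pclass (AMul t u).
Proof. by apply/pclass_eq/aeq_mul; apply: repr_pclass. Qed.

Lemma paddA : associative padd.
Proof.
move=> a b c; rewrite -(pclass_repr a) -(pclass_repr b) -(pclass_repr c) !paddE.
exact/pclass_eq/aeq_addA.
Qed.
Lemma paddC : commutative padd.
Proof.
move=> a b; rewrite -(pclass_repr a) -(pclass_repr b) !paddE.
exact/pclass_eq/aeq_addC.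
Qed.
Lemma padd0 : left_id (pconst 0) padd.
Proof.
by move=> a; rewrite -(pclass_repr a) paddE; apply/pclass_eq/aeq_add0.
Qed.
Lemma paddN : left_inverse (pconst 0) popp padd.
Proof.
move=> a; rewrite -(pclass_repr a) /popp pmulE paddE; apply/pclass_eq.
set t := repr a.
apply: aeq_trans (aeq_add (aeq_refl _ _) (aeq_sym (aeq_mul1 _ _))) _.
apply: aeq_trans (aeq_sym (aeq_mulDl _ _ _ _)) _.
apply: aeq_trans (aeq_mul (aeq_sym (aeq_constD _ _ _)) (aeq_refl _ _)) _.
by rewrite addNr; apply: aeq_mul0.
Qed.

HB.instance Definition _ := GRing.isZmodule.Build palg paddA paddC padd0 paddN.

Lemma pmulA : associative pmul.
Proof.
move=> a b c; rewrite -(pclass_repr a) -(pclass_repr b) -(pclass_repr c) !pmulE.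
exact/pclass_eq/aeq_mulA.
Qed.
Lemma pmul1 : left_id (pconst 1) pmul.
Proof.
by move=> a; rewrite -(pclass_repr a) pmulE; apply/pclass_eq/aeq_mul1.
Qed.
Lemma pconstC c a : pmul (pconst c) a = pmul a (pconst c).
Proof. by rewrite -(pclass_repr a) !pmulE; apply/pclass_eq/aeq_constC. Qed.
Lemma pmul1r : right_id (pconst 1) pmul.
Proof. by move=> a; rewrite -pconstC pmul1. Qed.
Lemma pmulDl : left_distributive pmul +%R.
Proof.
move=> a b c; rewrite -(pclass_repr a) -(pclass_repr b) -(pclass_repr c).
by rewrite -![_ + _]/(padd _ _) !(paddE, pmulE); apply/pclass_eq/aeq_mulDl.
Qed.
Lemma pmulDr : right_distributive pmul +%R.
Proof.
move=> a b c; rewrite -(pclass_repr a) -(pclass_repr b) -(pclass_repr c).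
by rewrite -![_ + _]/(padd _ _) !(paddE, pmulE); apply/pclass_eq/aeq_mulDr.
Qed.

HB.instance Definition _ :=
  GRing.Zmodule_isPzRing.Build palg pmulA pmul1 pmul1r pmulDl pmulDr.

End Quotient.
End PresentedAlgebra.

Arguments AGen {k G}.
Arguments AConst {k G}.

(* Since char k = 0, the image I of Z in k is identified with Z. *)
Definition weight := {fsfun int -> nat with 0%N}.
Definition level (lam : weight) : nat := (\sum_(i <- finsupp lam) lam i)%N.

(* Generators are numbered from 0: HX i and HS i are x_{i+1} and s_{i+1}. *)
Inductive hgen (n : nat) : Type := HX of 'I_n | HS of 'I_n.-1.

Section Hecke.
Variables (k : fieldType) (lam : weight).
Local Notation term n := (aterm k (hgen n)).

Definition tx n (i : nat) : term n :=
  if insub i is Some j then AGen (HX j) else AConst 0.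
Definition ts n (i : nat) : term n :=
  if insub i is Some j then AGen (HS j) else AConst 0.

Local Notation "t + u" := (AAdd t u).
Local Notation "t * u" := (AMul t u).

Inductive hrel (n : nat) : term n -> term n -> Prop :=
| hrel_ss (i : 'I_n.-1) : hrel (ts n i * ts n i) (AConst 1)
| hrel_far (i j : 'I_n.-1) : (i.+1 < j)%N ->
    hrel (ts n i * ts n j) (ts n j * ts n i)
| hrel_braid (i j : 'I_n.-1) : j = i.+1 :> nat ->
    hrel (ts n i * (ts n j * ts n i)) (ts n j * (ts n i * ts n j))
| hrel_sx_far (j : 'I_n.-1) (i : 'I_n) : i != j :> nat -> i != j.+1 :> nat ->
    hrel (ts n j * tx n i) (tx n i * ts n j)
| hrel_sx (i : 'I_n.-1) :
    hrel (ts n i * tx n i) (tx n i.+1 * ts n i + AConst (-1))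
| hrel_xx (i j : 'I_n) : hrel (tx n i * tx n j) (tx n j * tx n i)
| hrel_cyc : (0 < n)%N ->
    hrel (\big[@AMul k (hgen n) / AConst 1]_(i <- finsupp lam)
            iter (lam i) (AMul (tx n 0 + AConst (- i%:~R)%R))
                 (AConst 1))
         (AConst 0).

Definition hecke n := palg (@hrel n).
HB.instance Definition _ n := GRing.PzRing.on (hecke n).

(* x_{i+1} and s_{i+1} in H_n; the value is 0 when the index is out of range,
   in particular sH 1 0 = 0, which makes H_0 s_0 H_0 the zero bimodule. *)
Definition xH n i : hecke n := pclass (@hrel n) (tx n i).
Definition sH n i : hecke n := pclass (@hrel n) (ts n i).
Definition cH n (c : k) : hecke n := pconst (@hrel n) c.

Definition gsub m n (g : hgen m) : term n :=
  match g with HX i => tx n i | HS i => ts n i end.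

(* The natural map H_m -> H_n, meaningful for m <= n *)
Definition emb m n (a : hecke m) : hecke n :=
  pclass (@hrel n) (asubst (gsub n) (repr a)).

End Hecke.

Section Inclusion.
Variables (k : fieldType) (lam : weight).
Local Notation H := (hecke k lam).

Lemma asubst_tx m n i : (i < m)%N -> (m <= n)%N ->
  asubst (gsub k n) (tx k m i) = tx k n i.
Proof. by move=> im mn; rewrite {1}/tx; case: insubP => [j _ <-|/negP]. Qed.

Lemma asubst_ts m n i : (i < m.-1)%N -> (m <= n)%N ->
  asubst (gsub k n) (ts k m i) = ts k n i.
Proof. by move=> im mn; rewrite {1}/ts; case: insubP => [j _ <-|/negP]. Qed.

Lemma hrel_gsub m n : (m <= n)%N -> forall t u, @hrel k lam m t u ->
  aeq (@hrel k lam n) (asubst (gsub k n) t) (asubst (gsub k n) u).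
Proof.
move=> mn; have mn' : (m.-1 <= n.-1)%N by case: m n mn => [|m] [|n].
have lt_pred (i : 'I_m.-1) : (i.+1 < m)%N by case: m {mn mn'} i => [[]|m i] //=; rewrite ltnS.
have ltW_pred (i : 'I_m.-1) : (i < m)%N by apply: ltn_trans (lt_pred i).
move=> t u; case=> [i|i j ij|i j ij|j i ij1 ij2|i|i j|m0] /=;
  rewrite ?asubst_tx ?asubst_ts //; apply: aeq_rel.
- exact: (@hrel_ss k lam n (widen_ord mn' i)).
- exact: (@hrel_far k lam n (widen_ord mn' i) (widen_ord mn' j)).
- exact: (@hrel_braid k lam n (widen_ord mn' i) (widen_ord mn' j)).
- exact: (@hrel_sx_far k lam n (widen_ord mn' j) (widen_ord mn i)).
- exact: (@hrel_sx k lam n (widen_ord mn' i)).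
- exact: (@hrel_xx k lam n (widen_ord mn i) (widen_ord mn j)).
rewrite (big_morph (asubst (@gsub k m n)) (id1 := AConst 1)
  (op1 := @AMul k (hgen n))) //.
under eq_bigr => i _.
  have -> p : asubst (@gsub k m n)
      (iter p (AMul (AAdd (tx k m 0) (AConst (- i%:~R)))) (AConst 1))
    = iter p (AMul (AAdd (tx k n 0) (AConst (- i%:~R)))) (AConst 1).
    by elim: p => //= p ->; rewrite asubst_tx.
over.
exact: (@hrel_cyc k lam n (leq_trans m0 mn)).
Qed.

Section Leq.
Variables (m n : nat).
Hypothesis mn : (m <= n)%N.

Lemma embE t : emb n (pclass (@hrel k lam m) t) =
  pclass (@hrel k lam n) (asubst (gsub k n) t).
Proof.
apply/pclass_eq/aeq_asubst; [exact: hrel_gsub | exact: repr_pclass].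
Qed.

Lemma embD : {morph @emb k lam m n : a b / a + b}.
Proof.
move=> a b; rewrite -(pclass_repr a) -(pclass_repr b).
by rewrite -![_ + _]/(padd _ _) paddE !embE paddE.
Qed.

Lemma embM : {morph @emb k lam m n : a b / a * b}.
Proof.
move=> a b; rewrite -(pclass_repr a) -(pclass_repr b).
by rewrite -![_ * _]/(pmul _ _) pmulE !embE pmulE.
Qed.

Lemma emb1 : @emb k lam m n 1 = 1.
Proof. exact: embE. Qed.

End Leq.

Definition incl n : H n -> H n.+1 := @emb k lam n n.+1.

Lemma incl_is_additive n : {morph @incl n : a b / a - b}.
Proof.
have D := @embD n n.+1 (leqnSn n); have N b : @incl n (- b) = - incl b.
  apply: (addrI (incl b)); rewrite -D !addrN.
  by apply: (addrI (incl 0)); rewrite -D !addr0.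
by move=> a b; rewrite -N -D.
Qed.

Lemma incl_is_multiplicative n : GRing.monoid_morphism (@incl n).
Proof. by split; [apply: emb1 | apply: embM]. Qed.

HB.instance Definition _ n :=
  GRing.isZmodMorphism.Build (H n) (H n.+1) (@incl n) (@incl_is_additive n).
HB.instance Definition _ n :=
  GRing.isMonoidMorphism.Build (H n) (H n.+1) (@incl n)
    (@incl_is_multiplicative n).

End Inclusion.

Section Trace.
Variables (k : fieldType) (lam : weight) (n : nat).
Local Notation H := (hecke k lam).
Local Notation d := (level lam).
Local Notation x := (xH k lam n.+1 n).

(* The sub-bimodule H_n s_n H_n of H_{n+1}; it is 0 for n = 0. *)
Definition in_HsH (z : H n.+1) : Prop :=
  exists (r : nat) (a b : 'I_r -> H n),
    z = \sum_(l < r) incl (a l) * sH k lam n.+1 n.-1 * incl (b l).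

(* tr_{n+1} : H_{n+1} -> H_n reads off u_{d-1} in the decomposition
   z = w + \sum_(j < d) u_j x_{n+1}^j with w in H_n s_n H_n.  Since
   H_{n+1} = H_n s_n H_n (+) \bigoplus_(j < d) H_n x_{n+1}^j with the u_j
   unique, the element selected by xget is the only candidate. *)
Definition trH (z : H n.+1) : H n :=
  xget 0 [set c | exists (w : H n.+1) (u : nat -> H n),
    [/\ in_HsH w, z = w + \sum_(j < d) incl (u j) * x ^+ j & c = u d.-1]].

(* y_{n+1,j} *)
Definition yH (j : nat) : H n.+1 :=
  \sum_(j <= t < d) (-1) ^+ (d.-1 - t) * x ^+ (t - j) *
    incl (\det (\matrix_(a < d.-1 - t, b < d.-1 - t) trH (x ^+ (d + b - a)))).

End Trace.

(* For algebras over k, the bimodules considered below are generated from the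
   regular ones by tensor products, direct sums and images, so that k acts in
   the same way on both sides, and homomorphisms are automatically k-linear. *)
Record bimod (A B : pzRingType) := Bimod {
  bcar :> zmodType;
  lact : A -> bcar -> bcar;
  ract : bcar -> B -> bcar;
  lactDl : forall a a' u, lact (a + a') u = lact a u + lact a' u;
  lactDr : forall a u u', lact a (u + u') = lact a u + lact a u';
  lact1 : forall u, lact 1 u = u;
  lactM : forall a a' u, lact (a * a') u = lact a (lact a' u);
  ractDl : forall u u' b, ract (u + u') b = ract u b + ract u' b;
  ractDr : forall u b b', ract u (b + b') = ract u b + ract u b';
  ract1 : forall u, ract u 1 = u;
  ractM : forall u b b', ract u (b * b') = ract (ract u b) b';
  lactA : forall a u b, lact a (ract u b) = ract (lact a u) b
}.

Section BimodTheory.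
Variables (A B : pzRingType) (M : bimod A B).

Lemma lact0 (a : A) : lact a (0 : M) = 0.
Proof. by apply: (addrI (lact a 0)); rewrite -lactDr !addr0. Qed.
Lemma ract0 (b : B) : ract (0 : M) b = 0.
Proof. by apply: (addrI (ract 0 b)); rewrite -ractDl !addr0. Qed.
Lemma lactN (a : A) (u : M) : lact a (- u) = - lact a u.
Proof. by apply: (addrI (lact a u)); rewrite -lactDr !addrN lact0. Qed.
Lemma ractN (b : B) (u : M) : ract (- u) b = - ract u b.
Proof. by apply: (addrI (ract u b)); rewrite -ractDl !addrN ract0. Qed.

End BimodTheory.

Record bhom (A B : pzRingType) (M N : bimod A B) := Bhom {
  bfun :> M -> N;
  bhomD : forall u u', bfun (u + u') = bfun u + bfun u';
  bhom_lact : forall a u, bfun (lact a u) = lact a (bfun u);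
  bhom_ract : forall u b, bfun (ract u b) = ract (bfun u) b
}.

HB.instance Definition _ A B (M N : bimod A B) := gen_eqMixin (bhom M N).
HB.instance Definition _ A B (M N : bimod A B) := gen_choiceMixin (bhom M N).

Section BhomOperations.
Variables (A B : pzRingType).
Implicit Types M N P : bimod A B.

Definition bid M : bhom M M.
Proof. by exists id. Defined.

Definition bcomp M N P (g : bhom N P) (f : bhom M N) : bhom M P.
Proof.
exists (fun u => g (f u)) => [u u'|a u|u b].
- by rewrite !bhomD.
- by rewrite !bhom_lact.
- by rewrite !bhom_ract.
Defined.

Definition bnull M N : bhom M N.
Proof.
exists (fun=> 0) => [u u'|a u|u b]; by rewrite ?addr0 ?lact0 ?ract0.
Defined.

Definition badd M N (f g : bhom M N) : bhom M N.
Proof.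
exists (fun u => f u + g u) => [u u'|a u|u b].
- by rewrite !bhomD addrACA.
- by rewrite !bhom_lact lactDr.
- by rewrite !bhom_ract ractDl.
Defined.

Definition bscale M N (c : B) (cC : forall b, c * b = b * c) (f : bhom M N) :
  bhom M N.
Proof.
exists (fun u => ract (f u) c) => [u u'|a u|u b].
- by rewrite bhomD ractDl.
- by rewrite bhom_lact lactA.
- by rewrite bhom_ract -!ractM cC.
Defined.

(* Used with properties P that prescribe the values on a set of generators, and
   so hold for at most one homomorphism. *)
Definition the_bhom M N (P : bhom M N -> Prop) : bhom M N :=
  xget (bnull M N) [set f | P f].

End BhomOperations.

(* The ring C, on which A and B act by multiplication through f and g *)
Definition ring_bimod (A B C : pzRingType) (f : {rmorphism A -> C})
  (g : {rmorphism B -> C}) : bimod A B.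
Proof.
exists C (fun a c => f a * c) (fun c b => c * g b) => *;
  by rewrite ?(rmorphD, rmorphM, rmorph1, mulrDl, mulrDr, mul1r, mulr1, mulrA).
Defined.

Definition zero_bimod (A B : pzRingType) : bimod A B.
Proof.
by exists 'rV[int]_0 (fun _ u => u) (fun u _ => u) => *;
  apply/matrixP => ? [].
Defined.

(* Tensor product over B: formal sums of pure tensors modulo the congruence
   generated by the axioms of abelian groups, biadditivity and B-balancedness *)
Section Tensor.
Variables (A B C : pzRingType) (M : bimod A B) (N : bimod B C).

Inductive tterm : Type :=
| TPure of M & N
| TZero
| TOpp of tterm
| TAdd of tterm & tterm.

HB.instance Definition _ := gen_eqMixin tterm.
HB.instance Definition _ := gen_choiceMixin tterm.

Inductive teq : tterm -> tterm -> Prop :=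
| teq_refl s : teq s s
| teq_sym s t : teq s t -> teq t s
| teq_trans s t r : teq s t -> teq t r -> teq s r
| teq_opp s t : teq s t -> teq (TOpp s) (TOpp t)
| teq_add s s' t t' : teq s s' -> teq t t' -> teq (TAdd s t) (TAdd s' t')
| teq_addA s t r : teq (TAdd s (TAdd t r)) (TAdd (TAdd s t) r)
| teq_addC s t : teq (TAdd s t) (TAdd t s)
| teq_add0 s : teq (TAdd TZero s) s
| teq_addN s : teq (TAdd (TOpp s) s) TZero
| teq_pureDl u u' v : teq (TPure (u + u') v) (TAdd (TPure u v) (TPure u' v))
| teq_pureDr u v v' : teq (TPure u (v + v')) (TAdd (TPure u v) (TPure u v'))
| teq_bal u b v : teq (TPure (ract u b) v) (TPure u (lact b v)).

Lemma teq_equiv_refl : reflexive (fun s t => `[< teq s t >]).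
Proof. by move=> t; apply/asboolP/teq_refl. Qed.
Lemma teq_equiv_sym : symmetric (fun s t => `[< teq s t >]).
Proof. by move=> s t; apply/asboolP/asboolP => /teq_sym. Qed.
Lemma teq_equiv_trans : transitive (fun s t => `[< teq s t >]).
Proof.
by move=> t s r /asboolP st /asboolP tr; apply/asboolP/(teq_trans st tr).
Qed.
Definition teq_equiv :=
  EquivRel (fun s t => `[< teq s t >])
    teq_equiv_refl teq_equiv_sym teq_equiv_trans.

Definition tens_type := {eq_quot teq_equiv}.
HB.instance Definition _ := Choice.on tens_type.

Definition tclass (t : tterm) : tens_type := \pi_{eq_quot teq_equiv} t.

Lemma tclass_eq s t : tclass s = tclass t <-> teq s t.
Proof.
split=> [/eqmodP/asboolP //|st].
by apply/eqmodP/asboolP.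
Qed.
Lemma tclass_repr a : tclass (repr a) = a.
Proof. exact: reprK. Qed.
Lemma repr_tclass t : teq (repr (tclass t)) t.
Proof. by apply/tclass_eq; rewrite tclass_repr. Qed.

Definition tadd (a b : tens_type) := tclass (TAdd (repr a) (repr b)).
Definition topp (a : tens_type) := tclass (TOpp (repr a)).

Lemma taddE s t : tadd (tclass s) (tclass t) = tclass (TAdd s t).
Proof. by apply/tclass_eq/teq_add; apply: repr_tclass. Qed.
Lemma toppE s : topp (tclass s) = tclass (TOpp s).
Proof. by apply/tclass_eq/teq_opp; apply: repr_tclass. Qed.

Lemma taddA : associative tadd.
Proof.
move=> a b c; rewrite -(tclass_repr a) -(tclass_repr b) -(tclass_repr c) !taddE.
exact/tclass_eq/teq_addA.
Qed.
Lemma taddC : commutative tadd.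
Proof.
move=> a b; rewrite -(tclass_repr a) -(tclass_repr b) !taddE.
exact/tclass_eq/teq_addC.
Qed.
Lemma tadd0 : left_id (tclass TZero) tadd.
Proof.
by move=> a; rewrite -(tclass_repr a) taddE; apply/tclass_eq/teq_add0.
Qed.
Lemma taddN : left_inverse (tclass TZero) topp tadd.
Proof.
by move=> a; rewrite -(tclass_repr a) toppE taddE; apply/tclass_eq/teq_addN.
Qed.

HB.instance Definition _ :=
  GRing.isZmodule.Build tens_type taddA taddC tadd0 taddN.

Definition tpure (u : M) (v : N) : tens_type := tclass (TPure u v).

Fixpoint tmap (f : M -> M) (g : N -> N) (t : tterm) : tterm :=
  match t with
  | TPure u v => TPure (f u) (g v)
  | TZero => TZero
  | TOpp s => TOpp (tmap f g s)
  | TAdd s t => TAdd (tmap f g s) (tmap f g t)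
  end.

Definition tlact (a : A) (z : tens_type) : tens_type :=
  tclass (tmap (lact a) id (repr z)).
Definition tract (z : tens_type) (c : C) : tens_type :=
  tclass (tmap id (fun v => ract v c) (repr z)).

Lemma teq_tmap f g s t :
    {morph f : u v / u + v} -> {morph g : u v / u + v} ->
    (forall u b, f (ract u b) = ract (f u) b) ->
    (forall b v, g (lact b v) = lact b (g v)) ->
  teq s t -> teq (tmap f g s) (tmap f g t).
Proof.
move=> fD gD fB gB; elim=> /= *; rewrite ?(fD, gD, fB, gB);
  by [apply: teq_trans; eassumption | solve [constructor; assumption]].
Qed.

Lemma tlactE a t : tlact a (tclass t) = tclass (tmap (lact a) id t).
Proof.
apply/tclass_eq/teq_tmap => //; last exact: repr_tclass.
- by move=> u v; rewrite lactDr.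
- by move=> u b; rewrite lactA.
Qed.
Lemma tractE c t : tract (tclass t) c = tclass (tmap id (fun v => ract v c) t).
Proof.
apply/tclass_eq/teq_tmap => //; last exact: repr_tclass.
- by move=> u v; rewrite ractDl.
- by move=> b u; rewrite lactA.
Qed.

Lemma tclassD s t : tclass (TAdd s t) = tclass s + tclass t.
Proof. by rewrite -taddE. Qed.
Lemma tclassN s : tclass (TOpp s) = - tclass s.
Proof. by rewrite -toppE. Qed.
Lemma tpureDl u u' v : tpure (u + u') v = tpure u v + tpure u' v.
Proof. by rewrite -tclassD; apply/tclass_eq/teq_pureDl. Qed.
Lemma tpureDr u v v' : tpure u (v + v') = tpure u v + tpure u v'.
Proof. by rewrite -tclassD; apply/tclass_eq/teq_pureDr. Qed.

Lemma tens_ind (P : tens_type -> Prop) :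
  (forall u v, P (tpure u v)) -> P 0 -> (forall a, P a -> P (- a)) ->
  (forall a b, P a -> P b -> P (a + b)) -> forall a, P a.
Proof.
move=> Pp P0 PN PD a; rewrite -(tclass_repr a); elim: (repr a) => //.
- by move=> s Ps; rewrite tclassN; apply: PN.
- by move=> s Ps t Pt; rewrite tclassD; apply: PD.
Qed.

Lemma tlactD a x y : tlact a (x + y) = tlact a x + tlact a y.
Proof.
by rewrite -(tclass_repr x) -(tclass_repr y) -tclassD !tlactE /= tclassD.
Qed.
Lemma tlactN a x : tlact a (- x) = - tlact a x.
Proof. by rewrite -(tclass_repr x) -tclassN !tlactE /= tclassN. Qed.
Lemma tlact0 a : tlact a 0 = 0.
Proof. exact: tlactE. Qed.
Lemma tlact_pure a u v : tlact a (tpure u v) = tpure (lact a u) v.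
Proof. exact: tlactE. Qed.
Lemma tractD c x y : tract (x + y) c = tract x c + tract y c.
Proof.
by rewrite -(tclass_repr x) -(tclass_repr y) -tclassD !tractE /= tclassD.
Qed.
Lemma tractN c x : tract (- x) c = - tract x c.
Proof. by rewrite -(tclass_repr x) -tclassN !tractE /= tclassN. Qed.
Lemma tract0 c : tract 0 c = 0.
Proof. exact: tractE. Qed.
Lemma tract_pure c u v : tract (tpure u v) c = tpure u (ract v c).
Proof. exact: tractE. Qed.

Definition tactE := (tlactD, tlactN, tlact0, tlact_pure,
  tractD, tractN, tract0, tract_pure).

Definition tens : bimod A C.
Proof.
exists tens_type tlact tract.
- move=> a a'; apply: tens_ind => [u v||x e|x y ex ey]; rewrite !tactE.
  + by rewrite lactDl tpureDl.
  + by rewrite addr0.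
  + by rewrite e opprD.
  + by rewrite ex ey addrACA.
- by move=> a x y; rewrite tlactD.
- apply: tens_ind => [u v||x e|x y ex ey]; rewrite !tactE ?lact1 //.
  + by rewrite e.
  + by rewrite ex ey.
- move=> a a'; apply: tens_ind => [u v||x e|x y ex ey]; rewrite !tactE ?lactM //.
  + by rewrite e.
  + by rewrite ex ey.
- by move=> x y c; rewrite tractD.
- move=> x c c'; elim/tens_ind: x => [u v||x e|x y ex ey]; rewrite !tactE.
  + by rewrite ractDr tpureDr.
  + by rewrite addr0.
  + by rewrite e opprD.
  + by rewrite ex ey addrACA.
- apply: tens_ind => [u v||x e|x y ex ey]; rewrite !tactE ?ract1 //.
  + by rewrite e.
  + by rewrite ex ey.
- move=> x c c'; elim/tens_ind: x => [u v||x e|x y ex ey];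
    rewrite !tactE ?ractM //.
  + by rewrite e.
  + by rewrite ex ey.
- move=> a x c; elim/tens_ind: x => [u v||x e|x y ex ey]; rewrite !tactE //.
  + by rewrite e.
  + by rewrite ex ey.
Defined.

Definition ptens (u : M) (v : N) : tens := tpure u v.

End Tensor.

Definition tens_map (A B C : pzRingType) (M : bimod A B) (N N' : bimod B C)
    (f : bhom N N') : bhom (tens M N) (tens M N') :=
  the_bhom (fun g : bhom (tens M N) (tens M N') =>
    forall u v, g (ptens u v) = ptens u (f v)).

Section DirectSum.
Variables (A B : pzRingType) (r : nat) (M : 'I_r -> bimod A B).

Definition dprod := forall i, M i.
HB.instance Definition _ := Choice.on dprod.

Fact dprod_addA : associative (fun u v : dprod => (fun i => u i + v i) : dprod).
Proof. by move=> u v w; apply: functional_extensionality_dep => i; rewrite addrA. Qed.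
Fact dprod_addC : commutative (fun u v : dprod => (fun i => u i + v i) : dprod).
Proof. by move=> u v; apply: functional_extensionality_dep => i; rewrite addrC. Qed.
Fact dprod_add0 :
  left_id (fun i => 0 : M i) (fun u v : dprod => (fun i => u i + v i) : dprod).
Proof. by move=> u; apply: functional_extensionality_dep => i; rewrite add0r. Qed.
Fact dprod_addN :
  left_inverse (fun i => 0 : M i) (fun u : dprod => (fun i => - u i) : dprod)
    (fun u v : dprod => (fun i => u i + v i) : dprod).
Proof. by move=> u; apply: functional_extensionality_dep => i; rewrite addNr. Qed.

HB.instance Definition _ :=
  GRing.isZmodule.Build dprod dprod_addA dprod_addC dprod_add0 dprod_addN.

Definition dsum : bimod A B.
Proof.
exists dprod (fun a u i => lact a (u i)) (fun u b i => ract (u i) b) => *;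
  apply: functional_extensionality_dep => i;
  by rewrite ?(lactDl, lactDr, lact1, lactM, ractDl, ractDr, ract1, ractM, lactA).
Defined.

End DirectSum.

Definition dsum_map (A B : pzRingType) (r s : nat) (M : 'I_r -> bimod A B)
    (N : 'I_s -> bimod A B) (f : forall j i, bhom (M i) (N j)) :
  bhom (dsum M) (dsum N).
Proof.
exists (fun u => (fun j => \sum_(i < r) f j i (u i)) : dsum N) => [u u'|a u|u b];
  apply: functional_extensionality_dep => j /=.
- rewrite [RHS](_ : _ = \sum_(i < r) f j i (u i) + \sum_(i < r) f j i (u' i)) //.
  by rewrite -big_split; apply: eq_bigr => i _; apply: bhomD.
- elim/big_rec2: _ => [|i x y _ ->]; first by rewrite lact0.
  by rewrite lactDr bhom_lact.
- elim/big_rec2: _ => [|i x y _ ->]; first by rewrite ract0.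
  by rewrite ractDl bhom_ract.
Defined.

Section Image.
Variables (A B : pzRingType) (M N : bimod A B) (f : bhom M N).

Definition im_pred : {pred N} := fun v => `[< exists u, f u = v >].

Fact im_zmod_closed : zmod_closed im_pred.
Proof.
split=> [|_ _ /asboolP[u <-] /asboolP[v <-]]; apply/asboolP.
  by exists 0; apply: (addrI (f 0)); rewrite -bhomD !addr0.
exists (u - v); rewrite bhomD; congr (_ + _).
by apply: (addrI (f v)); rewrite -bhomD !addrN;
   apply: (addrI (f 0)); rewrite -bhomD !addr0.
Qed.
HB.instance Definition _ := GRing.isZmodClosed.Build N im_pred im_zmod_closed.

Inductive im_type := Im v of v \in im_pred.
Definition im_val (u : im_type) : N := let: Im v _ := u in v.
HB.instance Definition _ := [isSub for im_val].
HB.instance Definition _ := [Choice of im_type by <:].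
HB.instance Definition _ := [SubChoice_isSubZmodule of im_type by <:].

Fact im_lact a (u : im_type) : lact a (val u) \in im_pred.
Proof.
by case: u => /= v /asboolP[u <-]; apply/asboolP; exists (lact a u);
   rewrite bhom_lact.
Qed.
Fact im_ract (u : im_type) b : ract (val u) b \in im_pred.
Proof.
by case: u => /= v /asboolP[u <-]; apply/asboolP; exists (ract u b);
   rewrite bhom_ract.
Qed.

Definition im_bimod : bimod A B.
Proof.
exists im_type (fun a u => Im (im_lact a u)) (fun u b => Im (im_ract u b)) => *;
  apply: val_inj;
  by rewrite /= ?(lactDl, lactDr, lact1, lactM, ractDl, ractDr, ract1, ractM, lactA).
Defined.

Definition im_incl : bhom im_bimod N.
Proof. by exists (@im_val). Defined.

Definition im_proj : bhom M im_bimod.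
Proof.
exists (fun u => Im (introT (asboolP _) (ex_intro (fun u => f u = _) u erefl)) :
                 im_type) => [u u'|a u|u b]; apply: val_inj => /=.
- by rewrite bhomD.
- by rewrite bhom_lact.
- by rewrite bhom_ract.
Defined.

End Image.

(* The word Q_{e_1} ... Q_{e_r} is [:: e_1; ...; e_r], with up for Q_+ and dn
   for Q_-; tensor product of words is concatenation. *)
Inductive ori := up | dn.
Definition word := seq ori.

(* Dot, upward crossing, right cup, right cap, left cup, left cap *)
Inductive gen := Gx | Gs | Gcup | Gcap | Gcup' | Gcap'.

Definition gdom (g : gen) : word :=
  match g with
  | Gx => [:: up] | Gs => [:: up; up] | Gcup => [::] | Gcap => [:: up; dn]
  | Gcup' => [::] | Gcap' => [:: dn; up]
  end.
Definition gcod (g : gen) : word :=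
  match g with
  | Gx => [:: up] | Gs => [:: up; up] | Gcup => [:: dn; up] | Gcap => [::]
  | Gcup' => [:: up; dn] | Gcap' => [::]
  end.

Declare Scope diag_scope.
Delimit Scope diag_scope with D.

Section Diagrams.
Variable k : fieldType.

(* Expressions for linear combinations of diagrams, read with the bottom word
   first: dgen g v is g (x) 1_v, and dwhisk e f is 1_{Q_e} (x) f.  Every
   morphism of the free strict k-linear monoidal category is a linear
   combination of composites of morphisms 1_u (x) g (x) 1_v, so no other
   tensor products are needed, and associativity of the tensor product holds
   on the nose.  f (x) 1_v for a composite local diagram f is expressed by
   taking f as a function of the word v on its right. *)
Inductive diag : word -> word -> Type :=
| did a : diag a a
| dcomp a b c : diag b c -> diag a b -> diag a c
| dwhisk e a b : diag a b -> diag (e :: a) (e :: b)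
| dgen g v : diag (gdom g ++ v) (gcod g ++ v)
| dzero a b : diag a b
| dadd a b : diag a b -> diag a b -> diag a b
| dscale a b : k -> diag a b -> diag a b.

HB.instance Definition _ a b := gen_eqMixin (diag a b).
HB.instance Definition _ a b := gen_choiceMixin (diag a b).

Fixpoint dwhiskw (w : word) a b (f : diag a b) : diag (w ++ a) (w ++ b) :=
  match w return diag (w ++ a) (w ++ b) with
  | [::] => f
  | e :: w' => dwhisk e (dwhiskw w' f)
  end.

Local Notation "g * f" := (dcomp g f) : diag_scope.
Local Notation "f + g" := (dadd f g) : diag_scope.
Local Notation "c *: f" := (dscale c f) : diag_scope.
Local Notation "f - g" := (dadd f (dscale (-1) g)) : diag_scope.
Local Notation "0" := (dzero _ _) : diag_scope.
Local Notation "1" := (did _) : diag_scope.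
Local Notation "e |> f" := (dwhisk e f)
  (at level 35, right associativity) : diag_scope.
Local Open Scope diag_scope.

Definition dx v : diag (up :: v) (up :: v) := dgen Gx v.
Definition ds v : diag (up :: up :: v) (up :: up :: v) := dgen Gs v.
Definition dcup v : diag v (dn :: up :: v) := dgen Gcup v.
Definition dcap v : diag (up :: dn :: v) v := dgen Gcap v.
Definition dcup' v : diag v (up :: dn :: v) := dgen Gcup' v.
Definition dcap' v : diag (dn :: up :: v) v := dgen Gcap' v.

Definition dxn (j : nat) v : diag (up :: v) (up :: v) := iter j (dcomp (dx v)) 1.

Definition dt v : diag (up :: dn :: v) (dn :: up :: v) :=
  (dn |> up |> dcap v) * (dn |> ds (dn :: v)) * dcup (up :: dn :: v).
Definition dt' v : diag (dn :: up :: v) (up :: dn :: v) :=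
  dcap' (up :: dn :: v) * (dn |> ds (dn :: v)) * (dn |> up |> dcup' v).

Definition dbubble (j : nat) v : diag v v := dcap' v * (dn |> dxn j v) * dcup v.

Definition dx_mate v : diag (dn :: v) (dn :: v) :=
  (dn |> dcap v) * (dn |> dx (dn :: v)) * dcup (dn :: v).
Definition dx_mate' v : diag (dn :: v) (dn :: v) :=
  dcap' (dn :: v) * (dn |> dx (dn :: v)) * (dn |> dcup' v).
Definition ds_mate v : diag (dn :: dn :: v) (dn :: dn :: v) :=
  (dn |> dn |> dcap v) * (dn |> dn |> up |> dcap (dn :: v)) *
  (dn |> dn |> ds (dn :: dn :: v)) *
  (dn |> dcup (up :: dn :: dn :: v)) * dcup (dn :: dn :: v).
Definition ds_mate' v : diag (dn :: dn :: v) (dn :: dn :: v) :=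
  dcap' (dn :: dn :: v) * (dn |> dcap' (up :: dn :: dn :: v)) *
  (dn |> dn |> ds (dn :: dn :: v)) *
  (dn |> dn |> up |> dcup' (dn :: v)) * (dn |> dn |> dcup' v).

Section Relations.
Variable lam : weight.
Local Notation d := (level lam).

(* c_s = (-1)^s det(bubble_{d+j-i}), expanded by the Leibniz formula *)
Definition dc (s : nat) v : diag v v :=
  \big[@dadd v v / 0]_(p : 'S_s)
    ((-1) ^+ (s + odd_perm p)%N *:
     \big[@dcomp v v v / 1]_(i < s) dbubble (d + p i - i)%N v).

Definition dxdual (j : nat) v : diag (up :: v) (up :: v) :=
  \big[@dadd _ _ / 0]_(j <= i < d)
    (dxn (i - j)%N v * (up |> dc (d.-1 - i)%N v)).

(* Local relations, with an arbitrary word v on the right *)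
Inductive lrel : forall a b, diag a b -> diag a b -> Prop :=
| lrel_zigzag1 v : lrel (dcap (up :: v) * (up |> dcup v)) 1
| lrel_zigzag2 v : lrel ((up |> dcap' v) * dcup' (up :: v)) 1
| lrel_zigzag3 v : lrel ((dn |> dcap v) * dcup (dn :: v)) 1
| lrel_zigzag4 v : lrel (dcap' (dn :: v) * (dn |> dcup' v)) 1
| lrel_x_mates v : lrel (dx_mate v) (dx_mate' v)
| lrel_s_mates v : lrel (ds_mate v) (ds_mate' v)
| lrel_ss v : lrel (ds v * ds v) 1
| lrel_braid v :
    lrel (ds (up :: v) * (up |> ds v) * ds (up :: v))
         ((up |> ds v) * ds (up :: v) * (up |> ds v))
| lrel_sx v : lrel (ds v * dx (up :: v) - (up |> dx v) * ds v) 1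
| lrel_xs v : lrel (dx (up :: v) * ds v - ds v * (up |> dx v)) 1
| lrel_dn_up v :
    lrel 1 (dt v * dt' v +
            \big[@dadd _ _ / 0]_(j < d)
              ((dn |> dxn j v) * dcup v * dcap' v * (dn |> dxdual j v)))
| lrel_up_dn v : lrel (dt' v * dt v) 1
| lrel_bubble0 j v : (j < d.-1)%N -> lrel (dbubble j v) 0
| lrel_bubble1 v : lrel (dbubble d.-1 v) 1
| lrel_bubbled v :
    lrel (dbubble d v) ((\sum_(i <- finsupp lam) i%:~R * (lam i)%:R)%R *: 1)
| lrel_curl v : lrel (dcap' (up :: v) * (dn |> ds v) * dcup (up :: v)) 0.

Inductive deq : forall a b, diag a b -> diag a b -> Prop :=
| deq_lrel a b (f g : diag a b) : lrel f g -> deq f g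
| deq_refl a b (f : diag a b) : deq f f
| deq_sym a b (f g : diag a b) : deq f g -> deq g f
| deq_trans a b (f g h : diag a b) : deq f g -> deq g h -> deq f h
| deq_comp a b c (g g' : diag b c) (f f' : diag a b) :
    deq g g' -> deq f f' -> deq (g * f) (g' * f')
| deq_whisk e a b (f f' : diag a b) : deq f f' -> deq (e |> f) (e |> f')
| deq_add a b (f f' g g' : diag a b) :
    deq f f' -> deq g g' -> deq (f + g) (f' + g')
| deq_scale a b c (f f' : diag a b) : deq f f' -> deq (c *: f) (c *: f')
| deq_compA a b c d' (h : diag c d') (g : diag b c) (f : diag a b) :
    deq (h * (g * f)) (h * g * f)
| deq_comp1l a b (f : diag a b) : deq (1 * f) f
| deq_comp1r a b (f : diag a b) : deq (f * 1) f
| deq_addA a b (f g h : diag a b) : deq (f + (g + h)) (f + g + h)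
| deq_addC a b (f g : diag a b) : deq (f + g) (g + f)
| deq_add0 a b (f : diag a b) : deq (0 + f) f
| deq_addN a b (f : diag a b) : deq (f - f) 0
| deq_scale1 a b (f : diag a b) : deq (1%R *: f) f
| deq_scaleA a b c c' (f : diag a b) : deq (c *: (c' *: f)) ((c * c')%R *: f)
| deq_scaleDl a b c c' (f : diag a b) : deq ((c + c')%R *: f) (c *: f + c' *: f)
| deq_scaleDr a b c (f g : diag a b) : deq (c *: (f + g)) (c *: f + c *: g)
| deq_compDl a b c (g g' : diag b c) (f : diag a b) :
    deq ((g + g') * f) (g * f + g' * f)
| deq_compDr a b c (g : diag b c) (f f' : diag a b) :
    deq (g * (f + f')) (g * f + g * f')
| deq_compZl a b c z (g : diag b c) (f : diag a b) :
    deq ((z *: g) * f) (z *: (g * f))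
| deq_compZr a b c z (g : diag b c) (f : diag a b) :
    deq (g * (z *: f)) (z *: (g * f))
| deq_whisk1 e a : deq (e |> did a) 1
| deq_whiskM e a b c (g : diag b c) (f : diag a b) :
    deq (e |> (g * f)) ((e |> g) * (e |> f))
| deq_whiskD e a b (f g : diag a b) : deq (e |> (f + g)) ((e |> f) + (e |> g))
| deq_whiskZ e a b c (f : diag a b) : deq (e |> (c *: f)) (c *: (e |> f))
| deq_interchange g a b (f : diag a b) :
    deq (dgen g b * dwhiskw (gdom g) f) (dwhiskw (gcod g) f * dgen g a).

Section Hom.
Variables a b : word.

Lemma deq_equiv_refl : reflexive (fun f g : diag a b => `[< deq f g >]).
Proof. by move=> f; apply/asboolP/deq_refl. Qed.
Lemma deq_equiv_sym : symmetric (fun f g : diag a b => `[< deq f g >]).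
Proof. by move=> f g; apply/asboolP/asboolP => /deq_sym. Qed.
Lemma deq_equiv_trans : transitive (fun f g : diag a b => `[< deq f g >]).
Proof.
by move=> g f h /asboolP fg /asboolP gh; apply/asboolP/(deq_trans fg gh).
Qed.
Definition deq_equiv :=
  EquivRel (fun f g : diag a b => `[< deq f g >])
    deq_equiv_refl deq_equiv_sym deq_equiv_trans.

Definition whom := {eq_quot deq_equiv}.
HB.instance Definition _ := Choice.on whom.

Definition dclass (f : diag a b) : whom := \pi_{eq_quot deq_equiv} f.

Lemma dclass_eq f g : dclass f = dclass g <-> deq f g.
Proof.
split=> [/eqmodP/asboolP //|fg].
by apply/eqmodP/asboolP.
Qed.
Lemma dclass_repr f : dclass (repr f) = f.
Proof. exact: reprK. Qed.
Lemma repr_dclass f : deq (repr (dclass f)) f.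
Proof. by apply/dclass_eq; rewrite dclass_repr. Qed.

Definition whom_add (f g : whom) : whom := dclass (repr f + repr g).
Definition whom_opp (f : whom) : whom := dclass (dscale (-1)%R (repr f)).

Lemma whom_addE f g : whom_add (dclass f) (dclass g) = dclass (f + g).
Proof. by apply/dclass_eq/deq_add; apply: repr_dclass. Qed.
Lemma whom_oppE f : whom_opp (dclass f) = dclass (dscale (-1)%R f).
Proof. by apply/dclass_eq/deq_scale; apply: repr_dclass. Qed.

Lemma whom_addA : associative whom_add.
Proof.
move=> f g h; rewrite -(dclass_repr f) -(dclass_repr g) -(dclass_repr h).
by rewrite !whom_addE; apply/dclass_eq/deq_addA.
Qed.
Lemma whom_addC : commutative whom_add.
Proof.
move=> f g; rewrite -(dclass_repr f) -(dclass_repr g) !whom_addE.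
exact/dclass_eq/deq_addC.
Qed.
Lemma whom_add0 : left_id (dclass 0) whom_add.
Proof.
by move=> f; rewrite -(dclass_repr f) whom_addE; apply/dclass_eq/deq_add0.
Qed.
Lemma whom_addN : left_inverse (dclass 0) whom_opp whom_add.
Proof.
move=> f; rewrite whom_addC -(dclass_repr f) whom_oppE whom_addE.
exact/dclass_eq/deq_addN.
Qed.

HB.instance Definition _ :=
  GRing.isZmodule.Build whom whom_addA whom_addC whom_add0 whom_addN.

End Hom.

Definition whom_comp a b c (g : whom b c) (f : whom a b) : whom a c :=
  dclass (repr g * repr f).

End Relations.
End Diagrams.

Section Heisenberg.
Variables (k : fieldType) (lam : weight).

Record hobj := HObj { hlen : nat; hword : 'I_hlen -> word }.
Arguments hword : clear implicits.

Definition hmor (X Y : hobj) : Type :=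
  forall (j : 'I_(hlen Y)) (i : 'I_(hlen X)),
    whom k lam (hword X i) (hword Y j).

Definition hcomp X Y Z (g : hmor Y Z) (f : hmor X Y) : hmor X Z :=
  fun l i => \sum_(j < hlen Y) whom_comp (g l j) (f j i).

Record kobj := KObj {
  kbase : hobj;
  kidem : hmor kbase kbase;
  kidemP : hcomp kidem kidem = kidem
}.
Arguments kidem : clear implicits.

Record kmor (X Y : kobj) := KMor {
  kfun :> hmor (kbase X) (kbase Y);
  kfunP : hcomp (kidem Y) (hcomp kfun (kidem X)) = kfun
}.

End Heisenberg.

Arguments hword : clear implicits.
Arguments kidem {k lam} X : rename.

Section Functor.
Variables (k : fieldType) (lam : weight) (n : nat).
Local Notation H := (hecke k lam).
Local Notation d := (level lam).
Local Notation x := (xH k lam).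
Local Notation s := (sH k lam).

(* A formal direct sum of (H_m, H_n)-bimodules for various m is a family
   indexed by m.  The morphisms between two such families are the families of
   bimodule homomorphisms, so there are only zero morphisms between bimodules
   with different left algebras.  B_n^lambda is the full subcategory of direct
   sums of direct summands of the families Fword w below; its morphism sets are
   the bmor M N. *)
Definition bobj := forall m, bimod (H m) (H n).
Definition bmor (M N : bobj) := forall m, bhom (M m) (N m).

Definition reg m : bimod (H m) (H m) := ring_bimod idfun idfun.
(* (m+1)_m *)
Definition ind m : bimod (H m.+1) (H m) := ring_bimod idfun (@incl k lam m).
(* _m(m+1) *)
Definition res m : bimod (H m) (H m.+1) := ring_bimod (@incl k lam m) idfun.

(* (n), placed in degree n *)
Definition unit_bobj : bobj := fun m =>
  match m =P n with
  | ReflectT e => eq_rect m (fun q => bimod (H m) (H q)) (reg m) n e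
  | ReflectF _ => zero_bimod (H m) (H n)
  end.

(* F_n on words.  The component of index m is the bimodule attached to the
   word when its leftmost region is labelled m.  A word with a negative label
   in some region is sent to 0, since labels m are natural numbers. *)
Fixpoint Fword (w : word) : bobj :=
  match w with
  | [::] => unit_bobj
  | up :: v => fun m =>
      if m is p.+1 then tens (ind p) (Fword v p) else zero_bimod (H 0) (H n)
  | dn :: v => fun m => tens (res m) (Fword v m.+1)
  end.

(* F_n on a generator with the word v on its right; m is the label of the
   leftmost region.  Below, a (x) (b (x) u) is written a *t b *t u. *)
Local Notation "a *t u" := (ptens a u) (at level 37, right associativity).

Definition Fx v : bmor (Fword (up :: v)) (Fword (up :: v)) := fun m =>
  match m return bhom (Fword (up :: v) m) (Fword (up :: v) m) with
  | 0 => bnull _ _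
  | p.+1 => the_bhom (fun f : bhom (Fword (up :: v) p.+1) (Fword (up :: v) p.+1) =>
      forall (a : ind p) (u : Fword v p),
        f (a *t u) = ((a : H p.+1) * x p.+1 p : ind p) *t u)
  end.

(* (p+2)_p is identified with (p+2)_{p+1}(p+1)_p by a b |-> a (x) b *)
Definition Fs v : bmor (Fword (up :: up :: v)) (Fword (up :: up :: v)) := fun m =>
  match m return bhom (Fword (up :: up :: v) m) (Fword (up :: up :: v) m) with
  | p.+2 => the_bhom (fun f : bhom (Fword (up :: up :: v) p.+2)
                                   (Fword (up :: up :: v) p.+2) =>
      forall (a : ind p.+1) (b : ind p) (u : Fword v p),
        f (a *t b *t u) =
        ((a : H p.+2) * incl (b : H p.+1) * s p.+2 p : ind p.+1) *t
          (1 : ind p) *t u)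
  | _ => bnull _ _
  end.

Definition Fcup v : bmor (Fword v) (Fword (dn :: up :: v)) := fun m =>
  the_bhom (fun f : bhom (Fword v m) (Fword (dn :: up :: v) m) =>
    forall u : Fword v m, f u = (1 : res m) *t (1 : ind m) *t u).

Definition Fcap v : bmor (Fword (up :: dn :: v)) (Fword v) := fun m =>
  match m return bhom (Fword (up :: dn :: v) m) (Fword v m) with
  | 0 => bnull _ _
  | p.+1 => the_bhom (fun f : bhom (Fword (up :: dn :: v) p.+1) (Fword v p.+1) =>
      forall (a : ind p) (b : res p) (u : Fword v p.+1),
        f (a *t b *t u) = lact ((a : H p.+1) * (b : H p.+1)) u)
  end.

(* \sum_(i, j) x_i^j s_i ... s_p (x) s_p ... s_i y_{i,j} (x) u, with the
   indices of x, s and y shifted by 1 *)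
Definition Fcup' v : bmor (Fword v) (Fword (up :: dn :: v)) := fun m =>
  match m return bhom (Fword v m) (Fword (up :: dn :: v) m) with
  | 0 => bnull _ _
  | p.+1 => the_bhom (fun f : bhom (Fword v p.+1) (Fword (up :: dn :: v) p.+1) =>
      forall u : Fword v p.+1,
        f u = \sum_(i < p.+1) \sum_(j < d)
          (x p.+1 i ^+ j * \prod_(i <= l < p) s p.+1 l : ind p) *t
          ((\prod_(l <- rev (index_iota i p)) s p.+1 l) *
             emb p.+1 (yH k lam i j) : res p) *t u)
  end.

Definition Fcap' v : bmor (Fword (dn :: up :: v)) (Fword v) := fun m =>
  the_bhom (fun f : bhom (Fword (dn :: up :: v) m) (Fword v m) =>
    forall (a : res m) (b : ind m) (u : Fword v m),
      f (a *t b *t u) = lact (trH ((a : H m.+1) * (b : H m.+1))) u).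

Definition Fgen (g : gen) v : bmor (Fword (gdom g ++ v)) (Fword (gcod g ++ v)) :=
  match g return bmor (Fword (gdom g ++ v)) (Fword (gcod g ++ v)) with
  | Gx => Fx v | Gs => Fs v | Gcup => Fcup v | Gcap => Fcap v
  | Gcup' => Fcup' v | Gcap' => Fcap' v
  end.

Definition Fwhisk e a b (f : bmor (Fword a) (Fword b)) :
    bmor (Fword (e :: a)) (Fword (e :: b)) :=
  match e return bmor (Fword (e :: a)) (Fword (e :: b)) with
  | up => fun m =>
      match m return bhom (Fword (up :: a) m) (Fword (up :: b) m) with
      | 0 => bnull _ _
      | p.+1 => tens_map (ind p) (f p)
      end
  | dn => fun m => tens_map (res m) (f m.+1)
  end.

Lemma cH_central m c (a : H m) : cH lam m c * a = a * cH lam m c.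
Proof. exact: pconstC. Qed.

Fixpoint Fdiag a b (f : diag k a b) : bmor (Fword a) (Fword b) :=
  match f in diag _ a b return bmor (Fword a) (Fword b) with
  | did a => fun m => bid _
  | dcomp _ _ _ g f => fun m => bcomp (Fdiag g m) (Fdiag f m)
  | dwhisk e _ _ f => Fwhisk e (Fdiag f)
  | dgen g v => Fgen g v
  | dzero _ _ => fun m => bnull _ _
  | dadd _ _ f g => fun m => badd (Fdiag f m) (Fdiag g m)
  | dscale _ _ c f => fun m => bscale (@cH_central n c) (Fdiag f m)
  end.

(* Independence of the representative is the well-definedness of F_n on the
   category presented by generators and relations. *)
Definition Fwhom a b (f : whom k lam a b) : bmor (Fword a) (Fword b) :=
  Fdiag (repr f).

Definition Fhobj (X : hobj) : bobj := fun m => dsum (fun i => Fword (hword X i) m).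

Definition Fhmor X Y (f : hmor k lam X Y) : bmor (Fhobj X) (Fhobj Y) := fun m =>
  dsum_map (fun j i => Fwhom (f j i) m).

(* Extension to the idempotent completion: (X, e) is sent to the image of F(e),
   and f : (X, e) -> (Y, e') to the restriction of F(e') F(f) = F(f). *)
Definition Fobj (X : kobj k lam) : bobj := fun m => im_bimod (Fhmor (kidem X) m).

Definition Fmor (X Y : kobj k lam) (f : kmor X Y) : bmor (Fobj X) (Fobj Y) :=
  fun m => bcomp (im_proj (Fhmor (kidem Y) m))
             (bcomp (Fhmor f m) (im_incl (Fhmor (kidem X) m))).

End Functor.

(* Main.v *)
(* Bending strands by the adjunctions between Q_+ and Q_- and splitting tensor
   products by the Mackey decomposition of H_{n+1} reduce fullness to
   endomorphisms of the empty word, that is, to the assertion that the center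
   of H_n is generated by bubbles.

   The center is generated by the power sums p_j of the dots.  Filter H_n by
   giving dots weight 2 and transpositions weight 1; since x^d has weight
   2d - 1, the power x^j has weight 2j - floor(j/d).  A central z is, up to the
   factor n, the average of z over the transpositions (i n), and the average of
   x_n^j is (floor(j/d) + 1) p_j up to lower weight.

   In the generating series of the bubbles with coefficients in H_n, each strand
   contributes the factor (1 - v x)^2 / ((1 - v (x + 1)) (1 - v (x - 1))).
   Newton's identities express the sums of (x_i + 1)^c + (x_i - 1)^c - 2 x_i^c
   through bubbles, and since their leading term is c (c - 1) x_i^(c - 2), all
   p_j are polynomials in bubbles in characteristic zero. *)

From HB Require Import structures.
Require Import Defs.
From mathcomp Require Import all_boot all_order all_algebra perm finmap.
From mathcomp Require Import boolp classical_sets.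
From mathcomp Require Import zify.

Set Implicit Arguments.
Unset Strict Implicit.
Unset Printing Implicit Defensive.

Import GRing.Theory.
Local Open Scope ring_scope.

(** * Degenerate cyclotomic Hecke algebras *)

(** Since [trH] is a choice made by [xget], the value of any single trace rests on the uniqueness of
    the coefficient of x_{n+1}^{d-1}. A decomposition exists by straightening into normal forms.
    Uniqueness needs a module on which H_{n+1} visibly acts: the affine algebra on n + 1 strands,
    base changed to H_n, is free over the polynomials H_n[X] in the last dot, and the cyclotomic
    relation cuts out a submodule whose generators have leading terms X^d e_p. Only the coefficient
    of x_{n+1}^{d-1} is proved unique; the dual bases and the left cup are then controlled through
    the trace.

    The functor is made of choices as well: [the_bhom] selects the maps of the generators and
    [Fwhom] evaluates a selected representative, so its well-definedness has to be proved before any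
    value can be computed.

    The reduction to the empty word terminates by rotating a strand Q_- from one end of the word to
    the other: this trades the label n + 1 for n, and for n = 0 such words are sent to zero.

    The averages determine the center because floor(j/d) + 1 is never zero, so that the leading term
    of an average is always visible and a descent on the weight is possible. *)

Record hecke_rel (R : pzRingType) (n : nat) (x s : nat -> R) : Prop := HeckeRel {
  hr_ss : forall i, (i.+1 < n)%N -> s i * s i = 1;
  hr_far : forall i j, (i.+1 < j)%N -> (j.+1 < n)%N -> s i * s j = s j * s i;
  hr_braid : forall i, (i.+2 < n)%N -> s i * s i.+1 * s i = s i.+1 * s i * s i.+1;
  hr_sx_far : forall i j, (j.+1 < n)%N -> (i < n)%N -> i != j -> i != j.+1 ->
    s j * x i = x i * s j;
  hr_sx : forall i, (i.+1 < n)%N -> s i * x i = x i.+1 * s i - 1;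
  hr_xx : forall i j, (i < n)%N -> (j < n)%N -> x i * x j = x j * x i
}.

(** For commuting a and b, the divided difference (a^j - b^j)/(a - b). It is the correction that
    appears when the power of a dot passes a crossing. *)
Definition hsum (R : pzRingType) (a b : R) (j : nat) : R :=
  \sum_(l < j) a ^+ l * b ^+ (j.-1 - l).

Lemma hsumS (R : pzRingType) (a b : R) j :
  hsum a b j.+1 = hsum a b j * b + a ^+ j.
Proof.
rewrite /hsum big_ord_recr /= subnn expr0 mulr1; congr (_ + _).
case: j => [|j]; first by rewrite !big_ord0 mul0r.
rewrite mulr_suml; apply: eq_bigr => l _; rewrite -mulrA -exprSr /=.
by congr (_ * _ ^+ _); have := ltn_ord l; lia.
Qed.

Definition tpn (a b i : nat) : nat := if i == a then b else if i == b then a else i.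

Lemma tpnC a b i : tpn a b i = tpn b a i.
Proof. by rewrite /tpn; case: eqP => [->|]; case: eqP => // ->. Qed.

Ltac tpn_lia := rewrite /tpn; repeat match goal with |- context [if ?b then _ else _] =>
  lazymatch b with context [if _ then _ else _] => fail | _ => case: (boolP b) => ? end end; lia.

Lemma tpn_lt m a b i : (a < m)%N -> (b < m)%N -> (i < m)%N -> (tpn a b i < m)%N.
Proof. by rewrite /tpn; case: ifP => // _; case: ifP. Qed.

Lemma tpnS a b i : (a < b)%N -> tpn b b.+1 (tpn a b (tpn b b.+1 i)) = tpn a b.+1 i.
Proof. by move=> ab; tpn_lia. Qed.

Section HeckeRelTheory.
Variables (R : pzRingType) (n : nat) (x s : nat -> R).
Hypothesis hr : hecke_rel n x s.

Lemma hr_farC i j : (i.+1 < n)%N -> (j.+1 < n)%N ->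
  i != j.+1 -> j != i.+1 -> s i * s j = s j * s i.
Proof.
move=> i_n j_n ij ji; have [->//|nij] := eqVneq i j.
have [lij|lji] : (i.+1 < j \/ j.+1 < i)%N by lia.
  exact: (hr_far hr).
by apply/esym/(hr_far hr).
Qed.

Lemma hr_xs i : (i.+1 < n)%N -> x i.+1 * s i = s i * x i + 1.
Proof. by move=> i_n; rewrite (hr_sx hr) // subrK. Qed.

Lemma hr_xS i : (i.+1 < n)%N -> x i.+1 = s i * x i * s i + s i.
Proof.
move=> i_n; rewrite -[LHS]mulr1 -(hr_ss hr i_n) mulrA hr_xs //.
by rewrite mulrDl mul1r.
Qed.

Lemma hr_sx1 i : (i.+1 < n)%N -> s i * x i.+1 = x i * s i + 1.
Proof.
by move=> i_n; rewrite hr_xS // mulrDr !mulrA (hr_ss hr i_n) mul1r.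
Qed.

Lemma hr_xsX i j : (i.+1 < n)%N ->
  x i.+1 ^+ j * s i = s i * x i ^+ j + hsum (x i) (x i.+1) j.
Proof.
move=> i_n; have xx : GRing.comm (x i) (x i.+1) by apply: (hr_xx hr) => //; apply: ltnW.
elim: j => [|j IHj]; first by rewrite /hsum big_ord0 addr0 !expr0 mulr1 mul1r.
rewrite exprS -mulrA IHj mulrDr mulrA hr_xs // mulrDl mul1r -mulrA -exprS.
rewrite -addrA; congr (_ + _); rewrite (hsumS _ _ j) addrC; congr (_ + _).
rewrite -/(GRing.comm (x i.+1) (hsum _ _ _)).
apply: commr_sum => l _; apply: commrM; apply: commrX => //.

Qed.

Lemma hr_sxX i j : (i.+1 < n)%N ->
  s i * x i ^+ j = x i.+1 ^+ j * s i - hsum (x i) (x i.+1) j.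
Proof. by move=> i_n; rewrite hr_xsX // addrK. Qed.

Lemma hr_sx1X i j : (i.+1 < n)%N ->
  s i * x i.+1 ^+ j = x i ^+ j * s i + hsum (x i) (x i.+1) j.
Proof.
move=> i_n; have xx : GRing.comm (x i) (x i.+1) by apply: (hr_xx hr) => //; apply: ltnW.
elim: j => [|j IHj]; first by rewrite /hsum big_ord0 addr0 !expr0 mulr1 mul1r.
rewrite exprSr mulrA IHj mulrDl -mulrA hr_sx1 // mulrDr mulr1 mulrA -exprSr.
by rewrite -addrA (hsumS _ _ j) [x i ^+ j + _]addrC.
Qed.

Lemma hr_sx_farX i j e : (j.+1 < n)%N -> (i < n)%N -> i != j -> i != j.+1 ->
  s j * x i ^+ e = x i ^+ e * s j.
Proof. by move=> *; apply: commrX; apply: (hr_sx_far hr). Qed.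

(* Indices start at 0: s i exchanges the strands i and i.+1, and trp i j
   represents the transposition (i j). *)
Fixpoint taur (i l : nat) : R :=
  if l is l'.+1 then s (i + l'.+1) * taur i l' * s (i + l'.+1) else s i.
Definition trp (i j : nat) : R :=
  if (i < j)%N then taur i (j - i).-1 else if (j < i)%N then taur j (i - j).-1 else 1.

Lemma trpC i j : trp i j = trp j i.
Proof. by rewrite /trp; case: ltngtP. Qed.

Lemma trp_s i : trp i i.+1 = s i.
Proof. by rewrite /trp ltnSn subSnn. Qed.

Lemma trpS i j : (i < j)%N -> trp i j.+1 = s j * trp i j * s j.
Proof.
move=> ij; rewrite /trp ij (ltnW ij : (i < j.+1)%N).
have -> : (j.+1 - i).-1 = (j - i).-1.+1 by lia.
by rewrite /=; have -> : (i + (j - i).-1.+1)%N = j by lia.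
Qed.

Lemma trpK i j : (i < n)%N -> (j < n)%N -> trp i j * trp i j = 1.
Proof.
wlog ij : i j / (i < j)%N => [W i_n j_n|].
  have [ij|ji|->] := ltngtP i j; [exact: W | by rewrite trpC; exact: W |].
  by rewrite /trp ltnn mulr1.
elim: j ij => // j IHj ij i_n j_n.
have [->|nij] := eqVneq i j; first by rewrite trp_s (hr_ss hr).
have {}ij : (i < j)%N by lia.
rewrite trpS // !mulrA -[_ * s j * s j]mulrA (hr_ss hr) // mulr1.
by rewrite -[_ * trp i j * trp i j]mulrA IHj // ?mulr1 ?(hr_ss hr) //; apply: ltnW.
Qed.


Lemma s_trp_lt l i j : (l.+1 < n)%N -> (i < j < n)%N ->
  s l * trp i j = trp (tpn l l.+1 i) (tpn l l.+1 j) * s l.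
Proof.
move=> + /andP[]; elim/ltn_ind: j l i => -[//|j] IHj l i l_n ij j_n.
have [ei|nij] := eqVneq i j.
  rewrite -ei in j_n *; rewrite trp_s; have [->|nli] := eqVneq l i.
    have -> : tpn i i.+1 i = i.+1 by tpn_lia.
    have -> : tpn i i.+1 i.+1 = i by tpn_lia.
    by rewrite trpC trp_s.
  have [eli|nli'] := eqVneq l i.+1.
    have -> : tpn l l.+1 i = i by tpn_lia.
    have -> : tpn l l.+1 i.+1 = i.+2 by tpn_lia.
    by rewrite eli trpS // trp_s -[RHS]mulrA (hr_ss hr) ?mulr1 // -eli.
  have [eil|nil] := eqVneq i l.+1.
    have -> : tpn l l.+1 i = l by tpn_lia.
    have -> : tpn l l.+1 i.+1 = l.+2 by tpn_lia.
    rewrite eil trpS // trp_s -(hr_braid hr) -?eil //.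
    by rewrite -[RHS]mulrA (hr_ss hr) ?mulr1 // -eil.
  have -> : tpn l l.+1 i = i by tpn_lia.
  have -> : tpn l l.+1 i.+1 = i.+1 by tpn_lia.
  by rewrite trp_s hr_farC.
have {nij} ij : (i < j)%N by lia.
have [->|nlj] := eqVneq l j.
  have -> : tpn j j.+1 i = i by tpn_lia.
  have -> : tpn j j.+1 j.+1 = j by tpn_lia.
  by rewrite trpS // !mulrA (hr_ss hr) // mul1r.
have [elj|nlj1] := eqVneq l j.+1.
  have -> : tpn l l.+1 i = i by tpn_lia.
  have -> : tpn l l.+1 j.+1 = j.+2 by tpn_lia.
  by rewrite elj (trpS (ltnW ij : (i < j.+1)%N)) -[RHS]mulrA (hr_ss hr) ?mulr1 // -elj.
have -> : tpn l l.+1 j.+1 = j.+1 by tpn_lia.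
have [elj|nlj2] := eqVneq l.+1 j; last first.
  have comm : s l * s j = s j * s l by apply: hr_farC => //; lia.
  have lt_j : (tpn l l.+1 i < j)%N by tpn_lia.
  rewrite !trpS // !mulrA comm -[s j * s l * _]mulrA IHj //; last exact: ltnW.
  have -> : tpn l l.+1 j = j by tpn_lia.
  by rewrite !mulrA -!mulrA comm.
have [eil|nil] := eqVneq i l.
  have -> : tpn l l.+1 i = l.+1 by tpn_lia.
  have il2 : (l < l.+1)%N by [].
  rewrite eil -elj in j_n *; rewrite trpS // !trp_s -(hr_braid hr) //.
  by rewrite !mulrA (hr_ss hr) // mul1r.
have il : (i < l)%N by lia.
have -> : tpn l l.+1 i = i by tpn_lia.
(* The case l + 1 = j, where s_l and s_j do not commute. Two outer conjugations are peeled off, and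
   the braid relation trades s_l for s_{l+1}, which passes the shorter transposition by the
   induction hypothesis for l. *)
rewrite -elj in j_n *; rewrite !(trpS (ltnW il : (i < l.+1)%N)) trpS //.
have /= com := IHj l _ l.+1 i j_n il (ltnW l_n).
have e1 : tpn l.+1 l.+2 i = i by tpn_lia.
have e2 : tpn l.+1 l.+2 l = l by tpn_lia.
rewrite e1 e2 in com.
rewrite !mulrA (hr_braid hr) // -[_ * s l.+1 * trp i l]mulrA com; last lia.
by rewrite -!mulrA; do 3 congr (_ * _); rewrite !mulrA (hr_braid hr).
Qed.

Lemma s_trp l i j : (l.+1 < n)%N -> (i < n)%N -> (j < n)%N ->
  s l * trp i j = trp (tpn l l.+1 i) (tpn l l.+1 j) * s l.
Proof.
move=> l_n i_n j_n; have [ij|ji|->] := ltngtP i j.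
- by apply: s_trp_lt => //; rewrite ij.
- by rewrite trpC s_trp_lt ?ji // trpC.
- by rewrite /trp !ltnn mulr1 mul1r.
Qed.

Lemma trp_trp a b i j : (a < n)%N -> (b < n)%N -> (i < n)%N -> (j < n)%N ->
  trp a b * trp i j = trp (tpn a b i) (tpn a b j) * trp a b.
Proof.
wlog ab : a b / (a < b)%N => [W a_n b_n|].
  have [ab|ba|->] := ltngtP a b; first exact: W.
    by rewrite trpC => *; rewrite W // ![tpn b a _]tpnC.
  move=> _ _; rewrite /trp ltnn mul1r mulr1.
  by rewrite /tpn; case: eqP => [<-|_]; case: eqP => [<-|_].
elim: b ab i j => // b IHb ab i j a_n b_n i_n j_n.
have [->|nab] := eqVneq a b; first by rewrite trp_s s_trp.
have {}ab : (a < b)%N by lia.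
have b_n' := ltnW b_n; rewrite trpS // -!mulrA s_trp // (mulrA (trp a b)) IHb ?tpn_lt //.
by rewrite !mulrA s_trp ?tpn_lt // !tpnS.
Qed.

End HeckeRelTheory.

Section HeckeRelGeneration.
Variables (R : pzRingType) (n : nat) (x0 : R) (s : nat -> R).
Hypothesis ss : forall i, (i.+1 < n)%N -> s i * s i = 1.
Hypothesis far : forall i j, (i.+1 < j)%N -> (j.+1 < n)%N -> s i * s j = s j * s i.
Hypothesis braid : forall i, (i.+2 < n)%N -> s i * s i.+1 * s i = s i.+1 * s i * s i.+1.
Hypothesis sx0 : forall j, (j.+2 < n)%N -> s j.+1 * x0 = x0 * s j.+1.

(** The relations force x_{i+1} = s_i x_i s_i + s_i. Conversely, for dots defined this way, all
    relations follow from those among the s_i, from x_0 commuting with s_1, s_2, ... and from x_0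
    x_1 = x_1 x_0. This leaves few identities to verify for the matrices of the coset
    representation. *)
Fixpoint xrec (i : nat) : R :=
  if i is i'.+1 then s i' * xrec i' * s i' + s i' else x0.

Hypothesis x0x1 : (1 < n)%N -> x0 * xrec 1 = xrec 1 * x0.

Lemma xrec_sgt i j : (j.+1 < n)%N -> (i < j)%N -> s j * xrec i = xrec i * s j.
Proof.
elim: i j => [|i IHi] j j_n ij /=; first by case: j j_n ij => // j *; apply: sx0.
have si : s i * s j = s j * s i by apply: far.
rewrite mulrDr mulrDl -si !mulrA -si; congr (_ + _).
by rewrite -[s i * s j * _]mulrA IHi // ?(ltnW ij) // -!mulrA -si.
Qed.

Lemma xrec_slt i j : (i < n)%N -> (j.+1 < i)%N -> s j * xrec i = xrec i * s j.
Proof.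
elim: i j => // i IHi j + ji1; move=> i_n; have [ji|ji] := leqP i j.+1; last first.
  have si : s j * s i = s i * s j by apply: far.
  rewrite /= mulrDr mulrDl -si !mulrA si; congr (_ + _).
  by rewrite -[s i * s j * _]mulrA IHi ?(ltnW i_n) // -!mulrA -si.
have eij : i = j.+1 by lia.
rewrite {}eij {ji IHi ji1} in i_n *.
have j_n : (j.+1 < n)%N by apply: ltnW.
have jj : s j.+1 * xrec j = xrec j * s j.+1 by apply: xrec_sgt.
have br := braid i_n.
have e : s j * (s j.+1 * s j * s j.+1) * s j = s j.+1.
  by rewrite -br !mulrA ss // mul1r -mulrA ss // mulr1.
have e1 : s j * (s j.+1 * s j * s j.+1) = s j.+1 * s j.
  by rewrite -br !mulrA ss // mul1r.
have e2 : s j.+1 * s j * s j.+1 * s j = s j * s j.+1.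
  by rewrite -br -mulrA ss // mulr1.
rewrite /= !(mulrDr, mulrDl) -!addrA; congr (_ + _); last first.
  by rewrite addrC e1 e2.
rewrite !mulrA br -[_ * s j.+1 * xrec j]mulrA jj.
by rewrite -!mulrA; do 3 congr (_ * _); rewrite !mulrA br.
Qed.

Lemma xrec_comm i j : (i < j)%N -> (j < n)%N -> xrec i * xrec j = xrec j * xrec i.
Proof.
elim: i j => [|i IHi] j ij j_n; last first.
  have c1 : xrec j * s i = s i * xrec j by rewrite xrec_slt.
  rewrite /= mulrDr mulrDl -c1 !mulrA c1; congr (_ + _).
  by rewrite -[s i * xrec j * _]mulrA -IHi ?(ltnW ij) // -!mulrA c1.
elim: j ij j_n => // -[|j] IHj _ j_n; first exact: x0x1.
have c1 : x0 * s j.+1 = s j.+1 * x0 by rewrite sx0.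
rewrite [xrec j.+2]/= mulrDr mulrDl -c1 !mulrA c1; congr (_ + _).
have {}IHj := IHj isT (ltnW j_n); rewrite -/(xrec j.+1) -[s j.+1 * x0 * _]mulrA.
by rewrite [x0 * _]IHj -!mulrA c1.
Qed.

Lemma xrec_hecke_rel : hecke_rel n xrec s.
Proof.
split=> //.
- move=> i j j_n i_n ij ij1; have [ltij|leji] := ltnP i j; first exact: xrec_sgt.
  by apply: xrec_slt => //; lia.
- move=> i i_n; rewrite /= mulrDl ss // addrK.
  by rewrite -[RHS]mulrA ss ?mulr1.
- move=> i j i_n j_n; have [ij|ji|->] := ltngtP i j => //; first exact: xrec_comm.
  by apply/esym/xrec_comm.
Qed.

End HeckeRelGeneration.

Section Hecke.
Variables (k : fieldType) (lam : weight).
Local Notation H := (hecke k lam).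
Local Notation x := (xH k lam).
Local Notation s := (sH k lam).
Local Notation d := (level lam).

Lemma pclassD n (t u : aterm k (hgen n)) :
  pclass (@hrel k lam n) (AAdd t u) = pclass (@hrel k lam n) t + pclass (@hrel k lam n) u.
Proof. by rewrite -[RHS]/(padd _ _) paddE. Qed.

Lemma pclassM n (t u : aterm k (hgen n)) :
  pclass (@hrel k lam n) (AMul t u) = pclass (@hrel k lam n) t * pclass (@hrel k lam n) u.
Proof. by rewrite -[RHS]/(pmul _ _) pmulE. Qed.

Lemma cH_is_additive n : {morph @cH k lam n : a b / a - b}.
Proof.
have D (a b : k) : cH lam n (a + b) = cH lam n a + cH lam n b.
  by rewrite /cH /pconst -pclassD; apply/pclass_eq/aeq_constD.
by move=> a b; apply: (addIr (cH lam n b)); rewrite -D !subrK.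
Qed.
Lemma cH_is_multiplicative n : GRing.monoid_morphism (@cH k lam n).
Proof.
split=> // a b; rewrite /cH /pconst -pclassM; exact/pclass_eq/aeq_constM.
Qed.
HB.instance Definition _ n :=
  GRing.isZmodMorphism.Build k (H n) (@cH k lam n) (@cH_is_additive n).
HB.instance Definition _ n :=
  GRing.isMonoidMorphism.Build k (H n) (@cH k lam n) (@cH_is_multiplicative n).

Lemma cHC n c (a : H n) : cH lam n c * a = a * cH lam n c.
Proof. exact: pconstC. Qed.

Lemma pclass_cH n c : pclass (@hrel k lam n) (AConst c) = cH lam n c.
Proof. by []. Qed.

Lemma pclass_rel n (t u : aterm k (hgen n)) : hrel lam t u ->
  pclass (@hrel k lam n) t = pclass (@hrel k lam n) u.
Proof. by move=> tu; apply/pclass_eq/aeq_rel. Qed.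

Lemma hecke_relP n : hecke_rel n (x n) (s n).
Proof.
split.
- move=> i i_n; have i_n' : (i < n.-1)%N by lia.
  by have := pclass_rel (@hrel_ss k lam n (Ordinal i_n')); rewrite pclassM.
- move=> i j ij j_n; have j_n' : (j < n.-1)%N by lia.
  have i_n' : (i < n.-1)%N by lia.
  by have := pclass_rel (@hrel_far k lam n (Ordinal i_n') (Ordinal j_n') ij); rewrite !pclassM.
- move=> i i_n; have i_n' : (i < n.-1)%N by lia.
  have i_n1 : (i.+1 < n.-1)%N by lia.
  have := pclass_rel (@hrel_braid k lam n (Ordinal i_n') (Ordinal i_n1) erefl).
  by rewrite !pclassM !mulrA.
- move=> i j j_n i_n ij ij1; have j_n' : (j < n.-1)%N by lia.
  by have := pclass_rel (@hrel_sx_far k lam n (Ordinal j_n') (Ordinal i_n) ij ij1); rewrite !pclassM.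
- move=> i i_n; have i_n' : (i < n.-1)%N by lia.
  have := pclass_rel (@hrel_sx k lam n (Ordinal i_n')).
  by rewrite pclassD !pclassM pclass_cH rmorphN1.
- move=> i j i_n j_n.
  by have := pclass_rel (@hrel_xx k lam n (Ordinal i_n) (Ordinal j_n)); rewrite !pclassM.
Qed.

(* The roots, with multiplicities, of the cyclotomic polynomial. *)
Definition croots : seq k := flatten [seq nseq (lam i) i%:~R | i <- finsupp lam].

Lemma size_croots : size croots = d.
Proof.
rewrite size_flatten /shape -map_comp sumnE big_map /level.
by apply: eq_bigr => i _; rewrite /= size_nseq.
Qed.

Lemma sum_croots : \sum_(c <- croots) c = \sum_(i <- finsupp lam) i%:~R * (lam i)%:R.
Proof.
rewrite /croots big_flatten big_map; apply: eq_bigr => i _.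
by rewrite big_nseq -Monoid.iteropE /= mulr_natr; elim: (lam i) => //= p ->; rewrite mulrS.
Qed.

Definition cycp (R : pzRingType) (f : k -> R) (a : R) : R := \prod_(c <- croots) (a - f c).

Lemma cycpE n : (0 < n)%N -> cycp (cH lam n) (x n 0) = 0.
Proof.
move=> n0; have := pclass_rel (hrel_cyc k lam n0); rewrite pclass_cH rmorph0 => <-.
rewrite (big_morph (pclass (@hrel k lam n)) (id1 := 1) (op1 := *%R)) //; last first.
  exact: pclassM.
rewrite /cycp /croots big_flatten big_map; apply: eq_bigr => i _.
elim: (lam i) => [|p IHp] /=; first by rewrite big_nil.
by rewrite big_cons IHp pclassM pclassD pclass_cH rmorphN.
Qed.

Lemma sH0 n i : (n <= i.+1)%N -> s n i = 0.
Proof. by move=> ni; rewrite /sH /ts insubF ?pclass_cH ?rmorph0 //; lia. Qed.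

Lemma hecke_ind n (P : H n -> Prop) :
  (forall c, P (cH lam n c)) -> (forall i, (i < n)%N -> P (x n i)) ->
  (forall i, (i.+1 < n)%N -> P (s n i)) ->
  (forall a b, P a -> P b -> P (a + b)) -> (forall a b, P a -> P b -> P (a * b)) ->
  forall a, P a.
Proof.
move=> Pc Px Ps PD PM a; rewrite -(pclass_repr a).
elim: (repr a) => [[i|i]|c|t IHt u IHu|t IHt u IHu] //.
- by have := Px i (ltn_ord i); rewrite /xH /tx valK.
- have i_n : (i.+1 < n)%N by have := ltn_ord i; lia.
  by have := Ps i i_n; rewrite /sH /ts valK.
- exact: Pc.
- by rewrite pclassD; apply: PD.
- by rewrite pclassM; apply: PM.
Qed.

Lemma incl_x n i : (i < n)%N -> incl (x n i) = x n.+1 i.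
Proof. by move=> i_n; rewrite /incl embE ?leqnSn // asubst_tx. Qed.

Lemma incl_s n i : (i.+1 < n)%N -> incl (s n i) = s n.+1 i.
Proof. by move=> i_n; rewrite /incl embE ?leqnSn // asubst_ts //; lia. Qed.

Lemma incl_cH n (c : k) : incl (cH lam n c) = cH lam n.+1 c.
Proof. by rewrite /incl embE. Qed.

Lemma inclD n (a b : H n) : incl (a + b) = incl a + incl b.
Proof. exact: rmorphD. Qed.
Lemma inclN n (a : H n) : incl (- a) = - incl a.
Proof. exact: rmorphN. Qed.
Lemma inclB n (a b : H n) : incl (a - b) = incl a - incl b.
Proof. exact: rmorphB. Qed.
Lemma inclM n (a b : H n) : incl (a * b) = incl a * incl b.
Proof. exact: rmorphM. Qed.
Lemma incl0 n : incl (0 : H n) = 0.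
Proof. exact: rmorph0. Qed.
Lemma incl1 n : incl (1 : H n) = 1.
Proof. exact: rmorph1. Qed.
Lemma inclX n (a : H n) j : incl (a ^+ j) = incl a ^+ j.
Proof. exact: rmorphXn. Qed.
Lemma incl_sum n (I : Type) (r : seq I) (P : pred I) (F : I -> H n) :
  incl (\sum_(i <- r | P i) F i) = \sum_(i <- r | P i) incl (F i).
Proof. exact: rmorph_sum. Qed.

Lemma incl_s_comm n (a : H n) : incl (incl a) * s n.+2 n = s n.+2 n * incl (incl a).
Proof.
elim/hecke_ind: a => [c|i i_n|i i_n|a b IHa IHb|a b IHa IHb].
- by rewrite !incl_cH cHC.
- rewrite (incl_x i_n) (incl_x (leqW i_n)); apply/esym/(hr_sx_far (hecke_relP _)); lia.
- rewrite (incl_s i_n) (incl_s (leqW i_n)); apply: (hr_far (hecke_relP _)); lia.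
- by rewrite !rmorphD mulrDl mulrDr IHa IHb.
- by rewrite !rmorphM -mulrA IHb !mulrA IHa.
Qed.

Lemma incl_x_comm n (a : H n) : incl a * x n.+1 n = x n.+1 n * incl a.
Proof.
elim/hecke_ind: a => [c|i i_n|i i_n|a b IHa IHb|a b IHa IHb].
- by rewrite !incl_cH cHC.
- by rewrite !incl_x // (hr_xx (hecke_relP _)) //; lia.
- by rewrite incl_s // (hr_sx_far (hecke_relP _)) //; lia.
- by rewrite !rmorphD mulrDl mulrDr IHa IHb.
- by rewrite !rmorphM -mulrA IHb !mulrA IHa.
Qed.

End Hecke.

(** * A coset representation of the cyclotomic Hecke algebra *)

Section CosetRepresentation.
Variables (k : fieldType) (lam : weight) (R : nzRingType) (n : nat).
Variables (xR sR : nat -> R) (c : {rmorphism k -> R}).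
Hypothesis hr : hecke_rel n xR sR.
Hypothesis cC : forall z a, c z * a = a * c z.
Hypothesis cyc0 : (0 < n)%N -> cycp lam c (xR 0%N) = 0.
Local Notation d := (level lam).
Local Notation row := 'rV[{poly R}]_n.+1.
Local Notation mat := 'M[{poly R}]_n.+1.

Definition ce (p : nat) : row := delta_mx 0 (inord p).

(** Right multiplication by s_j on the affine algebra on n + 1 strands, base changed to R along the
    affine algebra on n strands. It is a free left module over R[X], where X is the last dot and
    [ce p] stands for s_{n-1} ... s_p, so that [ce n] is the unit coset. With matrices, freeness
    holds by construction and only the relations have to be checked. *)
Definition cS (j : nat) : mat := \matrix_(i < n.+1)
  (if i == j :> nat then ce j.+1 else if i == j.+1 :> nat then ce j
   else if (i < j)%N then (sR j.-1)%:P *: ce i else (sR j)%:P *: ce i).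

Fixpoint cD (l : nat) : R := if l is l'.+1 then sR l' * cD l' else 1.

(** The corrections when x_0 is moved to the left through s_{n-1} ... s_0: the term in which s_l is
    left out equals s_{l-1} ... s_0 times [ce l.+1]. *)
Definition cZ : row := \sum_(l < n) (cD l)%:P *: ce l.+1.

Definition cX : mat := \matrix_(i < n.+1)
  (if i == 0%N :> nat then 'X *: ce 0 - cZ else (xR 0)%:P *: ce i).

Lemma ceK (A B : mat) : (forall p, (p <= n)%N -> ce p *m A = ce p *m B) -> A = B.
Proof.
move=> AB; apply/row_matrixP => i.
by have := AB i (ltn_ord i); rewrite /ce inord_val -!rowE.
Qed.

Lemma ce_mat (F : 'I_n.+1 -> row) p : (p <= n)%N ->
  ce p *m (\matrix_i F i) = F (inord p).
Proof. by move=> pn; rewrite /ce -rowE rowK. Qed.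

Lemma ceS0 j : (j < n)%N -> ce j *m cS j = ce j.+1.
Proof. by move=> jn; rewrite ce_mat ?inordK ?eqxx // ltnW. Qed.
Lemma ceS1 j : (j < n)%N -> ce j.+1 *m cS j = ce j.
Proof. by move=> jn; rewrite ce_mat ?inordK ?eqxx // (gtn_eqF (ltnSn j)). Qed.
Lemma ceSlt p j : (p < j)%N -> (j < n)%N -> ce p *m cS j = (sR j.-1)%:P *: ce p.
Proof.
move=> pj jn; rewrite ce_mat ?inordK; try lia.
by rewrite (ltn_eqF pj) (ltn_eqF (ltnW pj : (p < j.+1)%N)) pj.
Qed.
Lemma ceSgt p j : (j.+1 < p)%N -> (p <= n)%N -> ce p *m cS j = (sR j)%:P *: ce p.
Proof.
move=> pj jn; rewrite ce_mat ?inordK //.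
by rewrite (gtn_eqF pj) (gtn_eqF (ltnW pj : (j < p)%N)) ltnNge (ltnW (ltnW pj)).
Qed.
Lemma ceX0 : ce 0 *m cX = 'X *: ce 0 - cZ.
Proof. by rewrite ce_mat // inordK. Qed.
Lemma ceX p : (0 < p)%N -> (p <= n)%N -> ce p *m cX = (xR 0)%:P *: ce p.
Proof. by move=> p0 pn; rewrite ce_mat // inordK // (gtn_eqF p0). Qed.

Ltac cest := rewrite ?mulmxA -?scalemxAl; first
  [rewrite ceS0; [|lia] | rewrite ceS1; [|lia] | rewrite ceSlt; [|lia|lia]
  |rewrite ceSgt; [|lia|lia] | rewrite ceX; [|lia|lia]].

Ltac cests := repeat cest.

Lemma cSS j : (j.+1 < n.+1)%N -> cS j *m cS j = 1.
Proof.
move=> jn; apply: ceK => p pn; rewrite mulmx1.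
have [->|npj] := eqVneq p j; first by cests.
have [->|npj'] := eqVneq p j.+1; first by cests.
have [pj|jp] := ltnP p j; cests; rewrite scalerA -polyCM (hr_ss hr) ?scale1r //; lia.
Qed.

Lemma cSfar i j : (i.+1 < j)%N -> (j.+1 < n.+1)%N -> cS i *m cS j = cS j *m cS i.
Proof.
move=> ij jn; apply: ceK => p pn.
have [->|npi] := eqVneq p i; first by cests.
have [->|npi'] := eqVneq p i.+1; first by cests.
have [->|npj] := eqVneq p j; first by cests.
have [->|npj'] := eqVneq p j.+1; first by cests.
have [pi|ip] := ltnP p i; [|have [pj|jp] := ltnP p j]; cests;
  by rewrite !scalerA -!polyCM (hr_far hr) //; lia.
Qed.

Lemma cSbraid i : (i.+2 < n.+1)%N ->
  cS i *m cS i.+1 *m cS i = cS i.+1 *m cS i *m cS i.+1.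
Proof.
move=> jn; apply: ceK => p pn.
have [->|npi] := eqVneq p i; first by cests.
have [->|npi'] := eqVneq p i.+1; first by cests.
have [->|npj] := eqVneq p i.+2; first by cests.
have [pi|ip] := ltnP p i; cests; rewrite !scalerA -!polyCM; last first.
  by rewrite (hr_braid hr) //; lia.
by congr (_%:P *: _); case: i pi {npi npi' npj} jn => // i *; rewrite (hr_braid hr).
Qed.

Lemma cD_far j l : (l < j)%N -> (j.+1 < n)%N -> sR j * cD l = cD l * sR j.
Proof.
elim: l => [|l IHl] /= lj jn; first by rewrite mulr1 mul1r.
rewrite mulrA -(hr_far hr) // -(mulrA (sR l) (sR j)) IHl ?mulrA //; lia.
Qed.

Lemma cD_up j l : (j.+1 < l)%N -> (l < n)%N -> sR j * cD l = cD l * sR j.+1.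
Proof.
elim: l => [|l IHl] //= jl ln; have [jl'|lj] := ltnP j.+1 l.
  by rewrite mulrA (hr_far hr) // -(mulrA (sR l) (sR j)) IHl ?mulrA //; lia.
have el : l = j.+1 by lia.
rewrite {}el in ln *; have j_n := ltnW ln.
by rewrite /= !mulrA (hr_braid hr) // -(mulrA (sR j.+1 * sR j) (sR j.+1)) cD_far ?mulrA.
Qed.

Lemma cZS j : (j.+1 < n)%N -> cZ *m cS j.+1 = (sR j)%:P *: cZ.
Proof.
move=> jn; have jn' := ltnW jn.
rewrite /cZ mulmx_suml scaler_sumr.
rewrite [RHS](reindex_inj (@perm_inj _ (tperm (Ordinal jn') (Ordinal jn)))) /=.
apply: eq_bigr => l _; case: tpermP => [->|->|/eqP nlj /eqP nlj1] /=.
- by cest; rewrite scalerA -polyCM mulrA (hr_ss hr) // mul1r.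
- by cest; rewrite scalerA -polyCM.
have ln := ltn_ord l.
rewrite -!val_eqE /= in nlj nlj1; have [lj|jl] := ltnP l j; cest; rewrite !scalerA -!polyCM.
  by rewrite cD_far.
by rewrite cD_up //; lia.
Qed.

Lemma cSX j : (j.+2 < n.+1)%N -> cS j.+1 *m cX = cX *m cS j.+1.
Proof.
move=> jn; apply: ceK => p pn; have [->|p0] := posnP p.
  cest; rewrite -scalemxAl !ceX0 mulmxBl cZS // scalerBr.
  by cest; rewrite !scalerA commr_polyX.
have [->|npj] := eqVneq p j.+1; first by cests.
have [->|npj'] := eqVneq p j.+2; first by cests.
by have [pi|ip] := ltnP p j.+1; cests; rewrite !scalerA -!polyCM (hr_sx_far hr) //; lia.
Qed.

Lemma cD_x l : (0 < l < n)%N -> xR 0%N * cD l = cD l * (xR 1%N - sR 0%N).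
Proof.
elim: l => // l IHl /andP[_ ln] /=; have [->|l0] := posnP l.
  have n1 : (1 < n)%N by lia.
  by rewrite mulr1 mulrBr (hr_ss hr) // (hr_sx1 hr) // addrK.
rewrite mulrA -(hr_sx_far hr) ?(ltn_eqF l0) -?mulrA ?IHl //; lia.
Qed.

Definition cY : mat := cS 0 *m cX *m cS 0 + cS 0.

Lemma ceY0 : (0 < n)%N -> ce 0 *m cY = (xR 0)%:P *: ce 0 + ce 1.
Proof. by move=> n0; rewrite /cY mulmxDr; cests. Qed.

Lemma ceYgt p : (1 < p)%N -> (p <= n)%N -> ce p *m cY = (xR 1)%:P *: ce p.
Proof.
move=> p1 pn; rewrite /cY mulmxDr; cests.
rewrite !scalerA -!polyCM -scalerDl -polyCD ?mulrA -(hr_xS hr) //; lia.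
Qed.

Lemma ceX0E : (0 < n)%N ->
  ce 0 *m cX = 'X *: ce 0 - ce 1 - \sum_(1 <= l < n) (cD l)%:P *: ce l.+1.
Proof.
move=> n0; rewrite ceX0 /cZ -(big_mkord xpredT (fun l => (cD l)%:P *: ce l.+1)).
by rewrite big_ltn // scale1r opprD addrA.
Qed.

Lemma ceY1 : (0 < n)%N ->
  ce 1 *m cY = 'X *: ce 1 - \sum_(1 <= l < n) (cD l * sR 0)%:P *: ce l.+1.
Proof.
move=> n0; rewrite /cY mulmxDr !mulmxA ceS1 // ceX0E // !mulmxBl -scalemxAl ceS0 //.
rewrite ceS1 // addrAC subrK; congr (_ - _).
rewrite mulmx_suml; apply: eq_big_nat => l /andP[l1 ln].
by cests; rewrite scalerA -polyCM.
Qed.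

Lemma cXY : (1 < n.+1)%N -> cX *m cY = cY *m cX.
Proof.
rewrite ltnS => n0; apply: ceK => p pn; have [->|p0] := posnP p.
  rewrite !mulmxA ceY0 // ceX0E // mulmxDl !mulmxBl -!scalemxAl ceY0 // ceY1 //.
  rewrite [in RHS]mulmxDl -scalemxAl ceX0E // ceX // !scalerBr scalerDr.
  set Z := \sum_(1 <= l < n) (cD l)%:P *: _.
  set Z1 := \sum_(1 <= l < n) _.
  (* By [cD_x], D_l x_1 = x_0 D_l + D_l s_0 for D_l = [cD l]; the two summands give the two sums. *)
  have eZ : Z *m cY = Z1 + (xR 0)%:P *: Z.
    rewrite /Z1 /Z mulmx_suml scaler_sumr -big_split; apply: eq_big_nat => l /andP[l1 ln] /=.
    rewrite -scalemxAl ceYgt // !scalerA -!polyCM -scalerDl -polyCD.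
    by rewrite cD_x ?l1 // -mulrDr addrC subrK.
  have e1 (V : zmodType) (a b e f : V) : a + b - (b - e) - f = a + (e - f).
    by rewrite opprB addrA [a + b + e]addrAC addrK addrA.
  have e2 (V : zmodType) (a b e : V) : a - b - e + b = a - e.
    by rewrite addrAC subrK.
  have eZ' : Z1 - Z *m cY = - ((xR 0)%:P *: Z) by rewrite eZ opprD addrA subrr add0r.
  by rewrite mulNmx e1 e2 eZ' !scalerA commr_polyX.
have [->|np1] := eqVneq p 1%N; last first.
  rewrite !mulmxA ceX // ceYgt //; last lia.
  rewrite -!scalemxAl ceYgt ?ceX //; last lia.
  by rewrite !scalerA -!polyCM (hr_xx hr) //; lia.
rewrite !mulmxA ceX // ceY1 // mulmxBl -!scalemxAl ceX // ceY1 // scalerBr.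
rewrite !scalerA commr_polyX; congr (_ - _); rewrite mulmx_suml scaler_sumr.
apply: eq_big_nat => l /andP[l1 ln]; cests; rewrite !scalerA -!polyCM.
congr (_%:P *: _); rewrite mulrA cD_x ?l1 // -!mulrA; congr (_ * _).
have n1 : (1 < n)%N by lia.
by rewrite mulrBl (hr_ss hr) // (hr_sx hr).
Qed.


Lemma coset_hecke_rel : hecke_rel n.+1 (xrec cX cS) cS.
Proof.
apply: xrec_hecke_rel; [exact: cSS | exact: cSfar | exact: cSbraid | exact: cSX | exact: cXY].
Qed.

(* Scalars commute with every matrix since they are central in R. *)
Definition cC_mx (z : k) : mat := (c z)%:P%:M.

Lemma mul_cC_mx (v : row) z : v *m cC_mx z = (c z)%:P *: v.
Proof.
apply/rowP => i; rewrite !mxE (bigD1 i) //= !mxE eqxx mulr1n big1 ?addr0 => [|j ji].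
  by apply/polyP => e; rewrite coefMC coefCM; apply/esym/cC.
by rewrite mxE (negbTE ji) mulr0n mulr0.
Qed.

Definition szle (j : nat) (v : row) := forall i, (size (v 0%R i) <= j)%N.

Lemma szle0 j : szle j 0. Proof. by move=> i; rewrite mxE size_poly0. Qed.
Lemma szleD j v w : szle j v -> szle j w -> szle j (v + w).
Proof.
move=> vj wj i; rewrite mxE (leq_trans (size_polyD _ _)) // geq_max vj; exact: wj.
Qed.
Lemma szleN j v : szle j v -> szle j (- v).
Proof. by move=> vj i; rewrite mxE size_polyN. Qed.
Lemma szleC j a v : szle j v -> szle j (a%:P *: v).
Proof.
move=> vj i; rewrite mxE; apply/leq_sizeP => e je; rewrite coefCM.
by rewrite nth_default ?mulr0 // (leq_trans (vj i)).
Qed.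
Lemma szleX j v : szle j v -> szle j.+1 ('X *: v).
Proof.
move=> vj i; rewrite mxE; apply/leq_sizeP => -[//|e]; rewrite ltnS coefXM /= => je.
by rewrite nth_default // (leq_trans (vj i)).
Qed.
Lemma szleW j j' v : (j <= j')%N -> szle j v -> szle j' v.
Proof. by move=> jj vj i; apply: leq_trans jj. Qed.
Lemma szle_ce p : szle 1 (ce p).
Proof. by move=> i; rewrite mxE eqxx /= -polyC_natr size_polyC_leq1. Qed.
Lemma szle_sum j (I : finType) (F : I -> row) :
  (forall i, szle j (F i)) -> szle j (\sum_i F i).
Proof. by move=> FI; elim/big_ind: _ => //; [apply: szle0 | apply: szleD]. Qed.

Lemma row_ceE (v : row) : v = \sum_(i < n.+1) v 0 i *: ce i.
Proof. by rewrite [LHS]row_sum_delta; apply: eq_bigr => i _; rewrite /ce inord_val. Qed.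

Lemma szle_mulS j v l : (l < n)%N -> szle j v -> szle j (v *m cS l).
Proof.
move=> ln vj; rewrite [v]row_ceE mulmx_suml; apply: szle_sum => i.
have ce_sz p : szle j (v 0 i *: ce p).
  move=> q; rewrite !mxE eqxx /=; case: eqP => _; rewrite ?mulr1 //.
  by rewrite mulr0 size_poly0.
have ce_szC a p : szle j (v 0 i *: (a%:P *: ce p)).
  move=> q; rewrite !mxE eqxx /=; case: eqP => _; rewrite ?mulr1 ?mulr0 ?size_poly0 //.
  apply/leq_sizeP => e je; rewrite coefMC nth_default ?mul0r //.
  exact: leq_trans (vj _) je.
rewrite -scalemxAl /ce -rowE inord_val rowK.
by case: ifP => _; [|case: ifP => _; [|case: ifP => _]].
Qed.

Lemma ce0_prod (cs : seq k) :
  exists2 v, szle (size cs) v &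
  ce 0 *m \prod_(z <- cs) (cX - cC_mx z) = 'X^(size cs) *: ce 0 + v.
Proof.
elim: cs => [|z cs [v vs IH]] /=.
  by exists 0; [exact: szle0 | rewrite big_nil mulmx1 expr0 scale1r addr0].
(* On [ce p] with p > 0 every factor acts as an element of R, so the correction [cZ] contributes
   entries of degree 0 only and leaves the leading term alone. *)
have cst p : (0 < p)%N -> (p <= n)%N -> exists a,
    ce p *m \prod_(z <- cs) (cX - cC_mx z) = a%:P *: ce p.
  move=> p0 pn; elim: {v vs IH} cs => [|y cs [a IH]].
    by exists 1; rewrite big_nil mulmx1 polyC1 scale1r.
  exists ((xR 0 - c y) * a); rewrite big_cons mulmxA mulmxBr ceX // mul_cC_mx -scalerBl.
  by rewrite -scalemxAl IH scalerA polyCM polyCB.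
exists ('X *: v - (c z)%:P *: ('X^(size cs) *: ce 0 + v) -
        cZ *m \prod_(z <- cs) (cX - cC_mx z)).
  have s1 : szle (size cs).+1 ('X^(size cs) *: ce 0).
    move=> i; rewrite !mxE eqxx /=; case: eqP => _; rewrite ?mulr0 ?size_poly0 // mulr1.
    by rewrite size_polyXn.
  have s2 : szle (size cs).+1 (cZ *m \prod_(z <- cs) (cX - cC_mx z)).
    rewrite /cZ mulmx_suml; apply: szle_sum => l; rewrite -scalemxAl.
    have [a ->] := cst l.+1 isT (ltn_ord l).
    by do 2 apply: szleC; apply: szleW (szle_ce _).
  apply: szleD; last exact: szleN.
  apply: szleD; first exact: szleX.
  by apply/szleN/szleC/szleD => //; apply: szleW vs.
rewrite big_cons mulmxA mulmxBr ceX0 mul_cC_mx !mulmxBl -!scalemxAl IH scalerDr scalerA.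
by rewrite -exprS -!addrA; congr (_ + (_ + _)); rewrite addrC.
Qed.

Definition cF : mat := cycp lam cC_mx cX.

(** For p > 0 the first dot acts on [ce p] as that of R, which already satisfies the cyclotomic
    relation. *)
Lemma ceF p : (0 < p)%N -> (p <= n)%N -> ce p *m cF = 0.
Proof.
move=> p0 pn.
suff -> : ce p *m cF = (cycp lam c (xR 0))%:P *: ce p by rewrite cyc0 ?scale0r //; lia.
rewrite /cF /cycp; elim: (croots k lam) => [|y cs IH].
  by rewrite !big_nil mulmx1 scale1r.
rewrite !big_cons mulmxA mulmxBr ceX // mul_cC_mx -scalerBl.
by rewrite -scalemxAl IH scalerA -polyCB -polyCM.
Qed.

(** The image of [ce 0 *m cF] under successive crossings. By [ceF], the cyclotomic polynomial has no
    other nonzero values on the basis. *)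
Fixpoint cE (p : nat) : row := if p is p'.+1 then cE p' *m cS p' else ce 0 *m cF.

Lemma cE_lead p : (p <= n)%N -> exists2 v, szle d v & cE p = 'X^d *: ce p + v.
Proof.
elim: p => [_|p IHp pn] /=.
  by have := ce0_prod (croots k lam); rewrite size_croots.
have [v vd ->] := IHp (ltnW pn); exists (v *m cS p); first exact: szle_mulS.
by rewrite mulmxDl -scalemxAl ceS0.
Qed.

(** The span over R[X] of the [cE i]. It is stable under [cS j] and [cX], so the quotient by it is a
    module over the cyclotomic algebra. The quotient is never formed: equality in it is membership
    of the difference in [cSub]. *)
Definition cSub (v : row) := exists q : 'I_n.+1 -> {poly R}, v = \sum_i q i *: cE i.

Lemma cSub0 : cSub 0.
Proof. by exists (fun=> 0); rewrite big1 // => i _; rewrite scale0r. Qed.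
Lemma cSubD v w : cSub v -> cSub w -> cSub (v + w).
Proof.
move=> [p ->] [q ->]; exists (fun i => p i + q i).
by rewrite -big_split; apply: eq_bigr => i _; rewrite scalerDl.
Qed.
Lemma cSubZ a v : cSub v -> cSub (a *: v).
Proof.
move=> [p ->]; exists (fun i => a * p i).
by rewrite scaler_sumr; apply: eq_bigr => i _; rewrite scalerA.
Qed.
Lemma cSubN v : cSub v -> cSub (- v).
Proof. by rewrite -scaleN1r; apply: cSubZ. Qed.
Lemma cSub_sum (I : finType) (F : I -> row) : (forall i, cSub (F i)) -> cSub (\sum_i F i).
Proof. by move=> FI; elim/big_ind: _ => //; [apply: cSub0 | apply: cSubD]. Qed.
Lemma cSubE p : (p <= n)%N -> cSub (cE p).
Proof.
move=> pn; exists (fun i => (i == p :> nat)%:R); rewrite (bigD1 (inord p)) //= inordK //.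
rewrite eqxx scale1r big1 ?addr0 // => i ip; rewrite -val_eqE /= inordK // in ip.
by rewrite (negbTE ip) scale0r.
Qed.

Lemma cSub_mul (A : mat) : (forall p, (p <= n)%N -> cSub (cE p *m A)) ->
  forall v, cSub v -> cSub (v *m A).
Proof.
move=> EA v [q ->]; rewrite mulmx_suml; apply: cSub_sum => i.
by rewrite -scalemxAl; apply/cSubZ/EA/leq_ord.
Qed.

Lemma cC_mxC (A : mat) z : cC_mx z *m A = A *m cC_mx z.
Proof. by apply: ceK => p pn; rewrite !mulmxA !mul_cC_mx -scalemxAl. Qed.

Lemma comm_cF (A : mat) : cX *m A = A *m cX -> cF *m A = A *m cF.
Proof.
move=> XA; apply/esym; apply: (@commr_prod _ _ _ _ _ (A : mat)) => z _.
by rewrite /GRing.comm mulrBr mulrBl; congr (_ - _); apply/esym; [|apply: cC_mxC].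
Qed.

Lemma cEP p (A B : mat) (a : {poly R}) : (p < n)%N ->
  cS p *m A = B *m cS p -> cE p *m B = a *: cE p -> cE p.+1 *m A = a *: cE p.+1.
Proof. by move=> pn SA EB; rewrite /= -mulmxA SA mulmxA EB -scalemxAl. Qed.

Lemma cE_Sgt p j : (p < j)%N -> (j < n)%N -> cE p *m cS j = (sR j.-1)%:P *: cE p.
Proof.
elim: p => [|p IHp] pj jn.
  case: j pj jn => // j _ jn; rewrite /= -mulmxA comm_cF; last by rewrite cSX.
  by rewrite mulmxA ceSlt //= -scalemxAl.
apply: (@cEP p _ (cS j)); [lia | by apply: cSfar; lia | by apply: IHp; lia].
Qed.

Lemma cE_Slt p j : (j.+1 < p)%N -> (p <= n)%N -> cE p *m cS j = (sR j)%:P *: cE p.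
Proof.
elim: p => // p IHp; rewrite ltnS leq_eqVlt => /orP[/eqP <- | jp] pn; last first.
  apply: (@cEP p _ (cS j)); [by [] | by apply/esym/cSfar; lia | by apply: IHp; lia].
rewrite /= -!mulmxA (mulmxA (cS j)) cSbraid // !mulmxA.
by rewrite cE_Sgt ?(ltnW pn) //= -!scalemxAl.
Qed.

Lemma cSub_S j : (j < n)%N -> forall v, cSub v -> cSub (v *m cS j).
Proof.
move=> jn; apply: cSub_mul => p pn.
have [->|npj] := eqVneq p j; first exact: (cSubE (p := j.+1)).
have [->|npj1] := eqVneq p j.+1.
  by rewrite /= -mulmxA cSS // mulmx1; apply: cSubE; apply: ltnW.
have [pj|jp] := ltnP p j; [rewrite cE_Sgt // | rewrite cE_Slt //; last lia];
  exact/cSubZ/cSubE.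
Qed.

(** For p = 0, F commutes with the first dot X and kills the correction [cZ]. For p = 1, S_0 X = Y
    S_0 - 1, and F commutes with Y as well. For p > 1 the last crossing in [cE p] commutes with
    X. *)
Lemma cSub_X v : cSub v -> cSub (v *m cX).
Proof.
move: v; apply: cSub_mul => p; elim/ltn_ind: p => -[|[|p]] IHp pn.
- rewrite /= -mulmxA comm_cF // mulmxA ceX0 mulmxBl -scalemxAl.
  suff -> : cZ *m cF = 0 by rewrite subr0; apply/cSubZ/(cSubE (p := 0%N)).
  rewrite /cZ mulmx_suml big1 // => l _.
  by rewrite -scalemxAl ceF // scaler0.
- have SX : cS 0 *m cX = cY *m cS 0 - 1.
    by rewrite /cY mulmxDl cSS // -mulmxA cSS // mulmx1 addrK.
  rewrite /= -mulmxA SX mulmxBr mulmx1; apply: cSubD; last exact/cSubN/(cSubE (p := 0%N)).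
  rewrite mulmxA -(mulmxA (ce 0)) comm_cF; last exact: cXY.
  rewrite mulmxA ceY0 // !mulmxDl ceF // mul0mx addr0 -!scalemxAl.
  exact/cSubZ/(cSubE pn).
have -> : cE p.+2 = cE p.+1 *m cS p.+1 by [].
rewrite -mulmxA cSX // mulmxA; apply: cSub_S => //.
by apply: IHp => //; apply: ltnW.
Qed.

Lemma cSub_F (v : row) : cSub (v *m cF).
Proof.
rewrite [v]row_ceE mulmx_suml; apply: cSub_sum => i; rewrite -scalemxAl; apply: cSubZ.
have [->|i0] := posnP i; first exact: (cSubE (p := 0%N)).
by rewrite ceF //; [apply: cSub0 | apply: leq_ord].
Qed.

(* The E_p have leading terms X^d e_p, so that no nonzero combination of them
   has all its coefficients of degree less than d. *)
Lemma cSub_small v : cSub v -> szle d v -> v = 0.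
Proof.
move=> [q vq] vd; suff q0 i : q i = 0 by rewrite vq big1 // => i _; rewrite q0 scale0r.
pose M := \max_i size (q i); have [M0|Mpos] := posnP M.
  apply/eqP; rewrite -size_poly_leq0 -M0; exact: (leq_bigmax i).
have [i0 Mi0] : {i0 | M = size (q i0)} by apply: eq_bigmax; rewrite card_ord.
have w_ex (p : 'I_n.+1) : exists w, szle d w /\ cE p = 'X^d *: ce p + w.
  by have [w wd ->] := cE_lead (leq_ord p); exists w.
have /fin_all_exists[w wP] := w_ex.
have : (v 0 i0)`_(d + M.-1) = 0 by rewrite nth_default // (leq_trans (vd i0)) // leq_addr.
rewrite vq summxE coef_sum (bigD1 i0) //= (wP i0).2 scalerDr scalerA !mxE eqxx /=.
rewrite /ce inord_val eqxx mulr1 coefD coefMXn ltnNge leq_addr /= addKn.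
have sz0 (a b : {poly R}) : (size a <= M)%N -> (size b <= d)%N -> (a * b)`_(d + M.-1) = 0.
  move=> aM bd; rewrite nth_default // (leq_trans (size_polyMleq _ _)) //; lia.
rewrite sz0 ?addr0 -?Mi0 ?(wP i0).1 // big1 => [|i1 ii0]; last first.
  rewrite (wP i1).2 scalerDr scalerA !mxE inord_val eq_sym (negbTE ii0) andbF mulr0 add0r.
  by rewrite sz0 ?(wP i1).1 //; apply: (leq_bigmax i1).
rewrite addr0 => /eqP; rewrite Mi0 -/(lead_coef (q i0)) lead_coef_eq0 => /eqP q0.
by rewrite Mi0 q0 size_poly0 in Mpos.
Qed.

Fixpoint cev (t : aterm k (hgen n.+1)) : mat :=
  match t with
  | AGen (HX i) => xrec cX cS i
  | AGen (HS i) => cS i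
  | AConst z => cC_mx z
  | AAdd t u => cev t + cev u
  | AMul t u => cev t *m cev u
  end.

Lemma cSub_cev t v : cSub v -> cSub (v *m cev t).
Proof.
elim: t v => [[i|i]|z|t IHt u IHu|t IHt u IHu] /= v vS.
- have := ltn_ord i; elim: (i : nat) v vS => /= [|j IHj] v vS jn; first exact: cSub_X.
  rewrite mulmxDr !mulmxA; apply: cSubD; apply: cSub_S => //.
  by apply: IHj; [apply: cSub_S | apply: ltnW].
- exact: cSub_S.
- by rewrite mul_cC_mx; apply: cSubZ.
- by rewrite mulmxDr; apply: cSubD; [apply: IHt | apply: IHu].
- by rewrite mulmxA; apply/IHu/IHt.
Qed.

Lemma cC_mxD z y : cC_mx (z + y) = cC_mx z + cC_mx y.
Proof. by rewrite /cC_mx rmorphD polyCD raddfD. Qed.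
Lemma cC_mxN z : cC_mx (- z) = - cC_mx z.
Proof. by rewrite /cC_mx rmorphN polyCN raddfN. Qed.
Lemma cC_mxM z y : cC_mx (z * y) = cC_mx z *m cC_mx y.
Proof. by rewrite /cC_mx rmorphM polyCM scalar_mxM. Qed.
Lemma cC_mx1 : cC_mx 1 = 1.
Proof. by rewrite /cC_mx rmorph1. Qed.
Lemma cC_mx0 : cC_mx 0 = 0.
Proof. by rewrite /cC_mx rmorph0 raddf0. Qed.

Lemma cev_tx i : (i < n.+1)%N -> cev (tx k n.+1 i) = xrec cX cS i.
Proof. by move=> i_n; rewrite /tx insubT. Qed.
Lemma cev_ts i : (i < n)%N -> cev (ts k n.+1 i) = cS i.
Proof. by move=> i_n; rewrite /ts insubT. Qed.

Lemma cev_hrel t u : hrel lam t u -> forall v, cSub (v *m (cev t - cev u)).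
Proof.
have eq0 A B : A = B -> forall v, cSub (v *m (A - B)).
  by move=> -> v; rewrite subrr mulmx0; apply: cSub0.
have hrc := coset_hecke_rel.
case=> [i|i j ij|i j ij|j i ij1 ij2|i|i j|n0] /=;
  [apply: eq0 | apply: eq0 | apply: eq0 | apply: eq0 | apply: eq0 | apply: eq0 | ].
- by have i_n := ltn_ord i; rewrite /= in i_n; rewrite cev_ts // cSS // cC_mx1.
- by rewrite !cev_ts //; apply: cSfar => //; rewrite ltnS; apply: ltn_ord.
- have jn : (i.+1 < n)%N by rewrite -ij; apply: ltn_ord.
  by rewrite ij !cev_ts ?(ltnW jn) // !mulmxA; apply: cSbraid.
- have j_n := ltn_ord j; rewrite /= in j_n.
  by rewrite cev_ts // cev_tx //; apply: (hr_sx_far hrc).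
- have i_n := ltn_ord i; rewrite /= in i_n; rewrite cev_ts // !cev_tx //; last exact: ltnW.
  by rewrite cC_mxN cC_mx1; apply: (hr_sx hrc).
- by rewrite !cev_tx //; apply: (hr_xx hrc).
suff -> : cev (\big[@AMul k (hgen n.+1)/AConst 1]_(i <- finsupp lam)
    iter (lam i) (AMul (AAdd (tx k n.+1 0) (AConst (- i%:~R)))) (AConst 1)) = cF.
  by move=> v; rewrite cC_mx0 subr0; apply: cSub_F.
rewrite (big_morph cev (id1 := 1) (op1 := *%R)) //; last exact: cC_mx1.
rewrite /cF /cycp /croots big_flatten big_map; apply: eq_bigr => i _.
elim: (lam i) => [|p IHp] /=; first by rewrite big_nil cC_mx1.
by rewrite big_cons IHp cev_tx // cC_mxN.
Qed.

(** The matrices satisfy all relations exactly except the cyclotomic one, which holds modulo [cSub].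
    In a product, an error in the first factor is still multiplied by the second, which [cSub_cev]
    allows. *)
Lemma cev_aeq t u : aeq (@hrel k lam n.+1) t u -> forall v, cSub (v *m (cev t - cev u)).
Proof.
have eq0 A B : A = B -> forall v, cSub (v *m (A - B)).
  by move=> -> v; rewrite subrr mulmx0; apply: cSub0.
elim=> {t u} [t u tu|t|t u _ IH|t u v _ IH1 _ IH2|t t' u u' _ IH1 _ IH2|
  t t' u u' _ IH1 _ IH2|t u v|t u|t|t u v|t|t|t u v|t u v|y z|y z|y t] /=.
- exact: cev_hrel.
- exact: eq0.
- by move=> v; rewrite -opprB mulmxN; apply/cSubN/IH.
- by move=> w; rewrite -(subrKA (cev u)) mulmxDr; apply: cSubD.
- by move=> w; rewrite opprD addrACA mulmxDr; apply: cSubD.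
- move=> w; have -> : cev t *m cev u - cev t' *m cev u' =
     (cev t - cev t') *m cev u + cev t' *m (cev u - cev u').
    by rewrite mulmxBl mulmxBr addrA subrK.
  by rewrite mulmxDr !mulmxA; apply: cSubD => //; apply: cSub_cev.
- exact/eq0/addrA.
- exact/eq0/addrC.
- by apply: eq0; rewrite cC_mx0 add0r.
- exact/eq0/mulmxA.
- by apply: eq0; rewrite cC_mx1 mul1mx.
- by apply: eq0; rewrite cC_mx0 mul0mx.
- exact/eq0/mulmxDl.
- exact/eq0/mulmxDr.
- exact/eq0/cC_mxD.
- exact/eq0/cC_mxM.
- exact/eq0/cC_mxC.
Qed.

End CosetRepresentation.

Section Uniqueness.
Variables (k : fieldType) (lam : weight).
Local Notation H := (hecke k lam).
Local Notation x := (xH k lam).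
Local Notation s := (sH k lam).
Local Notation d := (level lam).

Lemma hecke0_nz : (1 : H 0) != 0.
Proof.
pose fix ev (t : aterm k (hgen 0)) : k := match t with
  | AGen _ => 0 | AConst z => z | AAdd t u => ev t + ev u | AMul t u => ev t * ev u end.
have evE t u : aeq (@hrel k lam 0) t u -> ev t = ev u.
  elim=> {t u} //=; try (by move=> *; congruence).
  - by move=> t u; case=> [[]|[]|[]|[]|[]|[]|].
  - by move=> *; rewrite addrA.
  - by move=> *; rewrite addrC.
  - by move=> *; rewrite add0r.
  - by move=> *; rewrite mulrA.
  - by move=> *; rewrite mul1r.
  - by move=> *; rewrite mul0r.
  - by move=> *; rewrite mulrDl.
  - by move=> *; rewrite mulrDr.
  - by move=> *; rewrite mulrC.
apply/eqP => /pclass_eq /evE /= /eqP; exact/negP/oner_neq0.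
Qed.

End Uniqueness.

(** * Degree filtration *)

Section Span.
Variable V : zmodType.
Inductive span (G : V -> Prop) : V -> Prop :=
| span0 : span G 0
| spanS g z : G g -> span G z -> span G (g + z).

Lemma span1 (G : V -> Prop) g : G g -> span G g.
Proof. by move=> Gg; rewrite -[g]addr0; apply: spanS => //; apply: span0. Qed.

Lemma spanD (G : V -> Prop) y z : span G y -> span G z -> span G (y + z).
Proof.
move=> Gy Gz; elim: Gy => [|g {}y Gg _ IH]; first by rewrite add0r.
by rewrite -addrA; apply: spanS.
Qed.

Lemma span_ind_add (G P : V -> Prop) : P 0 -> (forall y z, P y -> P z -> P (y + z)) ->
  (forall g, G g -> P g) -> forall z, span G z -> P z.
Proof. by move=> P0 PD PG z; elim=> // g y Gg _ Py; apply/PD/Py/PG. Qed.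
End Span.

(** * Moving dots through transpositions *)

Section Transpositions.
Variables (R : pzRingType) (n : nat) (x s : nat -> R).
Hypothesis hr : hecke_rel n x s.
Local Notation trp := (trp s).

(** For i < j this is the conjugate of x_{j-1} by the transposition (i j-1). It is what x_j becomes,
    up to the constant 1, when moved to the left through (i j), and it involves no strand beyond j -
    1. *)
Definition yel (i j : nat) : R := x i + \sum_(i.+1 <= l < j) trp i l.

Lemma s_comm_yel i j : (i < j)%N -> (j.+1 < n)%N -> s j * yel i j = yel i j * s j.
Proof.
move=> ij jn; rewrite /yel mulrDr mulrDl; congr (_ + _).
  by rewrite (hr_sx_far hr) //; lia.
rewrite mulr_sumr mulr_suml; apply: eq_big_nat => l /andP[il lj].
rewrite (s_trp hr) //; try lia.
by have [-> ->] : tpn j j.+1 i = i /\ tpn j j.+1 l = l by split; tpn_lia.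
Qed.

Lemma trp_x_max i j : (i < j)%N -> (j < n)%N -> trp i j * x j = yel i j * trp i j + 1.
Proof.
elim: j => // j IHj ij jn; have [->|nij] := eqVneq i j.
  by rewrite /yel big_geq // addr0 trp_s (hr_sx1 hr).
have {}ij : (i < j)%N by lia.
have jn' := ltnW jn.
rewrite (trpS _ ij) -!mulrA (hr_sx1 hr) // mulrDr mulr1 (mulrA (trp i j)) IHj //.
rewrite mulrDl mul1r 2!mulrDr (hr_ss hr) // -mulrA (mulrA (s j) (yel i j)) s_comm_yel //.
have -> : yel i j.+1 = yel i j + trp i j by rewrite /yel big_nat_recr //= addrA.
have tt : trp i j * trp i j.+1 = s j * trp i j.
  rewrite (trp_trp hr) //; try lia.
  by have [-> ->] : tpn i j i = j /\ tpn i j j.+1 = j.+1 by [split; tpn_lia]; rewrite trp_s.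
rewrite -!mulrA (mulrA (s j) (trp i j)) -(trpS _ ij) in tt *.
by rewrite (mulrDl (yel i j)) tt addrAC.
Qed.

Lemma x_trp_max i j : (i < j)%N -> (j < n)%N -> x j * trp i j = trp i j * yel i j + 1.
Proof.
move=> ij jn; have i_n := ltn_trans ij jn.
rewrite -[x j]mul1r -{1}(trpK hr i_n jn) -!mulrA (mulrA (trp i j) (x j)) trp_x_max //.
by rewrite mulrDl mul1r -!mulrA (trpK hr) // mulr1 mulrDr (trpK hr).
Qed.

Lemma trp_x_lt i j l : (l < i)%N -> (i < j)%N -> (j < n)%N -> trp i j * x l = x l * trp i j.
Proof.
move=> li; elim: j => // j IHj ij jn; have [->|nij] := eqVneq i j.
  by rewrite trp_s (hr_sx_far hr) //; lia.
have {}ij : (i < j)%N by lia.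
have sx : s j * x l = x l * s j by rewrite (hr_sx_far hr) //; lia.
by rewrite (trpS _ ij) -mulrA sx mulrA -(mulrA (s j)) IHj ?(ltnW jn) // !mulrA sx.
Qed.

Lemma trp_x_min i j : (i < j)%N -> (j < n)%N ->
  trp i j * x i = x j * trp i j - 1 - \sum_(i.+1 <= l < j) trp i l * trp l j.
Proof.
move=> ij jn; rewrite x_trp_max // addrK /yel mulrDr mulr_sumr.
rewrite -[LHS]addr0 -addrA; congr (_ + _); apply/esym/eqP; rewrite subr_eq0; apply/eqP.
apply: eq_big_nat => l /andP[il lj].
rewrite [RHS](trp_trp hr) //; try lia.
have [-> ->] : tpn i l l = i /\ tpn i l j = j by split; tpn_lia.
by [].
Qed.

(** With (i j) = (i l)(l j)(i l), the dot x_l passes the right factor as its larger index and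
    becomes [yel i l]. That element commutes with (l j) and turns back into x_l - (i l) at the left
    factor. *)
Lemma trp_x_mid i l j : (i < l)%N -> (l < j)%N -> (j < n)%N ->
  trp i j * x l = (x l - trp i l) * trp i j + trp i l * trp l j.
Proof.
move=> il lj jn; have ln := ltn_trans lj jn; have i_n := ltn_trans il ln.
have cij : trp i j * trp i l = trp i l * trp l j.
  rewrite [RHS](trp_trp hr) //.
  by have [-> ->] : tpn i l l = i /\ tpn i l j = j by split; tpn_lia.
have yc : trp l j * yel i l = yel i l * trp l j.
  rewrite /yel mulrDr mulrDl trp_x_lt // mulr_sumr mulr_suml; congr (_ + _).
  apply: eq_big_nat => m /andP[im ml]; rewrite (trp_trp hr) //; try lia.
  by have [-> ->] : tpn l j i = i /\ tpn l j m = m by split; tpn_lia.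
have ty : trp i l * yel i l = (x l - trp i l) * trp i l.
  by rewrite mulrBl (trpK hr) // x_trp_max // addrK.
rewrite -[trp i j]mulr1 -{1}(trpK hr i_n ln) mulrA cij -!mulrA trp_x_max //.
rewrite !mulrDr mulr1 (mulrA (trp l j)) yc -(mulrA (yel i l)) (mulrA (trp i l)) ty.
by rewrite -mulrA (mulrA (trp i l)) -cij -!mulrA (trpK hr) // mulr1.
Qed.

End Transpositions.

(** The subleading coefficient is recorded because the trace of x^d on one strand reads it off; the
    alternative [cs = [::]] is the case in which there is none. *)
Lemma prod_sub_expand (k : fieldType) (R : pzRingType) (f : {rmorphism k -> R}) (a : R)
    (cs : seq k) : (forall z b, f z * b = b * f z) ->
  exists q : nat -> k, (q (size cs).-1 = - \sum_(z <- cs) z \/ cs = [::]) /\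
    \prod_(z <- cs) (a - f z) = a ^+ size cs + \sum_(j < size cs) f (q j) * a ^+ j.
Proof.
move=> fC; elim: cs => [|z cs [q [q1 IH]]] /=.
  by exists (fun=> 0); split; [right | rewrite big_nil big_ord0 addr0].
exists (fun j => (if j is j'.+1 then q j' else 0) -
          (if j == size cs then z else if (j < size cs)%N then z * q j else 0)).
split.
  left; rewrite eqxx big_cons; case: q1 => [|->].
    case: (cs) => [|y cs'] /=; first by rewrite big_nil addr0 sub0r.
    by move=> ->; rewrite opprD addrC.
  by rewrite /= big_nil addr0 sub0r.
rewrite big_cons IH mulrBl mulrDr -exprS -addrA; congr (_ + _).
under [RHS]eq_bigr => j _ do rewrite rmorphB mulrBl.
rewrite sumrB big_ord_recl /= rmorph0 mul0r add0r; congr (_ - _).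
  rewrite mulr_sumr; apply: eq_bigr => j _.
  by rewrite mulrA -fC -mulrA -exprS.
rewrite big_ord_recr /= eqxx addrC mulrDr mulr_sumr; congr (_ + _).
apply: eq_bigr => j _; have jn := ltn_ord j.
by rewrite (ltn_eqF jn) jn rmorphM mulrA.
Qed.

Section Filtration.
Variables (k : fieldType) (lam : weight).
Local Notation H := (hecke k lam).
Local Notation x := (xH k lam).
Local Notation s := (sH k lam).
Local Notation d := (level lam).
Hypothesis d_gt0 : (0 < d)%N.

Definition tH n i j : H n := trp (s n) i j.

Lemma incl_tH n i j : (i < n)%N -> (j < n)%N -> incl (tH n i j) = tH n.+1 i j.
Proof.
wlog ij : i j / (i < j)%N => [W i_n j_n|].
  have [ij|ji|->] := ltngtP i j; [exact: W | by rewrite /tH ![trp _ i j]trpC; apply: W |].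
  by rewrite /tH /trp ltnn incl1.
elim: j ij => // j IHj ij i_n j_n; rewrite /tH.
have [->|nij] := eqVneq i j; first by rewrite !trp_s incl_s.
have {}ij : (i < j)%N by lia.
by rewrite !(trpS _ ij) !inclM incl_s // -/(tH n i j) IHj // ltnW.
Qed.

Lemma tHM n a b i j : (a < n)%N -> (b < n)%N -> (i < n)%N -> (j < n)%N ->
  tH n a b * tH n i j = tH n (tpn a b i) (tpn a b j) * tH n a b.
Proof. by move=> *; rewrite /tH (trp_trp (hecke_relP _ _ _)). Qed.

Lemma tHK n i j : (i < n)%N -> (j < n)%N -> tH n i j * tH n i j = 1.
Proof. by move=> *; rewrite /tH (trpK (hecke_relP _ _ _)). Qed.

(* Fil n R z : the element z has weight at most R, where the dots x_i have
   weight 2 and the transpositions have weight 1. *)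
Fixpoint Fil (n : nat) (S : nat) : H n -> Prop :=
  match n return H n -> Prop with
  | 0 => fun=> True
  | n'.+1 => span (fun z => exists R j (a : H n'),
      [/\ (j < d)%N, Fil R a &
         ((R + 2 * j <= S)%N /\ z = incl a * x n'.+1 n' ^+ j) \/
         (exists i, [/\ (i < n')%N, (R + 2 * j < S)%N &
                     z = incl a * x n'.+1 n' ^+ j * tH n'.+1 i n'])])
  end.

Lemma Fil0 n S : @Fil n S 0.
Proof. by case: n => //= n; apply: span0. Qed.

Lemma FilD n S (y z : H n) : Fil S y -> Fil S z -> Fil S (y + z).
Proof. by case: n y z => //= n y z; apply: spanD. Qed.

Lemma Fil_sum n S (I : Type) (r : seq I) (P : pred I) (F : I -> H n) :
  (forall i, P i -> Fil S (F i)) -> Fil S (\sum_(i <- r | P i) F i).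
Proof. by move=> FS; elim/big_ind: _ => //; [apply: Fil0 | apply: FilD]. Qed.

Lemma FilW n S S' (z : H n) : (S <= S')%N -> Fil S z -> Fil S' z.
Proof.
case: n z => //= n z SS; move: z; apply: span_ind_add.
- exact: span0.
- by move=> y z; apply: spanD.
move=> g [R [j [a [jd aR H]]]]; apply: span1; exists R, j, a; split=> //.
case: H => [[RS ->]|[i [i_n RS ->]]]; [left | right; exists i]; split=> //;
  exact: leq_trans SS.
Qed.

Lemma Fil_x n R j (a : H n) : (j < d)%N -> Fil R a ->
  Fil (R + 2 * j) (incl a * x n.+1 n ^+ j).
Proof. by move=> jd aR; apply: span1; exists R, j, a; split=> //; left. Qed.

Lemma Fil_xt n R j i (a : H n) : (j < d)%N -> (i < n)%N -> Fil R a ->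
  Fil (R + 2 * j).+1 (incl a * x n.+1 n ^+ j * tH n.+1 i n).
Proof.
by move=> jd i_n aR; apply: span1; exists R, j, a; split=> //; right; exists i.
Qed.

Lemma Fil_normal n S (P : H n.+1 -> Prop) : P 0 -> (forall y z, P y -> P z -> P (y + z)) ->
  (forall R j a, (j < d)%N -> @Fil n R a -> (R + 2 * j <= S)%N ->
     P (incl a * x n.+1 n ^+ j)) ->
  (forall R j a i, (j < d)%N -> @Fil n R a -> (i < n)%N -> (R + 2 * j < S)%N ->
     P (incl a * x n.+1 n ^+ j * tH n.+1 i n)) ->
  forall z, Fil S z -> P z.
Proof.
move=> P0 PD Px Pt; apply: span_ind_add => // g [R [j [a [jd aR H]]]].
case: H => [[RS ->]|[i [i_n RS ->]]]; [exact: Px aR RS | exact: Pt aR i_n RS].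
Qed.

Lemma FilN n S (z : H n) : Fil S z -> Fil S (- z).
Proof.
elim: n S z => // n IHn S z; move: z; apply: Fil_normal => [|y z Fy Fz|R j a jd aR RS|R j a i jd aR i_n RS].
- by rewrite oppr0; apply: Fil0.
- by rewrite opprD; apply: FilD.
- by rewrite -mulNr -inclN; apply: FilW (Fil_x jd (IHn _ _ aR)).
- by rewrite -!mulNr -inclN; apply: FilW (Fil_xt jd i_n (IHn _ _ aR)).
Qed.

Lemma Fil_incl n S (a : H n) : Fil S a -> Fil S (incl a).
Proof. by move=> aS; have := Fil_x d_gt0 aS; rewrite muln0 addn0 expr0 mulr1. Qed.

Lemma Fil_cH n c : Fil 0 (cH lam n c).
Proof. by elim: n => // n IHn; rewrite -incl_cH; apply: Fil_incl. Qed.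

Lemma Fil1 n : @Fil n 0 1.
Proof. by rewrite -(rmorph1 (@cH k lam n)); apply: Fil_cH. Qed.

Lemma Fil_tH n i j : (i < n)%N -> (j < n)%N -> Fil 1 (tH n i j).
Proof.
wlog ij : i j / (i < j)%N => [W i_n j_n|].
  have [ij|ji|->] := ltngtP i j; [exact: W | by rewrite /tH trpC; apply: W |].
  by rewrite /tH /trp ltnn; apply: FilW (Fil1 n).
elim: n => // n IHn; move=> i_n; rewrite ltnS leq_eqVlt => /orP[/eqP ej|jn].
  rewrite {}ej in ij *; have := Fil_xt d_gt0 ij (Fil1 n).
  by rewrite incl1 expr0 !mul1r.
by rewrite -incl_tH ?(ltn_trans ij) //; apply/Fil_incl/IHn; rewrite ?(ltn_trans ij).
Qed.

Section Step.
Variable n : nat.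
Hypothesis FilM_n : forall R S (a b : H n), Fil R a -> Fil S b -> Fil (R + S) (a * b).
Hypothesis Fil_x_n : forall l, (l < n)%N -> Fil 2 (x n l).
Local Notation X := (x n.+1 n).
Local Notation hrP := (hecke_relP k lam n.+1).

Lemma step_lmul R S (a : H n) (z : H n.+1) : Fil R a -> Fil S z -> Fil (R + S) (incl a * z).
Proof.
move=> aR; move: z; apply: Fil_normal => [|y z Fy Fz|R' j b jd bR RS|R' j b i jd bR i_n RS].
- by rewrite mulr0; apply: Fil0.
- by rewrite mulrDr; apply: FilD.
- rewrite mulrA -inclM; apply: FilW (Fil_x jd (FilM_n aR bR)); lia.
- rewrite !mulrA -inclM; apply: FilW (Fil_xt jd i_n (FilM_n aR bR)); lia.
Qed.

Lemma step_mult l S (z : H n.+1) : (l < n)%N -> Fil S z -> Fil S.+1 (z * tH n.+1 l n).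
Proof.
move=> ln; move: z; apply: Fil_normal => [|y z Fy Fz|R' j b jd bR RS|R' j b i jd bR i_n RS].
- by rewrite mul0r; apply: Fil0.
- by rewrite mulrDl; apply: FilD.
- by apply: FilW (Fil_xt jd ln bR).
have [->|nil] := eqVneq i l.
  by rewrite -mulrA tHK ?(leqW ln) // mulr1; apply: FilW (Fil_x jd bR); lia.
have -> : incl b * X ^+ j * tH n.+1 i n * tH n.+1 l n =
    incl (b * tH n i l) * X ^+ j * tH n.+1 i n.
  rewrite inclM incl_tH // -!mulrA; congr (_ * _); rewrite [RHS]mulrA.
  have -> : tH n.+1 i l * X ^+ j = X ^+ j * tH n.+1 i l.
    by rewrite -incl_tH //; apply: commrX; apply: incl_x_comm.
  rewrite -mulrA; congr (_ * _); rewrite tHM ?(leqW ln) ?(leqW i_n) //.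
  have [-> ->] : tpn i n l = l /\ tpn i n n = i by split; tpn_lia.
  by rewrite /tH trpC.
apply: FilW (Fil_xt jd i_n (FilM_n bR (Fil_tH i_n ln))); lia.
Qed.

(** The exponent d is allowed because multiplying a normal form by the last dot can raise d - 1 to
    d. The bound on X ^+ d is a premise, being proved by the same induction on n. *)
Lemma step_xj R j (a : H n) : (j <= d)%N -> Fil R a -> Fil (2 * d).-1 (X ^+ d) ->
  Fil (R + 2 * j) (incl a * X ^+ j).
Proof.
rewrite leq_eqVlt => /orP[/eqP -> | jd] aR Fd; last exact: Fil_x.
by apply: FilW (step_lmul aR Fd); lia.
Qed.

Lemma step_mulX S (z : H n.+1) : Fil (2 * d).-1 (X ^+ d) -> Fil S z -> Fil S.+2 (z * X).
Proof.
move=> Fd; move: z; apply: Fil_normal => [|y z Fy Fz|R' j b jd bR RS|R' j b i jd bR i_n RS].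
- by rewrite mul0r; apply: Fil0.
- by rewrite mulrDl; apply: FilD.
- by rewrite -mulrA -exprSr; apply: FilW (step_xj jd bR Fd); lia.
have yE : incl (yel (x n) (s n) i n) = yel (x n.+1) (s n.+1) i n.
  rewrite /yel inclD incl_x // incl_sum; congr (_ + _).
  by apply: eq_big_nat => l /andP[il ln]; rewrite -/(tH n i l) incl_tH.
have yF : Fil 2 (yel (x n) (s n) i n).
  apply: FilD; first exact: Fil_x_n.
  rewrite big_seq; apply: Fil_sum => l; rewrite mem_index_iota => /andP[_ ln].
  by apply: (@FilW _ 1) => //; apply: Fil_tH.
rewrite -mulrA (trp_x_max hrP) // mulrDr mulr1 -yE; apply: FilD; last first.
  by apply: FilW (Fil_x jd bR); lia.
rewrite mulrA -[incl b * _ * _]mulrA -(commrX j (incl_x_comm (yel (x n) (s n) i n))) mulrA -inclM.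
by apply: FilW (Fil_xt jd i_n (FilM_n bR yF)); lia.
Qed.

Lemma step_mulx l S (z : H n.+1) : Fil (2 * d).-1 (X ^+ d) -> (l < n)%N ->
  Fil S z -> Fil S.+2 (z * x n.+1 l).
Proof.
move=> Fd ln; move: z; apply: Fil_normal => [|y z Fy Fz|R' j b jd bR RS|R' j b i jd bR i_n RS].
- by rewrite mul0r; apply: Fil0.
- by rewrite mulrDl; apply: FilD.
- rewrite -(incl_x _ _ ln) -mulrA -(commrX j (incl_x_comm _)) mulrA -inclM.
  by apply: FilW (Fil_x jd (FilM_n bR (Fil_x_n ln))); lia.
have [li|il|eil] := ltngtP l i.
- rewrite -mulrA (trp_x_lt hrP) // -(incl_x _ _ ln) mulrA -[incl b * _ * _]mulrA.
  rewrite -(commrX j (incl_x_comm _)) mulrA -inclM.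
  by apply: FilW (Fil_xt jd i_n (FilM_n bR (Fil_x_n ln))); lia.
- have Ft : Fil 1 (tH n i l) by apply: Fil_tH.
  rewrite -mulrA (trp_x_mid hrP) // -(incl_x _ _ ln) -/(tH n.+1 i l) -incl_tH // -inclB.
  rewrite mulrDr !mulrA -![incl b * _ * incl _]mulrA -!(commrX j (incl_x_comm _)) !mulrA -!inclM.
  apply: FilD; last by apply: FilW (Fil_xt jd ln (FilM_n bR Ft)); lia.
  have Fxt : Fil 2 (x n l - tH n i l).
    by apply: FilD; [apply: Fil_x_n | apply/FilN/(FilW _ Ft)].
  by apply: FilW (Fil_xt jd i_n (FilM_n bR Fxt)); lia.
rewrite eil in ln *; rewrite -mulrA (trp_x_min hrP) // !mulrBr mulr1.
apply: FilD; first apply: FilD.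
- rewrite mulrA -[incl b * _ * _]mulrA -exprSr.
  by apply: FilW (step_mult ln (step_xj jd bR Fd)); lia.
- by apply: FilN; apply: FilW (Fil_x jd bR); lia.
apply: FilN; rewrite mulr_sumr big_seq; apply: Fil_sum => m.
rewrite mem_index_iota => /andP[im mn].
rewrite -/(tH n.+1 i m) -incl_tH // mulrA -[incl b * _ * _]mulrA -(commrX j (incl_x_comm _)).
rewrite mulrA -inclM; apply: FilW (Fil_xt jd mn (FilM_n bR (Fil_tH ln mn))); lia.
Qed.

Lemma step_mulT i l S (z : H n.+1) : (i < n)%N -> (l < n)%N ->
  Fil S z -> Fil S.+1 (z * tH n.+1 i l).
Proof.
move=> i_n ln; move: z; apply: Fil_normal => [|y z Fy Fz|R' j b jd bR RS|R' j b m jd bR mn RS].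
- by rewrite mul0r; apply: Fil0.
- by rewrite mulrDl; apply: FilD.
- rewrite -incl_tH // -mulrA -(commrX j (incl_x_comm _)) mulrA -inclM.
  by apply: FilW (Fil_x jd (FilM_n bR (Fil_tH i_n ln))); lia.
have e : tH n.+1 m n * tH n.+1 i l = tH n.+1 i l * tH n.+1 (tpn i l m) n.
  have m'n : (tpn i l m < n)%N by apply: tpn_lt.
  rewrite [RHS]tHM ?(leqW i_n) ?(leqW ln) ?(leqW m'n) //; congr (tH _ _ _ * _); tpn_lia.
rewrite -mulrA e -incl_tH // mulrA -[incl b * _ * _]mulrA -(commrX j (incl_x_comm _)).
rewrite mulrA -inclM.
by apply: FilW (Fil_xt jd (tpn_lt i_n ln mn) (FilM_n bR (Fil_tH i_n ln))); lia.
Qed.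

End Step.

(* Conjugation by the last generator raises the last strand of a normal form. *)
Lemma Fil_conj n S (z : H n.+1) :
  (forall R S (a b : H n.+1), Fil R a -> Fil S b -> Fil (R + S) (a * b)) ->
  (Fil 2 (x n.+1 n)) ->
  Fil S z -> Fil S (s n.+2 n * incl z * s n.+2 n).
Proof.
move=> FM Fx; have hrP := hecke_relP k lam n.+2.
have Fxl l : Fil (2 * l) (x n.+1 n ^+ l).
  elim: l => [|l IHl]; first by rewrite expr0; apply: Fil1.
  by rewrite exprSr mulnS addnC; apply: FM.
have es : s n.+2 n = tH n.+2 n n.+1 by rewrite /tH trp_s.
have sxs j : s n.+2 n * x n.+2 n ^+ j * s n.+2 n =
    x n.+2 n.+1 ^+ j - hsum (x n.+2 n) (x n.+2 n.+1) j * s n.+2 n.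
  by rewrite (hr_sxX hrP) // mulrBl -mulrA (hr_ss hrP) // mulr1.
have Fh R j (a : H n) : (j < d)%N -> Fil R a ->
    Fil (R + 2 * j).-1 (incl (incl a) * (hsum (x n.+2 n) (x n.+2 n.+1) j * s n.+2 n)).
  move=> jd aR; rewrite /hsum mulr_suml mulr_sumr; apply: Fil_sum => l _.
  rewrite -incl_x // -inclX !mulrA -inclM es.
  have lj := ltn_ord l; apply: FilW (Fil_xt _ _ (FM _ _ _ _ (Fil_incl aR) (Fxl l))); lia.
have Fj R j (a : H n) : (j < d)%N -> Fil R a ->
    Fil (R + 2 * j) (s n.+2 n * incl (incl a * x n.+1 n ^+ j) * s n.+2 n).
  move=> jd aR; rewrite inclM inclX incl_x // mulrA -incl_s_comm -!mulrA (mulrA (s n.+2 n)) sxs.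
  rewrite mulrBr; apply: FilD; first by apply: Fil_x => //; apply: Fil_incl.
  by apply: FilN; apply: FilW (Fh _ _ _ jd aR); apply: leq_pred.
move: z; apply: Fil_normal => [|y z Fy Fz|R' j b jd bR RS|R' j b i jd bR i_n RS].
- by rewrite incl0 mulr0 mul0r; apply: Fil0.
- by rewrite inclD mulrDr mulrDl; apply: FilD.
- by apply: FilW (Fj _ _ _ jd bR).
have -> : s n.+2 n * incl (incl b * x n.+1 n ^+ j * tH n.+1 i n) * s n.+2 n =
    s n.+2 n * incl (incl b * x n.+1 n ^+ j) * s n.+2 n * tH n.+2 i n.+1.
  rewrite inclM incl_tH ?(leqW i_n) // -!mulrA; do 2 congr (_ * _).
  rewrite /tH (trpS _ i_n) !mulrA (hr_ss hrP) // mul1r //.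
have F1 := step_mult FM (leqW i_n) (Fj _ _ _ jd bR).
by apply: FilW F1.
Qed.

Lemma hecke0_cH (a : H 0) : exists c, a = cH lam 0 c.
Proof.
elim/hecke_ind: a => [c|i i0|i i0|a b [y ->] [z ->]|a b [y ->] [z ->]] //.
- by exists c.
- by exists (y + z); rewrite rmorphD.
- by exists (y * z); rewrite rmorphM.
Qed.

(** The second factor is taken apart strand by strand. The map f is arbitrary because each step of
    the induction on m composes it with one more [incl]; only its effect on dots and transpositions
    has to be controlled. *)
Lemma Fil_mulr_gen n m S (z : H n) (a : H m) (f : H m -> H n) R :
  {morph f : a b / a + b} -> {morph f : a b / a * b} ->
  f 0 = 0 -> (forall c, f (cH lam m c) = cH lam n c) ->
  (forall i S z, (i < m)%N -> Fil S z -> Fil S.+2 (z * f (x m i))) ->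
  (forall i l S z, (i < m)%N -> (l < m)%N -> Fil S z -> Fil S.+1 (z * f (tH m i l))) ->
  (forall c S z, @Fil n S z -> Fil S (z * cH lam n c)) ->
  Fil S z -> Fil R a -> Fil (S + R) (z * f a).
Proof.
elim: m S z a f R => [|m IHm] S z a f R fD fM f0 fc fx ft fcc zS.
  have [c ->] := hecke0_cH a; move=> _.
  by rewrite fc; apply: FilW (fcc _ _ _ zS); apply: leq_addr.
have fX j S' z' : Fil S' z' -> Fil (S' + 2 * j) (z' * f (x m.+1 m ^+ j)).
  elim: j => [|j IHj] zS'.
    by rewrite expr0 -(rmorph1 (@cH k lam _)) fc muln0 addn0; apply: fcc.
  by rewrite exprSr fM mulrA mulnS [(2 + _)%N]addnC addnA addn2; apply: fx => //; apply: IHj.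
have IH R' b : Fil R' b -> Fil (S + R') (z * f (incl b)).
  apply: (IHm S z b (fun b => f (incl b))) => //.
  - by move=> *; rewrite inclD fD.
  - by move=> *; rewrite inclM fM.
  - by rewrite incl0.
  - by move=> *; rewrite incl_cH fc.
  - by move=> *; rewrite incl_x //; apply: fx => //; apply: leqW.
  - by move=> *; rewrite incl_tH //; apply: ft => //; apply: leqW.
move: a; apply: Fil_normal => [|y y' Fy Fy'|R' j b jd bR RS|R' j b i jd bR i_n RS].
- by rewrite f0 mulr0; apply: Fil0.
- by rewrite fD mulrDr; apply: FilD.
- by rewrite fM mulrA; apply: FilW (fX j _ _ (IH _ _ bR)); lia.
rewrite 2!fM 2!mulrA.
by apply: FilW (ft _ _ _ _ (leqW i_n) (ltnSn m) (fX j _ _ (IH _ _ bR))); lia.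
Qed.

(** Multiplication in H_{n+1} uses the bound on the d-th power of the last dot. That power is given
    by the cyclotomic relation on one strand; on more strands it is s x^d s plus a divided
    difference times s, where x is the preceding dot. Hence the simultaneous induction. *)
Lemma Fil_theory n :
  [/\ forall R S (a b : H n), Fil R a -> Fil S b -> Fil (R + S) (a * b),
      forall l, (l < n)%N -> Fil 2 (x n l) &
      (0 < n)%N -> Fil (2 * d).-1 (x n n.-1 ^+ d)].
Proof.
elim: n => [|n [FM Fx Fd]]; first by split.
have Fd' : Fil (2 * d).-1 (x n.+1 n ^+ d).
  case: n FM Fx Fd => [|n] FM Fx Fd.
    have [q [_]] := @prod_sub_expand k (H 1) (@cH k lam 1) (x 1 0) (croots k lam) (@cHC k lam 1).
    have -> : \prod_(z <- croots k lam) (x 1 0 - cH lam 1 z) = 0 by apply: cycpE.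
    rewrite size_croots => /eqP; rewrite eq_sym addr_eq0 => /eqP ->.
    apply: FilN; apply: Fil_sum => j _; have jd := ltn_ord j.
    have F1 := Fil_x jd (Fil_cH 0 (q j)); rewrite incl_cH in F1.
    by apply: FilW F1; lia.
  have hrP := hecke_relP k lam n.+2; have {}Fd := Fd isT; rewrite /= in Fd.
  have Fxl l : Fil (2 * l) (x n.+1 n ^+ l).
    elim: l => [|l IHl]; first by rewrite expr0; apply: Fil1.
    by rewrite exprSr mulnS addnC; apply: FM => //; apply: Fx.
  have -> : x n.+2 n.+1 ^+ d = s n.+2 n * incl (x n.+1 n ^+ d) * s n.+2 n +
       hsum (x n.+2 n) (x n.+2 n.+1) d * s n.+2 n.
    rewrite inclX incl_x // -mulrDl -(hr_xsX hrP) // -mulrA (hr_ss hrP) // mulr1 //.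
  apply: FilD; first by apply: Fil_conj => //; apply: Fx.
  rewrite /hsum mulr_suml; apply: Fil_sum => l _; have lj := ltn_ord l.
  rewrite -incl_x // -inclX -[s n.+2 n]/(taur _ _ 0) -/(tH n.+2 n n.+1).
  have -> : taur (s n.+2) n 0 = tH n.+2 n n.+1 by rewrite /tH trp_s.
  have pl : (d.-1 - l < d)%N by lia.
  by apply: FilW (Fil_xt pl (ltnSn n) (Fxl l)); lia.
have Fx' l S (z : H n.+1) : (l < n.+1)%N -> Fil S z -> Fil S.+2 (z * x n.+1 l).
  rewrite ltnS leq_eqVlt => /orP[/eqP -> | ln]; first exact: step_mulX.
  exact: step_mulx.
have Ft' i l S (z : H n.+1) : (i < n.+1)%N -> (l < n.+1)%N -> Fil S z ->
    Fil S.+1 (z * tH n.+1 i l).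
  wlog: i l / (i <= l)%N => [W i_n ln|].
    by have [il|li] := leqP i l; [apply: W | rewrite /tH trpC; apply: W => //; apply: ltnW].
  rewrite leq_eqVlt => /orP[/eqP -> _ _ zS|il i_n].
    by rewrite /tH /trp ltnn mulr1; apply: FilW zS.
  rewrite ltnS leq_eqVlt => /orP[/eqP eln|ln]; last by apply: step_mulT => //; apply: ltn_trans ln.
  by rewrite eln in il *; apply: step_mult.
have Fc' c S (z : H n.+1) : Fil S z -> Fil S (z * cH lam n.+1 c).
  by move=> zS; rewrite -cHC -incl_cH -[S]add0n; apply: step_lmul => //; apply: Fil_cH.
split=> //.
- by move=> R S a b aR bS; apply: (Fil_mulr_gen (f := id)).
- by move=> l ln; rewrite -[x n.+1 l]mul1r; apply: Fx' => //; apply: Fil1.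
Qed.

Lemma FilM n R S (a b : H n) : Fil R a -> Fil S b -> Fil (R + S) (a * b).
Proof. by have [FM _ _] := Fil_theory n; apply: FM. Qed.

Lemma Fil_xl n l : (l < n)%N -> Fil 2 (x n l).
Proof. by have [_ Fx _] := Fil_theory n; apply: Fx. Qed.

Lemma Fil_xd n l : (l < n)%N -> Fil (2 * d).-1 (x n l ^+ d).
Proof.
elim: n => // n IHn; rewrite ltnS leq_eqVlt => /orP[/eqP -> | ln].
  by have [_ _] := Fil_theory n.+1; apply.
by rewrite -(incl_x _ _ ln) -inclX; apply/Fil_incl/IHn.
Qed.

(* The relation of degree d lowers the weight of x_i^d from 2d to 2d - 1. *)
Definition wt (j : nat) : nat := 2 * j - j %/ d.

Lemma Fil_xX n l j : (l < n)%N -> Fil (wt j) (x n l ^+ j).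
Proof.
move=> ln; have Fxl i : Fil (2 * i) (x n l ^+ i).
  elim: i => [|i IHi]; first by rewrite expr0; apply: Fil1.
  by rewrite exprSr mulnS addnC; apply: FilM => //; apply: Fil_xl.
have Fxd i : Fil (i * (2 * d).-1) ((x n l ^+ d) ^+ i).
  elim: i => [|i IHi]; first by rewrite expr0; apply: Fil1.
  by rewrite exprSr mulSn addnC; apply: FilM => //; apply: Fil_xd.
rewrite {2}(divn_eq j d) exprD mulnC exprM; apply: FilW (FilM (Fxd _) (Fxl _)).
rewrite /wt {3}(divn_eq j d); set q := (j %/ d)%N; set r := (j %% d)%N.
rewrite -subn1 mulnBr muln1 mulnDr; have : (q <= q * (2 * d))%N by nia.
by rewrite mulnCA; nia.
Qed.

Lemma Fil_exhaust n (z : H n) : exists S, Fil S z.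
Proof.
elim/hecke_ind: z => [c|i i_n|i i_n|a b [R aR] [S bS]|a b [R aR] [S bS]].
- by exists 0%N; apply: Fil_cH.
- by exists 2; apply: Fil_xl.
- by exists 1%N; rewrite -trp_s; apply: Fil_tH => //; apply: ltnW.
- by exists (maxn R S); apply: FilD; [apply: FilW aR | apply: FilW bS]; lia.
- by exists (R + S)%N; apply: FilM.
Qed.

End Filtration.

(** * The basis theorem and the trace *)

Section Spanning.
Variables (k : fieldType) (lam : weight).
Local Notation H := (hecke k lam).
Local Notation x := (xH k lam).
Local Notation s := (sH k lam).
Local Notation d := (level lam).
Hypothesis d_gt0 : (0 < d)%N.

Lemma HsH1 n (a b : H n) : in_HsH (incl a * s n.+1 n.-1 * incl b).
Proof. by exists 1%N, (fun=> a), (fun=> b); rewrite big_ord1. Qed.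

Lemma HsH0 n : in_HsH (0 : H n.+1).
Proof. by exists 0%N, (fun=> 0), (fun=> 0); rewrite big_ord0. Qed.

Lemma HsHD n (y z : H n.+1) : in_HsH y -> in_HsH z -> in_HsH (y + z).
Proof.
move=> [r [a [b ->]]] [r' [a' [b' ->]]].
exists (r + r')%N, (fun l => match split l with inl i => a i | inr i => a' i end),
  (fun l => match split l with inl i => b i | inr i => b' i end).
rewrite big_split_ord /=; congr (_ + _); apply: eq_bigr => l _.
  by rewrite (unsplitK (inl l : 'I_r + 'I_r')).
by rewrite (unsplitK (inr l : 'I_r + 'I_r')).
Qed.

Lemma HsHl n a (z : H n.+1) : in_HsH z -> in_HsH (incl a * z).
Proof.
move=> [r [b [c ->]]]; exists r, (fun l => a * b l), c.
by rewrite mulr_sumr; apply: eq_bigr => l _; rewrite inclM !mulrA.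
Qed.

Lemma HsHr n a (z : H n.+1) : in_HsH z -> in_HsH (z * incl a).
Proof.
move=> [r [b [c ->]]]; exists r, b, (fun l => c l * a).
by rewrite mulr_suml; apply: eq_bigr => l _; rewrite inclM !mulrA.
Qed.

Lemma tH_last n i : (i <= n)%N ->
  tH k lam n.+2 i n.+1 = incl (tH k lam n.+1 i n) * s n.+2 n * incl (tH k lam n.+1 i n).
Proof.
move=> i_n; rewrite incl_tH ?ltnS //; have i_n2 : (i < n.+2)%N by lia.
have -> : s n.+2 n = tH k lam n.+2 n n.+1 by rewrite /tH trp_s.
rewrite tHM // -mulrA tHK // mulr1; congr (tH _ _ _); tpn_lia.
Qed.

Lemma tH_diag n i : tH k lam n i i = 1.
Proof. by rewrite /tH /trp ltnn. Qed.

Lemma xX_tH n i j : (i <= n)%N ->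
  x n.+2 n.+1 ^+ j * tH k lam n.+2 i n.+1 =
  incl (tH k lam n.+1 i n) * s n.+2 n * incl (x n.+1 n ^+ j * tH k lam n.+1 i n) +
  \sum_(l < j) incl (tH k lam n.+1 i n * x n.+1 n ^+ l * tH k lam n.+1 i n) *
     x n.+2 n.+1 ^+ (j.-1 - l).
Proof.
move=> i_n; have hrP := hecke_relP k lam n.+2.
rewrite tH_last // !mulrA -(commrX j (incl_x_comm _)) -(mulrA (incl _)) (hr_xsX hrP) //.
rewrite mulrDr mulrDl; congr (_ + _); first by rewrite inclM inclX incl_x // !mulrA.
rewrite /hsum mulr_sumr mulr_suml; apply: eq_bigr => l _.
rewrite 2!inclM inclX incl_x // -!mulrA; do 2 congr (_ * _).
by rewrite -(commrX _ (incl_x_comm _)).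
Qed.

(** A relation between z and the coefficients: existence is [Tdec_ex], and uniqueness is established
    for the coefficient u_{d-1}, which is what the trace needs. *)
Definition Tdec n (z : H n.+1) (u : nat -> H n) :=
  exists2 w, in_HsH w & z = w + \sum_(j < d) incl (u j) * x n.+1 n ^+ j.

Lemma Tdec0 n : Tdec (0 : H n.+1) (fun=> 0).
Proof.
exists 0; first exact: HsH0.
by rewrite big1 ?addr0 // => j _; rewrite incl0 mul0r.
Qed.

Lemma TdecD n (y z : H n.+1) u v : Tdec y u -> Tdec z v -> Tdec (y + z) (fun j => u j + v j).
Proof.
move=> [w Hw ->] [w' Hw' ->]; exists (w + w'); first exact: HsHD.
by rewrite addrACA -big_split; congr (_ + _); apply: eq_bigr => j _; rewrite inclD mulrDl.
Qed.

Lemma Tdecl n a (z : H n.+1) u : Tdec z u -> Tdec (incl a * z) (fun j => a * u j).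
Proof.
move=> [w Hw ->]; exists (incl a * w); first exact: HsHl.
rewrite mulrDr mulr_sumr; congr (_ + _).
by apply: eq_bigr => j _; rewrite inclM mulrA.
Qed.

Lemma Tdecr n a (z : H n.+1) u : Tdec z u -> Tdec (z * incl a) (fun j => u j * a).
Proof.
move=> [w Hw ->]; exists (w * incl a); first exact: HsHr.
rewrite mulrDl mulr_suml; congr (_ + _).
by apply: eq_bigr => j _; rewrite inclM -!mulrA (commrX j (incl_x_comm a)).
Qed.

Lemma Tdec_HsH n (w : H n.+1) : in_HsH w -> Tdec w (fun=> 0).
Proof.
by move=> Hw; exists w => //; rewrite big1 ?addr0 // => j _; rewrite incl0 mul0r.
Qed.

Lemma Tdec_x n a j : (j < d)%N -> Tdec (incl a * x n.+1 n ^+ j) (fun i => if i == j then a else 0).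
Proof.
move=> jd; exists 0; first exact: HsH0.
rewrite add0r (bigD1 (Ordinal jd)) //= eqxx big1 ?addr0 // => i ij.
by rewrite -val_eqE /= in ij; rewrite (negbTE ij) incl0 mul0r.
Qed.

Lemma Tdec_sum n (I : Type) (r : seq I) (F : I -> H n.+1) (u : I -> nat -> H n) :
  (forall i, Tdec (F i) (u i)) -> Tdec (\sum_(i <- r) F i) (fun j => \sum_(i <- r) u i j).
Proof.
move=> FU; elim: r => [|i r IHr].
  have := Tdec0 n; rewrite big_nil; congr (Tdec _ _); apply: funext => j; by rewrite big_nil.
rewrite big_cons; have := TdecD (FU i) IHr; congr (Tdec _ _).
by apply: funext => j; rewrite big_cons.
Qed.

(** Moving the power of the last dot through the transposition, by [xX_tH], leaves a term in H_n s_n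
    H_n and powers of the dot with exponent at most j - 1 < d - 1. So the trace kills normal forms
    that end in a transposition. *)
Lemma Tdec_xt n a j i : (j < d)%N -> (i < n)%N ->
  exists2 u, Tdec (incl a * x n.+1 n ^+ j * tH k lam n.+1 i n) u & u d.-1 = 0.
Proof.
case: n a => // n a jd i_n; rewrite -mulrA xX_tH //.
pose v (l : 'I_j) i' := if i' == (j.-1 - l)%N then
  tH k lam n.+1 i n * x n.+1 n ^+ l * tH k lam n.+1 i n else 0.
have H1 : forall l : 'I_j, Tdec (incl (tH k lam n.+1 i n * x n.+1 n ^+ l * tH k lam n.+1 i n) *
     x n.+2 n.+1 ^+ (j.-1 - l)) (v l).
  by move=> l; apply: Tdec_x; lia.
eexists; first apply/Tdecl/(TdecD (Tdec_HsH (HsH1 _ _)) (Tdec_sum _ H1)).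
rewrite /= add0r big1 ?mulr0 // => l _; rewrite /v ifF //.
by have := ltn_ord l; apply: contraTF => /eqP; lia.
Qed.

Lemma Tdec_ex n (z : H n.+1) : exists u, Tdec z u.
Proof.
have [S] := Fil_exhaust d_gt0 z; move: z.
apply: Fil_normal => [|y z [u Hu] [v Hv]|R j a jd _ _|R j a i jd _ i_n _].
- by exists (fun=> 0); apply: Tdec0.
- by exists (fun j => u j + v j); apply: TdecD.
- by eexists; apply: Tdec_x.
- by have [u Hu _] := Tdec_xt a jd i_n; exists u.
Qed.

Lemma emb_x m n i : (i < m)%N -> (m <= n)%N -> emb n (x m i) = x n i.
Proof. by move=> im mn; rewrite embE // asubst_tx. Qed.

Lemma emb_s m n i : (i.+1 < m)%N -> (m <= n)%N -> emb n (s m i) = s n i.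
Proof. by move=> im mn; rewrite embE // asubst_ts //; lia. Qed.

Lemma emb_cH m n (c : k) : (m <= n)%N -> emb n (cH lam m c) = cH lam n c.
Proof. by move=> mn; rewrite embE. Qed.

Lemma emb_incl m n (a : H m) : (m < n)%N -> emb n (incl a) = emb n a.
Proof.
move=> mn; elim/hecke_ind: a => [c|i i_n|i i_n|a b IHa IHb|a b IHa IHb].
- by rewrite incl_cH !emb_cH // ltnW.
- by rewrite incl_x // !emb_x ?(ltnW mn) // leqW.
- by rewrite incl_s // !emb_s ?(ltnW mn) // leqW.
- by rewrite inclD !embD ?IHa ?IHb // ltnW.
- by rewrite inclM !embM ?IHa ?IHb // ltnW.
Qed.

Lemma emb_id n (a : H n) : emb n a = a.
Proof.
elim/hecke_ind: a => [c|i i_n|i i_n|a b IHa IHb|a b IHa IHb].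
- by rewrite emb_cH.
- by rewrite emb_x.
- by rewrite emb_s.
- by rewrite embD ?IHa ?IHb.
- by rewrite embM ?IHa ?IHb.
Qed.

(** * Uniqueness of the trace coefficient by the coset representation *)

Section Uniqueness.
Variables (n : nat) (R : nzRingType) (iota : {rmorphism H n -> R}).
Hypothesis iotaI : injective iota.
Hypothesis iotaS : forall a, exists b, a = iota b.
Let c : {rmorphism k -> R} := iota \o @cH k lam n.
Let xR (i : nat) : R := iota (x n i).
Let sR (i : nat) : R := iota (s n i).
Local Notation row := 'rV[{poly R}]_n.+1.
Local Notation ce := (@ce R n).
Local Notation cS := (@cS R n sR).
Local Notation cX := (@cX R n xR sR).
Local Notation cSub := (@cSub k lam R n xR sR c).
Local Notation cev := (@cev k R n xR sR c).

Lemma iota_hecke_rel : hecke_rel n xR sR.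
Proof.
have hrP := hecke_relP k lam n; rewrite /xR /sR; split.
- by move=> i i_n; rewrite -rmorphM (hr_ss hrP) // rmorph1.
- by move=> i j ij j_n; rewrite -!rmorphM (hr_far hrP).
- by move=> i i_n; rewrite -!rmorphM (hr_braid hrP).
- by move=> i j j_n i_n ij ij1; rewrite -!rmorphM (hr_sx_far hrP).
- by move=> i i_n; rewrite -!rmorphM (hr_sx hrP) // rmorphB rmorph1.
- by move=> i j i_n j_n; rewrite -!rmorphM (hr_xx hrP).
Qed.

Lemma Ucyc0 : (0 < n)%N -> cycp lam c (xR 0%N) = 0.
Proof.
move=> n0; rewrite -(rmorph0 iota) -(cycpE k lam n0) /cycp rmorph_prod.
by apply: eq_bigr => z _; rewrite rmorphB.
Qed.

Lemma UcC z (a : R) : c z * a = a * c z.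
Proof. by have [b ->] := iotaS a; rewrite /c /= -!rmorphM cHC. Qed.

(** In the quotient by [cSub], v times z is w. It is a relation because the quotient is not formed
    and z is evaluated at a representative. *)
Definition Act (v : row) (z : H n.+1) (w : row) : Prop := cSub (v *m cev (repr z) - w).

Lemma Act_term v t : Act v (pclass (@hrel k lam n.+1) t) (v *m cev t).
Proof.
rewrite /Act -mulmxBr; apply: (cev_aeq iota_hecke_rel UcC Ucyc0); exact: repr_pclass.
Qed.

Lemma Act_eq v z w w' : Act v z w -> Act v z w' -> cSub (w - w').
Proof.
move=> H1 H2; have -> : w - w' = - (v *m cev (repr z) - w) + (v *m cev (repr z) - w').
  by rewrite opprB addrA subrK.
by apply: cSubD => //; apply: cSubN.
Qed.

Lemma Act_scale a v z w : Act v z w -> Act (a *: v) z (a *: w).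
Proof. by move=> H1; rewrite /Act -scalemxAl -scalerBr; apply: cSubZ. Qed.

Lemma Act_add v z z' w w' : Act v z w -> Act v z' w' -> Act v (z + z') (w + w').
Proof.
move=> H1 H2; have := Act_term v (AAdd (repr z) (repr z')).
rewrite pclassD !pclass_repr /= mulmxDr /Act => H3.
rewrite -(subrKA (v *m cev (repr z) + v *m cev (repr z'))); apply: cSubD => //.
by rewrite opprD addrACA; apply: cSubD.
Qed.

Lemma Act_mul v z z' w w' : Act v z w -> Act w z' w' -> Act v (z * z') w'.
Proof.
move=> H1 H2; have := Act_term v (AMul (repr z) (repr z')).
rewrite pclassM !pclass_repr /= mulmxA /Act => H3.
rewrite -(subrKA (v *m cev (repr z) *m cev (repr z'))); apply: cSubD => //.
rewrite -(subrKA (w *m cev (repr z'))) -mulmxBl; apply: cSubD => //.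
by apply: (cSub_cev iota_hecke_rel UcC Ucyc0).
Qed.

Lemma Act_x v i : (i < n.+1)%N -> Act v (x n.+1 i) (v *m xrec cX cS i).
Proof. by move=> i_n; have := Act_term v (tx k n.+1 i); rewrite (cev_tx _ _ _ i_n). Qed.

Lemma Act_s v i : (i < n)%N -> Act v (s n.+1 i) (v *m cS i).
Proof. by move=> i_n; have := Act_term v (ts k n.+1 i); rewrite (cev_ts _ _ _ i_n). Qed.

Lemma Act_cH v z : Act v (cH lam n.+1 z) ((c z)%:P *: v).
Proof. by have := Act_term v (AConst z); rewrite /= (mul_cC_mx UcC). Qed.

Lemma Act_1 v : Act v 1 v.
Proof. by have := Act_cH v 1; rewrite !rmorph1 scale1r. Qed.

Lemma Act_0 v : Act v 0 0.
Proof. by have := Act_cH v 0; rewrite !rmorph0 scale0r. Qed.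

Lemma Act_sum v (I : Type) (r : seq I) (F : I -> H n.+1) (G : I -> row) :
  (forall i, Act v (F i) (G i)) -> Act v (\sum_(i <- r) F i) (\sum_(i <- r) G i).
Proof.
move=> FG; elim: r => [|i r IHr]; last by rewrite !big_cons; apply: Act_add.
by rewrite !big_nil; apply: Act_0.
Qed.

Lemma ce_xlt i p : (i < p)%N -> (p <= n)%N -> ce p *m xrec cX cS i = (xR i)%:P *: ce p.
Proof.
elim: i => [|i IHi] ip pn; first by apply: ceX.
rewrite /= mulmxDr !mulmxA ceSgt // -!scalemxAl IHi ?(ltnW ip) //.
rewrite -!scalemxAl ceSgt // !scalerA -!polyCM -scalerDl -polyCD (hr_xS iota_hecke_rel) ?mulrA //; lia.
Qed.

(** The product s_{l-1} ... s_p, which plays for x_p and s_{n-1} ... s_p the role of [cD] for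
    x_0. *)
Fixpoint cDD (p l : nat) : R :=
  if l is l'.+1 then if (p <= l')%N then sR l' * cDD p l' else 1 else 1.

Lemma cDD_s p l : (p < l)%N -> (l < n)%N -> cDD p l * sR p = cDD p.+1 l.
Proof.
elim: l => // l IHl; rewrite ltnS leq_eqVlt => /orP[/eqP <- | pl] ln /=.
  rewrite leqnn ltnn.
  have -> : cDD p p = 1 by case: (p) => //= p'; rewrite ltnn.
  by rewrite mulr1 (hr_ss iota_hecke_rel).
by rewrite (ltnW pl) pl -mulrA IHl // ltnW.
Qed.

Lemma ce_xdiag p : (p <= n)%N -> ce p *m xrec cX cS p =
  'X *: ce p - \sum_(p <= l < n) (cDD p l)%:P *: ce l.+1.
Proof.
elim: p => [|p IHp] pn.
  rewrite /= ceX0 /cZ big_mkord; congr (_ - _); apply: eq_bigr => l _.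
  by congr (_%:P *: _); elim: (l : nat) => //= l' ->.
rewrite /= mulmxDr !mulmxA ceS1 // IHp ?(ltnW pn) // mulmxBl -scalemxAl ceS0 //.
rewrite (big_ltn pn) mulmxDl -scalemxAl ceS1 //.
have -> : cDD p p = 1 by case: (p) => //= p'; rewrite ltnn.
rewrite scale1r opprD addrA addrAC subrK; congr (_ - _).
rewrite mulmx_suml; apply: eq_big_nat => l /andP[pl ln].
by rewrite -scalemxAl ceSgt // scalerA -polyCM cDD_s.
Qed.

Definition Up (p j : nat) (v : row) :=
  exists2 f : nat -> {poly R}, (forall l, size (f l) <= j)%N &
  v = \sum_(p.+1 <= l < n.+1) f l *: ce l.

Lemma Act_xX p j : (p <= n)%N -> exists2 v, Up p j v &
  Act (ce p) (x n.+1 p ^+ j) ('X^j *: ce p + v).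
Proof.
move=> pn; elim: j => [|j [v [f fj vf] IH]].
  exists 0; last by rewrite !expr0 scale1r addr0; apply: Act_1.
  by exists (fun=> 0) => [l|]; rewrite ?size_poly0 // big1 // => l _; rewrite scale0r.
exists (\sum_(p.+1 <= l < n.+1) (f l * (xR p)%:P - 'X^j * (cDD p l.-1)%:P) *: ce l).
  exists (fun l => f l * (xR p)%:P - 'X^j * (cDD p l.-1)%:P) => // l.
  rewrite (leq_trans (size_polyD _ _)) // geq_max size_polyN; apply/andP; split.
    by rewrite (leq_trans (size_polyMleq _ _)) // (leq_trans (leq_pred _)) //;
      have := size_polyC_leq1 (xR p); have := fj l; lia.
  rewrite (leq_trans (size_polyMleq _ _)) // size_polyXn.
  by have := size_polyC_leq1 (cDD p l.-1); lia.
rewrite exprSr; apply: Act_mul IH _.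
have e : ('X^j *: ce p + v) *m xrec cX cS p = 'X^(j.+1) *: ce p +
   \sum_(p.+1 <= l < n.+1) (f l * (xR p)%:P - 'X^j * (cDD p l.-1)%:P) *: ce l.
  rewrite mulmxDl -scalemxAl ce_xdiag // scalerBr scalerA -exprSr -addrA; congr (_ + _).
  rewrite vf mulmx_suml (_ : \sum_(p <= l < n) _ = \sum_(p.+1 <= l < n.+1) (cDD p l.-1)%:P *: ce l); last first.
    by rewrite big_add1.
  under [RHS]eq_bigr => l _ do rewrite scalerBl.
  rewrite sumrB scaler_sumr addrC; congr (_ - _).
    by apply: eq_big_nat => l /andP[pl ln]; rewrite -scalemxAl ce_xlt // scalerA.
  by apply: eq_bigr => l _; rewrite scalerA.
by rewrite -e; apply: Act_x.
Qed.

Lemma Act_emb p q (a : H p) : (p <= q)%N -> (q <= n)%N ->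
  Act (ce q) (emb n.+1 a) ((iota (emb n a))%:P *: ce q).
Proof.
move=> pq qn; have pn := leq_trans pq qn; have pn1 := leqW pn.
elim/hecke_ind: a => [z|i i_p|i i_p|a b IHa IHb|a b IHa IHb].
- by rewrite !emb_cH //; apply: Act_cH.
- rewrite !emb_x //; have := @Act_x (ce q) i; rewrite ce_xlt //; last lia.
  by apply; lia.
- rewrite !emb_s //; have := @Act_s (ce q) i; rewrite ceSgt //; last lia.
  by apply; lia.
- by rewrite !embD // rmorphD polyCD scalerDl; apply: Act_add.
- rewrite !embM // rmorphM polyCM -scalerA; apply: Act_mul IHa _; exact: Act_scale.
Qed.

(** The shape of [ce n] times an element of H_n s_n H_n: degrees below d, so that [cSub_small]
    applies, and no X^{d-1} in the last entry, which is where u_j x_{n+1}^j contributes u_j X^j. *)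
Definition Good (v : row) := szle d v /\ (size (v 0%R ord_max) <= d.-1)%N.

Lemma Good0 : Good 0.
Proof. by split; [exact: szle0 | rewrite mxE size_poly0]. Qed.
Lemma GoodD v w : Good v -> Good w -> Good (v + w).
Proof.
move=> [v1 v2] [w1 w2]; split; first exact: szleD.
by rewrite mxE (leq_trans (size_polyD _ _)) // geq_max v2.
Qed.
Lemma GoodC a v : Good v -> Good (a%:P *: v).
Proof.
move=> [v1 v2]; split; first exact: szleC.
rewrite mxE; apply/leq_sizeP => e je; rewrite coefCM nth_default ?mulr0 //.
exact: leq_trans je.
Qed.

Lemma Up_szle p j v : Up p j v -> szle j v.
Proof.
move=> [f fj ->] i; rewrite summxE; elim/big_rec: _ => [|l y _ yj]; first by rewrite size_poly0.
rewrite (leq_trans (size_polyD _ _)) // geq_max yj andbT !mxE eqxx /=.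
by case: eqP => _; rewrite ?mulr1 // mulr0 size_poly0.
Qed.

Lemma Good_lead p j v : (p < n)%N -> (j < d)%N -> Up p j v -> Good ('X^j *: ce p + v).
Proof.
move=> pn jd /Up_szle vj; split.
  apply: szleD; last by apply: szleW vj; apply: ltnW.
  move=> i; rewrite !mxE eqxx /=; case: eqP => _; rewrite ?mulr1 ?mulr0 ?size_poly0 //.
  by rewrite size_polyXn.
rewrite !mxE eqxx /= -val_eqE /= inordK ?(gtn_eqF pn) ?mulr0 ?add0r; last exact: ltnW.
by rewrite (leq_trans (vj _)) //; lia.
Qed.

Lemma embX m q (a : H m) j : (m <= q)%N -> emb q (a ^+ j) = emb q a ^+ j.
Proof. by move=> mq; elim: j => [|j IHj]; rewrite ?expr0 ?emb1 // !exprS embM // IHj. Qed.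

Lemma emb0 m q : (m <= q)%N -> emb q (0 : H m) = 0.
Proof. by move=> mq; rewrite -(rmorph0 (@cH k lam m)) /= emb_cH // rmorph0. Qed.

Lemma Act_Good_x p (u : nat -> H p) : (p < n)%N -> exists2 v, Good v &
  Act (ce p) (emb n.+1 (\sum_(j < d) incl (u j) * x p.+1 p ^+ j)) v.
Proof.
move=> pn; have pn1 := leqW pn.
elim/big_ind: _ => [|y z [v vG vA] [w wG wA]|j _].
- by exists 0; [exact: Good0 | rewrite emb0 //; apply: Act_0].
- by exists (v + w); [exact: GoodD | rewrite embD //; apply: Act_add].
have [v vU vA] := Act_xX j (ltnW pn); exists ((iota (emb n (u j)))%:P *: ('X^j *: ce p + v)).
  exact/GoodC/Good_lead.
rewrite embM // emb_incl // embX // emb_x //.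
apply: Act_mul (Act_emb _ _ _) _ => //; exact: Act_scale.
Qed.

(** Induction on p: a crossing carries [ce p.+1] to [ce p], where the induction hypothesis applies.
    For the powers of the dot, p < n keeps the leading term X^j away from the last entry, and the
    later entries have degree below j < d. *)
Lemma Act_Good p (b : H p.+1) : (p < n)%N -> exists2 v, Good v & Act (ce p) (emb n.+1 b) v.
Proof.
elim: p b => [|p IHp] b pn; have [u [w [r [a1 [a2 ->]]] ->]] := Tdec_ex b.
  rewrite big1 ?add0r; first exact: Act_Good_x.
  by move=> l _; rewrite sH0 // mulr0 mul0r.
have [v vG vA] := Act_Good_x u pn; have pn1 := leqW pn; have pn2 := ltnW pn.
suff [w' wG wA] : exists2 w', Good w' &
    Act (ce p.+1) (emb n.+1 (\sum_(l < r) incl (a1 l) * s p.+2 p * incl (a2 l))) w'.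
  by exists (w' + v); [exact: GoodD | rewrite embD //; apply: Act_add].
elim/big_ind: _ => [|y z [y' yG yA] [z' zG zA]|l _].
- by exists 0; [exact: Good0 | rewrite emb0 //; apply: Act_0].
- by exists (y' + z'); [exact: GoodD | rewrite embD //; apply: Act_add].
have [w' wG wA] := IHp (a2 l) pn2; exists ((iota (emb n (a1 l)))%:P *: w'); first exact: GoodC.
rewrite !embM // !emb_incl // emb_s //.
have H1 := Act_emb (a1 l) (leqnn p.+1) pn2.
have H2 : Act (ce p.+1) (s n.+1 p) (ce p) by have := Act_s (ce p.+1) pn2; rewrite ceS1.
by apply: Act_mul (Act_scale _ wA); apply: Act_mul H1 (Act_scale _ H2).
Qed.

Lemma Tdec_uniq_iota (u : nat -> H n) : Tdec (0 : H n.+1) u -> u d.-1 = 0.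
Proof.
move=> [w Hw e0]; have dd : (d.-1 < d)%N by lia.
have [v vG vA] : exists2 v, Good v & Act (ce n) w v.
  have [r [a1 [a2 ->]]] := Hw.
  elim/big_ind: _ => [|y z [y' yG yA] [z' zG zA]|l _].
  - by exists 0; [exact: Good0 | apply: Act_0].
  - by exists (y' + z'); [exact: GoodD | apply: Act_add].
  have [n0|n0] := posnP n.
    exists 0; first exact: Good0.
    by rewrite [X in Act _ (_ * X * _)]sH0 ?mulr0 ?mul0r; [exact: Act_0 | lia].
  have pn : (n.-1 < n)%N by rewrite prednK.
  have A3 m (b : H m) p : m = p.+1 -> (p < n)%N ->
      exists2 v, Good v & Act (ce p) (emb n.+1 b) v.
    by move=> em; rewrite em in b *; apply: Act_Good.
  have [w' wG wA] := A3 n (a2 l) n.-1 (esym (prednK n0)) pn.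
  exists ((iota (emb n (a1 l)))%:P *: w'); first exact: GoodC.
  have H1 := Act_emb (a1 l) (leqnn n) (leqnn n).
  have H2 : Act (ce n) (s n.+1 n.-1) (ce n.-1).
    by have := Act_s (ce n) pn; have := @ceS1 R n sR n.-1 pn; rewrite (prednK n0) => ->.
  have ei (b : H n) : incl b = emb n.+1 b by [].
  by rewrite !ei; apply: Act_mul (Act_scale _ wA); apply: Act_mul H1 (Act_scale _ H2).
have A2 : Act (ce n) (\sum_(j < d) incl (u j) * x n.+1 n ^+ j)
    (\sum_(j < d) (iota (u j))%:P *: ('X^j *: ce n)).
  apply: Act_sum => j; have [f [g _ fg] A4] := Act_xX j (leqnn n).
  rewrite big_geq // in fg; rewrite fg addr0 in A4.
  have := Act_emb (u j) (leqnn n) (leqnn n); rewrite emb_id => H1.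
  exact: Act_mul H1 (Act_scale _ A4).
have := Act_eq (Act_add vA A2) _; rewrite -e0 => /(_ _ (Act_0 _)); rewrite subr0 => S0.
have sz : szle d (v + \sum_(j < d) (iota (u j))%:P *: ('X^j *: ce n)).
  apply: szleD; first exact: (vG.1).
  apply: szle_sum => j; apply: szleC => i; rewrite !mxE eqxx /=.
  case: eqP => _; rewrite ?mulr1 ?mulr0 ?size_poly0 //.
  by rewrite size_polyXn; apply: ltn_ord.
(* The vector lies in [cSub] and is small, hence zero; the coefficient of X^{d-1} in its last entry
   is u_{d-1}. *)
have /rowP/(_ ord_max)/(congr1 (fun p : {poly R} => p`_d.-1)) := cSub_small UcC Ucyc0 S0 sz.
have ej (j : nat) : (((iota (u j))%:P *: ('X^j *: ce n)) 0 ord_max)`_d.-1 =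
    iota (u j) * (d.-1 == j)%:R.
  by rewrite !mxE eqxx /= -val_eqE /= inordK // eqxx mulr1 coefCM coefXn.
have v0 : (v 0 ord_max)`_d.-1 = 0 by rewrite nth_default // vG.2.
rewrite mxE coefD v0 add0r summxE coef_sum mxE coef0.
rewrite (bigD1 (Ordinal dd)) //= ej eqxx mulr1 big1 ?addr0 => [/eqP|j jd]; last first.
  by rewrite ej eq_sym; rewrite -val_eqE /= in jd; rewrite (negbTE jd) mulr0.
by rewrite -(rmorph0 iota) => /eqP /iotaI.
Qed.

End Uniqueness.

Lemma Tdec_uniq_nz n (u : nat -> H n) : (1 : H n) != 0 -> Tdec (0 : H n.+1) u -> u d.-1 = 0.
Proof.
move=> nz.
(* Matrices over [{poly R}] require 1 to differ from 0, so H_n is repackaged as a nontrivial ring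
   with the same carrier. *)
pose R : nzRingType := HB.pack (H n) (GRing.PzSemiRing_isNonZero.Build (H n) nz).
by apply: (@Tdec_uniq_iota n R (GRing.RMorphism.clone _ _ (idfun : H n -> R) _)) => // a; exists a.
Qed.

(** Nontriviality and uniqueness climb together: if 1 = 0 in H_{n+1}, then x_{n+1}^{d-1} = 0 has a
    decomposition with u_{d-1} = 1, which uniqueness over the nontrivial H_n forbids. *)
Lemma hecke_nz n : (1 : H n) != 0.
Proof.
elim: n => [|n IHn]; first exact: hecke0_nz.
apply/eqP => e; have dd : (d.-1 < d)%N by lia.
have := Tdec_x (1 : H n) dd; rewrite incl1 mul1r.
have -> : x n.+1 n ^+ d.-1 = 0 by rewrite -[LHS]mul1r e mul0r.
by move=> /(Tdec_uniq_nz IHn) /eqP; rewrite eqxx (negbTE IHn).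
Qed.

Lemma TdecN n (z : H n.+1) u : Tdec z u -> Tdec (- z) (fun j => - u j).
Proof.
move=> /(Tdecl (-1)); rewrite inclN incl1 mulN1r; congr (Tdec _ _).
by apply: funext => j; rewrite mulN1r.
Qed.

Lemma trHE n (z : H n.+1) u : Tdec z u -> trH z = u d.-1.
Proof.
move=> [w Hw zE]; rewrite /trH.
have ex : [set c | exists (w : H n.+1) (u : nat -> H n),
    [/\ in_HsH w, z = w + \sum_(j < d) incl (u j) * x n.+1 n ^+ j & c = u d.-1]]%classic (u d.-1).
  by exists w, u.
have [w' [u' [Hw' zE' ->]]] := xgetI 0 ex.
have Du : Tdec z u by exists w.
have Du' : Tdec z u' by exists w'.
have := TdecD Du' (TdecN Du); rewrite subrr => /(Tdec_uniq_nz (hecke_nz n)) /eqP.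
by rewrite subr_eq0 => /eqP.
Qed.

Lemma trHD n (y z : H n.+1) : trH (y + z) = trH y + trH z.
Proof.
have [u Hu] := Tdec_ex y; have [v Hv] := Tdec_ex z.
by rewrite (trHE Hu) (trHE Hv) (trHE (TdecD Hu Hv)).
Qed.

Lemma trHl n (a : H n) z : trH (incl a * z) = a * trH z.
Proof. by have [u Hu] := Tdec_ex z; rewrite (trHE Hu) (trHE (Tdecl a Hu)). Qed.

Lemma trHr n (a : H n) z : trH (z * incl a) = trH z * a.
Proof. by have [u Hu] := Tdec_ex z; rewrite (trHE Hu) (trHE (Tdecr a Hu)). Qed.

Lemma trH0 n : trH (0 : H n.+1) = 0.
Proof. by rewrite (trHE (Tdec0 n)). Qed.

Lemma trHN n (z : H n.+1) : trH (- z) = - trH z.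
Proof. by rewrite -mulN1r -(incl1 k lam n) -inclN trHl mulN1r. Qed.

Lemma trHB n (y z : H n.+1) : trH (y - z) = trH y - trH z.
Proof. by rewrite trHD trHN. Qed.

Lemma trH_sum n (I : Type) (r : seq I) (P : pred I) (F : I -> H n.+1) :
  trH (\sum_(i <- r | P i) F i) = \sum_(i <- r | P i) trH (F i).
Proof. by rewrite (big_morph _ (@trHD n) (trH0 n)). Qed.

Lemma trH_HsH n (w : H n.+1) : in_HsH w -> trH w = 0.
Proof. by move=> /Tdec_HsH /trHE. Qed.

Lemma trH_s n (a b : H n) : trH (incl a * s n.+1 n.-1 * incl b) = 0.
Proof. exact/trH_HsH/HsH1. Qed.

Lemma trH_x n j : (j < d)%N -> trH (x n.+1 n ^+ j) = (j == d.-1)%:R :> H n.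
Proof.
move=> jd; have := trHE (Tdec_x (1 : H n) jd); rewrite incl1 mul1r => ->.
by rewrite eq_sym; case: eqP.
Qed.

Lemma trH_xt n (a : H n) j i : (j < d)%N -> (i < n)%N ->
  trH (incl a * x n.+1 n ^+ j * tH k lam n.+1 i n) = 0.
Proof. by move=> jd i_n; have [u Hu u0] := Tdec_xt a jd i_n; rewrite (trHE Hu). Qed.

(* To check an additive identity in H_{n+1}, it suffices to do so on the two
   kinds of elements spanning it. *)
Lemma hecke_spanning n (P : H n.+1 -> Prop) : (forall y z, P y -> P z -> P (y + z)) ->
  P 0 ->
  (forall (a b : H n), (0 < n)%N -> P (incl a * s n.+1 n.-1 * incl b)) ->
  (forall (a : H n) j, (j < d)%N -> P (incl a * x n.+1 n ^+ j)) -> forall z, P z.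
Proof.
move=> PD P0 Ps Px z; have [u [w [r [a [b ->]]] ->]] := Tdec_ex z.
have P1 : P (\sum_(j < d) incl (u j) * x n.+1 n ^+ j).
  by elim/big_ind: _ => // j _; apply: Px.
apply: (PD _ _ _ P1); elim/big_ind: _ => // l _; have [n0|n0] := posnP n; last exact: Ps.
by rewrite [X in _ * X * _]sH0 ?mulr0 ?mul0r //; lia.
Qed.

End Spanning.

(** * Traces of dots and determinants *)

Section Center.
Variable R : pzRingType.

Definition center_pred : {pred R} := fun a => `[< forall b, a * b = b * a >].

Fact center_subring_closed : subring_closed center_pred.
Proof.
split; first by apply/asboolP => b; rewrite mul1r mulr1.
- move=> a b /asboolP aC /asboolP bC; apply/asboolP => c.
  by rewrite mulrBl mulrBr aC bC.
- move=> a b /asboolP aC /asboolP bC; apply/asboolP => c.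
  by rewrite -mulrA bC mulrA aC mulrA.
Qed.
HB.instance Definition _ := GRing.isSubringClosed.Build R center_pred center_subring_closed.

(** A commutative ring containing the bubbles, in which Cramer's rule is available. *)
Record center := Center { center_val : R; _ : center_val \in center_pred }.
HB.instance Definition _ := [isSub for center_val].
HB.instance Definition _ := [Choice of center by <:].
HB.instance Definition _ :=
  GRing.SubChoice_isSubPzRing.Build R center_pred center center_subring_closed.

Fact center_mulC : commutative (@GRing.mul center).
Proof.
by move=> a b; apply: val_inj; rewrite !rmorphM /=; case: a => a /= /asboolP; apply.
Qed.
HB.instance Definition _ := GRing.PzRing_hasCommutativeMul.Build center center_mulC.

End Center.

Section Toeplitz.
Variable R : comPzRingType.

(* The inverse of the Toeplitz matrix of g is that of c, so Cramer's rule gives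
   a determinantal formula for the coefficients of the inverse power series. *)
Lemma det_toeplitz (g c : nat -> R) m : g 0%N = 1 -> c 0%N = 1 ->
  (forall e, \sum_(i < e.+2) g i * c (e.+1 - i)%N = 0) ->
  \det (\matrix_(a < m, b < m) (if (a <= b.+1)%N then g (b.+1 - a)%N else 0)) =
  (-1) ^+ m * c m.
Proof.
move=> g0 c0 gc.
pose T (h : nat -> R) : 'M_m.+1 := \matrix_(a, b) (if (a <= b)%N then h (b - a)%N else 0).
have dT : \det (T g) = 1.
  rewrite -det_tr det_trig ?big1 // => [i _|]; first by rewrite !mxE leqnn subnn.
  by apply/is_trig_mxP => i j ij; rewrite !mxE leqNgt ij.
have TT : T g *m T c = 1%:M.
  apply/matrixP => a b; rewrite !mxE.
  under eq_bigr => e _ do rewrite !mxE.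
  have [ab|ba] := leqP a b; last first.
    rewrite -val_eqE (gtn_eqF ba) big1 // => e _.
    by case: leqP => ae; rewrite ?mul0r //; case: leqP => eb; rewrite ?mulr0 //; lia.
  have -> : \sum_(e < m.+1) (if (a <= e)%N then g (e - a)%N else 0) *
      (if (e <= b)%N then c (b - e)%N else 0) = \sum_(a <= e < b.+1) g (e - a)%N * c (b - e)%N.
    rewrite -(big_mkord xpredT (fun e => (if (a <= e)%N then g (e - a)%N else 0) *
      (if (e <= b)%N then c (b - e)%N else 0))).
    have bm := ltn_ord b; rewrite (@big_cat_nat _ _ _ a) //=; last by lia.
    rewrite big_nat_cond big1 ?add0r => [|e /andP[/andP[_ ea] _]]; last by rewrite leqNgt ea mul0r.
    rewrite (@big_cat_nat _ _ _ b.+1) //=; last by lia.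
    rewrite [X in _ + X]big_nat_cond [X in _ + X]big1 ?addr0 => [|e /andP[/andP[be _] _]].
      by apply: eq_big_nat => e /andP[ae eb]; rewrite ae -ltnS eb.
    by rewrite (leqNgt e) be mulr0.
  rewrite -{1}(add0n (a : nat)) big_addn subSn // big_mkord.
  have e1 i : g (i + a - a)%N * c (b - (i + a))%N = g i * c (b - a - i)%N.
    by rewrite addnK; congr (_ * c _); lia.
  under eq_bigr => i _ do rewrite e1.
  rewrite -val_eqE; case E: (b - a)%N => [|q]; last first.
    by rewrite gc; case: eqP E => // ->; rewrite subnn.
  by rewrite big_ord1 g0 c0 mulr1 (_ : (a == b :> nat)); [|lia].
have adjT : \adj (T g) = T c.
  by rewrite -[LHS]mulmx1 -TT mulmxA mul_adj_mx dT mul1mx.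
(* This entry of the adjugate is the cofactor deleting the last row and the first column: the
   deleted column shifts b to b + 1, and the sign is (-1)^m. *)
have := congr1 (fun M : 'M_m.+1 => M 0 ord_max) adjT; rewrite !mxE /= subn0 /cofactor /= addn0.
move=> <-; rewrite mulrA -exprD addnn -signr_odd odd_double expr0 mul1r; congr (\det _).
apply/matrixP => a b; rewrite !mxE /= /bump leq0n.
by have -> : (m <= a)%N = false by have := ltn_ord a; lia.
Qed.

(* The list is in reverse order: its head is the coefficient of degree m. *)
Fixpoint invs_seq (g : nat -> R) (m : nat) : seq R :=
  if m is m'.+1 then let l := invs_seq g m' in
    (- \sum_(i < m'.+1) g i.+1 * nth 0 l i) :: l else [:: 1].
Definition invs (g : nat -> R) (m : nat) : R := head 0 (invs_seq g m).

Lemma nth_invs_seq g m i : (i <= m)%N -> nth 0 (invs_seq g m) i = invs g (m - i).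
Proof.
elim: m i => [|m IHm] [|i] //= im; first by rewrite subSS -IHm.
Qed.

Lemma invs_conv g e : g 0%N = 1 -> \sum_(i < e.+2) g i * invs g (e.+1 - i)%N = 0.
Proof.
move=> g0; rewrite big_ord_recl g0 mul1r subn0 {1}/invs /=.
apply/eqP; rewrite addrC subr_eq0; apply/eqP; apply: eq_bigr => i _.
by rewrite nth_invs_seq -1?ltnS // /bump leq0n add1n subSS.
Qed.

End Toeplitz.

Section DualBases.
Variables (k : fieldType) (lam : weight).
Local Notation H := (hecke k lam).
Local Notation x := (xH k lam).
Local Notation s := (sH k lam).
Local Notation d := (level lam).
Local Notation y := (yH k lam).
Hypothesis d_gt0 : (0 < d)%N.

Lemma trH_xs n j : (j < d)%N -> trH (x n.+2 n.+1 ^+ j * s n.+2 n) = 0.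
Proof.
move=> jd; have := @trH_xt k lam d_gt0 n.+1 1 j n jd (ltnSn n).
by rewrite incl1 mul1r /tH trp_s.
Qed.

(** The last dot occurs with exponents at most j - 1, and the exponent d - 1 is reached only for j =
    d, with coefficient 1. *)
Lemma trH_hsum n j : (j < d.+1)%N -> trH (hsum (x n.+2 n) (x n.+2 n.+1) j) = (j == d)%:R.
Proof.
move=> jd; rewrite /hsum trH_sum //.
have e (l : 'I_j) : trH (x n.+2 n ^+ l * x n.+2 n.+1 ^+ (j.-1 - l)) =
   if (j == d) && (l == 0%N :> nat) then 1 else 0 :> H n.+1.
  rewrite -incl_x // -inclX trHl // trH_x //; last by have := ltn_ord l; lia.
  have [->|nl0] := eqVneq (l : nat) 0%N.
    have lj := ltn_ord l; rewrite expr0 mul1r andbT subn0.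
    have -> : (j.-1 == d.-1) = (j == d) by apply/eqP/eqP; lia.
    by case: eqP.
  rewrite andbF (_ : (_ == _) = false) ?mulr0 //; apply/eqP.
  by have := ltn_ord l; lia.
under eq_bigr => l _ do rewrite e.
case: j jd {e} => [|j] jd; first by rewrite big_ord0; case: eqP => //; lia.
by rewrite big_ord_recl /= andbT big1 ?addr0 => [|l _]; [case: eqP | rewrite andbF].
Qed.

Lemma trH_sx n j : (j < d)%N -> trH (s n.+2 n * x n.+2 n.+1 ^+ j) = 0.
Proof.
move=> jd; rewrite (hr_sx1X (hecke_relP _ _ _)) // trHD // trH_hsum ?(ltn_eqF jd) ?addr0 //; last exact: ltnW.
by rewrite -incl_x // -inclX -[s n.+2 n]mulr1 -(incl1 k lam n.+1) mulrA trH_s.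
Qed.

Lemma sxs n j : s n.+2 n * x n.+2 n ^+ j * s n.+2 n =
  x n.+2 n.+1 ^+ j - hsum (x n.+2 n) (x n.+2 n.+1) j * s n.+2 n.
Proof.
have hrP := hecke_relP k lam n.+2.
by rewrite (hr_sxX hrP) // mulrBl -mulrA (hr_ss hrP) // mulr1.
Qed.

Lemma trH_hsum_s n j : (j < d.+1)%N ->
  trH (hsum (x n.+2 n) (x n.+2 n.+1) j * s n.+2 n) = 0.
Proof.
move=> jd; rewrite /hsum mulr_suml trH_sum // big1 // => l _.
rewrite -incl_x // -inclX -mulrA trHl // trH_xs ?mulr0 //.
by have := ltn_ord l; lia.
Qed.

(** Diagrammatically, a closed strand carrying f is pulled off a strand that it crosses twice. For f
    in H s H, the braid relation turns s f s into an element of the next H s H, and both sides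
    vanish. For powers of a dot, s x^j s is the power of the next dot up to terms of trace 0. *)
Lemma trH_sfs n (f : H n.+1) : trH (s n.+2 n * incl f * s n.+2 n) = incl (trH f).
Proof.
have hrP := hecke_relP k lam n.+2.
move: f; apply: hecke_spanning => // [f g Hf Hg||a b n0|a j jd].
- by rewrite inclD mulrDr mulrDl !trHD // Hf Hg inclD.
- by rewrite incl0 mulr0 mul0r !trH0 // incl0.
- rewrite trH_s // incl0; case: n a b n0 hrP => // n a b _ hrP.
  rewrite 2!inclM incl_s // !mulrA -incl_s_comm -!mulrA incl_s_comm !mulrA.
  rewrite -!mulrA (mulrA (s n.+3 n)) (mulrA (s n.+3 n.+1)) (mulrA (s n.+3 n.+1)) -(hr_braid hrP) //.
  rewrite -(incl_s _ _ (ltnSn n.+1)) -!mulrA -inclM !mulrA -inclM.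
  by rewrite trH_s.
rewrite inclM inclX incl_x // mulrA -incl_s_comm -!mulrA (mulrA (s n.+2 n)) sxs.
rewrite !trHl // trHB // trH_hsum_s // ?subr0; last exact: leqW.
by rewrite inclM trH_x // trH_x //; case: eqP => _; rewrite ?incl1 ?incl0.
Qed.

(** With [trH_trH_s], this is the symmetry of the trace that makes the two mates of the dot, and
    those of the crossing, coincide. *)
Lemma trH_xC n (z : H n.+1) : trH (x n.+1 n * z) = trH (z * x n.+1 n).
Proof.
move: z; apply: hecke_spanning => // [f g Hf Hg||a b n0|a j jd].
- by rewrite mulrDl mulrDr !trHD // Hf Hg.
- by rewrite mulr0 mul0r.
- case: n a b n0 => // n a b _; have hrP := hecke_relP k lam n.+2.
  have -> : x n.+2 n.+1 * (incl a * s n.+2 n * incl b) =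
      incl a * s n.+2 n * incl (x n.+1 n * b) + incl a * incl b.
    rewrite !mulrA -incl_x_comm -(mulrA (incl a)) (hr_xs hrP) // mulrDr mulr1 mulrDl.
    by rewrite inclM incl_x // !mulrA.
  have -> : incl a * s n.+2 n * incl b * x n.+2 n.+1 =
      incl (a * x n.+1 n) * s n.+2 n * incl b + incl a * incl b.
    rewrite -mulrA incl_x_comm mulrA -(mulrA (incl a)) (hr_sx1 hrP) // mulrDr mulr1 mulrDl.
    by rewrite inclM incl_x // !mulrA.
  by rewrite !trHD // !trH_s.
by rewrite mulrA -incl_x_comm -!mulrA -exprS -exprSr.
Qed.

Lemma trH_trH_s n (z : H n.+2) : trH (trH (z * s n.+2 n)) = trH (trH (s n.+2 n * z)).
Proof.
move: z; apply: hecke_spanning => // [f g Hf Hg||a b n0|a j jd].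
- by rewrite mulrDl mulrDr !trHD // Hf Hg.
- by rewrite mulr0 mul0r.
- rewrite /= -!mulrA (mulrA (s n.+2 n) (incl b)) trHl // trH_sfs.
  by rewrite !mulrA !trHr // trH_sfs trHl.
rewrite -mulrA trHl // trH_xs // mulr0 (commrX j (incl_x_comm a)) mulrA trHr // trH_sx //.
by rewrite mul0r.
Qed.

(* Gm n e is the counterclockwise bubble with d - 1 + e dots. *)
Definition Gm n e : H n := trH (x n.+1 n ^+ (d.-1 + e)).

Lemma Gm0 n : Gm n 0 = 1.
Proof. by rewrite /Gm addn0 trH_x ?eqxx //; lia. Qed.

Lemma trH_x_central n j (a : H n) : trH (x n.+1 n ^+ j) * a = a * trH (x n.+1 n ^+ j).
Proof. by rewrite -trHr // -trHl // (commrX j (incl_x_comm a)). Qed.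

Lemma GmC n e (a : H n) : Gm n e * a = a * Gm n e.
Proof. exact: trH_x_central. Qed.

Lemma Gm_lt n j : (j < d.-1)%N -> trH (x n.+1 n ^+ j) = 0 :> H n.
Proof. by move=> jd; rewrite trH_x ?(ltn_eqF jd) //; lia. Qed.

(** The power is s x^N s plus a divided difference times s. Moving the powers of the last dot past
    that s once more gives the double sum; the terms s x^M have trace 0. Thus bubbles reduce to
    those with one strand fewer and to bubbles with at least two dots fewer. *)
Lemma trH_x_rec n N : trH (x n.+2 n.+1 ^+ N) = incl (trH (x n.+1 n ^+ N)) +
  \sum_(l < N) \sum_(l' < N.-1 - l) x n.+1 n ^+ (l + l') * trH (x n.+2 n.+1 ^+ (N.-2 - (l + l'))).
Proof.
have hrP := hecke_relP k lam n.+2.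
have -> : x n.+2 n.+1 ^+ N = s n.+2 n * incl (x n.+1 n ^+ N) * s n.+2 n +
       hsum (x n.+2 n) (x n.+2 n.+1) N * s n.+2 n.
  by rewrite inclX incl_x // -mulrDl -(hr_xsX hrP) // -mulrA (hr_ss hrP) // mulr1.
rewrite trHD // trH_sfs /hsum mulr_suml trH_sum //; congr (_ + _).
apply: eq_bigr => l _; rewrite -(incl_x _ _ (ltnSn n)) -inclX -mulrA trHl // (hr_xsX hrP) // trHD //.
have -> M : trH (s n.+2 n * x n.+2 n ^+ M) = 0.
  by have := @trH_s k lam d_gt0 n.+1 1 (x n.+1 n ^+ M); rewrite incl1 mul1r inclX incl_x.
rewrite add0r /hsum.
rewrite trH_sum // mulr_sumr; apply: eq_bigr => l' _; rewrite -(incl_x _ _ (ltnSn n)) -inclX trHl // mulrA -exprD.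
by congr (_ * trH (_ ^+ _)); have := ltn_ord l; have := ltn_ord l'; lia.
Qed.

(** On one strand the cyclotomic relation yields the sum of the roots. A further strand adds only
    bubbles with fewer than d - 1 dots, which vanish. *)
Lemma Gm1 n : Gm n 1 = cH lam n (\sum_(z <- croots k lam) z).
Proof.
have ed : (d.-1 + 1 = d)%N by lia.
rewrite /Gm ed; elim: n => [|n IHn].
  have [q [q1]] := @prod_sub_expand k (H 1) (@cH k lam 1) (x 1 0) (croots k lam) (@cHC k lam 1).
  have -> : \prod_(z <- croots k lam) (x 1 0 - cH lam 1 z) = 0 by apply: cycpE.
  rewrite size_croots => /eqP; rewrite eq_sym addr_eq0 => /eqP ->.
  have {}q1 : q d.-1 = - \sum_(z <- croots k lam) z.
    case: q1 => [|e]; first by rewrite size_croots.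
    by have := size_croots k lam; rewrite e /= => e0; move: d_gt0; rewrite -e0.
  have dd : (d.-1 < d)%N by lia.
  have tq (j : nat) : (j < d)%N -> trH (cH lam 1 (q j) * x 1 0 ^+ j) = cH lam 0 (q j) * (j == d.-1)%:R.
    by move=> jd; have <- := @incl_cH k lam 0 (q j); rewrite trHl // trH_x.
  rewrite trHN // trH_sum // (bigD1 (Ordinal dd)) //= tq // eqxx mulr1.
  rewrite big1 ?addr0 => [|j jd]; first by rewrite q1 rmorphN opprK.
  rewrite tq // (_ : (j == d.-1 :> nat) = false) ?mulr0 //.
  by apply: contra_neqF jd => /eqP jd; apply: val_inj.
rewrite trH_x_rec IHn incl_cH [X in _ + X]big1 ?addr0 // => l _.
by rewrite big1 // => l' _; rewrite Gm_lt ?mulr0 //; have := ltn_ord l; have := ltn_ord l'; lia.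
Qed.

End DualBases.

(** * Dual bases and the Casimir element *)

Lemma det_rmorph (R S : pzRingType) (f : {rmorphism R -> S}) n (A : 'M[R]_n) :
  f (\det A) = \det (map_mx f A).
Proof.
rewrite /determinant rmorph_sum; apply: eq_bigr => p _.
by rewrite rmorphM rmorph_sign rmorph_prod; under [in RHS]eq_bigr => i _ do rewrite mxE.
Qed.

Section DualBases2.
Variables (k : fieldType) (lam : weight).
Local Notation H := (hecke k lam).
Local Notation x := (xH k lam).
Local Notation s := (sH k lam).
Local Notation d := (level lam).
Local Notation yH := (yH k lam).
Local Notation Gm := (@Gm k lam).
Hypothesis d_gt0 : (0 < d)%N.

Fact Gm_center n e : Gm n e \in @center_pred (H n).
Proof. by apply/asboolP => b; apply: GmC. Qed.

Definition GmZ n e : center (H n) := Center (Gm_center n e).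
(** The inverse power series of the bubbles. By [cdE] its coefficients are the determinants in [yH],
    so that the convolution identity [Gm_cd] replaces computations with determinants. *)
Definition cd n m : H n := val (invs (GmZ n) m).

Lemma cdC n m (a : H n) : cd n m * a = a * cd n m.
Proof. by rewrite /cd; case: (invs _ _) => c /= /asboolP. Qed.

Lemma cd0 n : cd n 0 = 1.
Proof. by []. Qed.

Lemma Gm_cd n e : \sum_(i < e.+1) Gm n i * cd n (e - i)%N = (e == 0%N)%:R.
Proof.
case: e => [|e]; first by rewrite big_ord1 cd0 Gm0 ?mulr1.
have g0 : GmZ n 0 = 1 by apply: val_inj; apply: Gm0.
by have /(congr1 val) := invs_conv e g0; rewrite raddf_sum.
Qed.

Lemma cdE n m : (m <= d)%N ->
  (-1) ^+ m * \det (\matrix_(a < m, b < m) trH (x n.+1 n ^+ (d + b - a))) = cd n m.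
Proof.
move=> md; have g0 : GmZ n 0 = 1 by apply: val_inj; apply: Gm0.
have := det_toeplitz (c := invs (GmZ n)) m g0 erefl (fun e => invs_conv e g0).
move=> /(congr1 (fun z => val ((-1) ^+ m * z))).
rewrite signrMK -/(cd n m) => <-.
rewrite -[RHS]/((\val : {rmorphism center (H n) -> H n}) _) rmorphM rmorphXn rmorphN rmorph1.
rewrite det_rmorph; congr (_ * \det _); apply/matrixP => a b.
rewrite !mxE; have am := ltn_ord a; case: ifP => [ab|/negbT ab].
  by rewrite /= /Gm; congr (trH (_ ^+ _)); lia.
by rewrite Gm_lt //; lia.
Qed.

Lemma yHE n j : yH n j = \sum_(j <= t < d) x n.+1 n ^+ (t - j) * incl (cd n (d.-1 - t)).
Proof.
apply: eq_big_nat => t /andP[_ td]; rewrite -(cdE n (m := d.-1 - t)); last by lia.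
rewrite inclM inclX inclN incl1 mulrA; congr (_ * _).
exact/esym/commr_sign.
Qed.

Lemma yH_comm n j (a : H n) : incl a * yH n j = yH n j * incl a.
Proof.
rewrite yHE mulr_sumr mulr_suml; apply: eq_bigr => t _.
by rewrite mulrA (commrX _ (incl_x_comm a)) -!mulrA -!inclM cdC.
Qed.

(** For i >= j the trace is the coefficient of degree i - j in the product of the bubble series with
    its inverse; for i < j only vanishing bubbles occur. *)
Lemma trH_xy n i j : (i < d)%N -> (j < d)%N -> trH (x n.+1 n ^+ i * yH n j) = (i == j)%:R.
Proof.
move=> id jd; rewrite yHE mulr_sumr trH_sum //.
have e t : (j <= t)%N -> (t < d)%N ->
   trH (x n.+1 n ^+ i * (x n.+1 n ^+ (t - j) * incl (cd n (d.-1 - t)))) =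
   if (d.-1 + j <= i + t)%N then Gm n (i + t - d.-1 - j) * cd n (d.-1 - t) else 0.
  move=> jt td; rewrite mulrA -exprD trHr //; case: leqP => q.
    by rewrite /Gm; congr (trH (_ ^+ _) * _); lia.
  by rewrite Gm_lt ?mul0r //; lia.
rewrite (eq_big_nat _ _ (fun t h => e t (proj1 (andP h)) (proj2 (andP h)))).
have [ij|ji] := ltnP i j.
  rewrite (ltn_eqF ij) big_nat_cond big1 // => t /andP[/andP[_ td] _].
  by rewrite leqNgt ifF //; apply/negP; lia.
have -> : (i == j) = (i - j == 0)%N by apply/eqP/eqP; lia.
rewrite -Gm_cd (big_cat_nat (n := d.-1 - (i - j))) //=; [|lia..].
rewrite big_nat_cond big1 ?add0r => [|t /andP[/andP[_ td] _]]; last by rewrite ifF //; apply/negP; lia.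
rewrite -{1}(add0n (d.-1 - (i - j))%N) big_addn (_ : d - (d.-1 - (i - j)) = (i - j).+1)%N; last by lia.
rewrite big_mkord; apply: eq_bigr => a _; have := ltn_ord a => la.
rewrite ifT; last by lia.
by congr (Gm _ _ * cd _ _); lia.
Qed.

Lemma trH_yx n i j : (i < d)%N -> (j < d)%N -> trH (yH n j * x n.+1 n ^+ i) = (i == j)%:R.
Proof.
move=> id jd; rewrite -trH_xy //; congr trH; rewrite yHE mulr_suml mulr_sumr.
apply: eq_bigr => t _; rewrite -mulrA (commrX _ (incl_x_comm _)) !mulrA.
by rewrite -!exprD addnC.
Qed.

Lemma x_yH n j : (j < d)%N -> x n.+1 n ^+ j = \sum_(i < d) incl (trH (x n.+1 n ^+ (j + i))) * yH n i.
Proof.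
move=> jd.
have e (i : 'I_d) : incl (trH (x n.+1 n ^+ (j + i))) * yH n i =
  \sum_(v < d) if (d.-1 <= j + i)%N && (i + v < d)%N then
      x n.+1 n ^+ v * incl (Gm n (j + i - d.-1) * cd n (d.-1 - i - v)) else 0.
  case: leqP => ij; last by rewrite Gm_lt ?incl0 ?mul0r ?big1.
  rewrite yHE mulr_sumr -{1}(add0n (i : nat)) big_addn.
  rewrite -(big_mkord xpredT (fun v => if true && (i + v < d)%N then x n.+1 n ^+ v * incl (Gm n (j + i - d.-1) * cd n (d.-1 - i - v)) else 0)).
  have id := ltn_ord i.
  rewrite [RHS](big_cat_nat (n := d - i)) //=; last by lia.
  rewrite [X in _ + X]big_nat_cond [X in _ + X]big1 ?addr0 => [|v /andP[/andP[vd _] _]]; last by rewrite ifF //; apply/negP; lia.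
  apply: eq_big_nat => v /andP[_ vd]; rewrite ifT; last by lia.
  rewrite addnK mulrA (commrX _ (incl_x_comm _)) -mulrA -inclM.
  by congr (_ * incl (trH (_ ^+ _) * cd _ _)); lia.
under eq_bigr => i _ do rewrite e.
rewrite exchange_big /=.
have e2 (v : 'I_d) : \sum_(i < d) (if (d.-1 <= j + i)%N && (i + v < d)%N then
      x n.+1 n ^+ v * incl (Gm n (j + i - d.-1) * cd n (d.-1 - i - v)) else 0) =
    if (v == j :> nat) then x n.+1 n ^+ j else 0.
  have vd := ltn_ord v.
  rewrite -big_mkcond /= -(big_mkord (fun i => (d.-1 <= j + i)%N && (i + v < d)%N)
     (fun i => x n.+1 n ^+ v * incl (Gm n (j + i - d.-1) * cd n (d.-1 - i - v)))).
  have [jv|vj] := ltnP j v.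
    rewrite (gtn_eqF jv) big_nat_cond big1 // => i /andP[/andP[_ h] /andP[h1 h2]]; lia.
  rewrite big_mkcond (big_cat_nat (n := (d.-1 - j)%N)) //=; last by lia.
  rewrite big_nat_cond big1 ?add0r => [|i /andP[/andP[_ h] _]]; last by rewrite ifF //; apply/negP; lia.
  rewrite -{1}(add0n (d.-1 - j)%N) big_addn (_ : d - (d.-1 - j) = j.+1)%N; last by lia.
  rewrite (big_cat_nat (n := (j - v).+1)) //=; last by lia.
  rewrite [X in _ + X]big_nat_cond [X in _ + X]big1 ?addr0 => [|i /andP[/andP[h _] _]]; last by rewrite ifF //; apply/negP; lia.
  have -> : (v == j :> nat) = (j - v == 0)%N by apply/eqP/eqP; lia.
  transitivity (x n.+1 n ^+ v * incl (\sum_(a < (j - v).+1) Gm n a * cd n (j - v - a)%N)).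
    rewrite incl_sum mulr_sumr big_mkord; apply: eq_bigr => a _; have la := ltn_ord a.
    rewrite ifT; last by lia.
    by congr (_ * incl (Gm _ _ * cd _ _)); lia.
  rewrite Gm_cd; case: eqP => q; last by rewrite incl0 mulr0.
  by rewrite incl1 mulr1; congr (_ ^+ _); lia.
under eq_bigr => v _ do rewrite e2.
by rewrite (bigD1 (Ordinal jd)) //= eqxx big1 ?addr0 // => v /negbTE vj; rewrite -[_ == _]/(v == Ordinal jd) vj.
Qed.

(** With [bd], the factors of the summands of the left cup. By [casimir_l] and [casimir_r] they
    behave as dual bases of H_{p+1} over H_p for the trace. *)
Definition bb p i j : H p.+1 := x p.+1 i ^+ j * \prod_(i <= l < p) s p.+1 l.
Definition bd p i j : H p.+1 :=
  (\prod_(l <- rev (index_iota i p)) s p.+1 l) * emb p.+1 (yH i j).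

Lemma bbS p i j : (i <= p)%N -> bb p.+1 i j = incl (bb p i j) * s p.+2 p.
Proof.
move=> ip; rewrite /bb big_nat_recr //= inclM inclX incl_x ?ltnS // -!mulrA; congr (_ * (_ * _)).
rewrite /index_iota (big_morph (@incl k lam p.+1) (fun a b => inclM a b) (incl1 k lam p.+1)).
rewrite big_nat_cond [RHS]big_nat_cond; apply: eq_bigr => l /andP[/andP[_ lp] _].
by rewrite incl_s // ltnS.
Qed.

Lemma emb_emb l m n (a : H l) : (l <= m)%N -> (m <= n)%N -> emb n (emb m a) = emb n a.
Proof.
move=> lm mn; move: a; apply: hecke_ind => [c|i il|i il|a b Ha Hb|a b Ha Hb].
- by rewrite !emb_cH //; exact: leq_trans mn.
- by rewrite !emb_x //; [exact: leq_trans mn|exact: leq_trans lm].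
- by rewrite !emb_s //; [exact: leq_trans mn|exact: leq_trans lm].
- by rewrite !embD // ?Ha ?Hb //; exact: leq_trans mn.
by rewrite !embM // ?Ha ?Hb //; exact: leq_trans mn.
Qed.

Lemma bdS p i j : (i <= p)%N -> bd p.+1 i j = s p.+2 p * incl (bd p i j).
Proof.
move=> ip; rewrite /bd inclM /index_iota subSn // -[(p - i).+1]addn1 iotaD rev_cat /= big_cons subnKC //.
rewrite -mulrA; congr (_ * (_ * _)).
  rewrite (big_morph (@incl k lam p.+1) (fun a b => inclM a b) (incl1 k lam p.+1)).
  rewrite big_seq [RHS]big_seq; apply: eq_bigr => l.
  by rewrite mem_rev mem_iota => h; rewrite incl_s // ltnS; lia.
by rewrite /incl emb_emb.
Qed.

Lemma bb_top p j : bb p p j = x p.+1 p ^+ j.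
Proof. by rewrite /bb big_geq ?mulr1. Qed.

Lemma bd_top p j : bd p p j = yH p j.
Proof. by rewrite /bd /index_iota subnn big_nil mul1r emb_id. Qed.

(** The Casimir element, the sum of all [bb] tensor [bd], presented through an arbitrary expression
    F in its two factors. This serves products and tensor products alike. *)
Definition cas (V : zmodType) p (F : H p.+1 -> H p.+1 -> V) : V :=
  \sum_(i < p.+1) \sum_(j < d) F (bb p i j) (bd p i j).

Lemma cas0 (V : zmodType) (F : H 1 -> H 1 -> V) :
  cas F = \sum_(j < d) F (x 1 0 ^+ j) (yH 0 j).
Proof. by rewrite /cas big_ord1; apply: eq_bigr => j _; rewrite bb_top bd_top. Qed.

Lemma casS (V : zmodType) p (F : H p.+2 -> H p.+2 -> V) :
  cas F = cas (fun a b => F (incl a * s p.+2 p) (s p.+2 p * incl b)) +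
    \sum_(j < d) F (x p.+2 p.+1 ^+ j) (yH p.+1 j).
Proof.
rewrite /cas big_ord_recr /=; congr (_ + _); last first.
  by apply: eq_bigr => j _; rewrite bb_top bd_top.
by apply: eq_bigr => i _; apply: eq_bigr => j _; rewrite bbS ?bdS // -ltnS.
Qed.

Lemma cas_morph (V W : zmodType) (f : V -> W) p (F : H p.+1 -> H p.+1 -> V) : f 0 = 0 ->
  {morph f : u v / u + v} -> f (cas F) = cas (fun a b => f (F a b)).
Proof.
move=> f0 fD; rewrite /cas (big_morph f fD f0); apply: eq_bigr => i _.
exact: (big_morph f fD f0).
Qed.

Lemma eq_cas (V : zmodType) p (F G : H p.+1 -> H p.+1 -> V) : (forall a b, F a b = G a b) ->
  cas F = cas G.
Proof. by move=> FG; apply: eq_bigr => i _; apply: eq_bigr => j _. Qed.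

Lemma cas_eq0 (V : zmodType) p (F : H p.+1 -> H p.+1 -> V) : (forall a b, F a b = 0) ->
  cas F = 0.
Proof. by move=> F0; rewrite /cas big1 // => i _; apply: big1. Qed.

Lemma casD (V : zmodType) p (F G : H p.+1 -> H p.+1 -> V) :
  cas (fun a b => F a b + G a b) = cas F + cas G.
Proof. by rewrite /cas -big_split; apply: eq_bigr => i _; rewrite -big_split. Qed.

Lemma exch_cas (V : zmodType) p q (F : H p.+1 -> H p.+1 -> H q.+1 -> H q.+1 -> V) :
  cas (fun a b => cas (F a b)) = cas (fun c c' => cas (fun a b => F a b c c')).
Proof.
rewrite /cas; under eq_bigr => i _ do rewrite exchange_big /=.
rewrite exchange_big /=; apply: eq_bigr => i' _.
under eq_bigr => i _ do rewrite exchange_big /=.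
by rewrite exchange_big.
Qed.

Lemma trH_sxa n (a : H n.+1) j : (j < d)%N -> trH (s n.+2 n * incl a * x n.+2 n.+1 ^+ j) = 0.
Proof. by move=> jd; rewrite -mulrA (commrX j (incl_x_comm a)) mulrA trHr // trH_sx // mul0r. Qed.

Lemma trH_asx n (a b : H n) j : (0 < n)%N -> (j < d)%N ->
  trH (incl a * s n.+1 n.-1 * incl b * x n.+1 n ^+ j) = 0.
Proof.
case: n a b => // n a b _ jd; rewrite -!mulrA trHl // (mulrA (s n.+2 n)) trH_sxa //.
by rewrite mulr0.
Qed.

Lemma trH_xas n (a b : H n) j : (0 < n)%N -> (j < d)%N ->
  trH (x n.+1 n ^+ j * (incl a * s n.+1 n.-1 * incl b)) = 0.
Proof.
case: n a b => // n a b _ jd; rewrite !mulrA -(commrX j (incl_x_comm a)) trHr // -mulrA trHl //.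
by rewrite trH_xs // mulr0 mul0r.
Qed.

Lemma trH_xus p j (u : H p.+1) : (j < d)%N -> trH (x p.+2 p.+1 ^+ j * (incl u * s p.+2 p)) = 0.
Proof. by move=> jd; have := @trH_xas p.+1 u 1 j isT jd; rewrite incl1 mulr1. Qed.

Lemma trH_yas n (a b : H n) j : (0 < n)%N ->
  trH (yH n j * (incl a * s n.+1 n.-1 * incl b)) = 0.
Proof.
move=> n0; rewrite yHE mulr_suml trH_sum // big_nat_cond big1 // => t /andP[/andP[_ td] _].
by rewrite -mulrA !(mulrA (incl (cd _ _))) -inclM trH_xas //; lia.
Qed.

Lemma trH_asy n (a b : H n) j : (0 < n)%N ->
  trH ((incl a * s n.+1 n.-1 * incl b) * yH n j) = 0.
Proof.
move=> n0; rewrite yHE mulr_sumr trH_sum // big_nat_cond big1 // => t /andP[/andP[_ td] _].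
by rewrite !mulrA trHr // trH_asx // ?mul0r //; lia.
Qed.

Lemma trH_asbs p (a b u : H p.+1) :
  trH (incl a * s p.+2 p * incl b * (incl u * s p.+2 p)) = a * incl (trH (b * u)).
Proof. by rewrite -!mulrA trHl // (mulrA (incl b)) -inclM (mulrA (s _ _)) trH_sfs. Qed.

(** Induction along [casS]: on H s H the crossings of the recursive part cancel by [trH_asbs], the
    powers of the dot are expanded by [x_yH], and the mixed traces vanish. *)
Lemma casimir_r p (z : H p.+1) : cas (fun a b => incl (trH (z * a)) * b) = z.
Proof.
elim: p z => [|p IHp] z; move: z; apply: hecke_spanning => //.
- move=> f g Hf Hg; rewrite -[in RHS]Hf -[in RHS]Hg !cas0 -big_split; apply: eq_bigr => i _.
  by rewrite mulrDl trHD // inclD mulrDl.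
- by rewrite cas_eq0 // => a b; rewrite mul0r trH0 // incl0 mul0r.
- move=> a j jd; rewrite cas0 {2}(x_yH 0 jd) mulr_sumr; apply: eq_bigr => i _.
  by rewrite -mulrA trHl // -exprD inclM mulrA.
- move=> f g Hf Hg; rewrite -[in RHS]Hf -[in RHS]Hg /cas -big_split; apply: eq_bigr => i _; rewrite -big_split.
  by apply: eq_bigr => i' _; rewrite mulrDl trHD // inclD mulrDl.
- by rewrite cas_eq0 // => a b; rewrite mul0r trH0 // incl0 mul0r.
- move=> a b n0; rewrite casS /= [X in _ + X]big1 ?addr0 => [|i _]; last by rewrite trH_asx ?incl0 ?mul0r.
  rewrite -{2}(IHp b) (cas_morph (f := fun b => incl a * s p.+2 p * incl b)) ?incl0 ?mulr0 //; last first.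
    by move=> u v; rewrite inclD mulrDr.
  apply: eq_cas => u v.
  rewrite trH_asbs !inclM -!mulrA; congr (_ * _).
  by rewrite !mulrA incl_s_comm.
move=> a j jd; rewrite casS /= cas_eq0 ?add0r => [|u v]; last first.
  by rewrite -mulrA trHl // trH_xus // mulr0 incl0 mul0r.
rewrite {2}(x_yH _ jd) mulr_sumr; apply: eq_bigr => i _.
by rewrite -mulrA trHl // -exprD inclM mulrA.
Qed.

Lemma sum_x_try n j : (j < d)%N -> \sum_(i < d) x n.+1 n ^+ i * incl (trH (yH n i * x n.+1 n ^+ j)) = x n.+1 n ^+ j.
Proof.
move=> jd; rewrite (bigD1 (Ordinal jd)) //= trH_yx // eqxx incl1 mulr1 big1 ?addr0 // => i /negbTE ij.
by rewrite trH_yx // eq_sym -[_ == _]/(i == Ordinal jd) ij incl0 mulr0.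
Qed.

Lemma casimir_l p (z : H p.+1) : cas (fun a b => a * incl (trH (b * z))) = z.
Proof.
elim: p z => [|p IHp] z; move: z; apply: hecke_spanning => //.
- move=> f g Hf Hg; rewrite -[in RHS]Hf -[in RHS]Hg !cas0 -big_split; apply: eq_bigr => i _.
  by rewrite mulrDr trHD // inclD mulrDr.
- by rewrite cas_eq0 // => a b; rewrite mulr0 trH0 // incl0 mulr0.
- move=> a j jd; rewrite cas0 [in RHS](commrX j (incl_x_comm a)) -[in RHS](sum_x_try 0 jd) mulr_suml.
  apply: eq_bigr => i _.
  by rewrite (commrX j (incl_x_comm a)) mulrA trHr // inclM mulrA.
- move=> f g Hf Hg; rewrite -[in RHS]Hf -[in RHS]Hg /cas -big_split; apply: eq_bigr => i _; rewrite -big_split.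
  by apply: eq_bigr => i' _; rewrite mulrDr trHD // inclD mulrDr.
- by rewrite cas_eq0 // => a b; rewrite mulr0 trH0 // incl0 mulr0.
- move=> a b n0; rewrite casS /= [X in _ + X]big1 ?addr0 => [|i _]; last by rewrite trH_yas ?incl0 ?mulr0.
  rewrite -{2}(IHp a) (cas_morph (f := fun a => incl a * s p.+2 p * incl b)) ?incl0 ?mul0r //; last first.
    by move=> u v; rewrite inclD !mulrDl.
  apply: eq_cas => u v.
  rewrite !mulrA trHr // -!mulrA (mulrA (incl v)) -inclM !mulrA trH_sfs // !inclM !mulrA; congr (_ * _).
  by rewrite -!mulrA incl_s_comm.
move=> a j jd; rewrite casS /= cas_eq0 ?add0r => [|u v]; last first.
  by rewrite !mulrA -(mulrA (s p.+2 p)) -inclM trH_sxa // incl0 mulr0.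
rewrite (commrX j (incl_x_comm a)) -{2}(sum_x_try _ jd) mulr_suml; apply: eq_bigr => i _.
by rewrite mulrA trHr // inclM mulrA.
Qed.

(** The decomposition of H_{p+2} with its coefficients written as traces, in the form of the diagram
    relation that splits the identity of Q_- Q_+. *)
Lemma mackey p (z : H p.+2) :
  cas (fun a b => incl (trH (z * (incl a * s p.+2 p))) * (s p.+2 p * incl b)) +
    \sum_(j < d) incl (trH (z * yH p.+1 j)) * x p.+2 p.+1 ^+ j = z.
Proof.
move: z; apply: hecke_spanning => // [f g Hf Hg||a b n0|a j jd].
- rewrite -[in RHS]Hf -[in RHS]Hg addrACA; congr (_ + _).
    rewrite /cas -big_split; apply: eq_bigr => i _; rewrite -big_split.
    by apply: eq_bigr => i' _; rewrite mulrDl trHD // inclD mulrDl.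
  by rewrite -big_split; apply: eq_bigr => i' _; rewrite mulrDl trHD // inclD mulrDl.
- rewrite cas_eq0 ?add0r => [|a b]; last by rewrite mul0r trH0 // incl0 mul0r.
  by rewrite big1 // => j _; rewrite mul0r trH0 // incl0 mul0r.
- rewrite [X in _ + X]big1 ?addr0 => [|i _]; last by rewrite trH_asy ?incl0 ?mul0r.
  rewrite -{2}(casimir_r b) (cas_morph (f := fun b => incl a * s p.+2 p * incl b)) ?incl0 ?mulr0 //; last first.
    by move=> u v; rewrite inclD mulrDr.
  apply: eq_cas => u v.
  rewrite -[p.+1.-1]/p trH_asbs !inclM -!mulrA; congr (_ * _).
  by rewrite !mulrA incl_s_comm.
rewrite cas_eq0 ?add0r => [|u v]; last first.
  by rewrite -mulrA trHl // trH_xus // mulr0 incl0 mul0r.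
rewrite (bigD1 (Ordinal jd)) //= -mulrA trHl // trH_xy // eqxx mulr1 big1 ?addr0 // => i /negbTE ij.
by rewrite -mulrA trHl // trH_xy // eq_sym -[_ == _]/(i == Ordinal jd) ij mulr0 incl0 mul0r.
Qed.

(* For n = 0 the term H_0 s_0 H_0 vanishes. *)
Lemma mackey0 (z : H 1) : \sum_(j < d) incl (trH (z * yH 0 j)) * x 1 0 ^+ j = z.
Proof.
move: z; apply: hecke_spanning => // [f g Hf Hg||a j jd].
- rewrite -[in RHS]Hf -[in RHS]Hg -big_split.
  by apply: eq_bigr => i' _; rewrite mulrDl trHD // inclD mulrDl.
- by rewrite big1 // => j _; rewrite mul0r trH0 // incl0 mul0r.
rewrite (bigD1 (Ordinal jd)) //= -mulrA trHl // trH_xy // eqxx mulr1 big1 ?addr0 // => i /negbTE ij.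
by rewrite -mulrA trHl // trH_xy // eq_sym -[_ == _]/(i == Ordinal jd) ij mulr0 incl0 mul0r.
Qed.

End DualBases2.

(** * Tensor products of bimodules *)

Section BimodTools.
Variables (A B : pzRingType).

Lemma bhom_ext (M N : bimod A B) (f g : bhom M N) : (forall u, f u = g u) -> f = g.
Proof.
case: f g => f f1 f2 f3 [g g1 g2 g3] /= fg.
have {}fg : f = g by apply: functional_extensionality_dep.
by subst g; congr Bhom; apply: Prop_irrelevance.
Qed.

Lemma bhom0 (M N : bimod A B) (f : bhom M N) : f 0 = 0.
Proof. by apply: (addrI (f 0)); rewrite -bhomD !addr0. Qed.

Lemma bhom_sum (M N : bimod A B) (f : bhom M N) (I : Type) (r : seq I) (P : pred I) (F : I -> M) :
  f (\sum_(i <- r | P i) F i) = \sum_(i <- r | P i) f (F i).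
Proof. exact: (big_morph f (bhomD f) (bhom0 f)). Qed.

Lemma lact_suml (M : bimod A B) (I : Type) (r : seq I) (P : pred I) (F : I -> A) (u : M) :
  lact (\sum_(i <- r | P i) F i) u = \sum_(i <- r | P i) lact (F i) u.
Proof.
apply: (big_morph (fun a => lact a u)) => [a b|]; first exact: lactDl.
by apply: (addrI (lact 0 u)); rewrite -lactDl !addr0.
Qed.

Lemma lact0l (M : bimod A B) (u : M) : lact 0 u = 0.
Proof. by apply: (addrI (lact 0 u)); rewrite -lactDl !addr0. Qed.

(** The functor picks homomorphisms by prescribed values and falls back to zero, so each of its
    formulas becomes available only once a homomorphism with these values is exhibited. *)
Lemma the_bhomP (M N : bimod A B) (P : bhom M N -> Prop) : (exists f, P f) -> P (the_bhom P).
Proof. by case=> f Pf; apply: (@xgetI _ (bnull M N) [set f | P f]%classic f). Qed.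

End BimodTools.

Section TensTools.
Variables (A B C : pzRingType).

Section Tens.
Variables (M : bimod A B) (N : bimod B C).

Lemma ptensDl (u u' : M) (v : N) : ptens (u + u') v = ptens u v + ptens u' v.
Proof. exact: tpureDl. Qed.

Lemma ptensDr (u : M) (v v' : N) : ptens u (v + v') = ptens u v + ptens u v'.
Proof. exact: tpureDr. Qed.

Lemma ptens_bal (u : M) b (v : N) : ptens (ract u b) v = ptens u (lact b v).
Proof. by apply/tclass_eq/teq_bal. Qed.

Lemma ptens0l (v : N) : ptens (0 : M) v = 0.
Proof. by apply: (addrI (ptens 0 v)); rewrite -ptensDl !addr0. Qed.

Lemma ptens0r (u : M) : ptens u (0 : N) = 0.
Proof. by apply: (addrI (ptens u 0)); rewrite -ptensDr !addr0. Qed.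

Lemma ptensNl (u : M) (v : N) : ptens (- u) v = - ptens u v.
Proof. by apply: (addrI (ptens u v)); rewrite -ptensDl !addrN ptens0l. Qed.

Lemma ptens_suml (I : Type) (r : seq I) (P : pred I) (F : I -> M) (v : N) :
  ptens (\sum_(i <- r | P i) F i) v = \sum_(i <- r | P i) ptens (F i) v.
Proof.
by apply: (big_morph (fun u => ptens u v)) => [u u'|]; [exact: ptensDl|exact: ptens0l].
Qed.

Lemma lact_ptens a (u : M) (v : N) : lact a (ptens u v) = ptens (lact a u) v.
Proof. exact: tlact_pure. Qed.

Lemma ract_ptens c (u : M) (v : N) : ract (ptens u v) c = ptens u (ract v c).
Proof. exact: tract_pure. Qed.

Lemma tens_eq (P : zmodType) (f g : tens M N -> P) :
  {morph f : u v / u + v} -> {morph g : u v / u + v} ->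
  (forall u v, f (ptens u v) = g (ptens u v)) -> f =1 g.
Proof.
move=> fD gD fg.
have f0 : f 0 = 0 by apply: (addrI (f 0)); rewrite -fD !addr0.
have g0 : g 0 = 0 by apply: (addrI (g 0)); rewrite -gD !addr0.
have fN (h : tens M N -> P) : {morph h : u v / u + v} -> h 0 = 0 -> forall w, h (- w) = - h w.
  by move=> hD h0 w; apply: (addrI (h w)); rewrite -hD !addrN.
apply: tens_ind => // [|u fgu|u v fgu fgv].
- by rewrite [LHS]f0 [RHS]g0.
- by rewrite [LHS](fN f fD f0) [RHS](fN g gD g0) fgu.
- by rewrite [LHS]fD [RHS]gD fgu fgv.
Qed.

Section Lift.
Variables (P : zmodType) (F : M -> N -> P).
Hypothesis FDl : forall u u' v, F (u + u') v = F u v + F u' v.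
Hypothesis FDr : forall u v v', F u (v + v') = F u v + F u v'.
Hypothesis Fbal : forall u b v, F (ract u b) v = F u (lact b v).

Fixpoint teval (t : tterm M N) : P :=
  match t with
  | TPure u v => F u v
  | TZero => 0
  | TOpp s => - teval s
  | TAdd s t => teval s + teval t
  end.

Lemma teval_teq s t : teq s t -> teval s = teval t.
Proof.
elim=> //= *; rewrite ?(FDl, FDr, Fbal); try congruence.
- by rewrite addrA.
- by rewrite addrC.
- by rewrite add0r.
- by rewrite addNr.
Qed.

Definition tlift (z : tens M N) : P := teval (repr (z : tens_type M N)).

Lemma tlift_pure u v : tlift (ptens u v) = F u v.
Proof. exact: (teval_teq (repr_tclass _)). Qed.

Lemma tliftD y z : tlift (y + z) = tlift y + tlift z.
Proof. exact: (teval_teq (repr_tclass (TAdd _ _))). Qed.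

End Lift.

Lemma tens_bhom (P : bimod A C) (F : M -> N -> P) :
  (forall u u' v, F (u + u') v = F u v + F u' v) ->
  (forall u v v', F u (v + v') = F u v + F u v') ->
  (forall u b v, F (ract u b) v = F u (lact b v)) ->
  (forall a u v, F (lact a u) v = lact a (F u v)) ->
  (forall u v c, F u (ract v c) = ract (F u v) c) ->
  exists f : bhom (tens M N) P, forall u v, f (ptens u v) = F u v.
Proof.
move=> FDl FDr Fb Fl Fr; pose f := @tlift P F.
have fD : {morph f : u v / u + v} by apply: tliftD.
have fE u v : f (ptens u v) = F u v by apply: tlift_pure.
have fl a z : f (lact a z) = lact a (f z).
  move: z; apply: (tens_eq (f := fun z => f (lact a z)) (g := fun z => lact a (f z))) => [u v|u v|u v].
  - by rewrite lactDr fD.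
  - by rewrite fD lactDr.
  - by rewrite lact_ptens !fE Fl.
have fr z c : f (ract z c) = ract (f z) c.
  move: z; apply: (tens_eq (f := fun z => f (ract z c)) (g := fun z => ract (f z) c)) => [u v|u v|u v].
  - by rewrite ractDl fD.
  - by rewrite fD ractDl.
  - by rewrite ract_ptens !fE Fr.
by exists (Bhom fD fl fr).
Qed.

End Tens.

Lemma tens_mapE (M : bimod A B) (N N' : bimod B C) (f : bhom N N') u v :
  tens_map M f (ptens u v) = ptens u (f v).
Proof.
move: u v; apply: (@the_bhomP _ _ _ _ (fun g : bhom (tens M N) (tens M N') => forall u v, g (ptens u v) = ptens u (f v))).
apply: tens_bhom => [u u' v|u v v'|u b v|a u v|u v c].
- exact: ptensDl.
- by rewrite bhomD ptensDr.
- by rewrite bhom_lact ptens_bal.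
- by rewrite lact_ptens.
- by rewrite bhom_ract ract_ptens.
Qed.

End TensTools.

Section Tens3.
Variables (A B C D : pzRingType) (M1 : bimod A B) (M2 : bimod B C) (N : bimod C D).
Local Notation T := (tens M1 (tens M2 N)).

Lemma tens3_bhom (P : bimod A D) (F : M1 -> M2 -> N -> P) :
  (forall a a' b u, F (a + a') b u = F a b u + F a' b u) ->
  (forall a b b' u, F a (b + b') u = F a b u + F a b' u) ->
  (forall a b u u', F a b (u + u') = F a b u + F a b u') ->
  (forall a r b u, F (ract a r) b u = F a (lact r b) u) ->
  (forall a b r u, F a (ract b r) u = F a b (lact r u)) ->
  (forall r a b u, F (lact r a) b u = lact r (F a b u)) ->
  (forall a b u r, F a b (ract u r) = ract (F a b u) r) ->
  exists f : bhom T P, forall a b u, f (ptens a (ptens b u)) = F a b u.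
Proof.
move=> D1 D2 D3 B1 B2 L R.
pose G a : tens M2 N -> P := tlift (F a).
have GD a u v : G a (u + v) = G a u + G a v by apply: tliftD.
have GE a b u : G a (ptens b u) = F a b u by apply: tlift_pure.
have [f fE] : exists f : bhom T P, forall a z, f (ptens a z) = G a z.
  apply: tens_bhom => //.
  - move=> a a'; apply: (tens_eq (f := G (a + a')) (g := fun z => G a z + G a' z)) => // [u v|b u].
      by rewrite !GD addrACA.
    by rewrite !GE D1.
  - move=> a r; apply: (tens_eq (f := G (ract a r)) (g := fun z => G a (lact r z))) => // [u v|b u].
      by rewrite lactDr GD.
    by rewrite lact_ptens !GE B1.
  - move=> r a; apply: (tens_eq (f := G (lact r a)) (g := fun z => lact r (G a z))) => // [u v|b u].
      by rewrite GD lactDr.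
    by rewrite !GE L.
  - move=> a v r; move: v; apply: (tens_eq (f := fun z => G a (ract z r)) (g := fun z => ract (G a z) r)) => // [u v|u v|b u].
    + by rewrite ractDl GD.
    + by rewrite GD ractDl.
    + by rewrite ract_ptens !GE R.
by exists f => a b u; rewrite fE GE.
Qed.

End Tens3.

(** * The functor on generating diagrams *)

Section Words.
Variables (k : fieldType) (lam : weight) (n : nat).
Local Notation H := (hecke k lam).
Local Notation x := (xH k lam).
Local Notation s := (sH k lam).
Local Notation d := (level lam).
Local Notation yH := (yH k lam).
Local Notation ind := (ind k lam).
Local Notation res := (res k lam).
Local Notation Fword := (Fword k lam n).
Local Notation Fdiag := (Fdiag lam n).
Hypothesis d_gt0 : (0 < d)%N.
Implicit Types v w : word.

Definition tu w p (a : H p.+1) (u : Fword w p) : Fword (up :: w) p.+1 := ptens (a : ind p) u.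
Definition td w m (a : H m.+1) (u : Fword w m.+1) : Fword (dn :: w) m := ptens (a : res m) u.

Lemma tuDl w p a b (u : Fword w p) : tu (a + b) u = tu a u + tu b u.
Proof. exact: ptensDl. Qed.
Lemma tuDr w p a (u v : Fword w p) : tu a (u + v) = tu a u + tu a v.
Proof. exact: ptensDr. Qed.
Lemma tu0l w p (u : Fword w p) : tu 0 u = 0.
Proof. exact: ptens0l. Qed.
Lemma tu0r w p (a : H p.+1) : tu a (0 : Fword w p) = 0.
Proof. exact: ptens0r. Qed.
Lemma tu_lact w p a b (u : Fword w p) : tu a (lact b u) = tu (a * incl b) u.
Proof. exact/esym/ptens_bal. Qed.
Lemma lact_tu w p c a (u : Fword w p) : lact c (tu a u) = tu (c * a) u.
Proof. exact: lact_ptens. Qed.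
Lemma ract_tu w p c a (u : Fword w p) : ract (tu a u) c = tu a (ract u c).
Proof. exact: ract_ptens. Qed.
Lemma tu_suml w p (I : Type) (r : seq I) (P : pred I) (F : I -> H p.+1) (u : Fword w p) :
  tu (\sum_(i <- r | P i) F i) u = \sum_(i <- r | P i) tu (F i) u.
Proof. exact: ptens_suml. Qed.
Lemma tdDl w m a b (u : Fword w m.+1) : td (a + b) u = td a u + td b u.
Proof. exact: ptensDl. Qed.
Lemma tdDr w m a (u v : Fword w m.+1) : td a (u + v) = td a u + td a v.
Proof. exact: ptensDr. Qed.
Lemma td0l w m (u : Fword w m.+1) : td 0 u = 0.
Proof. exact: ptens0l. Qed.
Lemma td0r w m (a : H m.+1) : td a (0 : Fword w m.+1) = 0.
Proof. exact: ptens0r. Qed.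
Lemma td_lact w m a b (u : Fword w m.+1) : td a (lact b u) = td (a * b) u.
Proof. exact/esym/ptens_bal. Qed.
Lemma lact_td w m c a (u : Fword w m.+1) : lact c (td a u) = td (incl c * a) u.
Proof. exact: lact_ptens. Qed.
Lemma ract_td w m c a (u : Fword w m.+1) : ract (td a u) c = td a (ract u c).
Proof. exact: ract_ptens. Qed.
Lemma td_suml w m (I : Type) (r : seq I) (P : pred I) (F : I -> H m.+1) (u : Fword w m.+1) :
  td (\sum_(i <- r | P i) F i) u = \sum_(i <- r | P i) td (F i) u.
Proof. exact: ptens_suml. Qed.
Lemma tens_add_ind (A B C : pzRingType) (M : bimod A B) (N : bimod B C) (P : tens M N -> Prop) :
  (forall a u, P (ptens a u)) -> (forall y z, P y -> P z -> P (y + z)) -> forall z, P z.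
Proof.
move=> Pp PD z.
suff [] : P z /\ P (- z) by [].
move: z; apply: tens_ind => [a u||z [Pz PNz]|y z [Py PNy] [Pz PNz]].
- by split; [exact: Pp | have := Pp (- a) u; rewrite ptensNl].
- by rewrite oppr0; split; have := Pp 0 0; rewrite ptens0l.
- by split; rewrite // opprK.
- by split; [exact: PD | rewrite opprD; exact: PD].
Qed.

Lemma up_ind w p (P : Fword (up :: w) p.+1 -> Prop) :
  (forall a u, P (tu a u)) -> (forall y z, P y -> P z -> P (y + z)) -> forall z, P z.
Proof. by move=> Pp PD; apply: (@tens_add_ind _ _ _ (ind p) (Fword w p) P Pp PD). Qed.

Lemma dn_ind w m (P : Fword (dn :: w) m -> Prop) :
  (forall a u, P (td a u)) -> (forall y z, P y -> P z -> P (y + z)) -> forall z, P z.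
Proof. by move=> Pp PD; apply: (@tens_add_ind _ _ _ (res m) (Fword w m.+1) P Pp PD). Qed.

Lemma zero_bimod_eq (A B : pzRingType) (y z : zero_bimod A B) : y = z.
Proof. by apply/matrixP => i []. Qed.

Lemma up0_eq0 w (z : Fword (up :: w) 0) : z = 0.
Proof. exact: zero_bimod_eq. Qed.

Lemma FxE v p a (u : Fword v p) : Fx k lam n v p.+1 (tu a u) = tu (a * x p.+1 p) u.
Proof.
move: a u; apply: (@the_bhomP _ _ _ _ (fun f : bhom (Fword (up :: v) p.+1) (Fword (up :: v) p.+1) =>
  forall a u, f (tu a u) = tu (a * x p.+1 p) u)).
apply: (@tens_bhom _ _ _ (ind p) (Fword v p) (Fword (up :: v) p.+1)
  (fun a u => tu ((a : H p.+1) * x p.+1 p) u)) => [a b u|a u u'|a b u|a b u|a u c].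
- by rewrite mulrDl tuDl.
- exact: tuDr.
- by rewrite tu_lact -[ract a b]/((a : H p.+1) * incl b) -!mulrA incl_x_comm.
- by rewrite lact_tu mulrA.
- by rewrite ract_tu.
Qed.

Lemma FsE v p a b (u : Fword v p) :
  Fs k lam n v p.+2 (tu a (tu b u)) = tu (a * incl b * s p.+2 p) (tu 1 u).
Proof.
move: a b u; apply: (@the_bhomP _ _ _ _ (fun f : bhom (Fword (up :: up :: v) p.+2) (Fword (up :: up :: v) p.+2) =>
  forall a b u, f (tu a (tu b u)) = tu (a * incl b * s p.+2 p) (tu 1 u))).
apply: (@tens3_bhom _ _ _ _ (ind p.+1) (ind p) (Fword v p) (Fword (up :: up :: v) p.+2)
  (fun a b u => tu ((a : H p.+2) * incl (b : H p.+1) * s p.+2 p) (tu 1 u))) => [a a' b u|a b b' u|a b u u'|a r b u|a b r u|r a b u|a b u r].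
- by rewrite !mulrDl tuDl.
- by rewrite inclD mulrDr mulrDl tuDl.
- by rewrite !tuDr.
- by rewrite -[ract a r]/((a : H p.+2) * incl r) -[lact r b]/(r * (b : H p.+1)) inclM !mulrA.
- rewrite -[ract b r]/((b : H p.+1) * incl r) tu_lact mul1r -[in RHS](mulr1 (incl r)) -(lact_tu (incl r) 1 u) tu_lact inclM; congr tu.
  by rewrite -!mulrA; congr (_ * (_ * _)); apply: incl_s_comm.
- by rewrite lact_tu !mulrA.
- by rewrite !ract_tu.
Qed.

Lemma FcupE v m (u : Fword v m) : Fcup k lam n v m u = td 1 (tu 1 u).
Proof.
move: u; apply: (@the_bhomP _ _ _ _ (fun f : bhom (Fword v m) (Fword (dn :: up :: v) m) =>
  forall u, f u = td 1 (tu 1 u))).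
unshelve eexists (@Bhom _ _ (Fword v m) (Fword (dn :: up :: v) m) (fun u => td 1 (tu 1 u)) _ _ _) => //.
- by move=> u u' /=; rewrite tuDr tdDr.
- move=> a u; rewrite -[RHS]/(lact a (td 1 (tu 1 u))) -[LHS]/(td 1 (tu 1 (lact a u))) tu_lact lact_td mul1r mulr1 -[in RHS](mul1r (incl a)) -(td_lact 1 (incl a)) lact_tu.
  by rewrite mulr1.
- by move=> u b; rewrite -[RHS]/(ract (td 1 (tu 1 u)) b) ract_td ract_tu.
Qed.

Lemma FcapE v p a b (u : Fword v p.+1) : Fcap k lam n v p.+1 (tu a (td b u)) = lact (a * b) u.
Proof.
move: a b u; apply: (@the_bhomP _ _ _ _ (fun f : bhom (Fword (up :: dn :: v) p.+1) (Fword v p.+1) =>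
  forall a b u, f (tu a (td b u)) = lact (a * b) u)).
apply: (@tens3_bhom _ _ _ _ (ind p) (res p) (Fword v p.+1) (Fword v p.+1)
  (fun a b u => lact ((a : H p.+1) * (b : H p.+1)) u)) => [a a' b u|a b b' u|a b u u'|a r b u|a b r u|r a b u|a b u r].
- by rewrite mulrDl lactDl.
- by rewrite mulrDr lactDl.
- by rewrite lactDr.
- by rewrite /= mulrA.
- by rewrite /= mulrA lactM.
- by rewrite /= -mulrA lactM.
- by rewrite lactA.
Qed.

Lemma Fcap'E v m a b (u : Fword v m) : Fcap' k lam n v m (td a (tu b u)) = lact (trH (a * b)) u.
Proof.
move: a b u; apply: (@the_bhomP _ _ _ _ (fun f : bhom (Fword (dn :: up :: v) m) (Fword v m) =>
  forall a b u, f (td a (tu b u)) = lact (trH (a * b)) u)).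
apply: (@tens3_bhom _ _ _ _ (res m) (ind m) (Fword v m) (Fword v m)
  (fun a b u => lact (trH ((a : H m.+1) * (b : H m.+1))) u)) => [a a' b u|a b b' u|a b u u'|a r b u|a b r u|r a b u|a b u r].
- by rewrite mulrDl trHD // lactDl.
- by rewrite mulrDr trHD // lactDl.
- by rewrite lactDr.
- by rewrite /= mulrA.
- by rewrite /= mulrA trHr // lactM.
- by rewrite /= -mulrA trHl // lactM.
- by rewrite lactA.
Qed.

(** The Casimir element commutes with H_{p+1}, which makes the left cup a bimodule map. Each product
    with a is expanded by [casimir_l], the coefficients from H_p cross the tensor sign, and
    [casimir_r] collects the second factors. *)
Lemma cas_tens v p (a : H p.+1) (u : Fword v p.+1) :
  cas (fun b b' => tu (a * b) (td b' u)) = cas (fun b b' => tu b (td (b' * a) u)).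
Proof.
transitivity (cas (fun b b' => cas (fun c c' => tu c (td (incl (trH (c' * (a * b))) * b') u)))).
  apply: eq_cas => b b'; rewrite -[in LHS](casimir_l d_gt0 (a * b)).
  rewrite (cas_morph (f := fun z => tu z (td b' u))) ?tu0l //; last by move=> y z; apply: tuDl.
  by apply: eq_cas => c c'; rewrite -tu_lact lact_td.
rewrite exch_cas; apply: eq_cas => c c'; rewrite -[in RHS](casimir_r d_gt0 (c' * a)).
rewrite (cas_morph (f := fun z => tu c (td z u))) ?td0l ?tu0r //; last by move=> y z; rewrite tdDl tuDr.
by apply: eq_cas => b b'; rewrite mulrA.
Qed.

Lemma Fcup'E v p (u : Fword v p.+1) :
  Fcup' k lam n v p.+1 u = cas (fun a b => tu a (td b u)).
Proof.
move: u; apply: (@the_bhomP _ _ _ _ (fun f : bhom (Fword v p.+1) (Fword (up :: dn :: v) p.+1) =>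
  forall u, f u = cas (fun a b => tu a (td b u)))).
unshelve eexists (@Bhom _ _ (Fword v p.+1) (Fword (up :: dn :: v) p.+1)
  (fun u => cas (fun a b => tu a (td b u))) _ _ _) => //.
- by move=> u u' /=; rewrite -casD; apply: eq_cas => a b; rewrite tdDr tuDr.
- move=> a u; rewrite -[RHS]/(lact a (cas (fun a0 b => tu a0 (td b u)))) -[LHS]/(cas (fun a0 b => tu a0 (td b (lact a u)))).
  rewrite (cas_morph (f := lact a)) ?lact0 //; last by move=> y z; apply: lactDr.
  under eq_cas => b b' do rewrite td_lact.
  by rewrite -cas_tens; apply: eq_cas => b b'; rewrite lact_tu.
- move=> u b; rewrite -[RHS]/(ract (cas (fun a0 b => tu a0 (td b u))) b).
  rewrite (cas_morph (f := fun z => ract z b)) ?ract0 //; last by move=> y z; apply: ractDl.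
  by apply: eq_cas => c c'; rewrite ract_tu ract_td.
Qed.

Lemma Fwhisk_up a b (f : bmor (Fword a) (Fword b)) p c u : Fwhisk up f p.+1 (tu c u) = tu c (f p u).
Proof. exact: tens_mapE. Qed.

Lemma Fwhisk_dn a b (f : bmor (Fword a) (Fword b)) m c u : Fwhisk dn f m (td c u) = td c (f m.+1 u).
Proof. exact: tens_mapE. Qed.

Lemma Fdiag_comp a b c (g : diag k b c) (f : diag k a b) m u :
  Fdiag (dcomp g f) m u = Fdiag g m (Fdiag f m u).
Proof. by []. Qed.
Lemma Fdiag_up a b (f : diag k a b) p c u : Fdiag (dwhisk up f) p.+1 (tu c u) = tu c (Fdiag f p u).
Proof. exact: Fwhisk_up. Qed.
Lemma Fdiag_dn a b (f : diag k a b) m c u : Fdiag (dwhisk dn f) m (td c u) = td c (Fdiag f m.+1 u).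
Proof. exact: Fwhisk_dn. Qed.
Lemma Fdiag_id a m u : Fdiag (did k a) m u = u.
Proof. by []. Qed.
Lemma Fdiag_add a b (f g : diag k a b) m u : Fdiag (dadd f g) m u = Fdiag f m u + Fdiag g m u.
Proof. by []. Qed.
Lemma Fdiag_zero a b m u : Fdiag (dzero k a b) m u = 0.
Proof. by []. Qed.
Lemma Fdiag_scale a b c (f : diag k a b) m u :
  Fdiag (dscale c f) m u = ract (Fdiag f m u) (cH lam n c).
Proof. by []. Qed.
Lemma Fdiag_x v p a (u : Fword v p) : Fdiag (dx k v) p.+1 (tu a u) = tu (a * x p.+1 p) u.
Proof. exact: FxE. Qed.
Lemma Fdiag_s v p a b (u : Fword v p) :
  Fdiag (ds k v) p.+2 (tu a (tu b u)) = tu (a * incl b * s p.+2 p) (tu 1 u).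
Proof. exact: FsE. Qed.
Lemma Fdiag_cup v m (u : Fword v m) : Fdiag (dcup k v) m u = td 1 (tu 1 u).
Proof. exact: FcupE. Qed.
Lemma Fdiag_cap v p a b (u : Fword v p.+1) : Fdiag (dcap k v) p.+1 (tu a (td b u)) = lact (a * b) u.
Proof. exact: FcapE. Qed.
Lemma Fdiag_cup' v p (u : Fword v p.+1) : Fdiag (dcup' k v) p.+1 u = cas (fun a b => tu a (td b u)).
Proof. exact: Fcup'E. Qed.
Lemma Fdiag_cap' v m a b (u : Fword v m) : Fdiag (dcap' k v) m (td a (tu b u)) = lact (trH (a * b)) u.
Proof. exact: Fcap'E. Qed.

Definition FE := (Fdiag_comp, Fdiag_up, Fdiag_dn, Fdiag_id, Fdiag_add, Fdiag_zero,
  Fdiag_x, Fdiag_s, Fdiag_cup, Fdiag_cap, Fdiag_cup', Fdiag_cap').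

End Words.

(** * Soundness of the local relations *)

Lemma unit_scalar (k : fieldType) (lam : weight) n m c (u : unit_bobj k lam n m) :
  ract u (cH lam n c) = lact (cH lam m c) u.
Proof.
move: u; rewrite /unit_bobj; case: (m =P n) => [e|ne]; last by move=> u; apply: zero_bimod_eq.
case: _ / e => u; exact/esym/cH_central.
Qed.

Section Soundness.
Variables (k : fieldType) (lam : weight) (n : nat).
Local Notation H := (hecke k lam).
Local Notation x := (xH k lam).
Local Notation s := (sH k lam).
Local Notation d := (level lam).
Local Notation yH := (yH k lam).
Local Notation Fword := (Fword k lam n).
Local Notation Fdiag := (Fdiag lam n).
Hypothesis d_gt0 : (0 < d)%N.
Implicit Types v w : word.

Lemma Fword_scalar w m c (u : Fword w m) : ract u (cH lam n c) = lact (cH lam m c) u.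
Proof.
elim: w m u => [|[] w IHw] m u; first exact: unit_scalar.
  case: m u => [|m] u; first exact: zero_bimod_eq.
  elim/up_ind: u => [a u|y z Hy Hz]; last by rewrite ractDl lactDr Hy Hz.
  by rewrite ract_tu lact_tu IHw tu_lact incl_cH cHC.
elim/dn_ind: u => [a u|y z Hy Hz]; last by rewrite ractDl lactDr Hy Hz.
by rewrite ract_td lact_td IHw td_lact incl_cH cHC.
Qed.

Definition Feq a b (f g : diag k a b) := forall m u, Fdiag f m u = Fdiag g m u.

Definition FEd := @FE k lam n d_gt0.

Lemma Fdxn j v p a (u : Fword v p) : Fdiag (dxn k j v) p.+1 (tu a u) = tu (a * x p.+1 p ^+ j) u.
Proof.
elim: j => [|j IHj]; first by rewrite expr0 mulr1.
by rewrite -[dxn k j.+1 v]/(dcomp (dx k v) (dxn k j v)) !FEd IHj !FEd -mulrA -exprSr.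
Qed.

Lemma Fbubble j v m (u : Fword v m) : Fdiag (dbubble k j v) m u = lact (trH (x m.+1 m ^+ j)) u.
Proof. by rewrite /dbubble !FEd Fdxn !FEd !mul1r. Qed.

Lemma Fdiag_bigD a b (I : Type) (r : seq I) (P : pred I) (F : I -> diag k a b) m u :
  Fdiag (\big[@dadd k a b/dzero k a b]_(i <- r | P i) F i) m u =
  \sum_(i <- r | P i) Fdiag (F i) m u.
Proof. by rewrite (big_morph (fun f => Fdiag f m u) (id1 := 0) (op1 := +%R)). Qed.

Lemma Fdiag_bigM a (I : Type) (r : seq I) (F : I -> diag k a a) (G : forall m, I -> H m) m u :
  (forall i u, Fdiag (F i) m u = lact (G m i) u) ->
  Fdiag (\big[@dcomp k a a a/did k a]_(i <- r) F i) m u = lact (\prod_(i <- r) G m i) u.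
Proof.
move=> FG; elim: r => [|i r IHr]; first by rewrite !big_nil lact1.
by rewrite !big_cons lactM -IHr -FG.
Qed.

Lemma Fdc q v m (u : Fword v m) : (q <= d)%N -> Fdiag (dc k lam q v) m u = lact (cd k d_gt0 m q) u.
Proof.
move=> qd; rewrite /dc Fdiag_bigD -(cdE _ d_gt0) // /determinant mulr_sumr lact_suml.
apply: eq_bigr => p _; rewrite Fdiag_scale Fword_scalar.
rewrite (@Fdiag_bigM _ _ _ _ (fun m (i : 'I_q) => trH (x m.+1 m ^+ (d + p i - i)))); last by move=> i w; apply: Fbubble.
rewrite -lactM; under [in RHS]eq_bigr => i _ do rewrite mxE.
by rewrite [in RHS]mulrA -exprD rmorphXn rmorphN rmorph1.
Qed.

Lemma Fdxdual j v p a (u : Fword v p) :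
  Fdiag (dxdual k lam j v) p.+1 (tu a u) = tu (a * yH p j) u.
Proof.
rewrite /dxdual Fdiag_bigD yHE // mulr_sumr tu_suml; apply: eq_bigr => t _.
by rewrite !FEd Fdc ?tu_lact; [rewrite Fdxn -!mulrA (commrX _ (incl_x_comm _)) | lia].
Qed.

Lemma tu1 w p c (u : Fword w p) : tu c u = lact c (tu 1 u).
Proof. by rewrite lact_tu mulr1. Qed.

Lemma bhom_cas (A B : pzRingType) (M N : bimod A B) (f : bhom M N) p (F : H p.+1 -> H p.+1 -> M) :
  f (cas F) = cas (fun a b => f (F a b)).
Proof. by apply: cas_morph; [exact: bhom0 | exact: bhomD]. Qed.

Lemma td_cas w m a p (F : H p.+1 -> H p.+1 -> Fword w m.+1) :
  td a (cas F) = cas (fun b c => td a (F b c)).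
Proof. by apply: (cas_morph (f := td a)); [exact: td0r | exact: tdDr]. Qed.

Lemma tu_cas w m a p (F : H p.+1 -> H p.+1 -> Fword w m) :
  tu a (cas F) = cas (fun b c => tu a (F b c)).
Proof. by apply: (cas_morph (f := tu a)); [exact: tu0r | exact: tuDr]. Qed.

Lemma cas_tdl w m (u : Fword w m.+1) p (F : H p.+1 -> H p.+1 -> H m.+1) :
  cas (fun b c => td (F b c) u) = td (cas F) u.
Proof.
by rewrite (cas_morph (f := fun z => td z u)); [|exact: td0l | move=> y z; exact: tdDl].
Qed.

Lemma cas_tul w m (u : Fword w m) p (F : H p.+1 -> H p.+1 -> H m.+1) :
  cas (fun b c => tu (F b c) u) = tu (cas F) u.
Proof.
by rewrite (cas_morph (f := fun z => tu z u)); [|exact: tu0l | move=> y z; exact: tuDl].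
Qed.

Lemma bhom_eqD (A B : pzRingType) (M N : bimod A B) (f g : bhom M N) y z :
  f y = g y -> f z = g z -> f (y + z) = g (y + z).
Proof. by rewrite !bhomD => -> ->. Qed.

Lemma ractNr (A B : pzRingType) (M : bimod A B) (u : M) b : ract u (- b) = - ract u b.
Proof.
by apply: (addrI (ract u b)); rewrite -ractDr !addrN; apply: (addrI (ract u 0)); rewrite -ractDr !addr0.
Qed.

Lemma bhom_eq0 (A B : pzRingType) (M N : bimod A B) (f g : bhom M N) z :
  z = 0 -> f z = g z.
Proof. by move=> ->; rewrite !bhom0. Qed.

(* Rewriting with a multirule is too slow here: failed matches unfold Fdiag. *)
Ltac rewrite_at t e := pattern t; refine (eq_ind_r _ _ e); cbv beta.

Ltac fe := repeat match goal with
  | |- context [bfun (Defs.Fdiag ?l ?n (dcomp ?g ?f) ?m) ?u] =>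
      rewrite_at (bfun (Defs.Fdiag l n (dcomp g f) m) u) (Fdiag_comp g f u)
  | |- context [bfun (Defs.Fdiag ?l ?n (did ?k ?w) ?m) ?u] =>
      rewrite_at (bfun (Defs.Fdiag l n (did k w) m) u) (Fdiag_id u)
  | |- context [bfun (Defs.Fdiag ?l ?n (dadd ?g ?f) ?m) ?u] =>
      rewrite_at (bfun (Defs.Fdiag l n (dadd g f) m) u) (Fdiag_add g f u)
  | |- context [bfun (Defs.Fdiag ?l ?n (dwhisk dn ?f) ?m) (td ?c ?u)] =>
      rewrite_at (bfun (Defs.Fdiag l n (dwhisk dn f) m) (td c u)) (Fdiag_dn f c u)
  | |- context [bfun (Defs.Fdiag ?l ?n (dwhisk up ?f) ?m) (tu ?c ?u)] =>
      rewrite_at (bfun (Defs.Fdiag l n (dwhisk up f) m) (tu c u)) (Fdiag_up f c u)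
  | |- context [bfun (Defs.Fdiag ?l ?n (dx ?k ?v) ?m) (tu ?a ?u)] =>
      rewrite_at (bfun (Defs.Fdiag l n (dx k v) m) (tu a u)) (Fdiag_x a u)
  | |- context [bfun (Defs.Fdiag ?l ?n (ds ?k ?v) ?m) (tu ?a (tu ?b ?u))] =>
      rewrite_at (bfun (Defs.Fdiag l n (ds k v) m) (tu a (tu b u))) (Fdiag_s a b u)
  | |- context [bfun (Defs.Fdiag ?l ?n (dcup ?k ?v) ?m) ?u] =>
      rewrite_at (bfun (Defs.Fdiag l n (dcup k v) m) u) (Fdiag_cup u)
  | |- context [bfun (Defs.Fdiag ?l ?n (dcap ?k ?v) ?m) (tu ?a (td ?b ?u))] =>
      rewrite_at (bfun (Defs.Fdiag l n (dcap k v) m) (tu a (td b u))) (Fdiag_cap a b u)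
  | |- context [bfun (Defs.Fdiag ?l ?n (dcup' ?k ?v) (S ?m)) ?u] =>
      rewrite_at (bfun (Defs.Fdiag l n (dcup' k v) (S m)) u) (Fdiag_cup' d_gt0 u)
  | |- context [bfun (Defs.Fdiag ?l ?n (dcap' ?k ?v) ?m) (td ?a (tu ?b ?u))] =>
      rewrite_at (bfun (Defs.Fdiag l n (dcap' k v) m) (td a (tu b u))) (Fdiag_cap' d_gt0 a b u)
  | |- context [bfun (Defs.Fdiag ?l ?n (dxn ?k ?j ?v) ?m) (tu ?a ?u)] =>
      rewrite_at (bfun (Defs.Fdiag l n (dxn k j v) m) (tu a u)) (Fdxn j a u)
  | |- context [bfun ?f (@cas ?k ?l ?V ?p ?F)] =>
      rewrite_at (bfun f (@cas k l V p F)) (bhom_cas f F)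
  | |- context [td ?a (@cas ?k ?l ?V ?p ?F)] =>
      rewrite_at (td a (@cas k l V p F)) (td_cas a F)
  | |- context [tu ?a (@cas ?k ?l ?V ?p ?F)] =>
      rewrite_at (tu a (@cas k l V p F)) (tu_cas a F)
  end.

Lemma Fdt v p a b (u : Fword v p.+1) :
  Fdiag (dt k v) p.+1 (tu a (td b u)) = td (incl a * s p.+2 p * incl b) (tu 1 u).
Proof. by rewrite /dt; fe; rewrite !mul1r tu_lact tu1 td_lact mul1r. Qed.

Lemma Fdt' v p a b (u : Fword v p.+1) :
  Fdiag (dt' k v) p.+1 (td a (tu b u)) =
  cas (fun c c' => tu (trH (a * b * (incl c * s p.+2 p))) (td c' u)).
Proof.
rewrite /dt'; fe; apply: eq_cas => c c'.
by fe; rewrite lact_tu mulr1 !mulrA.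
Qed.

Lemma Fx_mate v m b (u : Fword v m.+1) : Fdiag (dx_mate k v) m (td b u) = td (x m.+1 m * b) u.
Proof. by rewrite /dx_mate; fe; rewrite !mul1r td_lact mul1r. Qed.

Lemma Fx_mate' v m b (u : Fword v m.+1) : Fdiag (dx_mate' k v) m (td b u) = td (x m.+1 m * b) u.
Proof.
rewrite /dx_mate'; fe; rewrite -[in RHS](casimir_r d_gt0 (_ * b)) -cas_tdl.
apply: eq_cas => c c'.
by fe; rewrite lact_td mulrA -trH_xC // mulrA.
Qed.

Lemma Fs_mate v m a b (u : Fword v m.+2) :
  Fdiag (ds_mate k v) m (td a (td b u)) = td 1 (td (s m.+2 m * incl a * b) u).
Proof.
rewrite /ds_mate; fe; rewrite !mul1r lact_td; fe.
by rewrite td_lact !incl1 !mul1r !mulrA.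
Qed.

(** The two left cups produce a double Casimir sum. [trH_trH_s] moves the crossing to the other side
    inside the iterated trace, and two uses of [casimir_r] collapse the sum. *)
Lemma Fs_mate' v m a b (u : Fword v m.+2) :
  Fdiag (ds_mate' k v) m (td a (td b u)) = td 1 (td (s m.+2 m * incl a * b) u).
Proof.
rewrite /ds_mate'; fe; rewrite -[in RHS](casimir_r d_gt0 (_ * b)) -cas_tdl td_cas.
apply: eq_cas => c c'.
fe; rewrite -lact_td td_lact mul1r -[in RHS](casimir_r d_gt0 (trH _)) -cas_tdl.
apply: eq_cas => e e'.
fe; rewrite lact_tu mulr1; fe; rewrite lact_td -trHl // -trHr //.
rewrite !mulrA trH_trH_s // !mulrA.
by [].
Qed.

Lemma tu2 w p a b (u : Fword w p) : tu a (tu b u) = tu (a * incl b) (tu 1 u).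
Proof. by rewrite (tu1 b) tu_lact. Qed.

Lemma Fdn_up j v m a b (u : Fword v m) :
  Fdiag (dcomp (dcomp (dcomp (dwhisk dn (dxn k j v)) (dcup k v)) (dcap' k v))
    (dwhisk dn (dxdual k lam j v))) m (td a (tu b u)) =
  td (incl (trH (a * b * yH m j)) * x m.+1 m ^+ j) (tu 1 u).
Proof.
fe; rewrite Fdxdual; fe; rewrite mul1r tu_lact tu1 td_lact mul1r mulrA.
by rewrite (commrX j (incl_x_comm _)).
Qed.

(** The zigzags with a left cup are [casimir_l] and [casimir_r], the splitting of Q_- Q_+ is
    [mackey], its counterpart for Q_+ Q_- is [trH_asbs] with [casimir_r], and the bubbles and the
    curl are values of the trace. *)
Lemma lrel_Feq a b (f g : diag k a b) : lrel lam f g -> Feq f g.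
Proof.
case=> {a b f g}
  [v|v|v|v|v|v|v|v|v|v|v|v|j v jd|v|v|v] m z.
- case: m z => [|m] z; first exact: (bhom_eq0 _ _ (up0_eq0 z)).
  elim/up_ind: z => [a u|y z Hy Hz]; last by exact: bhom_eqD.
  by fe; rewrite lact_tu !mulr1.
- case: m z => [|m] z; first exact: (bhom_eq0 _ _ (up0_eq0 z)).
  elim/up_ind: z => [a u|y z Hy Hz]; last by exact: bhom_eqD.
  fe; rewrite -[in RHS](casimir_l d_gt0 a) -cas_tul; apply: eq_cas => c c'.
  by fe; rewrite tu_lact.
- elim/dn_ind: z => [a u|y z Hy Hz]; last by exact: bhom_eqD.
  by fe; rewrite td_lact !mul1r.
- elim/dn_ind: z => [a u|y z Hy Hz]; last by exact: bhom_eqD.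
  fe; rewrite -[in RHS](casimir_r d_gt0 a) -cas_tdl; apply: eq_cas => c c'.
  by fe; rewrite lact_td.
- elim/dn_ind: z => [a u|y z Hy Hz]; last by exact: bhom_eqD.
  exact: etrans (Fx_mate _ _) (esym (Fx_mate' _ _)).
- elim/dn_ind: z => [a u|y z Hy Hz]; last by exact: bhom_eqD.
  elim/dn_ind: u => [b u|y z Hy Hz]; last by rewrite tdDr; exact: bhom_eqD.
  exact: etrans (Fs_mate _ _ _) (esym (Fs_mate' _ _ _)).
- case: m z => [|m] z; first exact: (bhom_eq0 _ _ (up0_eq0 z)).
  elim/up_ind: z => [a u|y z Hy Hz]; last by exact: bhom_eqD.
  case: m a u => [|m] a u; first by apply: bhom_eq0; rewrite (up0_eq0 u) tu0r.
  elim/up_ind: u => [b u|y z Hy Hz]; last by rewrite tuDr; exact: bhom_eqD.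
  have hrP := hecke_relP k lam m.+2.
  fe; rewrite incl1 mulr1 -[_ * s m.+2 m * s m.+2 m]mulrA (hr_ss hrP) // mulr1 -tu_lact.
  by rewrite lact_tu mulr1.
- case: m z => [|m] z; first exact: (bhom_eq0 _ _ (up0_eq0 z)).
  elim/up_ind: z => [a u|y z Hy Hz]; last by exact: bhom_eqD.
  case: m a u => [|m] a u; first by apply: bhom_eq0; rewrite (up0_eq0 u) tu0r.
  elim/up_ind: u => [b u|y z Hy Hz]; last by rewrite tuDr; exact: bhom_eqD.
  case: m a b u => [|m] a b u; first by apply: bhom_eq0; have -> : tu b u = 0; rewrite ?tu0r // (up0_eq0 u) tu0r.
  elim/up_ind: u => [c u|y z Hy Hz]; last by rewrite !tuDr; exact: bhom_eqD.
  have hrP := hecke_relP k lam m.+3.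
  fe; rewrite !mul1r; rewrite [X in _ = tu _ X]tu1 tu_lact; congr tu.
  rewrite !inclM !incl_s // -!mulrA; congr (_ * (_ * _)).
  rewrite (mulrA (s m.+3 m.+1)) -incl_s_comm -!mulrA; congr (_ * _).
  by rewrite !incl1 mul1r !mulrA (hr_braid hrP).
- case: m z => [|m] z; first exact: (bhom_eq0 _ _ (up0_eq0 z)).
  elim/up_ind: z => [a u|y z Hy Hz]; last by exact: bhom_eqD.
  case: m a u => [|m] a u; first by apply: bhom_eq0; rewrite (up0_eq0 u) tu0r.
  elim/up_ind: u => [b u|y z Hy Hz]; last by rewrite tuDr; exact: bhom_eqD.
  have hrP := hecke_relP k lam m.+2.
  fe; rewrite Fdiag_scale Fword_scalar; fe.
  rewrite mul1r [tu _ (tu (x _ _) _)]tu2 [RHS]tu2 lact_tu -tuDl rmorphN rmorph1 mulN1r; congr tu.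
  rewrite -(mulrA a) -incl_x_comm incl_x // -!mulrA -!mulrBr.
  by rewrite (hr_xs hrP) // addrC addKr mulr1.
- case: m z => [|m] z; first exact: (bhom_eq0 _ _ (up0_eq0 z)).
  elim/up_ind: z => [a u|y z Hy Hz]; last by exact: bhom_eqD.
  case: m a u => [|m] a u; first by apply: bhom_eq0; rewrite (up0_eq0 u) tu0r.
  elim/up_ind: u => [b u|y z Hy Hz]; last by rewrite tuDr; exact: bhom_eqD.
  have hrP := hecke_relP k lam m.+2.
  fe; rewrite Fdiag_scale Fword_scalar; fe.
  rewrite [RHS]tu2 lact_tu -tuDl rmorphN rmorph1 mulN1r; congr tu.
  rewrite inclM incl_x // -!mulrA -!mulrBr.
  by rewrite (hr_sx1 hrP) // addrC addKr mulr1.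
- elim/dn_ind: z => [a u|y z Hy Hz]; last by exact: bhom_eqD.
  case: m a u => [|m] a u.
    elim/up_ind: u => [b u|y z Hy Hz]; last by rewrite tdDr; exact: bhom_eqD.
    (* With leftmost label 0 the crossing factors through a word with a negative label, which is
       sent to zero; only the sum over j remains. *)
    fe; rewrite (up0_eq0 (Fdiag (dt' k v) 0 _)) bhom0 add0r Fdiag_bigD.
    under eq_bigr => j _ do rewrite Fdn_up.
    by rewrite -td_suml mackey0 // tu1 td_lact.
  elim/up_ind: u => [b u|y z Hy Hz]; last by rewrite tdDr; exact: bhom_eqD.
  fe; rewrite Fdt' Fdiag_bigD; fe.
  under eq_bigr => j _ do rewrite Fdn_up.
  rewrite -td_suml [LHS](_ : _ = td (a * b) (tu 1 u)); last by rewrite tu1 td_lact.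
  rewrite -[in LHS](mackey d_gt0 (a * b)) tdDl -cas_tdl; congr (_ + _); apply: eq_cas => c c'.
  by rewrite Fdt mulrA.
- case: m z => [|m] z; first exact: (bhom_eq0 _ _ (up0_eq0 z)).
  elim/up_ind: z => [a u|y z Hy Hz]; last by exact: bhom_eqD.
  elim/dn_ind: u => [b u|y z Hy Hz]; last by rewrite tuDr; exact: bhom_eqD.
  fe; rewrite Fdt Fdt'; fe; rewrite -[in RHS](casimir_r d_gt0 b) -cas_tdl tu_cas.
  apply: eq_cas => c c'.
  by rewrite mulr1 trH_asbs // -(lact_td (trH _)) tu_lact.
- by rewrite Fbubble Gm_lt // lact0l.
- by rewrite Fbubble -[d.-1]addn0 [trH _]Gm0 // lact1.
- rewrite Fbubble Fdiag_scale; fe; rewrite Fword_scalar -sum_croots -(Gm1 _ d_gt0) /Gm.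
  by congr (lact (trH (_ ^+ _)) _); lia.
case: m z => [|m] z; first exact: (bhom_eq0 _ _ (up0_eq0 z)).
elim/up_ind: z => [a u|y z Hy Hz]; last by exact: bhom_eqD.
fe; rewrite !mul1r -[incl a * _]mulr1 -(incl1 k lam m.+1) trH_s //.
by rewrite lact0l.
Qed.

Lemma interchange_Feq g a b (f : diag k a b) :
  Feq (dcomp (dgen k g b) (dwhiskw (gdom g) f)) (dcomp (dwhiskw (gcod g) f) (dgen k g a)).
Proof.
case: g => m z.
- change (Fdiag (dcomp (dx k b) (dwhisk up f)) m z = Fdiag (dcomp (dwhisk up f) (dx k a)) m z).
  case: m z => [|m] z; first exact: zero_bimod_eq.
  by elim/up_ind: z => [c u|y z Hy Hz]; [fe | exact: bhom_eqD].
- change (Fdiag (dcomp (ds k b) (dwhisk up (dwhisk up f))) m z =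
          Fdiag (dcomp (dwhisk up (dwhisk up f)) (ds k a)) m z).
  case: m z => [|m] z; first exact: zero_bimod_eq.
  elim/up_ind: z => [c u|y z Hy Hz]; last exact: bhom_eqD.
  case: m c u => [|m] c u; first by apply: bhom_eq0; rewrite (up0_eq0 u) tu0r.
  by elim/up_ind: u => [e u|y z Hy Hz]; [fe | rewrite tuDr; exact: bhom_eqD].
- change (Fdiag (dcomp (dcup k b) f) m z = Fdiag (dcomp (dwhisk dn (dwhisk up f)) (dcup k a)) m z).
  by fe.
- change (Fdiag (dcomp (dcap k b) (dwhisk up (dwhisk dn f))) m z = Fdiag (dcomp f (dcap k a)) m z).
  case: m z => [|m] z; first exact: (bhom_eq0 _ _ (up0_eq0 z)).
  elim/up_ind: z => [c u|y z Hy Hz]; last exact: bhom_eqD.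
  elim/dn_ind: u => [e u|y z Hy Hz]; last by rewrite tuDr; exact: bhom_eqD.
  by fe; rewrite bhom_lact.
- change (Fdiag (dcomp (dcup' k b) f) m z = Fdiag (dcomp (dwhisk up (dwhisk dn f)) (dcup' k a)) m z).
  case: m z => [|m] z; first exact: zero_bimod_eq.
  by fe; apply: eq_cas => c c'; fe.
change (Fdiag (dcomp (dcap' k b) (dwhisk dn (dwhisk up f))) m z = Fdiag (dcomp f (dcap' k a)) m z).
elim/dn_ind: z => [c u|y z Hy Hz]; last exact: bhom_eqD.
elim/up_ind: u => [e u|y z Hy Hz]; last by rewrite tdDr; exact: bhom_eqD.
by fe; rewrite bhom_lact.
Qed.

Lemma whisk_Feq e a b (f g : diag k a b) : Feq f g -> Feq (dwhisk e f) (dwhisk e g).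
Proof.
move=> fg; case: e => m z.
  case: m z => [|m] z; first exact: zero_bimod_eq.
  by elim/up_ind: z => [c u|y z Hy Hz]; [fe; rewrite fg | exact: bhom_eqD].
by elim/dn_ind: z => [c u|y z Hy Hz]; [fe; rewrite fg | exact: bhom_eqD].
Qed.

(** Well-definedness of the functor. Even computing values depends on it, since [Fwhom] evaluates
    whichever representative the quotient selects. *)
Lemma deq_Feq a b (f g : diag k a b) : deq lam f g -> Feq f g.
Proof.
elim=> {a b f g}.
- by move=> a b f g; apply: lrel_Feq.
- by [].
- by move=> a b f g _ fg m z; rewrite fg.
- by move=> a b f g h _ fg _ gh m z; rewrite fg.
- by move=> a b c g g' f f' _ gg _ ff m z; rewrite !Fdiag_comp ff gg.
- by move=> e a b f f' _ ff; apply: whisk_Feq.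
- by move=> a b f f' g g' _ ff _ gg m z; rewrite !Fdiag_add ff gg.
- by move=> a b c f f' _ ff m z; rewrite !Fdiag_scale ff.
- by [].
- by [].
- by [].
- by move=> a b f g h m z; rewrite !Fdiag_add addrA.
- by move=> a b f g m z; rewrite !Fdiag_add addrC.
- by move=> a b f m z; rewrite Fdiag_add add0r.
- move=> a b f m z; rewrite Fdiag_add Fdiag_scale rmorphN rmorph1.
  by rewrite Fdiag_zero ractNr ract1 addrN.
- by move=> a b f m z; rewrite Fdiag_scale rmorph1 ract1.
- by move=> a b c c' f m z; rewrite !Fdiag_scale -ractM -rmorphM mulrC.
- by move=> a b c c' f m z; rewrite Fdiag_add !Fdiag_scale rmorphD ractDr.
- by move=> a b c f g m z; rewrite !(Fdiag_add, Fdiag_scale) ractDl.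
- by [].
- by move=> a b c g f f' m z; rewrite !(Fdiag_comp, Fdiag_add) bhomD.
- by [].
- by move=> a b c z g f m u; rewrite !(Fdiag_comp, Fdiag_scale) bhom_ract.
- move=> [] a m z; last by elim/dn_ind: z => [c u|y z Hy Hz]; [fe | exact: bhom_eqD].
  case: m z => [|m] z; first exact: zero_bimod_eq.
  by elim/up_ind: z => [c u|y z Hy Hz]; [fe | exact: bhom_eqD].
- move=> [] a b c g f m z; last by elim/dn_ind: z => [e u|y z Hy Hz]; [fe | exact: bhom_eqD].
  case: m z => [|m] z; first exact: zero_bimod_eq.
  by elim/up_ind: z => [e u|y z Hy Hz]; [fe | exact: bhom_eqD].
- move=> [] a b f g m z; last by elim/dn_ind: z => [e u|y z Hy Hz]; [fe; rewrite -tdDr; fe | exact: bhom_eqD].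
  case: m z => [|m] z; first exact: zero_bimod_eq.
  by elim/up_ind: z => [e u|y z Hy Hz]; [fe; rewrite -tuDr; fe | exact: bhom_eqD].
- move=> [] a b c f m z; last first.
    elim/dn_ind: z => [e u|y z Hy Hz]; last exact: bhom_eqD.
    by rewrite Fdiag_scale; fe; rewrite Fdiag_scale ract_td.
  case: m z => [|m] z; first exact: zero_bimod_eq.
  elim/up_ind: z => [e u|y z Hy Hz]; last exact: bhom_eqD.
  by rewrite Fdiag_scale; fe; rewrite Fdiag_scale ract_tu.
- by move=> g a b f; apply: interchange_Feq.
Qed.

Lemma Fwhom_dclass a b (f : diag k a b) m u : Fwhom n (dclass lam f) m u = Fdiag f m u.
Proof. exact: (deq_Feq (repr_dclass lam f)). Qed.

End Soundness.

(** * The idempotent completion and adjunctions *)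

Section WhomCategory.
Variables (k : fieldType) (lam : weight).
Local Notation whom := (whom k lam).
Local Notation dclass := (dclass lam).

Lemma dclassD a b (f g : diag k a b) : dclass (dadd f g) = dclass f + dclass g.
Proof. exact/esym/whom_addE. Qed.

Lemma whom_compE a b c (g : diag k b c) (f : diag k a b) :
  whom_comp (dclass g) (dclass f) = dclass (dcomp g f).
Proof. by apply/dclass_eq/deq_comp; apply: repr_dclass. Qed.

Lemma whom_compA a b c e (h : whom c e) (g : whom b c) (f : whom a b) :
  whom_comp h (whom_comp g f) = whom_comp (whom_comp h g) f.
Proof.
rewrite -(dclass_repr h) -(dclass_repr g) -(dclass_repr f) !whom_compE.
exact/dclass_eq/deq_compA.
Qed.

Lemma whom_compDl a b c (g g' : whom b c) (f : whom a b) :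
  whom_comp (g + g') f = whom_comp g f + whom_comp g' f.
Proof.
rewrite -(dclass_repr g) -(dclass_repr g') -(dclass_repr f) -dclassD !whom_compE -dclassD.
exact/dclass_eq/deq_compDl.
Qed.

Lemma whom_compDr a b c (g : whom b c) (f f' : whom a b) :
  whom_comp g (f + f') = whom_comp g f + whom_comp g f'.
Proof.
rewrite -(dclass_repr g) -(dclass_repr f) -(dclass_repr f') -dclassD !whom_compE -dclassD.
exact/dclass_eq/deq_compDr.
Qed.

Lemma whom_comp_suml a b c (f : whom a b) r (G : 'I_r -> whom b c) :
  whom_comp (\sum_(i < r) G i) f = \sum_(i < r) whom_comp (G i) f.
Proof.
apply: (big_morph (fun g => whom_comp g f)) => [g g'|]; first exact: whom_compDl.
by apply: (addrI (whom_comp 0 f)); rewrite -whom_compDl !addr0.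
Qed.

Lemma whom_comp_sumr a b c (g : whom b c) r (F : 'I_r -> whom a b) :
  whom_comp g (\sum_(i < r) F i) = \sum_(i < r) whom_comp g (F i).
Proof.
apply: (big_morph (whom_comp g)) => [f f'|]; first exact: whom_compDr.
by apply: (addrI (whom_comp g 0)); rewrite -whom_compDr !addr0.
Qed.

Lemma hmor_ext X Y (f g : hmor k lam X Y) : (forall j i, f j i = g j i) -> f = g.
Proof.
by move=> fg; apply: functional_extensionality_dep => j; apply: functional_extensionality_dep => i.
Qed.

Lemma hcompA X Y Z W (h : hmor k lam Z W) (g : hmor k lam Y Z) (f : hmor k lam X Y) :
  hcomp h (hcomp g f) = hcomp (hcomp h g) f.
Proof.
apply: hmor_ext => l i; rewrite /hcomp.
under eq_bigr => j _ do rewrite whom_comp_sumr.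
under [in RHS]eq_bigr => j _ do rewrite whom_comp_suml.
rewrite exchange_big; apply: eq_bigr => j _; apply: eq_bigr => j' _; exact: whom_compA.
Qed.

End WhomCategory.

Section Karoubi.
Variables (k : fieldType) (lam : weight) (n : nat).
Local Notation d := (level lam).
Local Notation Fword := (Fword k lam n).
Local Notation Fdiag := (Fdiag lam n).
Hypothesis d_gt0 : (0 < d)%N.

Lemma FwhomD a b (f g : whom k lam a b) m u : Fwhom n (f + g) m u = Fwhom n f m u + Fwhom n g m u.
Proof. by rewrite -(dclass_repr f) -(dclass_repr g) -dclassD !Fwhom_dclass. Qed.

Lemma Fwhom_comp a b c (g : whom k lam b c) (f : whom k lam a b) m u :
  Fwhom n (whom_comp g f) m u = Fwhom n g m (Fwhom n f m u).
Proof. exact: Fwhom_dclass. Qed.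

Lemma Fwhom_sum a b r (F : 'I_r -> whom k lam a b) m u :
  Fwhom n (\sum_(i < r) F i) m u = \sum_(i < r) Fwhom n (F i) m u.
Proof.
apply: (big_morph (fun g => Fwhom n g m u)) => [g g'|]; first exact: FwhomD.
by apply: (addrI (Fwhom n 0 m u)); rewrite -FwhomD !addr0.
Qed.

Lemma Fhmor_comp X Y Z (g : hmor k lam Y Z) (f : hmor k lam X Y) m u :
  Fhmor n (hcomp g f) m u = Fhmor n g m (Fhmor n f m u).
Proof.
apply: functional_extensionality_dep => l /=; rewrite /hcomp.
under eq_bigr => i _ do rewrite Fwhom_sum.
rewrite exchange_big; apply: eq_bigr => j _; rewrite bhom_sum.
by apply: eq_bigr => i _; rewrite Fwhom_comp.
Qed.

Section Dsum.
Variables (A B : pzRingType) (r : nat) (M : 'I_r -> bimod A B).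

Definition dincl i (u : M i) : dsum M := dfwith (fun j => 0 : M j) u.

Lemma dinclE (u : dsum M) : u = \sum_(i < r) dincl (u i).
Proof.
apply: functional_extensionality_dep => j.
have sumE (I : Type) (s : seq I) (F : I -> dsum M) : (\sum_(i <- s) F i) j = \sum_(i <- s) F i j.
  by apply: (big_morph (fun v : dsum M => v j)).
rewrite sumE (bigD1 j) //= /dincl dfwith_in big1 ?addr0 // => i ij.
by rewrite dfwith_out.
Qed.

Lemma dincl_llin i (u v : M i) : dincl (u + v) = dincl u + dincl v.
Proof.
apply: functional_extensionality_dep => j; rewrite /dincl -[RHS]/(dfwith _ u j + dfwith _ v j).
case: (eqVneq i j) => [ij|ij]; first by subst j; rewrite !dfwith_in.
by rewrite !dfwith_out // addr0.
Qed.

Lemma dincl_lact i a (u : M i) : dincl (lact a u) = lact a (dincl u).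
Proof.
apply: functional_extensionality_dep => j; rewrite /dincl -[RHS]/(lact a (dfwith _ u j)).
case: (eqVneq i j) => [ij|ij]; first by subst j; rewrite !dfwith_in.
by rewrite !dfwith_out // lact0.
Qed.

Lemma dincl_ract i b (u : M i) : dincl (ract u b) = ract (dincl u) b.
Proof.
apply: functional_extensionality_dep => j; rewrite /dincl -[RHS]/(ract (dfwith _ u j) b).
case: (eqVneq i j) => [ij|ij]; first by subst j; rewrite !dfwith_in.
by rewrite !dfwith_out // ract0.
Qed.

End Dsum.

Definition Full a b := forall Phi : bmor (Fword a) (Fword b),
  exists f : diag k a b, forall m u, Fdiag f m u = Phi m u.

Hypothesis full : forall a b, Full a b.

Lemma full_hmor X Y (Phi : bmor (Fhobj k lam n X) (Fhobj k lam n Y)) :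
  exists g : hmor k lam X Y, forall m u, Fhmor n g m u = Phi m u.
Proof.
pose Psi j i : bmor (Fword (hword X i)) (Fword (hword Y j)) := fun m =>
  @Bhom _ _ (Fword (hword X i) m) (Fword (hword Y j) m)
   (fun u => Phi m (@dincl _ _ _ (fun i => Fword (hword X i) m) i u) j)
   (fun u u' => etrans (congr1 (fun v => Phi m v j) (dincl_llin u u')) (congr1 (fun v : Fhobj k lam n Y m => v j) (bhomD (Phi m) _ _)))
   (fun a u => etrans (congr1 (fun v => Phi m v j) (dincl_lact a u)) (congr1 (fun v : Fhobj k lam n Y m => v j) (bhom_lact (Phi m) _ _)))
   (fun u b => etrans (congr1 (fun v => Phi m v j) (dincl_ract b u)) (congr1 (fun v : Fhobj k lam n Y m => v j) (bhom_ract (Phi m) _ _))).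
exists (fun j i => dclass lam (sval (cid (full (Psi j i))))) => m u.
apply: functional_extensionality_dep => j /=.
rewrite [in RHS](dinclE u) bhom_sum.
have sumE (I : Type) (s : seq I) (F : I -> Fhobj k lam n Y m) : (\sum_(i <- s) F i) j = \sum_(i <- s) F i j.
  by apply: (big_morph (fun v : Fhobj k lam n Y m => v j)).
rewrite sumE; apply: eq_bigr => i _; rewrite Fwhom_dclass //.
by case: cid => f /= ->.
Qed.

(** A preimage g of the map extended by zero is replaced by e_Y g e_X, which is a morphism of the
    idempotent completion. This changes nothing on the images, since idempotents fix their images
    pointwise. *)
Lemma full_karoubi (X Y : kobj k lam) (phi : bmor (Fobj n X) (Fobj n Y)) :
  exists f : kmor X Y, Fmor n f = phi.
Proof.
pose eX := kidem X; pose eY := kidem Y.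
pose Phi : bmor (Fhobj k lam n (kbase X)) (Fhobj k lam n (kbase Y)) := fun m =>
  bcomp (im_incl (Fhmor n eY m)) (bcomp (phi m) (im_proj (Fhmor n eX m))).
have [g gP] := full_hmor Phi.
have fP : hcomp eY (hcomp (hcomp eY (hcomp g eX)) eX) = hcomp eY (hcomp g eX).
  by rewrite -!hcompA (kidemP X) hcompA (kidemP Y).
exists (KMor fP); apply: functional_extensionality_dep => m; apply: bhom_ext => u.
have idX (v : Fobj n X m) : Fhmor n eX m (im_val v) = im_val v.
  by case: v => v vP; have /asboolP[w wv] := vP; rewrite -[im_val _]/v -wv -Fhmor_comp (kidemP X).
have idY (v : Fobj n Y m) : Fhmor n eY m (im_val v) = im_val v.
  by case: v => v vP; have /asboolP[w wv] := vP; rewrite -[im_val _]/v -wv -Fhmor_comp (kidemP Y).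
apply: val_inj; rewrite -[LHS]/(Fhmor n eY m (Fhmor n (hcomp eY (hcomp g eX)) m (im_val u))).
rewrite !Fhmor_comp idX gP /Phi.
rewrite -[in LHS]/(Fhmor n eY m (Fhmor n eY m (im_val (phi m (im_proj (Fhmor n eX m) (im_val u)))))).
rewrite !idY; congr (im_val (phi m _)); apply: val_inj; exact: idX.
Qed.

End Karoubi.

Section Adjunction.
Variables (k : fieldType) (lam : weight) (n : nat).
Local Notation d := (level lam).
Local Notation H := (hecke k lam).
Local Notation Fword := (Fword k lam n).
Local Notation Fdiag := (Fdiag lam n).
Local Notation Full := (@Full k lam n).
Hypothesis d_gt0 : (0 < d)%N.

(** The first letter of the source is bent to the target. Out of Q_+ a, a homomorphism is recovered
    because its value on c (x) u is c times that on 1 (x) u; out of Q_- a, because c is the sum of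
    tr(c b) b' over the dual bases. *)
Lemma full_adjunction : (forall b, Full [::] b) -> forall a b, Full a b.
Proof.
move=> full0; elim=> [//|[] a IHa] b Phi.
  pose Psi : bmor (Fword a) (Fword (dn :: b)) := fun m =>
    bcomp (Fwhisk dn Phi m) (Fdiag (dcup k a) m).
  have [f fP] := IHa _ Psi.
  exists (dcomp (dcap k b) (dwhisk up f)) => m u.
  case: m u => [|m] u; first exact: (bhom_eq0 _ _ (up0_eq0 u)).
  elim/up_ind: u => [c u|y z Hy Hz]; last exact: bhom_eqD.
  rewrite Fdiag_comp Fdiag_up fP -[Psi m u]/(Fwhisk dn Phi m (Fdiag (dcup k a) m u)).
  by rewrite Fdiag_cup Fwhisk_dn Fdiag_cap mulr1 -bhom_lact -tu1.
pose Psi : bmor (Fword a) (Fword (up :: b)) := fun m =>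
  bcomp (Fwhisk up Phi m) (Fdiag (dcup' k a) m).
have [f fP] := IHa _ Psi.
exists (dcomp (dcap' k b) (dwhisk dn f)) => m u.
elim/dn_ind: u => [c u|y z Hy Hz]; last exact: bhom_eqD.
rewrite Fdiag_comp Fdiag_dn fP -[Psi m.+1 u]/(Fwhisk up Phi m.+1 (Fdiag (dcup' k a) m.+1 u)).
rewrite Fdiag_cup' // bhom_cas td_cas bhom_cas -[in RHS](casimir_r d_gt0 c) -cas_tdl bhom_cas.
by apply: eq_cas => e e'; rewrite Fwhisk_up Fdiag_cap' // -bhom_lact lact_td.
Qed.

End Adjunction.

(** * Rotation of diagrams *)

Section UnitWord.
Variables (k : fieldType) (lam : weight).
Local Notation H := (hecke k lam).
Local Notation Unit := (unit_bobj k lam).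

(** The unit family is defined by matching on [m =P n]. For m = n, [uout] and [uin] identify its
    component with H_n, and otherwise they are zero, so that transports do not leak into later
    arguments. *)
Definition uout n m : Unit n m -> H m :=
  match m =P n as r return
    bcar (match r with
          | ReflectT e => eq_rect m (fun q => bimod (H m) (H q)) (reg k lam m) n e
          | ReflectF _ => zero_bimod (H m) (H n)
          end) -> H m with
  | ReflectT e =>
      match e as e' in _ = q return
        bcar (eq_rect m (fun q => bimod (H m) (H q)) (reg k lam m) q e') -> H m with
      | erefl => id
      end
  | ReflectF _ => fun _ => 0
  end.

Definition uin n m (a : H m) : Unit n m :=
  match m =P n as r return
    bcar (match r with
          | ReflectT e => eq_rect m (fun q => bimod (H m) (H q)) (reg k lam m) n e
          | ReflectF _ => zero_bimod (H m) (H n)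
          end) with
  | ReflectT e =>
      match e as e' in _ = q return
        bcar (eq_rect m (fun q => bimod (H m) (H q)) (reg k lam m) q e') with
      | erefl => a
      end
  | ReflectF _ => 0
  end.

Lemma uoutK n m (z : Unit n m) : uin n (uout z) = z.
Proof.
move: z; rewrite /uin /uout /unit_bobj; case: (m =P n) => [e|ne] z; last exact: zero_bimod_eq.
by case: _ / e z.
Qed.

Lemma uinK n (a : H n) : uout (uin n a) = a.
Proof.
rewrite /uin /uout; case: (n =P n) => [e|//].
by rewrite (eq_irrelevance e erefl).
Qed.

Lemma uinD n m (a b : H m) : uin n (a + b) = uin n a + uin n b.
Proof.
rewrite /uin /unit_bobj; case: (m =P n) => [e|ne]; last exact: zero_bimod_eq.
by case: _ / e.
Qed.

Lemma uin_lact n m (a b : H m) : uin n (a * b) = lact a (uin n b).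
Proof.
rewrite /uin /unit_bobj; case: (m =P n) => [e|ne]; last exact: zero_bimod_eq.
by case: _ / e.
Qed.

Lemma uin_ract n (a b : H n) : ract (uin n a) b = uin n (a * b).
Proof.
rewrite /uin /unit_bobj; case: (n =P n) => [e|//].
by rewrite (eq_irrelevance e erefl).
Qed.

Lemma unit_eq0 n m (z : Unit n m) : m <> n -> z = 0.
Proof.
by move: z; rewrite /unit_bobj; case: (m =P n) => [e|ne] z // _; apply: zero_bimod_eq.
Qed.

Lemma uoutD n m (y z : Unit n m) : uout (y + z) = uout y + uout z.
Proof.
move: y z; rewrite /uout /unit_bobj; case: (m =P n) => [e|ne] y z; last by rewrite addr0.
by case: _ / e y z.
Qed.

Lemma uout_lact n m a (z : Unit n m) : uout (lact a z) = a * uout z.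
Proof.
move: z; rewrite /uout /unit_bobj; case: (m =P n) => [e|ne] z; last by rewrite mulr0.
by case: _ / e z.
Qed.

Lemma unitE n m (z : Unit n m) : z = lact (uout z) (uin n 1).
Proof. by rewrite -uin_lact mulr1 uoutK. Qed.

End UnitWord.

Section LeftLinear.

(** The rotation changes the right algebra from H_n to H_{n+1}, so its maps are linear on the left
    only and cannot be [bhom]s. *)
Definition llin (A B C : pzRingType) (M : bimod A B) (N : bimod A C) (f : M -> N) :=
  (forall u v, f (u + v) = f u + f v) /\ (forall a u, f (lact a u) = lact a (f u)).

Definition ltens (A B C D : pzRingType) (M : bimod A B) (N : bimod B C) (N' : bimod B D)
  (f : N -> N') : tens M N -> tens M N' := tlift (fun a u => ptens a (f u)).

Variables (A B C D : pzRingType) (M : bimod A B) (N : bimod B C) (N' : bimod B D) (f : N -> N').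
Hypothesis fL : llin f.

Lemma ltensE a u : ltens f (ptens a u : tens M N) = ptens a (f u).
Proof.
apply: tlift_pure => [a1 a2 v|a1 v v'|a1 b v]; first exact: ptensDl.
  by rewrite (proj1 fL) ptensDr.
by rewrite (proj2 fL) ptens_bal.
Qed.

Lemma ltens_llin : llin (ltens f : tens M N -> tens M N').
Proof.
have fD u v : ltens f (u + v : tens M N) = ltens f u + ltens f v.
  apply: tliftD => [a1 a2 w|a1 w w'|a1 b w]; first exact: ptensDl.
    by rewrite (proj1 fL) ptensDr.
  by rewrite (proj2 fL) ptens_bal.
split=> // a z; elim/tens_add_ind: z => [b u|y z Hy Hz]; last by rewrite lactDr !fD lactDr Hy Hz.
by rewrite lact_ptens !ltensE lact_ptens.
Qed.

Lemma llin0 (g : N -> N') : llin g -> g 0 = 0.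
Proof. by case=> gD _; apply: (addrI (g 0)); rewrite -gD !addr0. Qed.

End LeftLinear.

Section Rotation.
Variables (k : fieldType) (lam : weight) (n : nat).
Local Notation d := (level lam).
Local Notation H := (hecke k lam).
Local Notation Fw := (Fword k lam n).
Local Notation Fw1 := (Fword k lam n.+1).
Hypothesis d_gt0 : (0 < d)%N.

(* Fw1 (w ++ [:: dn]) m is the tensor product of Fw w m with H_(n+1) over H_n:
   Phi h is u |-> u (x) h, and Theta is id (x) tr. *)
Definition Phi0 (h : H n.+1) m (z : Fw [::] m) : Fw1 [:: dn] m :=
  td (incl (uout z) * emb m.+1 h) (uin n.+1 1 : Fw1 [::] m.+1).

Fixpoint Phi (h : H n.+1) w : forall m, Fw w m -> Fw1 (w ++ [:: dn]) m :=
  match w return forall m, Fw w m -> Fw1 (w ++ [:: dn]) m with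
  | [::] => Phi0 h
  | up :: v => fun m => match m return Fw (up :: v) m -> Fw1 (up :: (v ++ [:: dn])) m with
                        | 0 => fun=> 0
                        | p.+1 => ltens (@Phi h v p)
                        end
  | dn :: v => fun m => ltens (@Phi h v m.+1)
  end.

Definition Theta0 m : Fw1 [:: dn] m -> Fw [::] m :=
  tlift (fun (a : res k lam m) (z : Fw1 [::] m.+1) => uin n (trH ((a : H m.+1) * uout z)) : Fw [::] m).

Fixpoint Theta w : forall m, Fw1 (w ++ [:: dn]) m -> Fw w m :=
  match w return forall m, Fw1 (w ++ [:: dn]) m -> Fw w m with
  | [::] => Theta0
  | up :: v => fun m => match m return Fw1 (up :: (v ++ [:: dn])) m -> Fw (up :: v) m with
                        | 0 => fun=> 0
                        | p.+1 => ltens (@Theta v p)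
                        end
  | dn :: v => fun m => ltens (@Theta v m.+1)
  end.

Lemma Phi_llin h w m : llin (@Phi h w m).
Proof.
elim: w m => [|[] w IHw] m; last exact: ltens_llin.
  split=> [u v|a u]; first by rewrite /= /Phi0 uoutD inclD mulrDl tdDl.
  rewrite -[LHS]/(Phi0 h (lact a u)) -[RHS]/(lact a (Phi0 h u)) /Phi0.
  by rewrite uout_lact inclM -mulrA lact_td.
case: m => [|m]; last exact: ltens_llin.
by split=> *; apply: zero_bimod_eq.
Qed.

Lemma Phi_tu h w p a (u : Fw w p) : Phi h (tu a u) = tu a (Phi h u).
Proof. exact: (ltensE (Phi_llin h w p)). Qed.

Lemma Phi_td h w m a (u : Fw w m.+1) : Phi h (td a u) = td a (Phi h u).
Proof. exact: (ltensE (Phi_llin h w m.+1)). Qed.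

Lemma PhiD h w m (u v : Fw w m) : Phi h (u + v) = Phi h u + Phi h v.
Proof. exact: (proj1 (Phi_llin h w m)). Qed.

Lemma Phi_lact h w m a (u : Fw w m) : Phi h (lact a u) = lact a (Phi h u).
Proof. exact: (proj2 (Phi_llin h w m)). Qed.

Lemma Theta0_td m (a : H m.+1) z : Theta0 (td a z) = uin n (trH (a * uout z)).
Proof.
apply: (@tlift_pure _ _ _ (res k lam m) (Fw1 [::] m.+1)) => [a1 a2 u|a1 u v|a1 b u].
- by rewrite mulrDl trHD // uinD.
- by rewrite uoutD mulrDr trHD // uinD.
- by rewrite uout_lact mulrA.
Qed.

Lemma Theta0D m (y z : Fw1 [:: dn] m) : Theta0 (y + z) = Theta0 y + Theta0 z.
Proof.
apply: (@tliftD _ _ _ (res k lam m) (Fw1 [::] m.+1)) => [a1 a2 u|a1 u v|a1 b u].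
- by rewrite mulrDl trHD // uinD.
- by rewrite uoutD mulrDr trHD // uinD.
- by rewrite uout_lact mulrA.
Qed.

Lemma Theta_llin w m : llin (@Theta w m).
Proof.
elim: w m => [|[] w IHw] m; last exact: ltens_llin.
  split=> [u v|a u]; first exact: Theta0D.
  rewrite -[Theta _]/(Theta0 _) -[Theta u]/(Theta0 u).
  elim/dn_ind: u => [b u|y z Hy Hz]; last by rewrite lactDr !Theta0D lactDr Hy Hz.
  by rewrite lact_td !Theta0_td -mulrA trHl // uin_lact.
case: m => [|m]; last exact: ltens_llin.
by split=> *; apply: zero_bimod_eq.
Qed.

Lemma Theta_tu w p a (u : Fw1 (w ++ [:: dn]) p) : @Theta (up :: w) p.+1 (tu a u) = tu a (Theta u).
Proof. exact: (ltensE (Theta_llin w p)). Qed.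

Lemma Theta_td w m a (u : Fw1 (w ++ [:: dn]) m.+1) : @Theta (dn :: w) m (td a u) = td a (Theta u).
Proof. exact: (ltensE (Theta_llin w m.+1)). Qed.

Lemma ThetaD w m (u v : Fw1 (w ++ [:: dn]) m) : Theta (u + v) = Theta u + Theta v.
Proof. exact: (proj1 (Theta_llin w m)). Qed.

Lemma Theta_lact w m a (u : Fw1 (w ++ [:: dn]) m) : Theta (lact a u) = lact a (Theta u).
Proof. exact: (proj2 (Theta_llin w m)). Qed.

Lemma Theta_ract w m b (u : Fw1 (w ++ [:: dn]) m) : Theta (ract u (incl b)) = ract (Theta u) b.
Proof.
elim: w m u => [|[] w IHw] m u.
- case: (eqVneq m n) => [e|ne]; last first.
    have Z (z : Fw [::] m) : z = 0 by apply: unit_eq0; apply/eqP.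
    by rewrite (Z (Theta _)) [RHS]Z.
  subst m; elim/dn_ind: u => [a z|y z Hy Hz]; last by rewrite ractDl !ThetaD ractDl Hy Hz.
  rewrite ract_td -![Theta _]/(Theta0 _) !Theta0_td uin_ract.
  by rewrite -{1}(uoutK z) uin_ract uinK mulrA trHr.
- case: m u => [|m] u; first exact: zero_bimod_eq.
  elim/up_ind: u => [a z|y z Hy Hz]; last by rewrite ractDl !ThetaD ractDl Hy Hz.
  by rewrite ract_tu !Theta_tu ract_tu IHw.
- elim/dn_ind: u => [a z|y z Hy Hz]; last by rewrite ractDl !ThetaD ractDl Hy Hz.
  by rewrite ract_td !Theta_td ract_td IHw.
Qed.

(** This is [casimir_r] in the last tensor factor. *)
Lemma Phi_Theta w m (u : Fw1 (w ++ [:: dn]) m) :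
  cas (fun a b => Phi b (Theta (ract u a))) = u.
Proof.
elim: w m u => [|[] w IHw] m u.
- elim/dn_ind: u => [a z|y z Hy Hz]; last first.
    by rewrite -[in RHS]Hy -[in RHS]Hz -casD; apply: eq_cas => e e'; rewrite ractDl ThetaD PhiD.
  case: (eqVneq m n) => [e|/eqP ne]; last first.
    have -> : z = 0 by apply: unit_eq0 => -[].
    by rewrite td0r cas_eq0 // => e e'; rewrite ract0 (llin0 (Theta_llin _ _)) (llin0 (Phi_llin _ _ _)).
  subst m; have -> : td a z = td (a * uout z) (uin n.+1 1 : Fw1 [::] n.+1).
    by rewrite {1}(unitE z) td_lact.
  rewrite -[in RHS](casimir_r d_gt0 (a * uout z)) -cas_tdl; apply: eq_cas => e e'.
  rewrite ract_td uin_ract mul1r -[Theta _]/(Theta0 _) Theta0_td uinK.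
  by rewrite -[Phi _ _]/(Phi0 _ _) /Phi0 uinK emb_id.
- case: m u => [|m] u; first exact: zero_bimod_eq.
  elim/up_ind: u => [a z|y z Hy Hz]; last first.
    by rewrite -[in RHS]Hy -[in RHS]Hz -casD; apply: eq_cas => e e'; rewrite ractDl ThetaD PhiD.
  rewrite -[in RHS](IHw m z) tu_cas; apply: eq_cas => e e'.
  by rewrite ract_tu Theta_tu Phi_tu.
- elim/dn_ind: u => [a z|y z Hy Hz]; last first.
    by rewrite -[in RHS]Hy -[in RHS]Hz -casD; apply: eq_cas => e e'; rewrite ractDl ThetaD PhiD.
  rewrite -[in RHS](IHw m.+1 z) td_cas; apply: eq_cas => e e'.
  by rewrite ract_td Theta_td Phi_td.
Qed.

Definition dapp_gen g v :
    diag k ((gdom g ++ v) ++ [:: dn]) ((gcod g ++ v) ++ [:: dn]) :=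
  match g return diag k ((gdom g ++ v) ++ [:: dn]) ((gcod g ++ v) ++ [:: dn]) with
  | Gx => dx k (v ++ [:: dn]) | Gs => ds k (v ++ [:: dn])
  | Gcup => dcup k (v ++ [:: dn]) | Gcap => dcap k (v ++ [:: dn])
  | Gcup' => dcup' k (v ++ [:: dn]) | Gcap' => dcap' k (v ++ [:: dn])
  end.

(** Adds an identity strand Q_- on the right. Tensoring on the right is not a constructor of [diag],
    but every generator carries the word to its right, and this word is extended. *)
Fixpoint dapp a b (f : diag k a b) : diag k (a ++ [:: dn]) (b ++ [:: dn]) :=
  match f in diag _ a b return diag k (a ++ [:: dn]) (b ++ [:: dn]) with
  | did a => did k _
  | dcomp _ _ _ g f => dcomp (dapp g) (dapp f)
  | dwhisk e _ _ f => dwhisk e (dapp f)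
  | dgen g v => dapp_gen g v
  | dzero _ _ => dzero k _ _
  | dadd _ _ f g => dadd (dapp f) (dapp g)
  | dscale _ _ c f => dscale c (dapp f)
  end.

Local Notation F1 := (Fdiag lam n.+1).
Local Notation F0 := (Fdiag lam n).

Lemma Phi_cas h w m p (G : H p.+1 -> H p.+1 -> Fw w m) :
  Phi h (cas G) = cas (fun a b => Phi h (G a b)).
Proof. by apply: cas_morph; [apply: llin0; apply: Phi_llin | move=> y z; apply: PhiD]. Qed.

Lemma dapp_gen_nat h g v m (u : Fw (gdom g ++ v) m) :
  F1 (dapp_gen g v) m (Phi h u) = Phi h (F0 (dgen k g v) m u).
Proof.
case: g m u => m u.
- change (F1 (dx k (v ++ [:: dn])) m (Phi h (u : Fw (up :: v) m)) = Phi h (F0 (dx k v) m u)).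
  case: m u => [|m] u; first exact: zero_bimod_eq.
  elim/up_ind: u => [a z|y z Hy Hz]; last by rewrite PhiD !bhomD PhiD Hy Hz.
  by rewrite Phi_tu !Fdiag_x Phi_tu.
- change (F1 (ds k (v ++ [:: dn])) m (Phi h (u : Fw (up :: up :: v) m)) = Phi h (F0 (ds k v) m u)).
  case: m u => [|m] u; first exact: zero_bimod_eq.
  elim/up_ind: u => [a u|y z Hy Hz]; last by rewrite PhiD !bhomD PhiD Hy Hz.
  case: m a u => [|m] a u.
    have -> : tu a u = 0 by rewrite (up0_eq0 u) tu0r.
    by rewrite bhom0 !(llin0 (Phi_llin _ _ _)) bhom0.
  elim/up_ind: u => [b u|y z Hy Hz]; last by rewrite tuDr PhiD !bhomD PhiD Hy Hz.
  by rewrite !Phi_tu !Fdiag_s !Phi_tu.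
- change (F1 (dcup k (v ++ [:: dn])) m (Phi h (u : Fw v m)) = Phi h (F0 (dcup k v) m u)).
  by rewrite !Fdiag_cup Phi_td Phi_tu.
- change (F1 (dcap k (v ++ [:: dn])) m (Phi h (u : Fw (up :: dn :: v) m)) = Phi h (F0 (dcap k v) m u)).
  case: m u => [|m] u.
    by rewrite (up0_eq0 u) bhom0 !(llin0 (Phi_llin _ _ _)).
  elim/up_ind: u => [a u|y z Hy Hz]; last by rewrite PhiD !bhomD PhiD Hy Hz.
  elim/dn_ind: u => [b u|y z Hy Hz]; last by rewrite tuDr PhiD !bhomD PhiD Hy Hz.
  by rewrite Phi_tu Phi_td !Fdiag_cap Phi_lact.
- change (F1 (dcup' k (v ++ [:: dn])) m (Phi h (u : Fw v m)) = Phi h (F0 (dcup' k v) m u)).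
  case: m u => [|m] u; first exact: zero_bimod_eq.
  rewrite !Fdiag_cup' // Phi_cas; apply: eq_cas => a b.
  by rewrite Phi_tu Phi_td.
- change (F1 (dcap' k (v ++ [:: dn])) m (Phi h (u : Fw (dn :: up :: v) m)) = Phi h (F0 (dcap' k v) m u)).
  elim/dn_ind: u => [a u|y z Hy Hz]; last by rewrite PhiD !bhomD PhiD Hy Hz.
  elim/up_ind: u => [b u|y z Hy Hz]; last by rewrite tdDr PhiD !bhomD PhiD Hy Hz.
  by rewrite Phi_td Phi_tu !Fdiag_cap' // Phi_lact.
Qed.

Lemma dapp_nat h a b (f : diag k a b) m (u : Fw a m) :
  F1 (dapp f) m (Phi h u) = Phi h (F0 f m u).
Proof.
elim: f m u => {a b} [a|a b c g IHg f IHf|e a b f IHf|g v|a b|a b f IHf g IHg|a b c f IHf] m u.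
- by [].
- by rewrite -[dapp _]/(dcomp (dapp g) (dapp f)) !Fdiag_comp IHf IHg.
- case: e u => u; last first.
    elim/dn_ind: u => [c u|y z Hy Hz]; last by rewrite PhiD !bhomD PhiD Hy Hz.
    by rewrite Fdiag_dn !Phi_td -IHf -Fdiag_dn.
  case: m u => [|m] u; first exact: zero_bimod_eq.
  elim/up_ind: u => [c u|y z Hy Hz]; last by rewrite PhiD !bhomD PhiD Hy Hz.
  by rewrite Fdiag_up !Phi_tu -IHf -Fdiag_up.
- exact: dapp_gen_nat.
- by rewrite Fdiag_zero (llin0 (Phi_llin _ _ _)).
- by rewrite -[dapp _]/(dadd (dapp f) (dapp g)) !Fdiag_add IHf IHg PhiD.
- by rewrite -[dapp _]/(dscale c (dapp f)) !Fdiag_scale !Fword_scalar // IHf Phi_lact.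
Qed.

End Rotation.

Section Invariants.
Variables (k : fieldType) (lam : weight).
Local Notation d := (level lam).
Local Notation H := (hecke k lam).
Local Notation Fword := (Fword k lam).
Local Notation Fdiag := (Fdiag lam).
Hypothesis d_gt0 : (0 < d)%N.

Definition inv n w (u : Fword n w n) := forall a, lact a u = ract u a.

Definition Full0 n w := forall u : Fword n w n, inv u ->
  exists f : diag k [::] w, Fdiag n f n (uin n 1 : Fword n [::] n) = u.

Lemma Full0_Full n : (forall w, Full0 n w) -> forall b, @Full k lam n [::] b.
Proof.
move=> full b Phi.
have [|f fP] := full b (Phi n (uin n 1 : Fword n [::] n)).
  by move=> a; rewrite -bhom_lact -bhom_ract uin_ract -uin_lact mulr1 mul1r.
exists f => m u; case: (eqVneq m n) => [e|/eqP ne]; last first.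
  by apply: bhom_eq0; apply: unit_eq0.
by subst m; rewrite (unitE u) !bhom_lact fP.
Qed.

(** An invariant u of w Q_- over H_{n+1} gives the invariant 1 (x) Theta(u) of Q_- w over H_n,
    represented by some f. A left cup creates Q_+ Q_-, f is inserted between these strands, and a
    right cap joins Q_+ to the first strand of f; by [Phi_Theta] the result is u. *)
Lemma rotation n w : Full0 n (dn :: w) -> Full0 n.+1 (w ++ [:: dn]).
Proof.
move=> full u uI.
have [|f fP] := full (td 1 (Theta u)).
  move=> b; rewrite lact_td mulr1 -[incl b]mul1r -td_lact -Theta_lact //.
  by rewrite uI Theta_ract // ract_td.
exists (dcomp (dcap k (w ++ [:: dn])) (dcomp (dwhisk up (dapp f)) (dcup' k [::]))).
rewrite !Fdiag_comp Fdiag_cup' // !bhom_cas -[in RHS](Phi_Theta d_gt0 u).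
apply: eq_cas => a b.
have -> : td b (uin n.+1 1 : Fword n.+1 [::] n.+1) = Phi b (uin n 1 : Fword n [::] n).
  by rewrite /= /Phi0 uinK incl1 mul1r emb_id.
rewrite Fdiag_up (dapp_nat d_gt0 b f (uin n 1 : Fword n [::] n)) fP Phi_td.
rewrite [LHS](Fdiag_cap a 1 (Phi b (Theta u))) mulr1 -Phi_lact -Theta_lact //.
by rewrite uI.
Qed.

End Invariants.

(** * Reduction of fullness to the center *)

Section Reduction.
Variables (k : fieldType) (lam : weight).
Local Notation d := (level lam).
Local Notation H := (hecke k lam).
Local Notation x := (xH k lam).
Local Notation Fword := (Fword k lam).
Local Notation Fdiag := (Fdiag lam).
Local Notation Full0 := (@Full0 k lam).
Hypothesis d_gt0 : (0 < d)%N.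

Inductive balg n : H n -> Prop :=
| balg_const c : balg (cH lam n c)
| balg_bubble j : balg (trH (x n.+1 n ^+ j))
| balg_add y z : balg y -> balg z -> balg (y + z)
| balg_mul y z : balg y -> balg z -> balg (y * z).

Section Whisker.
Variable n : nat.

Lemma dwhiskw_comp v a b c (g : diag k b c) (f : diag k a b) m u :
  Fdiag n (dwhiskw v (dcomp g f)) m u = Fdiag n (dwhiskw v g) m (Fdiag n (dwhiskw v f) m u).
Proof.
rewrite -Fdiag_comp; move: m u; apply: (deq_Feq d_gt0 (n := n)).
elim: v => [|e v IHv]; first exact: deq_refl.
exact: (deq_trans (deq_whisk e IHv) (deq_whiskM lam e _ _)).
Qed.

Lemma dwhiskw_id v a m u : Fdiag n (dwhiskw v (did k a)) m u = u.
Proof.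
rewrite -[RHS](Fdiag_id (k := k)); move: m u; apply: (deq_Feq d_gt0 (n := n)).
elim: v => [|e v IHv]; first exact: deq_refl.
exact: (deq_trans (deq_whisk e IHv) (@deq_whisk1 k lam e (v ++ a))).
Qed.

Lemma dwhiskw_add v a b (f g : diag k a b) m u :
  Fdiag n (dwhiskw v (dadd f g)) m u = Fdiag n (dwhiskw v f) m u + Fdiag n (dwhiskw v g) m u.
Proof.
rewrite -Fdiag_add; move: m u; apply: (deq_Feq d_gt0 (n := n)).
elim: v => [|e v IHv]; first exact: deq_refl.
exact: (deq_trans (deq_whisk e IHv) (deq_whiskD lam e _ _)).
Qed.

Lemma dwhiskw_Feq v a b (f g : diag k a b) : @Feq k lam n a b f g ->
  @Feq k lam n _ _ (dwhiskw v f) (dwhiskw v g).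
Proof. by move=> fg; elim: v => [|e v IHv] //; apply: whisk_Feq. Qed.

Lemma dwhiskw_zero v a b m u : Fdiag n (dwhiskw v (dzero k a b)) m u = 0.
Proof.
apply: (addrI (Fdiag n (dwhiskw v (dzero k a b)) m u)); rewrite -dwhiskw_add addr0.
by apply: dwhiskw_Feq => m' u'; rewrite Fdiag_add Fdiag_zero addr0.
Qed.

Lemma dwhiskw_sum v a b (I : Type) (r : seq I) (F : I -> diag k a b) m u :
  Fdiag n (dwhiskw v (\big[@dadd k a b/dzero k a b]_(i <- r) F i)) m u =
  \sum_(i <- r) Fdiag n (dwhiskw v (F i)) m u.
Proof.
elim: r => [|i r IHr]; first by rewrite !big_nil dwhiskw_zero.
by rewrite !big_cons dwhiskw_add IHr.
Qed.

Definition repd w (u : Fword n w n) :=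
  exists f : diag k [::] w, Fdiag n f n (uin n 1 : Fword n [::] n) = u.

Lemma repd0 w : repd (0 : Fword n w n).
Proof. by exists (dzero k _ _). Qed.

Lemma repdD w (u v : Fword n w n) : repd u -> repd v -> repd (u + v).
Proof. by case=> f <- [g <-]; exists (dadd f g). Qed.

Lemma repd_map w w' (g : diag k w w') (u : Fword n w n) : repd u -> repd (Fdiag n g n u).
Proof. by case=> f <-; exists (dcomp g f). Qed.

Lemma inv_map w w' (g : diag k w w') (u : Fword n w n) : inv u -> inv (Fdiag n g n u).
Proof. by move=> uI a; rewrite -bhom_lact -bhom_ract uI. Qed.

End Whisker.

(** The identity of Q_- Q_+ is a sum of maps through Q_+ Q_- and through the empty word, so an
    invariant is recovered from its images in the other two words. *)
Lemma full0_mackey n v w : Full0 n (v ++ up :: dn :: w) -> Full0 n (v ++ w) ->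
  Full0 n (v ++ dn :: up :: w).
Proof.
move=> full1 full2 u uI; rewrite -[u]dwhiskw_id.
rewrite (@dwhiskw_Feq n v _ _ _ _ (lrel_Feq d_gt0 (lrel_dn_up k lam w))) dwhiskw_add dwhiskw_sum.
apply: repdD.
  rewrite dwhiskw_comp; apply: repd_map; apply: full1; exact: inv_map.
apply: (big_ind (@repd n _)) => [|y z|j _]; [exact: repd0 | exact: repdD | ].
rewrite 3!dwhiskw_comp; do 2! apply: repd_map.
by apply: full2; do 2! apply: inv_map.
Qed.

Lemma Fword_ups n a m (u : Fword n (nseq a up) m) : m <> (n + a)%N -> u = 0.
Proof.
elim: a m u => [|a IHa] m u mn; first by apply: unit_eq0 => e; apply: mn; rewrite addn0.
case: m u mn => [|m] u mn; first exact: up0_eq0.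
elim/up_ind: u => [c u|y z -> ->]; last exact: addr0.
by rewrite (IHa m u) ?tu0r // => e; apply: mn; rewrite addnS e.
Qed.

Lemma Fword0_dn w m (u : Fword 0 (w ++ [:: dn]) m) : u = 0.
Proof.
elim: w m u => [|[] w IHw] m u.
- elim/dn_ind: u => [c u|y z -> ->]; last exact: addr0.
  by rewrite (_ : u = 0) ?td0r //; apply: unit_eq0.
- case: m u => [|m] u; first exact: up0_eq0.
  elim/up_ind: u => [c u|y z -> ->]; last exact: addr0.
  by rewrite (IHw m u) tu0r.
- elim/dn_ind: u => [c u|y z -> ->]; last exact: addr0.
  by rewrite (IHw m.+1 u) td0r.
Qed.

Lemma word_split (w : word) : (exists a, w = nseq a up) \/ (exists v b, w = v ++ dn :: nseq b up).
Proof.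
elim: w => [|e w IHw]; first by left; exists 0%N.
case: IHw => [[a ->]|[v [b ->]]]; last by right; exists (e :: v), b.
case: e; first by left; exists a.+1.
by right; exists [::], a.
Qed.

Hypothesis center_balg : forall n (z : H n), (forall a, a * z = z * a) -> balg z.

Lemma full0_nil n : Full0 n [::].
Proof.
move=> u uI.
have : balg (uout u).
  by apply: center_balg => a; rewrite -uout_lact uI {1}(unitE u) -uin_lact mulr1 uin_ract uinK.
move=> ub; suff [f fP] : exists f : diag k [::] [::], forall v, Fdiag n f n v = lact (uout u) v.
  by exists f; rewrite fP [RHS]unitE.
move: (uout u) ub => z; elim=> {z} [c|j|y z _ [f fP] _ [g gP]|y z _ [f fP] _ [g gP]].
- by exists (dscale c (did k _)) => v; rewrite Fdiag_scale Fword_scalar.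
- by exists (dbubble k j [::]) => v; rewrite Fbubble.
- by exists (dadd f g) => v; rewrite Fdiag_add fP gP lactDl.
by exists (dcomp f g) => v; rewrite Fdiag_comp fP gP lactM.
Qed.

(** Nested induction on n, on the length, and on the number b of letters [up] behind the last [dn].
    A swap lowers b, and the other Mackey term is shorter. Once [dn] is the last letter, [rotation]
    lowers n, and for n = 0 the word is sent to zero. A nonempty word without [dn] has nothing in
    degree n, as it lives in degree n plus its length. *)
Lemma full0_all n w : Full0 n w.
Proof.
elim: n w => [|n IHn] w; move: {2}(size w) (leqnn (size w)) => N.
  elim: N w => [|N IHN] w; first by case: w => // _; apply: full0_nil.
  case: (word_split w) => [[[|a] ->]|[v [b ->]]] wN; first exact: full0_nil.
    by move=> u _; rewrite (@Fword_ups 0 a.+1 0 u) //; apply: repd0.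
  elim: b v wN => [|b IHb] v wN; first by move=> u _; rewrite (Fword0_dn u); apply: repd0.
  apply: (@full0_mackey 0 v (nseq b up)).
    by rewrite -cat_rcons; apply: IHb; move: wN; rewrite !size_cat size_rcons /= addnS.
  by apply: IHN; move: wN; rewrite !size_cat /=; lia.
elim: N w => [|N IHN] w; first by case: w => // _; apply: full0_nil.
case: (word_split w) => [[[|a] ->]|[v [b ->]]] wN; first exact: full0_nil.
  by move=> u _; rewrite (@Fword_ups n.+1 a.+1 n.+1 u); [apply: repd0|lia].
elim: b v wN => [|b IHb] v wN; first by apply: rotation.
apply: (@full0_mackey n.+1 v (nseq b up)).
  by rewrite -cat_rcons; apply: IHb; move: wN; rewrite !size_cat size_rcons /= addnS.
by apply: IHN; move: wN; rewrite !size_cat /=; lia.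
Qed.

Lemma full_of_center n (X Y : kobj k lam) (phi : bmor (Fobj n X) (Fobj n Y)) :
  exists f : kmor X Y, Fmor n f = phi.
Proof.
apply: full_karoubi => //; apply: full_adjunction => //.
by apply: Full0_Full => w; apply: full0_all.
Qed.

End Reduction.

(** * Refined degree estimates *)

Section Weights.
Variable d : nat.
Hypothesis d_gt0 : (0 < d)%N.

Lemma divnD_ge a b : (a %/ d + b %/ d <= (a + b) %/ d)%N.
Proof. by rewrite divnD // leq_addr. Qed.

(** The ceiling of c/d: the weight of a power of a dot drops by a floor, that of a bubble by a
    ceiling. *)
Definition cdiv c := ((c + d.-1) %/ d)%N.

Lemma divn_cdiv a b : ((a + b) %/ d <= a %/ d + cdiv b)%N.
Proof.
rewrite /cdiv {1}(divn_eq a d) {1}(divn_eq b d) addnACA -mulnDl divnMDl //.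
rewrite [in X in (_ <= _ + X)%N](divn_eq b d) -[(_ + d.-1)%N]addnA divnMDl // -addnA !leq_add2l.
have la := ltn_pmod a d_gt0; have lb := ltn_pmod b d_gt0.
have [->|b0] := posnP (b %% d); first by rewrite addn0 divn_small.
apply: (@leq_trans 1); last by rewrite divn_gt0 //; lia.
by rewrite -ltnS ltn_divLR //; lia.
Qed.

Lemma cdiv_gt a t : (a %/ d < cdiv (a + t).+1)%N.
Proof.
apply: (@leq_trans (cdiv a.+1)); last by apply: leq_div2r; lia.
by rewrite /cdiv (_ : a.+1 + d.-1 = a + 1 * d)%N ?divnDMl ?addn1 //; lia.
Qed.

Lemma cdivD a b : (cdiv (a + b) <= cdiv a + cdiv b)%N.
Proof. by have := divn_cdiv (a + d.-1) b; rewrite addnAC -/(cdiv (a + b)). Qed.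

Lemma cdiv_le c : (cdiv c <= c)%N.
Proof.
rewrite /cdiv; case: c => [|c]; first by rewrite divn_small //; lia.
by rewrite -ltnS ltn_divLR //; nia.
Qed.

Lemma cdiv_divn a : (cdiv a <= (a %/ d).+1)%N.
Proof.
rewrite /cdiv {1}(divn_eq a d) -addnA divnMDl // -[X in (_ <= X)%N]addn1 leq_add2l.
have la := ltn_pmod a d_gt0; by rewrite -ltnS ltn_divLR //; lia.
Qed.

Lemma divn_le a : (a %/ d <= a)%N.
Proof. exact: leq_div. Qed.

End Weights.

Lemma trp_x_gt (R : pzRingType) n (x s : nat -> R) (hr : hecke_rel n x s) i j l :
  (i < j)%N -> (j < l)%N -> (l < n)%N -> trp s i j * x l = x l * trp s i j.
Proof.
move=> ij jl ln; elim: j ij jl => // j IHj ij jl; have [->|nij] := eqVneq i j.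
  by rewrite trp_s (hr_sx_far hr) //; lia.
have {}ij : (i < j)%N by lia.
rewrite trpS // -!mulrA (hr_sx_far hr) //; [|lia..].
by rewrite (mulrA (trp s i j)) IHj // -?mulrA ?(mulrA (s j) (x l)) 1?(hr_sx_far hr) -?mulrA //; lia.
Qed.

Section StrictFiltration.
Variables (k : fieldType) (lam : weight).
Local Notation H := (hecke k lam).
Local Notation x := (xH k lam).
Local Notation s := (sH k lam).
Local Notation d := (level lam).
Local Notation wt := (wt lam).
Local Notation tH := (tH k lam).
Local Notation Fil := (@Fil k lam).
Hypothesis d_gt0 : (0 < d)%N.

Lemma wt_small j : (j < d)%N -> wt j = (2 * j)%N.
Proof. by move=> jd; rewrite /(wt _) divn_small ?subn0. Qed.

Lemma wt_addd a : wt (a + d) = (wt a + (2 * d).-1)%N.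
Proof.
rewrite /(wt (a + d)) /(wt a) -{2}[d]mul1n divnDMl //; have := divn_le d a; lia.
Qed.

Lemma wtE j : (wt j + j %/ d = 2 * j)%N.
Proof. by rewrite /(wt _); have := divn_le d j; lia. Qed.

Lemma wtD a b : (wt (a + b) <= wt a + wt b)%N.
Proof. by have := wtE (a + b); have := wtE a; have := wtE b; have := divnD_ge d_gt0 a b; lia. Qed.

(** Weight strictly below R. For R = 0 this has to mean zero, which ends the descent on the weight
    of a central element. *)
Definition Flt n R (z : H n) : Prop := if R is R'.+1 then Fil R' z else z = 0.

Lemma Flt_Fil n R S (z : H n) : (R < S)%N -> Fil R z -> Flt S z.
Proof. by case: S => // S RS; apply: FilW. Qed.

Lemma Flt_W n R S (z : H n) : (R <= S)%N -> Flt R z -> Flt S z.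
Proof.
case: R S => [|R] [|S] //= RS; last by apply: FilW.
by move=> ->; apply: Fil0.
Qed.

Lemma Flt_sub n R (z : H n) : Flt R z -> Fil R z.
Proof. by case: R => [->|R]; [apply: Fil0 | apply: FilW]. Qed.

Lemma Flt0 n R : Flt R (0 : H n).
Proof. by case: R => //= R; apply: Fil0. Qed.

Lemma FltD n R (y z : H n) : Flt R y -> Flt R z -> Flt R (y + z).
Proof. by case: R => [/= -> ->|R]; [rewrite addr0 | apply: FilD]. Qed.

Lemma FltN n R (z : H n) : Flt R z -> Flt R (- z).
Proof. by case: R => [/= ->|R]; [rewrite oppr0 | apply: FilN]. Qed.

Lemma FltB n R (y z : H n) : Flt R y -> Flt R z -> Flt R (y - z).
Proof. by move=> Fy /FltN; apply: FltD. Qed.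

Lemma Flt_sum n R (I : Type) (r : seq I) (P : pred I) (F : I -> H n) :
  (forall i, P i -> Flt R (F i)) -> Flt R (\sum_(i <- r | P i) F i).
Proof. by move=> FS; elim/big_ind: _ => //; [apply: Flt0 | apply: FltD]. Qed.

Lemma FltMl n R S (a b : H n) : Fil R a -> Flt S b -> Flt (R + S) (a * b).
Proof.
move=> Fa; case: S => [/= ->|S Fb]; first by rewrite mulr0; apply: Flt0.
by rewrite addnS; apply: FilM.
Qed.

Lemma FltMr n R S (a b : H n) : Flt R a -> Fil S b -> Flt (R + S) (a * b).
Proof.
case: R => [/= ->|R Fa] Fb; first by rewrite mul0r; apply: Flt0.
by rewrite addSn; apply: FilM.
Qed.

Lemma Flt_incl n R (a : H n) : Flt R a -> Flt R (incl a).
Proof. by case: R => [/= ->|R]; [rewrite incl0 | apply: Fil_incl]. Qed.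

Lemma FilB n R (y z : H n) : Fil R y -> Fil R z -> Fil R (y - z).
Proof. by move=> Fy /FilN; apply: FilD. Qed.

Lemma Fil_xpow n l j : (l < n)%N -> Fil (2 * j) (x n l ^+ j).
Proof. by move=> ln; apply: FilW (Fil_xX k d_gt0 j ln); rewrite /(wt _) leq_subr. Qed.

Lemma Fil_emb n m S (a : H n) : (n <= m)%N -> Fil S a -> Fil S (emb m a).
Proof.
move=> nm Fa; elim: m nm => [|m IHm].
  by rewrite leqn0 => /eqP e; subst n; rewrite emb_id.
rewrite leq_eqVlt => /orP[/eqP <-|nm]; first by rewrite emb_id.
by rewrite -(@emb_emb k lam d_gt0 n m m.+1) //; apply: Fil_incl => //; apply: IHm.
Qed.

Lemma Flt_emb n m S (a : H n) : (n <= m)%N -> Flt S a -> Flt S (emb m a).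
Proof.
move=> nm; case: S => [/= ->|S]; last exact: Fil_emb.
by rewrite emb0.
Qed.

(* Products of generators of total weight at most S; unlike the normal form,
   this description is visibly stable under conjugation. *)
Inductive mon n : nat -> H n -> Prop :=
| mon_0 S : mon S 0
| mon_add S y z : mon S y -> mon S z -> mon S (y + z)
| mon_c S c : mon S (cH lam n c)
| mon_x S l y : (l < n)%N -> mon S y -> mon S.+2 (y * x n l)
| mon_t S i j y : (i < n)%N -> (j < n)%N -> mon S y -> mon S.+1 (y * tH n i j).

Lemma monW n R S (z : H n) : (R <= S)%N -> mon R z -> mon S z.
Proof.
move=> RS zR; elim: zR S RS => {R z} [R|R y z _ IHy _ IHz|R c|R l y ln _ IHy|R i j y i_n j_n _ IHy] S RS.
- exact: mon_0.
- by apply: mon_add; [apply: IHy|apply: IHz].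
- exact: mon_c.
- by case: S RS => [|[|S]] // RS; apply: mon_x => //; apply: IHy.
- by case: S RS => // S RS; apply: mon_t => //; apply: IHy.
Qed.

Lemma mon_incl n S (z : H n) : mon S z -> mon S (incl z).
Proof.
elim=> {S z} [R|R y z _ IHy _ IHz|R c|R l y ln _ IHy|R i j y i_n j_n _ IHy].
- by rewrite incl0; apply: mon_0.
- by rewrite inclD; apply: mon_add.
- by rewrite incl_cH; apply: mon_c.
- by rewrite inclM incl_x //; apply: mon_x => //; apply: ltnW.
- by rewrite inclM incl_tH //; apply: mon_t => //; apply: ltnW.
Qed.

Lemma mon_xX n S l j (y : H n) : (l < n)%N -> mon S y -> mon (S + 2 * j) (y * x n l ^+ j).
Proof.
move=> ln yS; elim: j => [|j IHj]; first by rewrite muln0 addn0 expr0 mulr1.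
by rewrite exprSr mulrA mulnS addnCA add2n; apply: mon_x.
Qed.

Lemma Fil_mon n S (z : H n) : Fil S z -> mon S z.
Proof.
elim: n S z => [|n IHn] S z.
  by move=> _; have [c ->] := hecke0_cH z; apply: mon_c.
move: z; apply: Fil_normal => [|y z|R j a jd aR RS|R j a i jd aR i_n RS].
- exact: mon_0.
- exact: mon_add.
- by apply: monW RS _; apply: mon_xX => //; apply/mon_incl/IHn.
- by apply: monW RS _; apply: mon_t => //; [exact: leqW | apply: mon_xX => //; apply/mon_incl/IHn].
Qed.

Lemma tH_cycle n a l b : (a < n)%N -> (l < n)%N -> (b < n)%N -> a != l -> a != b -> l != b ->
  tH n a l * tH n l b * tH n a b = tH n b l.
Proof.
move=> a_n l_n b_n al ab lb; rewrite tHM //.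
have -> : tpn a l l = a by tpn_lia.
have -> : tpn a l b = b by tpn_lia.
rewrite tHM // -mulrA tHK // mulr1.
by congr (tH n _ _); tpn_lia.
Qed.

Lemma Fil_conj_x n a b l : (a < n)%N -> (b < n)%N -> (l < n)%N ->
  Fil 2 (tH n a b * x n l * tH n a b).
Proof.
wlog ab : a b / (a < b)%N => [W a_n b_n|].
  have [ab|ba|->] := ltngtP a b; [exact: W | by rewrite /(tH _ _ _) trpC; apply: W |].
  by rewrite tH_diag mul1r mulr1; apply: Fil_xl.
move=> a_n b_n l_n; have hrP := hecke_relP k lam n.
have tK := tHK k lam a_n b_n.
have F1 i j : (i < n)%N -> (j < n)%N -> Fil 1 (tH n i j) by apply: Fil_tH.
have Fx : Fil 2 (x n l) by apply: Fil_xl.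
have Fxa : Fil 2 (x n a) by apply: Fil_xl.
have Fxb : Fil 2 (x n b) by apply: Fil_xl.
have W1 i j : (i < n)%N -> (j < n)%N -> Fil 2 (tH n i j) by move=> *; apply: FilW (F1 _ _ _ _).
have [la|al|el] := ltngtP l a.
- by rewrite /(tH _ _ _) (trp_x_lt hrP) // -mulrA (trpK hrP) // mulr1.
- have [lb|bl|el] := ltngtP l b.
  + rewrite /(tH _ _ _) (trp_x_mid hrP) // mulrDl -!mulrA (trpK hrP) // mulr1.
    apply: FilD; first by apply: FilB => //; apply: W1.
    by rewrite mulrA -/(tH n a l) -/(tH n l b) -/(tH n a b) tH_cycle //; [apply: W1|lia..].
  + rewrite /(tH _ _ _) (trp_x_gt hrP) //.
    by rewrite -mulrA (trpK hrP) // mulr1.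
  + subst l; rewrite /(tH _ _ _) (trp_x_max hrP) // mulrDl mul1r -mulrA (trpK hrP) // mulr1.
    apply: FilD; last exact: W1.
    rewrite /yel; apply: FilD => //.
    by rewrite big_nat_cond; apply: Fil_sum => i /andP[/andP[ai ib] _]; apply: W1 => //; lia.
subst l; rewrite /(tH _ _ _) (trp_x_min hrP) // !mulrBl mul1r -mulrA (trpK hrP) // mulr1.
apply: FilB; first by apply: FilB => //; apply: W1.
rewrite mulr_suml big_nat_cond; apply: Fil_sum => i /andP[/andP[ai ib] _].
have i_n : (i < n)%N by lia.
by rewrite -/(tH n a i) -/(tH n i b) -/(tH n a b) tH_cycle //; [apply: W1|lia..].
Qed.

Lemma Fil_conj_tH n S a b (z : H n) : (a < n)%N -> (b < n)%N -> Fil S z ->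
  Fil S (tH n a b * z * tH n a b).
Proof.
move=> a_n b_n /Fil_mon; elim=> {S z} [R|R y z _ IHy _ IHz|R c|R l y ln _ IHy|R i j y i_n j_n _ IHy].
- by rewrite mulr0 mul0r; apply: Fil0.
- by rewrite mulrDr mulrDl; apply: FilD.
- by rewrite -cHC -mulrA tHK // mulr1; apply: (@FilW k lam n 0); last exact: Fil_cH.
- rewrite -[y]mulr1 -(tHK k lam a_n b_n) !mulrA -[_ * tH n a b * x n l]mulrA -mulrA.
  by rewrite -addn2; apply: FilM => //; rewrite ?mulrA; apply: Fil_conj_x.
have -> : tH n a b * (y * tH n i j) * tH n a b =
    (tH n a b * y * tH n a b) * (tH n a b * tH n i j * tH n a b).
  by rewrite -[in LHS](mul1r (tH n i j)) -(tHK k lam a_n b_n) !mulrA.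
rewrite -addn1; apply: FilM => //.
rewrite tHM // -mulrA tHK // mulr1; apply: Fil_tH => //; apply: tpn_lt => //.
Qed.

Lemma Fil_trH n S (z : H n.+1) : Fil (S + 2 * d.-1) z -> Fil S (trH z).
Proof.
move: z; apply: Fil_normal => [|y z Fy Fz|R j a jd aR RS|R j a i jd aR i_n RS].
- by rewrite trH0 //; apply: Fil0.
- by rewrite trHD //; apply: FilD.
- rewrite trHl // trH_x //; have [e|_] := eqVneq j d.-1; last by rewrite mulr0; apply: Fil0.
  by rewrite mulr1; apply: FilW aR; lia.
by rewrite trH_xt //; apply: Fil0.
Qed.

Lemma trH_Fil_eq0 n S (z : H n.+1) : (S < 2 * d.-1)%N -> Fil S z -> trH z = 0.
Proof.
move=> Sd; move: z; apply: Fil_normal => [|y z Fy Fz|R j a jd aR RS|R j a i jd aR i_n RS].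
- exact: trH0.
- by rewrite trHD // Fy Fz addr0.
- rewrite trHl // trH_x //; have [e|_] := eqVneq j d.-1; last by rewrite mulr0.
  lia.
by rewrite trH_xt.
Qed.

Lemma tH_s n i : (i < n)%N -> tH n.+2 i n.+1 * s n.+2 n = s n.+2 n * incl (tH n.+1 i n).
Proof.
move=> i_n; have hrP := hecke_relP k lam n.+2.
have -> : incl (tH n.+1 i n) = tH n.+2 i n by rewrite incl_tH //; lia.
by rewrite /(tH _ _ _) (trpS (s n.+2) i_n) -!mulrA (hr_ss hrP) // mulr1.
Qed.

(** Among normal forms only those with exponent d - 1 and the transposition s itself survive, so
    multiplying by s and taking the trace lowers weights by 2(d - 1) + 1. *)
Lemma trH_xts n (a : H n.+1) j i : (j < d)%N -> (i < n.+1)%N ->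
  trH (incl a * x n.+2 n.+1 ^+ j * tH n.+2 i n.+1 * s n.+2 n) =
  if (i == n) && (j == d.-1) then a else 0.
Proof.
move=> jd; rewrite ltnS leq_eqVlt => /orP[/eqP ->|i_n].
  rewrite -mulrA {1}/(tH _ _ _) trp_s (hr_ss (hecke_relP k lam n.+2)) // mulr1 trHl // trH_x //.
  by rewrite eqxx /=; case: eqP => _; rewrite ?mulr1 ?mulr0.
by rewrite (ltn_eqF i_n) -mulrA tH_s // mulrA trHr // -mulrA trHl // trH_xs // mulr0 mul0r.
Qed.

Lemma trH_axs n (a : H n.+1) j : (j < d)%N -> trH (incl a * x n.+2 n.+1 ^+ j * s n.+2 n) = 0.
Proof. by move=> jd; rewrite -mulrA trHl // trH_xs // mulr0. Qed.

Lemma Fil_trH_s n S (z : H n.+2) : Fil (S + (2 * d).-1) z -> Fil S (trH (z * s n.+2 n)).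
Proof.
move: z; apply: Fil_normal => [|y z Fy Fz|R j a jd aR RS|R j a i jd aR i_n RS].
- by rewrite mul0r trH0 //; apply: Fil0.
- by rewrite mulrDl trHD //; apply: FilD.
- by rewrite trH_axs //; apply: Fil0.
rewrite trH_xts //; case: andP => [[_ /eqP e]|_]; last exact: Fil0.
by apply: FilW aR; lia.
Qed.

Lemma trH_s_Fil_eq0 n S (z : H n.+2) : (S < (2 * d).-1)%N -> Fil S z -> trH (z * s n.+2 n) = 0.
Proof.
move=> Sd; move: z; apply: Fil_normal => [|y z Fy Fz|R j a jd aR RS|R j a i jd aR i_n RS].
- by rewrite mul0r trH0.
- by rewrite mulrDl trHD // Fy Fz addr0.
- by rewrite trH_axs.
by rewrite trH_xts //; case: andP => [[_ /eqP e]|_] //; lia.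
Qed.

Local Notation Gm := (@Gm k lam).
Local Notation cdiv := (cdiv d).
Local Notation cd := (@cd k lam d_gt0).

(** The summands of [trH_x_rec] are x^a times the bubble of index e with a + e = c - 2. This shift
    is worth 4 in weight, while ceil(c/d) exceeds floor(a/d) + ceil(e/d) by at most 3. *)
Lemma Fil_Gm n c : (0 < c)%N -> Fil (2 * c - 1 - cdiv c) (Gm n c).
Proof.
elim: n c => [|n IHn] c c0.
  by have [z ->] := hecke0_cH (Gm 0 c); apply: (@FilW k lam 0 0); last exact: Fil_cH.
elim/ltn_ind: c c0 => c IHc c0; rewrite /(Gm _ _) trH_x_rec // -/(Gm n c).
apply: FilD; first by apply: Fil_incl => //; apply: IHn.
apply: Fil_sum => l _; apply: Fil_sum => l' _; have ll := ltn_ord l; have ll' := ltn_ord l'.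
set a := (l + l')%N; have [lt|ge] := ltnP (d.-1 + c).-2 (d.-1 + a).
  by rewrite Gm_lt ?mulr0; [apply: Fil0 | lia | rewrite /a; lia].
have -> : ((d.-1 + c).-2 - a = d.-1 + (c - 2 - a))%N by lia.
rewrite -/(Gm n.+1 _); set e := (c - 2 - a)%N.
have ec : c = (a + e + 2)%N by rewrite /e; lia.
have Fx := Fil_xX k d_gt0 a (ltnSn n); have wa := wtE a.
have c1 : (cdiv c <= cdiv a + cdiv e + 2)%N.
  rewrite ec; have := cdivD d_gt0 (a + e) 2; have := cdivD d_gt0 a e; have := cdiv_le d_gt0 2; lia.
have c2 := cdiv_divn d_gt0 a; have c3 := cdiv_le d_gt0 e.
(* The bubble of index 0 is 1, and the bound is claimed for positive indices only. *)
have [e0|e0] := posnP e.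
  rewrite e0 Gm0 // mulr1; apply: FilW Fx.
  by move: c1 c3; rewrite e0; lia.
have Fe := IHc e _ e0; apply: FilW (FilM d_gt0 Fx (Fe _)); lia.
Qed.

Lemma Fil_cd n m : (0 < m)%N -> Fil (2 * m).-1 (cd n m).
Proof.
elim/ltn_ind: m => -[|m] IHm // _.
have := Gm_cd k d_gt0 n m.+1; rewrite big_ord_recl subn0 Gm0 // mul1r => /eqP.
rewrite addr_eq0 => /eqP ->; apply: FilN => //; apply: Fil_sum => i _.
rewrite lift0 subSS; have im := ltn_ord i.
have FG : Fil (2 * i.+1).-1 (Gm n i.+1) by apply: FilW (Fil_Gm n (ltn0Sn i)); lia.
have [e|e] := posnP (m - i)%N; first by rewrite e cd0 mulr1; apply: FilW FG; lia.
by apply: FilW (FilM d_gt0 FG (IHm _ _ e)); lia.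
Qed.

(** The summand t = d - 1 is the leading one. In the others, the coefficient [cd] of index m has
    weight at most 2m - 1, less than the 2m of the missing power of the dot. *)
Lemma yH_lead n j : (j < d)%N -> Flt (2 * (d.-1 - j)) (yH k lam n j - x n.+1 n ^+ (d.-1 - j)).
Proof.
move=> jd; rewrite yHE // (_ : d = d.-1.+1); last by lia.
rewrite big_nat_recr /=; last by lia.
rewrite subnn cd0 incl1 mulr1 addrK big_nat_cond; apply: Flt_sum => t /andP[/andP[jt td] _].
have td' : (0 < d.-1 - t)%N by lia.
apply: (@Flt_Fil _ (2 * (t - j) + (2 * (d.-1 - t)).-1)); first by lia.
apply: FilM => //; first exact: Fil_xpow.
by apply: Fil_incl => //; apply: Fil_cd.
Qed.

Lemma Fil_yH n j : (j < d)%N -> Fil (2 * (d.-1 - j)) (yH k lam n j).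
Proof.
move=> jd; rewrite -[yH _ _ _ _](subrK (x n.+1 n ^+ (d.-1 - j))); apply: FilD.
  exact/Flt_sub/yH_lead.
exact: Fil_xpow.
Qed.

(** These are the coefficients of x^j in the Mackey decomposition of x^{a+d}; the bound puts all
    those summands below the weight of x^{a+d}. *)
Lemma Fil_rho n a j : (j < d)%N ->
  Fil (wt (a + d) - 2 * j).-1 (trH (x n.+1 n ^+ (a + d) * yH k lam n j)).
Proof.
move=> jd; rewrite yHE // mulr_sumr trH_sum // big_nat_cond.
apply: Fil_sum => t /andP[/andP[jt td] _].
rewrite mulrA -exprD trHr // (_ : (a + d + (t - j) = d.-1 + (a + (t - j)).+1)%N); last by lia.
rewrite -/(Gm n _); set e := (a + _).+1.
have FG := Fil_Gm n (ltn0Sn (a + (t - j))); rewrite -/e in FG.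
have c1 : (a %/ d < cdiv e)%N := cdiv_gt d_gt0 a (t - j).
have wa := wtE a; have wd := wt_addd a; have ce := cdiv_le d_gt0 e.
have eE : e = (a + (t - j)).+1 by [].
clearbody e; have [e0|e0] := posnP (d.-1 - t).
  by rewrite e0 cd0 mulr1; apply: FilW FG; lia.
by apply: FilW (FilM d_gt0 FG (Fil_cd n e0)); lia.
Qed.
End StrictFiltration.

(** * Leading terms of averages *)

Section LeadingTerms.
Variables (k : fieldType) (lam : weight).
Local Notation H := (hecke k lam).
Local Notation x := (xH k lam).
Local Notation s := (sH k lam).
Local Notation d := (level lam).
Local Notation yH := (yH k lam).
Local Notation wt := (wt lam).
Local Notation tH := (tH k lam).
Local Notation Fil := (@Fil k lam).
Local Notation Flt := (@Flt k lam).
Local Notation Gm := (@Gm k lam).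
Hypothesis d_gt0 : (0 < d)%N.

Definition ye m i : H m.+1 := yel (x m.+1) (s m.+1) i m.

Lemma ye_conj p i : (i <= p)%N ->
  ye p.+1 i = incl (tH p.+1 i p * x p.+1 p * tH p.+1 i p).
Proof.
have hrP := hecke_relP k lam p.+1.
rewrite leq_eqVlt => /orP[/eqP ->|ip].
  by rewrite tH_diag mul1r mulr1 /ye /yel big_geq // addr0 incl_x.
rewrite {1}/(tH _ _ _) (trp_x_max hrP) // mulrDl mul1r -mulrA (trpK hrP) ?mulr1 //; last by lia.
rewrite /ye /yel big_nat_recr //= !inclD incl_x; last by lia.
rewrite addrA incl_sum; congr (_ + _ + _); last by rewrite incl_tH //; lia.
by apply: eq_big_nat => l /andP[il lp]; rewrite -/(tH _ i l) incl_tH //; lia.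
Qed.

Lemma tH_conjX n i p a (z : H n) : (i < n)%N -> (p < n)%N ->
  (tH n i p * z * tH n i p) ^+ a = tH n i p * z ^+ a * tH n i p.
Proof.
move=> i_n p_n; elim: a => [|a IHa]; first by rewrite !expr0 mulr1 tHK.
by rewrite exprSr IHa -!mulrA (mulrA (tH n i p) (tH n i p)) tHK // mul1r exprSr -!mulrA.
Qed.

Lemma Fil_ye p i a : (i <= p)%N -> Fil (wt a) (ye p.+1 i ^+ a).
Proof.
move=> ip; rewrite ye_conj // -inclX tH_conjX //; apply: Fil_incl => //.
by apply: Fil_conj_tH => //; apply: Fil_xX.
Qed.

Lemma ye_X p i a b : (i <= p)%N -> ye p.+1 i ^+ a * x p.+2 p.+1 ^+ b = x p.+2 p.+1 ^+ b * ye p.+1 i ^+ a.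
Proof. by move=> ip; rewrite ye_conj // -inclX (commrX _ (incl_x_comm _)). Qed.

Lemma tH_X p i j : (i <= p)%N -> tH p.+2 i p.+1 * x p.+2 p.+1 ^+ j =
  ye p.+1 i ^+ j * tH p.+2 i p.+1 + \sum_(a < j) x p.+2 p.+1 ^+ (j.-1 - a) * ye p.+1 i ^+ a.
Proof.
move=> ip; have hrP := hecke_relP k lam p.+2.
elim: j => [|j IHj]; first by rewrite big_ord0 addr0 !expr0 mul1r mulr1.
rewrite exprSr mulrA IHj mulrDl -mulrA {2}/(tH _ _ _) (trp_x_max hrP) // -/(ye _ _).
rewrite mulrDr mulr1 mulrA -exprSr -addrA; congr (_ + _).
rewrite big_ord_recr /= subnn expr0 mul1r addrC; congr (_ + _).
rewrite mulr_suml; apply: eq_bigr => a _; rewrite -mulrA -[x _ _]expr1 ye_X // mulrA -exprD.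
by congr (_ ^+ _ * _); have := ltn_ord a; lia.
Qed.

Definition U p a : H p.+2 := \sum_(i < p.+1) ye p.+1 i ^+ a * tH p.+2 i p.+1.

Lemma Fil_U p a : Fil (wt a).+1 (U p a).
Proof.
apply: Fil_sum => i _; rewrite -(addn1 (wt a)); have ip := ltn_ord i.
by apply: FilM => //; [apply: Fil_ye | apply: Fil_tH => //; lia].
Qed.

(** What conjugation by the transpositions (i p+1) with i <= p adds to the average from the smaller
    algebra, see [AvS]. It is the source of the multiple floor(j/d). *)
Definition Dblock p j : H p.+2 := \sum_(a < j) x p.+2 p.+1 ^+ (j.-1 - a) * U p a.

Definition Av m j : H m.+1 := \sum_(i < m.+1) tH m.+1 i m * x m.+1 m ^+ j * tH m.+1 i m.

Lemma AvS p j : Av p.+1 j = incl (Av p j) + x p.+2 p.+1 ^+ j + Dblock p j.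
Proof.
rewrite /Av big_ord_recr /= tH_diag mul1r mulr1 -addrA [X in _ = _ + X]addrC addrA; congr (_ + _).
rewrite incl_sum /Dblock /U.
under [X in _ = _ + X]eq_bigr => a _ do rewrite mulr_sumr.
rewrite exchange_big -big_split; apply: eq_bigr => i _ /=; have ip := ltn_ord i.
have i_n : (i < p.+2)%N by lia.
rewrite tH_X // mulrDl -mulrA tHK // mulr1 ye_conj // -inclX tH_conjX //; congr (_ + _).
by rewrite mulr_suml; apply: eq_bigr => a _; rewrite mulrA.
Qed.

Lemma cas_sum (V : zmodType) p r (F : 'I_r -> H p.+1 -> H p.+1 -> V) :
  \sum_(l < r) cas (F l) = cas (fun a b => \sum_(l < r) F l a b).
Proof.
rewrite /cas exchange_big; apply: eq_bigr => i _; exact: exchange_big.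
Qed.

(** The Casimir element with x^a s inserted between its factors. Its leading term is computed twice:
    through the sums [U] in [Sa_lead], and as x^{a+d} in [Sa_top]. The comparison evaluates the sums
    over transpositions. *)
Definition Sa p a : H p.+2 :=
  cas (fun b c => incl (b * x p.+1 p ^+ a) * s p.+2 p * incl c).

(* The Mackey decomposition of a large power of the last dot expresses it
   through the Sa p l with bubbles as coefficients. *)
Lemma Sa_rec p a : x p.+2 p.+1 ^+ (a + d) =
  \sum_(l < a.+1) incl (Gm p.+1 (a - l)) * Sa p l +
  \sum_(j < d) incl (trH (x p.+2 p.+1 ^+ (a + d) * yH p.+1 j)) * x p.+2 p.+1 ^+ j.
Proof.
have hrP := hecke_relP k lam p.+2.
rewrite -{1}(mackey d_gt0 (x p.+2 p.+1 ^+ (a + d))); congr (_ + _).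
have trs : trH (x p.+2 p.+1 ^+ (a + d) * s p.+2 p) =
    \sum_(l < a.+1) x p.+1 p ^+ l * Gm p.+1 (a - l).
  rewrite (hr_xsX hrP) // trHD //.
  have -> : trH (s p.+2 p * x p.+2 p ^+ (a + d)) = 0.
    by have := @trH_s k lam d_gt0 p.+1 1 (x p.+1 p ^+ (a + d)); rewrite incl1 mul1r inclX incl_x.
  rewrite add0r /hsum trH_sum // -(big_mkord xpredT (fun l => trH (x p.+2 p ^+ l * x p.+2 p.+1 ^+ ((a + d).-1 - l)))).
  rewrite (big_cat_nat (n := a.+1)) //=; last by lia.
  rewrite [X in _ + X]big_nat_cond [X in _ + X]big1 ?addr0 => [|l /andP[/andP[al ld] _]].
    rewrite big_mkord; apply: eq_bigr => l _; have la := ltn_ord l.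
    rewrite -incl_x // -inclX trHl // /(Gm _ _); congr (_ * trH (_ ^+ _)); lia.
  by rewrite -incl_x // -inclX trHl // Gm_lt ?mulr0 //; lia.
rewrite /Sa.
under [RHS]eq_bigr => l _.
  rewrite (cas_morph (f := fun z => incl (Gm p.+1 (a - l)) * z)) ?mulr0 //; last by move=> y z; rewrite mulrDr.
over.
rewrite /= cas_sum; apply: eq_cas => b c.
rewrite (mulrA _ (incl b)) -(commrX (a + d) (incl_x_comm b)) -mulrA trHl // trs mulr_sumr incl_sum mulr_suml.
apply: eq_bigr => l _; rewrite !mulrA -GmC // !inclM !mulrA -!inclM.
by [].
Qed.

Lemma Flt_tHx p i b : (i <= p)%N -> 
  Flt (2 * b).+1 (tH p.+2 i p.+1 * x p.+2 i ^+ b - x p.+2 p.+1 ^+ b * tH p.+2 i p.+1).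
Proof.
move=> ip; have hrP := hecke_relP k lam p.+2; have i_n : (i < p.+2)%N by lia.
have F2 i1 j1 i2 j2 : (i1 < p.+2)%N -> (j1 < p.+2)%N -> (i2 < p.+2)%N -> (j2 < p.+2)%N ->
    Fil 2 (tH p.+2 i1 j1 * tH p.+2 i2 j2).
  by move=> *; apply: (FilM d_gt0 (R := 1) (S := 1)); apply: Fil_tH.
have Ft : Fil 1 (tH p.+2 i p.+1) by apply: Fil_tH.
have F1 : Fil 2 (tH p.+2 i p.+1 * x p.+2 i - x p.+2 p.+1 * tH p.+2 i p.+1).
  rewrite {1}/(tH _ _ _) (trp_x_min hrP) // -/(tH _ _ _).
  have sub3 (A B C : H p.+2) : A - B - C - A = - B - C by rewrite addrC !addrA addNr add0r.
  rewrite sub3.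
  apply: FilB => //; first by apply: FilN => //; apply: (@FilW k lam p.+2 0 2); last exact: Fil1.
  rewrite big_nat_cond; apply: Fil_sum => l /andP[/andP[il lp] _]; apply: F2 => //; lia.
elim: b => [|b IHb]; first by rewrite !expr0 mulr1 mul1r subrr; apply: Flt0.
have -> : tH p.+2 i p.+1 * x p.+2 i ^+ b.+1 - x p.+2 p.+1 ^+ b.+1 * tH p.+2 i p.+1 =
   (tH p.+2 i p.+1 * x p.+2 i ^+ b - x p.+2 p.+1 ^+ b * tH p.+2 i p.+1) * x p.+2 i +
   x p.+2 p.+1 ^+ b * (tH p.+2 i p.+1 * x p.+2 i - x p.+2 p.+1 * tH p.+2 i p.+1).
  by rewrite mulrBl mulrBr !exprSr !mulrA addrA subrK.
apply: FltD.
  have -> : (2 * b.+1).+1 = ((2 * b).+1 + 2)%N by lia.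
  by apply: FltMr => //; apply: Fil_xl.
apply: (@Flt_Fil _ _ _ (2 * b + 2)); first by lia.
by apply: FilM => //; apply: Fil_xpow.
Qed.

Lemma Flt_x_ye p i b : (i <= p)%N -> Flt (2 * b) (x p.+2 i ^+ b - ye p.+1 i ^+ b).
Proof.
move=> ip; have i_n : (i < p.+2)%N by lia.
have F1 : Fil 1 (x p.+2 i - ye p.+1 i).
  rewrite /ye /yel opprD addrA subrr add0r; apply: FilN => //.
  by rewrite big_nat_cond; apply: Fil_sum => l /andP[/andP[il lp] _]; apply: Fil_tH => //; lia.
elim: b => [|b IHb]; first by rewrite !expr0 subrr.
have -> : x p.+2 i ^+ b.+1 - ye p.+1 i ^+ b.+1 = x p.+2 i * (x p.+2 i ^+ b - ye p.+1 i ^+ b) +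
    (x p.+2 i - ye p.+1 i) * ye p.+1 i ^+ b.
  by rewrite mulrBr mulrBl -!exprS addrA subrK.
rewrite mulnS; apply: FltD; first by apply: FltMl => //; apply: Fil_xl.
apply: (@Flt_Fil _ _ _ (1 + 2 * b)) => //.
apply: FilM => //; apply: FilW (Fil_ye b ip); rewrite /(wt _); exact: leq_subr.
Qed.

Section Coset.
Variables (R : pzRingType) (n : nat) (y t : nat -> R).
Hypothesis hr : hecke_rel n y t.

Definition gpr i p : R := \prod_(i <= l < p) t l.
Definition gprv i p : R := \prod_(l <- rev (index_iota i p)) t l.

Lemma gprS i p : (i <= p)%N -> gpr i p.+1 = gpr i p * t p.
Proof. by move=> ip; rewrite /gpr big_nat_recr. Qed.

Lemma gprvS i p : (i <= p)%N -> gprv i p.+1 = t p * gprv i p.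
Proof.
by move=> ip; rewrite /gprv /index_iota subSn // -[(p - i).+1]addn1 iotaD rev_cat /= big_cons subnKC.
Qed.

Lemma gpr_id i : gpr i i = 1.
Proof. by rewrite /gpr big_geq. Qed.

Lemma gprv_id i : gprv i i = 1.
Proof. by rewrite /gprv /index_iota subnn big_nil. Qed.

Lemma gpr_ind i (P : nat -> Prop) : P i -> (forall p, (i <= p)%N -> P p -> P p.+1) ->
  forall p, (i <= p)%N -> P p.
Proof.
move=> Pi PS; elim=> [|p IHp]; first by rewrite leqn0 => /eqP <-.
by rewrite leq_eqVlt => /orP[/eqP <- //|ip]; apply: PS => //; apply: IHp.
Qed.

Lemma gpr_comm i p l : (i <= p)%N -> (p < l)%N -> (l.+1 < n)%N ->
  gpr i p * t l = t l * gpr i p.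
Proof.
move=> ip; move: p ip; apply: gpr_ind => [|p ip IHp] pl ln; first by rewrite gpr_id mul1r mulr1.
have e := hr_farC hr; rewrite gprS // -mulrA e; [|lia..].
by rewrite mulrA IHp ?mulrA //; lia.
Qed.

Lemma gprv_comm i p l : (i <= p)%N -> (p < l)%N -> (l.+1 < n)%N ->
  gprv i p * t l = t l * gprv i p.
Proof.
move=> ip; move: p ip; apply: gpr_ind => [|p ip IHp] pl ln; first by rewrite gprv_id mul1r mulr1.
have e := hr_farC hr; rewrite gprvS // -mulrA IHp //; last by lia.
by rewrite mulrA e ?mulrA //; lia.
Qed.

Lemma gprvK i p : (i <= p)%N -> (p < n)%N -> gprv i p * gpr i p = 1.
Proof.
move=> ip; move: p ip; apply: gpr_ind => [|p ip IHp] pn; first by rewrite gprv_id gpr_id mulr1.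
rewrite gprS // gprvS // -mulrA (mulrA (gprv i p)) IHp; last exact: ltnW.
by rewrite mul1r (hr_ss hr).
Qed.

Lemma trp_gpr i p : (i <= p)%N -> (p.+1 < n)%N -> gpr i p * t p * gprv i p = trp t i p.+1.
Proof.
move=> ip; move: p ip; apply: gpr_ind => [|p ip IHp] pn.
  by rewrite gprv_id gpr_id mul1r mulr1 trp_s.
rewrite gprS // gprvS // trpS; last by lia.
rewrite -IHp; last exact: ltnW.
have b := hr_braid hr pn; have e1 := gpr_comm ip (ltnSn p) pn.
have e2 := gprv_comm ip (ltnSn p) pn.
rewrite !mulrA -e1 -(mulrA _ (gprv i p)) e2 !mulrA; congr (_ * _).
by rewrite -!mulrA; congr (_ * _); rewrite !mulrA b.
Qed.

Lemma gpr_x i p : (i <= p)%N -> (p < n)%N -> gpr i p * y p = yel y t i p.+1 * gpr i p.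
Proof.
move=> ip; move: p ip; apply: gpr_ind => [|p ip IHp] pn.
  by rewrite gpr_id /yel big_geq // addr0 mul1r mulr1.
have -> : yel y t i p.+2 = yel y t i p.+1 + trp t i p.+1 by rewrite /yel big_nat_recr //= addrA.
rewrite gprS // -mulrA (hr_sx1 hr) // mulrDr mulr1 mulrA IHp; last exact: ltnW.
rewrite [RHS]mulrDl !mulrA; congr (_ + _).
rewrite -trp_gpr // -!mulrA (mulrA (gprv i p)) gprvK ?(ltnW pn) //.
by rewrite mul1r (hr_ss hr) // mulr1.
Qed.

Lemma gpr_xX i p a : (i <= p)%N -> (p < n)%N ->
  gpr i p * y p ^+ a = yel y t i p.+1 ^+ a * gpr i p.
Proof.
move=> ip pn; elim: a => [|a IHa]; first by rewrite !expr0 mul1r mulr1.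
by rewrite exprS mulrA gpr_x // -mulrA IHa mulrA -exprS.
Qed.

End Coset.

Lemma SaE p a : Sa p a = \sum_(i < p.+1) \sum_(j < d)
  x p.+2 i ^+ j * ye p.+1 i ^+ a * tH p.+2 i p.+1 * emb p.+2 (yH i j).
Proof.
have hrP := hecke_relP k lam p.+2.
apply: eq_bigr => i _; apply: eq_bigr => j _; have ip : (i <= p)%N by rewrite -ltnS.
have i_n : (i < p.+1)%N by [].
have e1 : incl (\prod_(i <= l < p) s p.+1 l) = gpr (s p.+2) i p.
  rewrite /gpr (big_morph (@incl k lam p.+1) (fun a b => inclM a b) (incl1 k lam p.+1)).
  rewrite big_nat_cond [RHS]big_nat_cond; apply: eq_bigr => l /andP[/andP[_ lp] _].
  by rewrite incl_s // ltnS.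
have e2 : incl (\prod_(l <- rev (index_iota i p)) s p.+1 l) = gprv (s p.+2) i p.
  rewrite /gprv (big_morph (@incl k lam p.+1) (fun a b => inclM a b) (incl1 k lam p.+1)).
  rewrite big_seq [RHS]big_seq; apply: eq_bigr => l.
  by rewrite mem_rev mem_iota => h; rewrite incl_s // ltnS; lia.
rewrite /bb /bd !inclM !inclX e1 e2 !incl_x // -(mulrA _ (gpr _ _ _)) (gpr_xX hrP) //.
rewrite -[in RHS]/(yel _ _ _ _) /(tH _ _ _) -(trp_gpr hrP) // !mulrA.
by rewrite /incl (@emb_emb k lam d_gt0).
Qed.

(** In [SaE], y_j is replaced by its leading power, that power is moved through the transposition,
    and x_i is replaced by [ye]. The errors, bounded in L1, L2 and L3, have lower weight. *)
Lemma Sa_lead p a : Flt (wt (a + d)) (Sa p a - \sum_(j < d) x p.+2 p.+1 ^+ (d.-1 - j) * U p (a + j)).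
Proof.
rewrite SaE.
under [X in _ - X]eq_bigr => j _ do rewrite mulr_sumr.
rewrite [X in _ - X]exchange_big -sumrB /=; apply: Flt_sum => i _; rewrite -sumrB.
apply: Flt_sum => j _; have ip := ltn_ord i; have jd := ltn_ord j.
have i_n : (i < p.+2)%N by lia.
have Ft : Fil 1 (tH p.+2 i p.+1) by apply: Fil_tH => //; lia.
have Fya : Fil (wt a) (ye p.+1 i ^+ a) by apply: Fil_ye.
have Fxj : Fil (2 * j) (x p.+2 i ^+ j) by apply: Fil_xpow.
set b := (d.-1 - j)%N; set t := tH _ _ _ in Ft *; set y := ye _ _ in Fya *.
have wE : wt (a + d) = (2 * j + wt a + (2 * b).+1)%N by rewrite wt_addd // /b; lia.
have L1 : Flt (wt (a + d)) (x p.+2 i ^+ j * y ^+ a * t * (emb p.+2 (yH i j) - x p.+2 i ^+ b)).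
  have -> : emb p.+2 (yH i j) - x p.+2 i ^+ b = emb p.+2 (yH i j - x i.+1 i ^+ b).
    apply/eqP; rewrite subr_eq; apply/eqP.
    by rewrite -(emb_x k lam (ltnSn i) i_n) -embX // -embD ?subrK.
  have -> : wt (a + d) = (2 * j + wt a + 1 + 2 * b)%N by rewrite wE; lia.
  apply: FltMl => //; first by apply: FilM => //; apply: FilM.
  by apply: Flt_emb => //; apply: yH_lead.
have L2 : Flt (wt (a + d)) (x p.+2 i ^+ j * y ^+ a * (t * x p.+2 i ^+ b - x p.+2 p.+1 ^+ b * t)).
  by rewrite wE; apply: FltMl => //; [apply: FilM | apply: Flt_tHx].
have L3 : Flt (wt (a + d)) ((x p.+2 i ^+ j - y ^+ j) * (y ^+ a * (x p.+2 p.+1 ^+ b * t))).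
  have -> : wt (a + d) = (2 * j + (wt a + (2 * b + 1)))%N by rewrite wE; lia.
  have L0 := @Flt_x_ye p i j ip.
  apply: (FltMr d_gt0 (R := (2 * j)%N)); first exact: L0.
  by apply: FilM => //; apply: FilM => //; apply: Fil_xpow.
have -> : x p.+2 i ^+ j * y ^+ a * t * emb p.+2 (yH i j) -
    x p.+2 p.+1 ^+ b * (y ^+ (a + j) * t) =
  x p.+2 i ^+ j * y ^+ a * t * (emb p.+2 (yH i j) - x p.+2 i ^+ b) +
  x p.+2 i ^+ j * y ^+ a * (t * x p.+2 i ^+ b - x p.+2 p.+1 ^+ b * t) +
  (x p.+2 i ^+ j - y ^+ j) * (y ^+ a * (x p.+2 p.+1 ^+ b * t)).
  rewrite !mulrBr mulrBl !mulrA subrKA subrKA; congr (_ - _).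
  by rewrite -exprD (addnC j a) (@ye_X p i (a + j) b ip).
by apply: FltD => //; apply: FltD.
Qed.

(** [Sa_rec] is solved for its summand l = a. In the others the bubble of index a - l weighs 2(a -
    l) - 1 - ceil((a - l)/d), and floor(a/d) <= floor(l/d) + ceil((a - l)/d) keeps the product below
    wt(a + d). *)
Lemma Sa_top p a : Flt (wt (a + d)) (Sa p a - x p.+2 p.+1 ^+ (a + d)).
Proof.
elim/ltn_ind: a => a IHa.
have FS l : (l < a)%N -> Fil (wt (l + d)) (Sa p l).
  move=> la; rewrite -[Sa p l](subrK (x p.+2 p.+1 ^+ (l + d))).
  by apply: FilD; [apply: Flt_sub; apply: IHa | apply: Fil_xX].
have e (A S B : H p.+2) : S - (A + S + B) = - A - B.
  by rewrite (addrC A) -addrA opprD addrA subrr add0r opprD.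
rewrite Sa_rec big_ord_recr /= subnn Gm0 // incl1 mul1r e.
apply: FltB; last first.
  apply: Flt_sum => j _; have jd := ltn_ord j.
  have wd := wt_addd d_gt0 a.
  apply: (@Flt_Fil _ _ _ ((wt (a + d) - 2 * j).-1 + 2 * j)); first by lia.
  by apply: FilM => //; [apply: Fil_incl => //; apply: Fil_rho | apply: Fil_xpow].
apply: FltN => //; apply: Flt_sum => l _; have la := ltn_ord l.
have al : (0 < a - l)%N by rewrite subn_gt0.
have FG := Fil_incl d_gt0 (Fil_Gm k d_gt0 p.+1 al).
apply: Flt_Fil (FilM d_gt0 FG (FS _ la)).
have wa := wt_addd d_gt0 a; have wl := wt_addd d_gt0 l; have ea := wtE d_gt0 a; have el := wtE d_gt0 l.
have c1 : (a %/ d <= l %/ d + cdiv d (a - l))%N.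
  by rewrite -{1}(subnKC (ltnW la)); apply: divn_cdiv.
have c2 := cdiv_le d_gt0 (a - l); lia.
Qed.

(** Passing from a to a + d multiplies the block by x^d and adds the sum of [Sa_lead], which is
    x^{a+d} up to lower weight. So each full period d raises the coefficient by 1. *)
Lemma Dblock_lead p j : Flt (wt j) (Dblock p j - x p.+2 p.+1 ^+ j *+ (j %/ d)).
Proof.
elim/ltn_ind: j => j IHj; have [jd|dj] := ltnP j d.
  rewrite divn_small // mulr0n subr0 wt_small //; apply: Flt_sum => a _; have aj := ltn_ord a.
  have w : (wt a <= 2 * a)%N by apply: leq_subr.
  apply: (@Flt_Fil _ _ _ (2 * (j.-1 - a) + (wt a).+1)); first by move: (wt a) w => w; lia.
  by apply: FilM => //; [apply: Fil_xpow | apply: Fil_U].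
have [a ea] : exists a, j = (a + d)%N by exists (j - d)%N; rewrite subnK.
subst j; have IH : Flt (wt a) (Dblock p a - x p.+2 p.+1 ^+ a *+ (a %/ d)) by apply: IHj; lia.
have -> : Dblock p (a + d) = x p.+2 p.+1 ^+ d * Dblock p a +
    \sum_(j < d) x p.+2 p.+1 ^+ (d.-1 - j) * U p (a + j).
  rewrite /Dblock big_split_ord /= mulr_sumr; congr (_ + _); apply: eq_bigr => l _; have := ltn_ord l => ll.
    by rewrite mulrA -exprD; congr (_ ^+ _ * _); lia.
  by congr (_ ^+ _ * _); lia.
have -> : ((a + d) %/ d = (a %/ d).+1)%N by rewrite divnDr ?divnn ?d_gt0 ?addn1.
set D := Dblock p a; set S := \sum_(j < d) _; set X := x p.+2 p.+1.
have -> : X ^+ d * D + S - X ^+ (a + d) *+ (a %/ d).+1 =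
    X ^+ d * (D - X ^+ a *+ (a %/ d)) - (Sa p a - S) + (Sa p a - X ^+ (a + d)).
  rewrite mulrBr mulrnAr -exprD (addnC d a) mulrS.
  rewrite !opprD !opprK -!addrA (addrCA S (Sa p a)) [- Sa p a + _]addrA addNr add0r.
  by rewrite (addrCA (- (X ^+ (a + d) *+ _)) S) (addrC (- (X ^+ (a + d) *+ _))).
apply: FltD; last exact: Sa_top.
apply: FltB; last exact: Sa_lead.
by rewrite wt_addd // addnC; apply: FltMl => //; apply: Fil_xd.
Qed.

(** For one strand the average is x^j itself, whereas the general formula has the coefficient
    floor(j/d) + 1. They agree because x^j has lower weight once j >= d. *)
Lemma mackey_lead0 j : Flt (wt j) (x 1 0 ^+ j *+ (j %/ d)).
Proof.
have [jd|dj] := ltnP j d; first by rewrite divn_small // mulr0n; apply: Flt0.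
have [a ->] : exists a, j = (a + d)%N by exists (j - d)%N; rewrite subnK.
have F : Flt (wt (a + d)) (x 1 0 ^+ (a + d)).
  rewrite -[x 1 0 ^+ (a + d)](mackey0 d_gt0); apply: Flt_sum => i _; have id := ltn_ord i.
  have wd := wt_addd d_gt0 a.
  apply: (@Flt_Fil _ _ _ ((wt (a + d) - 2 * i).-1 + 2 * i)); first by lia.
  by apply: FilM => //; [apply: Fil_incl => //; apply: Fil_rho | apply: Fil_xpow].
by elim: (_ %/ _)%N => [|q IHq]; [apply: Flt0 | rewrite mulrS; apply: FltD].
Qed.

Definition psum n j : H n := \sum_(i < n) x n i ^+ j.

Lemma psumS n j : psum n.+1 j = incl (psum n j) + x n.+1 n ^+ j.
Proof.
rewrite /psum big_ord_recr incl_sum /=; congr (_ + _).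
by apply: eq_bigr => i _; rewrite inclX incl_x.
Qed.

Lemma Av_lead m j : Flt (wt j) (Av m j - psum m.+1 j *+ (j %/ d).+1).
Proof.
elim: m => [|p IHp].
  rewrite /Av /psum !big_ord1 tH_diag mul1r mulr1 mulrS opprD addrA subrr add0r.
  by apply: FltN => //; apply: mackey_lead0.
rewrite AvS psumS mulrnDl [_ ^+ _ *+ _.+1]mulrS.
have F1 := Flt_incl d_gt0 IHp; have F2 := Dblock_lead p j.
have := FltD F1 F2; congr (Flt _ _).
have e (C P D X Y : H p.+2) : C - P + (D - Y) = C + X + D - (P + (X + Y)).
  rewrite !opprD -!addrA (addrCA D) (addrCA X) (addrCA D (- X)).
  by rewrite [X + (_ + _)]addrA subrr add0r.
by rewrite -e inclB raddfMn.
Qed.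

End LeadingTerms.

(** * The center is generated by power sums *)

Section CenterFiltration.
Variables (k : fieldType) (lam : weight).
Local Notation H := (hecke k lam).
Local Notation x := (xH k lam).
Local Notation s := (sH k lam).
Local Notation d := (level lam).
Local Notation yH := (yH k lam).
Local Notation wt := (wt lam).
Local Notation tH := (tH k lam).
Local Notation cH := (cH lam).
Local Notation psum := (psum k lam).
Local Notation Fil := (@Fil k lam).
Local Notation Flt := (@Flt k lam).
Local Notation Gm := (@Gm k lam).
Hypothesis d_gt0 : (0 < d)%N.

Lemma psum_central n j (a : H n) : psum n j * a = a * psum n j.
Proof.
have hrP := hecke_relP k lam n.
elim/hecke_ind: a => [c|i i_n|i i_n|a b IHa IHb|a b IHa IHb].
- by rewrite cHC.
- rewrite /(psum _ _) mulr_suml mulr_sumr; apply: eq_bigr => l _.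
  by apply/esym/commrX/(hr_xx hrP).
- rewrite /(psum _ _) mulr_suml mulr_sumr.
  have i_n' : (i < n)%N := ltnW i_n.
  rewrite (bigD1 (Ordinal i_n')) // (bigD1 (Ordinal i_n)) /=; last by rewrite -val_eqE /= gtn_eqF.
  rewrite [RHS](bigD1 (Ordinal i_n')) // (bigD1 (Ordinal i_n)) /=; last by rewrite -val_eqE /= gtn_eqF.
  rewrite !addrA; congr (_ + _).
    rewrite (hr_sxX hrP) // (hr_sx1X hrP) //.
    by rewrite [RHS]addrACA addNr addr0 addrC.
  apply: eq_bigr => l /andP[li li1].
  by apply/esym/(hr_sx_farX hrP).
- by rewrite mulrDl mulrDr IHa IHb.
by rewrite mulrA IHa -!mulrA IHb.
Qed.

(** Polynomials in the power sums. The index bounds the weight of the expression term by term, which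
    is stronger than a bound on the element it represents. *)
Inductive gpow n : nat -> H n -> Prop :=
| gp_c R c : gpow R (cH n c)
| gp_p j : gpow (wt j) (psum n j)
| gp_D R y z : gpow R y -> gpow R z -> gpow R (y + z)
| gp_M R S y z : gpow R y -> gpow S z -> gpow (R + S) (y * z)
| gp_W R S z : (R <= S)%N -> gpow R z -> gpow S z.

Lemma gpow_central n R (g a : H n) : gpow R g -> g * a = a * g.
Proof.
move=> gR; elim: gR a => {R g} [R c|j|R y z _ IHy _ IHz|R S y z _ IHy _ IHz|R S z _ _ IHz] a //.
- by rewrite cHC.
- exact: psum_central.
- by rewrite mulrDl mulrDr IHy IHz.
by rewrite -mulrA IHz !mulrA IHy.
Qed.

Lemma gpow_Fil n R (g : H n) : gpow R g -> Fil R g.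
Proof.
elim=> {R g} [R c|j|R y z _ IHy _ IHz|R S y z _ IHy _ IHz|R S z RS _ IHz].
- by apply: (@FilW k lam n 0); last exact: Fil_cH.
- by apply: Fil_sum => i _; apply: Fil_xX.
- exact: FilD.
- exact: FilM.
exact: FilW IHz.
Qed.

Lemma gpowN n R (g : H n) : gpow R g -> gpow R (- g).
Proof.
by move=> gR; rewrite -mulN1r -(rmorph1 (@Defs.cH k lam n)) -rmorphN -[R]add0n; apply: gp_M => //; apply: gp_c.
Qed.

(** The candidate for the centralizer of H_n in H_{n+1}: polynomials in the power sums of all n + 1
    dots and in the last dot. The power sums of H_n lie in it, being p_j - x_{n+1}^j. *)
Inductive cspan n : nat -> H n.+1 -> Prop :=
| cs_0 R : cspan R 0
| cs_D R y z : cspan R y -> cspan R z -> cspan R (y + z)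
| cs_g R S g j : gpow S g -> (S + wt j <= R)%N -> cspan R (g * x n.+1 n ^+ j).

Lemma cspanW n R S (c : H n.+1) : (R <= S)%N -> cspan R c -> cspan S c.
Proof.
move=> RS cR; elim: cR RS => {R c} [R|R y z _ IHy _ IHz|R S' g j gS SR] RS.
- exact: cs_0.
- by apply: cs_D; [apply: IHy | apply: IHz].
by apply: cs_g gS _; apply: leq_trans RS.
Qed.

Lemma cspan_sum n R (I : Type) (r : seq I) (P : pred I) (F : I -> H n.+1) :
  (forall i, P i -> cspan R (F i)) -> cspan R (\sum_(i <- r | P i) F i).
Proof. by move=> FR; elim/big_ind: _ => //; [apply: cs_0 | apply: cs_D]. Qed.

Lemma cspanM n R S (c e : H n.+1) : cspan R c -> cspan S e -> cspan (R + S) (c * e).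
Proof.
move=> cR; elim: cR e => {R c} [R|R y z _ IHy _ IHz|R R' g i gR RR] e eS.
- by rewrite mul0r; apply: cs_0.
- by rewrite mulrDl; apply: cs_D; [apply: IHy | apply: IHz].
elim: eS => {S e} [S|S y z _ IHy _ IHz|S S' h j hS SS].
- by rewrite mulr0; apply: cs_0.
- by rewrite mulrDr; apply: cs_D.
rewrite -mulrA (mulrA (_ ^+ i)) -(gpow_central _ hS) -!mulrA -exprD mulrA.
by apply: cs_g (gp_M gR hS) _; have := wtD d_gt0 i j; lia.
Qed.

Lemma cspan_gpow n R (g : H n.+1) : gpow R g -> cspan R g.
Proof. by move=> gR; rewrite -[g]mulr1 -(expr0 (x n.+1 n)); apply: cs_g gR _; rewrite /(wt _) div0n addn0. Qed.

Lemma cspan_X n j : cspan (wt j) (x n.+1 n ^+ j).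
Proof.
by rewrite -[_ ^+ j]mul1r -(rmorph1 (@Defs.cH k lam n.+1)); apply: (cs_g (S := 0)) => //; apply: gp_c.
Qed.

Lemma cspanN n R (c : H n.+1) : cspan R c -> cspan R (- c).
Proof.
move=> cR; rewrite -mulN1r -[R]add0n; apply: cspanM => //; apply: cspan_gpow.
by rewrite -(rmorph1 (@Defs.cH k lam n.+1)); apply/gpowN/gp_c.
Qed.

Lemma cspan_incl n R (g : H n) : gpow R g -> cspan R (incl g).
Proof.
elim=> {R g} [R c|j|R y z _ IHy _ IHz|R S y z _ IHy _ IHz|R S z RS _ IHz].
- by rewrite incl_cH; apply/cspan_gpow/gp_c.
- rewrite -[incl _](addrK (x n.+1 n ^+ j)) -psumS; apply: cs_D.
    by apply: cspan_gpow; apply: gp_p.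
  by apply: cspanN; apply: cspan_X.
- by rewrite inclD; apply: cs_D.
- by rewrite inclM; apply: cspanM.
exact: cspanW IHz.
Qed.

(* The two statements are proved simultaneously by induction on n: averaging
   over coset representatives passes from the centralizer of H_n in H_{n+1} to
   the center of H_{n+1}, and the Mackey decomposition from the center of
   H_{n+1} and the centralizer of H_n to the centralizer of H_{n+1} in H_{n+2}. *)
Definition center_spanned n := forall R (z : H n), (forall a, a * z = z * a) -> Fil R z -> gpow R z.
Definition centralizer_spanned n := forall R (c : H n.+1), (forall a : H n, incl a * c = c * incl a) ->
  Fil R c -> cspan R c.

(** The coefficient is central in H_n because c and y_j commute with H_n. As y_j weighs 2(d - 1 - j)
    and the trace takes away 2(d - 1), its weight is R - 2j. *)
Lemma zeta_cspan n R (c : H n.+1) j : center_spanned n -> (forall a : H n, incl a * c = c * incl a) ->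
  Fil R c -> (j < d)%N -> cspan R (incl (trH (c * yH n j)) * x n.+1 n ^+ j).
Proof.
move=> cA cC cR jd; have Fy := FilM d_gt0 cR (Fil_yH k d_gt0 n jd).
have [Rj|jR] := ltnP R (2 * j).
  by rewrite (trH_Fil_eq0 d_gt0 _ Fy) ?incl0 ?mul0r; [apply: cs_0 | lia].
have -> : R = (R - 2 * j + wt j)%N by rewrite (wt_small jd) subnK.
apply: cspanM; last exact: cspan_X.
apply/cspan_incl/cA.
  by move=> a; rewrite -trHl // mulrA cC -mulrA yH_comm // mulrA trHr.
by apply: (Fil_trH d_gt0); apply: FilW Fy; lia.
Qed.

Lemma centralizer_spanned0 : center_spanned 0 -> centralizer_spanned 0.
Proof.
move=> cA R c cC cR; rewrite -[c](mackey0 d_gt0); apply: cspan_sum => j _.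
by apply: zeta_cspan.
Qed.

(** [Sa_rec] is solved for its top summand as in [Sa_top], but exactly: the bubbles and the traces
    in it are central in H_{p+1}. *)
Lemma Sa_cspan p a : center_spanned p.+1 -> cspan (wt (a + d)) (Sa k lam p a).
Proof.
move=> cA; elim/ltn_ind: a => a IHa.
have := Sa_rec k d_gt0 p a; rewrite big_ord_recr /= subnn Gm0 // incl1 mul1r => e.
have -> : Sa k lam p a = x p.+2 p.+1 ^+ (a + d) -
    \sum_(j < d) incl (trH (x p.+2 p.+1 ^+ (a + d) * yH p.+1 j)) * x p.+2 p.+1 ^+ j -
    \sum_(l < a) incl (Gm p.+1 (a - l)) * Sa k lam p l.
  have gen (A S B X : H p.+2) : X = A + S + B -> S = X - B - A.
    by move=> ->; rewrite addrK addrC addKr.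
  exact: gen e.
have X_central (b : H p.+1) : incl b * x p.+2 p.+1 ^+ (a + d) = x p.+2 p.+1 ^+ (a + d) * incl b.
  by rewrite (commrX _ (incl_x_comm b)).
apply: cs_D; first apply: cs_D.
- exact: cspan_X.
- apply: cspanN; apply: cspan_sum => j _; apply: zeta_cspan => //.
  by apply: Fil_xX.
apply: cspanN; apply: cspan_sum => l _; have la := ltn_ord l.
have al : (0 < a - l)%N by rewrite subn_gt0.
have FG := Fil_Gm k d_gt0 p.+1 al.
have gG : gpow (2 * (a - l) - 1 - cdiv d (a - l)) (Gm p.+1 (a - l)).
  by apply: cA => // b; rewrite GmC.
apply: cspanW (cspanM (cspan_incl gG) (IHa _ la)).
have wa := wt_addd d_gt0 a; have wl := wt_addd d_gt0 l; have ea := wtE d_gt0 a; have el := wtE d_gt0 l.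
have c1 : (a %/ d <= l %/ d + cdiv d (a - l))%N.
  by rewrite -{1}(subnKC (ltnW la)); apply: divn_cdiv.
have c2 := cdiv_le d_gt0 (a - l); lia.
Qed.

(** Since c commutes with H_{p+1}, its component in H s H depends only on c' = tr(c s), which
    centralizes H_p and so is a combination of terms g x^j. Each contributes g times [Sa], and the
    weight 2d - 1 lost in the trace is regained as wt(j + d) - wt(j). *)
Lemma centralizer_spannedS p : center_spanned p.+1 -> centralizer_spanned p -> centralizer_spanned p.+1.
Proof.
move=> cA cC R c cc cR; rewrite -[c](mackey d_gt0); apply: cs_D; last first.
  by apply: cspan_sum => j _; apply: zeta_cspan.
pose c' := trH (c * s p.+2 p).
pose L (u : H p.+1) := cas (fun a b => incl (a * u) * (s p.+2 p * incl b)).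
have -> : cas (fun a b => incl (trH (c * (incl a * s p.+2 p))) * (s p.+2 p * incl b)) = L c'.
  by apply: eq_cas => a b; rewrite (mulrA c) -cc -mulrA trHl.
have c'C (b : H p) : incl b * c' = c' * incl b.
  by rewrite -trHl // mulrA cc -mulrA incl_s_comm mulrA trHr.
have LD u v : L (u + v) = L u + L v.
  by rewrite /L -casD; apply: eq_cas => a b; rewrite mulrDr inclD mulrDl.
have L0 : L 0 = 0 by apply: cas_eq0 => a b; rewrite mulr0 incl0 mul0r.
have [Rd|dR] := ltnP R (2 * d).-1.
  by rewrite /c' (trH_s_Fil_eq0 d_gt0 Rd cR) L0; apply: cs_0.
have Fc' : Fil (R - (2 * d).-1) c' by apply: (Fil_trH_s d_gt0); rewrite subnK.
suff main R' u : cspan R' u -> (R' + (2 * d).-1 <= R)%N -> cspan R (L u).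
  by apply: main (cC _ c' c'C Fc') _; rewrite subnK.
elim=> {R' u} [R'|R' y z _ IHy _ IHz|R' S g j gS SR] RR.
- by rewrite L0; apply: cs_0.
- by rewrite LD; apply: cs_D; [apply: IHy | apply: IHz].
have -> : L (g * x p.+1 p ^+ j) = incl g * Sa k lam p j.
  rewrite /L /Sa (cas_morph (f := fun z => incl g * z)) ?mulr0 //; last by move=> y z; rewrite mulrDr.
  by apply: eq_cas => a b; rewrite (mulrA a) -(gpow_central _ gS) -!mulrA inclM !mulrA.
apply: cspanW (cspanM (cspan_incl gS) (Sa_cspan j cA)); rewrite wt_addd //; lia.
Qed.

Lemma cspan_avg n R (c : H n.+1) : cspan R c -> exists2 g, gpow R g &
  Flt R (\sum_(i < n.+1) tH n.+1 i n * c * tH n.+1 i n - g).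
Proof.
elim=> {R c} [R|R y z _ [g gR Fg] _ [h hR Fh]|R S g j gS SR].
- exists 0; first by rewrite -(rmorph0 (@Defs.cH k lam n.+1)); apply: gp_c.
  by rewrite subr0 big1 => [|i _]; [apply: Flt0 | rewrite mulr0 mul0r].
- exists (g + h); first exact: gp_D.
  have := FltD Fg Fh; congr (Flt _ _); rewrite addrACA -opprD -big_split; congr (_ - _).
  by apply: eq_bigr => i _; rewrite mulrDr mulrDl.
exists (g * (cH n.+1 (j %/ d).+1%:R * psum n.+1 j)).
  by apply: gp_W SR (gp_M gS _); rewrite -[wt j]add0n; apply: gp_M; [apply: gp_c | apply: gp_p].
have -> : \sum_(i < n.+1) tH n.+1 i n * (g * x n.+1 n ^+ j) * tH n.+1 i n = g * Av k lam n j.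
  by rewrite mulr_sumr; apply: eq_bigr => i _; rewrite mulrA -(gpow_central _ gS) -!mulrA.
rewrite -mulrBr rmorph_nat mulr_natl; apply: Flt_W SR _.
by apply: FltMl => //; [apply: gpow_Fil | apply: Av_lead].
Qed.

Hypothesis char_k : [pchar k]%R =i pred0.

(** A central z equals each of its conjugates, so n + 1 times z is the average, whose leading part g
    is a polynomial in power sums by [cspan_avg]. The difference is central of smaller weight and is
    left to the induction on R; the division by n + 1 uses characteristic zero. *)
Lemma center_spannedS n : centralizer_spanned n -> center_spanned n.+1.
Proof.
move=> cC.
have N0 : (n.+1%:R : k) != 0 by rewrite (pcharf0P _).1.
have zE (z : H n.+1) : z = cH n.+1 (n.+1%:R)^-1 * (z *+ n.+1).
  have e : cH n.+1 (n.+1%:R : k) = n.+1%:R := rmorph_nat _ _.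
  by rewrite -[in RHS](mulr_natl z) -e mulrA -rmorphM mulVf // rmorph1 mul1r.
have gpowV R (z : H n.+1) : gpow R (z *+ n.+1) -> gpow R z.
  by move=> zR; rewrite (zE z) -[R]add0n; apply: gp_M => //; apply: gp_c.
have avg R (z : H n.+1) : (forall a, a * z = z * a) -> Fil R z ->
    exists2 g, gpow R g & Flt R (z *+ n.+1 - g).
  move=> zC zR; have [g gR Fz] := cspan_avg (cC R z (fun a => zC (incl a)) zR).
  exists g => //; move: Fz; congr (Flt _ (_ - _)).
  under eq_bigr => i _ do rewrite zC -mulrA tHK // mulr1.
  by rewrite sumr_const card_ord.
elim=> [|R IHR] z zC zR; have [g gR Fz] := avg _ z zC zR; apply: gpowV.
  by move/eqP: Fz; rewrite subr_eq0 => /eqP ->.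
rewrite -[z *+ _](subrK g); apply: gp_D => //; apply: gp_W (leqnSn R) _; apply: IHR => // a.
by rewrite mulrBr mulrBl (gpow_central _ gR) mulrnAr mulrnAl zC.
Qed.

Lemma center_centralizer_spanned n : center_spanned n /\ centralizer_spanned n.
Proof.
elim: n => [|n [cA cC]].
  have cA : center_spanned 0 by move=> R z _ _; have [c ->] := hecke0_cH z; apply: gp_c.
  by split=> //; apply: centralizer_spanned0.
by have cA' := center_spannedS cC; split=> //; apply: centralizer_spannedS.
Qed.

Lemma center_gpow n (z : H n) : (forall a, a * z = z * a) -> exists R, gpow R z.
Proof. by move=> zC; have [R zR] := Fil_exhaust d_gt0 z; exists R; apply: (center_centralizer_spanned n).1. Qed.

End CenterFiltration.

(** * Newton's identities for bubbles *)

Section Newton.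
Variable R : pzRingType.

(* The defect of Newton's identities v G' = G P between power series. *)
Definition newton (G P : nat -> R) c := G c *+ c - \sum_(b < c) G (c.-1 - b)%N * P b.+1.

(* Multiplication of the power series G by 1 - v y. *)
Definition mulv (y : R) (G : nat -> R) c := G c - (if c is c'.+1 then G c' * y else 0).

Lemma mulv_sum y (G F : nat -> R) c : \sum_(b < c.+1) mulv y G (c - b) * F b =
  \sum_(b < c.+1) G (c - b)%N * F b - \sum_(b < c) G (c.-1 - b)%N * y * F b.
Proof.
rewrite big_ord_recr [in RHS]big_ord_recr /= subnn /mulv subr0 addrAC; congr (_ + _).
rewrite -sumrB; apply: eq_bigr => b _; have bc := ltn_ord b.
rewrite mulrBl; congr (_ - _); case E: (c - b)%N => [|e]; first by lia.
by congr (G _ * _ * _); lia.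
Qed.

(** The logarithmic derivative of 1 - v y, times v, is minus the sum of (v y)^b over b >= 1. The
    defect itself gets multiplied by 1 - v y. *)
Lemma newton_mulv y G P c : (forall b, GRing.comm y (P b)) ->
  newton (mulv y G) (fun b => P b - y ^+ b) c =
  newton G P c - (if c is c'.+1 then newton G P c' * y else 0).
Proof.
move=> yP; case: c => [|c]; first by rewrite /newton !big_ord0 !mulr0n !subr0.
rewrite /newton /=.
have -> : \sum_(b < c.+1) mulv y G (c - b) * (P b.+1 - y ^+ b.+1) =
    \sum_(b < c.+1) G (c - b)%N * P b.+1 - (\sum_(b < c) G (c.-1 - b)%N * P b.+1) * y - G c * y.
  under eq_bigr => b _ do rewrite mulrBr.
  rewrite sumrB (mulv_sum y G (fun b => P b.+1)) (mulv_sum y G (fun b => y ^+ b.+1)); congr (_ - _ - _).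
    by rewrite mulr_suml; apply: eq_bigr => b _; rewrite -!mulrA yP.
  rewrite big_ord_recl subn0 expr1 -[RHS]addr0 -addrA; congr (_ + _).
  apply/eqP; rewrite subr_eq0; apply/eqP; apply: eq_bigr => b _.
  by rewrite lift0 -mulrA -exprS; congr (G _ * _); lia.
have gen (E h g S Z : R) : E - (h + g) - (S - Z - g) = E - S - (h - Z).
  rewrite (opprB (S - Z)) (opprD h) addrA addrA subrK (opprB S) (opprB h).
  by rewrite addrACA [RHS]addrACA [- h - S]addrC.
by rewrite /mulv mulrnBl mulrBl !mulrnAl [G c * y *+ c.+1]mulrSr gen.
Qed.

Lemma newton_ex G N : G 0%N = 1 -> exists P, forall c, (c <= N)%N -> newton G P c = 0.
Proof.
move=> G0; elim: N => [|N [P PN]].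
  by exists G => c; rewrite leqn0 => /eqP ->; rewrite /newton big_ord0 mulr0n subrr.
exists (fun b => if b == N.+1 then G N.+1 *+ N.+1 - \sum_(b < N) G (N - b)%N * P b.+1 else P b) => c.
rewrite leq_eqVlt => /orP[/eqP ->|cN].
  rewrite /newton big_ord_recr /= subnn G0 mul1r eqxx.
  under eq_bigr => b _ do rewrite eqSS (ltn_eqF (ltn_ord b)).
  by rewrite addrC subrK subrr.
rewrite -(PN c) // /newton; congr (_ - _); apply: eq_bigr => b _.
by rewrite ifF //; apply/eqP; have := ltn_ord b; lia.
Qed.

Lemma newton_div y G P N : (forall b, GRing.comm y (P b)) ->
  (forall c, (c <= N)%N -> newton (mulv y G) (fun b => P b - y ^+ b) c = 0) ->
  forall c, (c <= N)%N -> newton G P c = 0.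
Proof.
move=> yP H0; elim=> [|c IHc] cN; first by rewrite /newton big_ord0 mulr0n subrr.
have := H0 _ cN; rewrite newton_mulv // IHc ?(ltnW cN) // mul0r subr0 //.
Qed.

Lemma newton_mul y G P N : (forall b, GRing.comm y (P b)) ->
  (forall c, (c <= N)%N -> newton G P c = 0) ->
  forall c, (c <= N)%N -> newton (mulv y G) (fun b => P b - y ^+ b) c = 0.
Proof.
move=> yP H0 c cN; rewrite newton_mulv // H0 // sub0r; case: c cN => [|c] cN; first by rewrite oppr0.
by rewrite H0 ?mul0r ?oppr0 // ltnW.
Qed.

Lemma newton_ext G G' P P' : G =1 G' -> P =1 P' -> newton G P =1 newton G' P'.
Proof. by move=> /funext -> /funext ->. Qed.

End Newton.

Section Bubbles.
Variables (k : fieldType) (lam : weight).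
Local Notation H := (hecke k lam).
Local Notation x := (xH k lam).
Local Notation s := (sH k lam).
Local Notation d := (level lam).
Local Notation psum := (psum k lam).
Local Notation Gm := (@Gm k lam).
Local Notation balg := (@balg k lam).
Hypothesis d_gt0 : (0 < d)%N.

(** The double sum in [trH_x_rec] is the convolution with v^2/(1 - v X)^2; multiplying twice by 1 -
    v X undoes it. *)
Lemma trH_x_diff n N :
  let X := x n.+1 n in
  let w M := trH (x n.+2 n.+1 ^+ M) - incl (trH (x n.+1 n ^+ M)) in
  w N.+2 - X * w N.+1 - X * (w N.+1 - X * w N) = trH (x n.+2 n.+1 ^+ N).
Proof.
move=> X w; pose f' N := trH (x n.+2 n.+1 ^+ N).
pose T M := \sum_(l < M.+1) X ^+ l * f' (M - l)%N.
pose W M := \sum_(l < M.-1) X ^+ l * T (M.-2 - l)%N.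
have wW M : w M = W M.
  rewrite /w trH_x_rec // addrC addKr /W /T.
  case: M => [|M]; first by rewrite !big_ord0.
  rewrite big_ord_recr /= subnn big_ord0 addr0; apply: eq_bigr => l _; have lM := ltn_ord l.
  rewrite mulr_sumr (_ : (M - l = (M.-1 - l).+1)%N); last by lia.
  apply: eq_bigr => l' _; have lM' := ltn_ord l'; rewrite mulrA -exprD.
  by congr (_ * trH (_ ^+ _)); lia.
have TS M : T M.+1 = f' M.+1 + X * T M.
  rewrite /T big_ord_recl subn0 expr0 mul1r; congr (_ + _).
  by rewrite mulr_sumr; apply: eq_bigr => l _; rewrite lift0 exprS -mulrA.
have WS M : W M.+2 = T M + X * W M.+1.
  rewrite /W /= big_ord_recl subn0 expr0 mul1r; congr (_ + _).
  rewrite mulr_sumr; apply: eq_bigr => l _; rewrite lift0 exprS -mulrA.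
  by congr (_ * (_ * T _)); have := ltn_ord l; lia.
rewrite !wW WS addrK; case: N => [|N].
  have -> : W 1 = 0 by rewrite /W big_ord0.
  have -> : W 0 = 0 by rewrite /W big_ord0.
  by rewrite mulr0 subr0 mulr0 subr0 /T big_ord1 expr0 mul1r.
by rewrite WS addrK TS addrK.
Qed.

(** The identity (1 - v(X + 1))(1 - v(X - 1)) = (1 - v X)^2 - v^2, where A, B, C and a, b, c are
    consecutive coefficients of the two series. *)
Lemma mulv_alg (R : pzRingType) (X A B C a b c : R) :
  X * (B - b) = (B - b) * X -> X * (C - c) = (C - c) * X ->
  A - a - X * (B - b) - X * (B - b - X * (C - c)) = C ->
  A - B * (X - 1) - (B - C * (X - 1)) * (X + 1) = a - b * X - (b - c * X) * X.
Proof.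
move=> Xu Xw; set u := B - b in Xu *; set w := C - c in Xw *.
rewrite mulrBr Xw Xu mulrA Xw; set p := u * X; set q := w * X * X => e.
have {e} AE : A = a + (p + p) - q + C.
  move/eqP: e; rewrite !subr_eq => /eqP ->; rewrite addrC -!addrA; congr (a + _).
  by rewrite (addrCA C) (addrC (- q)) (addrC C) -addrA.
have BE : B = u + b by rewrite subrK.
have CE : C = w + c by rewrite subrK.
have XX : (X - 1) * (X + 1) = X * X - 1 by rewrite mulrDr mulr1 mulrBl mul1r addrA subrK.
have -> : (B - C * (X - 1)) * (X + 1) = B * (X + 1) - (C * X * X - C).
  by rewrite mulrBl -[C * (X - 1) * (X + 1)]mulrA XX mulrBr mulr1 mulrA.
have -> : A - B * (X - 1) - (B * (X + 1) - (C * X * X - C)) = A - (B * X + B * X) + (C * X * X - C).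
  have gen (g Z : R) : A - (g - B) - (g + B - Z) = A - (g + g) + Z.
    rewrite !opprB addrACA [B - g]addrC opprD [- g + B + _]addrACA subrr addr0.
    by rewrite [RHS]addrAC opprD.
  by rewrite mulrBr mulrDr mulr1 gen.
have -> : C * X * X - C = q + c * X * X - C by rewrite {1}CE (mulrDl w c) mulrDl.
have -> : B * X = p + b * X by rewrite BE mulrDl.
rewrite mulrBl opprB AE; set r := b * X; set t := c * X * X.
clearbody p q r t; clear.
rewrite (_ : p + r + (p + r) = (p + p) + (r + r)); last exact: addrACA.
have -> : a - r + (t - r) = a - (r + r) + t by rewrite addrA [LHS]addrAC -[a - r - r]addrA -opprD.
move: (p + p) (r + r) => P S.
rewrite [a + _ - q]addrAC [_ + P + C]addrAC opprD [_ + (- P - S)]addrA addrK.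
have -> : q + t - C = - (C - q) + t by rewrite opprB addrAC.
rewrite -[a - q + C]addrA (addrC (- q)); set D := C - q.
by rewrite [X in X + _ = _]addrAC addrA addrK.
Qed.

Local Notation cH := (cH lam).

(* Hence, up to a factor with scalar coefficients, the generating series of the
   bubbles is the product over i of
   (1 - v x_i)^2 / ((1 - v (x_i + 1)) (1 - v (x_i - 1))), and bpow below is its
   power sum. *)
Lemma Gm_rel n : let X := x n.+1 n in
  mulv (X + 1) (mulv (X - 1) (Gm n.+1)) =1 mulv X (mulv X (fun c => incl (Gm n c))).
Proof.
move=> X [|[|c]]; rewrite /mulv ?(Gm0 _ d_gt0) ?incl1 ?subr0 //; last first.
  have cX (a : H n) : X * (Gm n.+1 c - incl a) = (Gm n.+1 c - incl a) * X.
    by rewrite mulrBl mulrBr (GmC d_gt0) incl_x_comm.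
  have cX' (a : H n) : X * (Gm n.+1 c.+1 - incl a) = (Gm n.+1 c.+1 - incl a) * X.
    by rewrite mulrBl mulrBr (GmC d_gt0) incl_x_comm.
  apply: mulv_alg => //; have := @trH_x_diff n (d.-1 + c).
  by rewrite /= /(Gm _ _) -!addnS.
rewrite !(Gm1 _ d_gt0) incl_cH !mul1r -[LHS]addrA -[RHS]addrA; congr (_ + _).
by rewrite (opprD X) (opprD X 1) addrACA addNr addr0.
Qed.

Definition bpow (pi : nat -> k) n b : H n :=
  cH n (pi b) + \sum_(i < n) ((x n i + 1) ^+ b + (x n i - 1) ^+ b - x n i ^+ b *+ 2).

Lemma inclMn n (a : H n) c : incl (a *+ c) = incl a *+ c.
Proof. exact: raddfMn. Qed.

Lemma incl_newton n (G P : nat -> H n) c :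
  newton (fun c => incl (G c)) (fun b => incl (P b)) c = incl (newton G P c).
Proof.
rewrite /newton inclB inclMn incl_sum; congr (_ - _).
by apply: eq_bigr => b _; rewrite inclM.
Qed.

Lemma bpow_comm pi n b : GRing.comm (x n.+1 n) (bpow pi n.+1 b).
Proof.
rewrite /GRing.comm /bpow mulrDl mulrDr cHC; congr (_ + _).
rewrite mulr_suml mulr_sumr; apply: eq_bigr => i _.
have c : GRing.comm (x n.+1 n) (x n.+1 i) by apply: (hr_xx (hecke_relP k lam n.+1)).
apply: commrB; last by rewrite -mulr_natr; apply: commrM; [apply: commrX|apply: commr_nat].
by apply: commrD; apply: commrX; [apply: commrD|apply: commrB] => //; apply: commr1.
Qed.

Lemma bpowS pi n b : let X := x n.+1 n in
  bpow pi n.+1 b - (X - 1) ^+ b - (X + 1) ^+ b = incl (bpow pi n b) - X ^+ b - X ^+ b.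
Proof.
move=> X; rewrite /bpow inclD incl_cH incl_sum big_ord_recr /= -/X.
set S := \sum_(i < n) _; set S' := \sum_(i < n) _.
have -> : S = S'.
  apply: eq_bigr => i _; have i_n := ltn_ord i.
  by rewrite inclB inclD inclMn !inclX inclD inclB incl1 incl_x.
rewrite mulr2n addrA [_ + _ ^+ b]addrC opprD !addrA.
move: (cH n.+1 (pi b) + S') ((X - 1) ^+ b) ((X + 1) ^+ b) (X ^+ b) => E A B U.
rewrite -[E + A + B]addrA -[_ - A - B]addrA -opprD; move: (A + B) => D.
by rewrite [LHS]addrAC [_ - U - D]addrAC addrK.
Qed.

(** In H_0 the bubbles are scalars and [pi] consists of the power sums that Newton's identities
    assign to them. For a new strand, the identities pass to the right side of [Gm_rel] by
    [newton_mul], and from its left side back to the new bubbles by [newton_div]. *)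
Lemma bubble_newton N : exists pi, forall n c, (c <= N)%N -> newton (Gm n) (bpow pi n) c = 0.
Proof.
have [P PN] := newton_ex N (@Gm0 k lam d_gt0 0).
pose pi b := projT1 (cid (hecke0_cH (P b))).
exists pi; elim=> [|n IHn].
  move=> c cN; rewrite -(PN c cN); apply: newton_ext => // b.
  by rewrite /bpow big_ord0 addr0 /pi; case: cid.
have cX b := bpow_comm pi n b; set X := x n.+1 n in cX.
have c1 : GRing.comm X 1 by apply: commr1.
have sym (a b : H n.+1) : GRing.comm a b -> GRing.comm b a by move=> /commr_sym.
have cXm b : GRing.comm (X - 1) (bpow pi n.+1 b) by apply/sym/commrB; [apply: sym|apply: commr1].
have cXp b : GRing.comm (X + 1) (bpow pi n.+1 b) by apply/sym/commrD; [apply: sym|apply: commr1].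
apply: (newton_div cXm).
apply: (@newton_div _ (X + 1)).
  move=> b; apply: commrB => //; apply: commrX; apply: commrB; last exact: commr1.
  by apply/sym/commrD => //; apply: commr1.
move=> c cN; rewrite (newton_ext (Gm_rel n) (bpowS pi n)).
have cI (a : H n) : GRing.comm X (incl a) by rewrite /GRing.comm incl_x_comm.
apply: (newton_mul (N := N)) => // [b|{}c {}cN].
  by apply: commrB => //; apply: commrX.
apply: (newton_mul (N := N)) => // {}c {}cN.
by rewrite incl_newton IHn // incl0.
Qed.

Lemma balgN n (z : H n) : balg z -> balg (- z).
Proof.
by move=> bz; rewrite -mulN1r -(rmorph1 (@Defs.cH k lam n)) -rmorphN; apply: balg_mul => //; apply: balg_const.
Qed.

Lemma balg_sum n (I : Type) (r : seq I) (F : I -> H n) : (forall i, balg (F i)) -> balg (\sum_(i <- r) F i).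
Proof.
move=> bF; elim: r => [|i r IHr]; first by rewrite big_nil -(rmorph0 (@Defs.cH k lam n)); apply: balg_const.
by rewrite big_cons; apply: balg_add.
Qed.

Lemma balg_nat n c (z : H n) : balg z -> balg (z *+ c).
Proof.
move=> bz; rewrite -mulr_natl -(rmorph_nat (@Defs.cH k lam n)).
by apply: balg_mul => //; apply: balg_const.
Qed.

Lemma balg_Gm n c : balg (Gm n c). Proof. exact: balg_bubble. Qed.

(** As the bubble series starts with 1, Newton's identities are solved for [bpow] without
    division. *)
Lemma balg_dpow n c : balg (\sum_(i < n) ((x n i + 1) ^+ c + (x n i - 1) ^+ c - x n i ^+ c *+ 2)).
Proof.
have [pi piN] := bubble_newton c.
suff : balg (bpow pi n c).
  rewrite /bpow => b; rewrite -[\sum_(i < n) _](addKr (cH n (pi c))).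
  by apply: balg_add => //; rewrite -rmorphN; apply: balg_const.
suff : forall m, (m <= c)%N -> balg (bpow pi n m) by apply.
elim/ltn_ind=> -[|m] IH mc.
  by apply: balg_add; [apply: balg_const|apply: balg_sum => i; rewrite !expr0 mulr2n subrr -(rmorph0 (@Defs.cH k lam n)); apply: balg_const].
have /eqP := piN n _ mc; rewrite /newton big_ord_recr /= subnn (Gm0 _ d_gt0) mul1r subr_eq0.
rewrite addrC -subr_eq => /eqP <-; apply: balg_add; first by apply: balg_nat; apply: balg_Gm.
apply/balgN/balg_sum => i; apply: balg_mul; first exact: balg_Gm.
by apply: IH; have := ltn_ord i; lia.
Qed.

Hypothesis char_k : [pchar k]%R =i pred0.

Lemma dpow_expand (R : pzRingType) (y : R) j :
  (y + 1) ^+ j.+2 + (y - 1) ^+ j.+2 - y ^+ j.+2 *+ 2 =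
  y ^+ j *+ (2 * 'C(j.+2, 2)) +
  \sum_(l < j) y ^+ (j - l.+1) * ((1 + (-1) ^+ l.+1) *+ 'C(j.+2, l.+3)).
Proof.
rewrite (exprDn_comm _ (commr1 y)) (exprDn_comm _ (commrN1 y)) -big_split /=.
rewrite !big_ord_recl /= !subn0 !expr0 !mulr1 !bin0 !mulr1n.
rewrite /bump !add1n /= !expr1 !expr1n sqrrN expr1n !mulr1 mulrN1 mulNrn subrr add0r.
rewrite -mulr2n [X in X = _]addrAC subrr add0r -mulr2n -mulrnA mulnC; congr (_ *+ _ + _); first by rewrite !subSS subn0.
apply: eq_bigr => l _; rewrite !add1n /= expr1n !subSS -mulrnDl -mulrDr mulrnAr; congr (_ * (1 + _) *+ _).
by rewrite exprS exprS mulrA mulrNN !mul1r.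
Qed.

Lemma balg_psum n j : balg (psum n j).
Proof.
elim/ltn_ind: j => j IHj.
(* The exponent j + 2 makes p_j the leading term: its coefficient 2 binom(j + 2, 2) is nonzero in
   characteristic zero, and the other terms involve lower power sums. *)
have := balg_dpow n j.+2.
under eq_bigr => i _ do rewrite dpow_expand.
rewrite big_split /= sumrMnl exchange_big /= => b.
have {}b : balg (psum n j *+ (2 * 'C(j.+2, 2))).
  rewrite -[_ *+ _](addrK (\sum_(l < j) \sum_(i < n) x n i ^+ (j - l.+1) * ((1 + (-1) ^+ l.+1) *+ 'C(j.+2, l.+3)))).
  apply: balg_add => //; apply/balgN/balg_sum => l; rewrite -mulr_suml; apply: balg_mul.
    by apply: IHj; have := ltn_ord l; lia.
  rewrite -(rmorph1 (@Defs.cH k lam n)) -rmorphN -rmorphXn -rmorphD -rmorphMn; exact: balg_const.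
set M := (2 * _)%N in b; have M0 : M%:R != 0 :> k.
  rewrite (iffLR (pcharf0P k) char_k) /M -lt0n; have : (0 < 'C(j.+2, 2))%N by rewrite bin_gt0; lia.
  by lia.
rewrite -[psum n j]mul1r -(rmorph1 (@Defs.cH k lam n)) -(mulVf M0) rmorphM rmorph_nat -mulrA mulr_natl.
by apply: balg_mul => //; apply: balg_const.
Qed.

Lemma center_balg n (z : H n) : (forall a, a * z = z * a) -> balg z.
Proof.
move=> /(center_gpow d_gt0 char_k)[R]; elim=> {z R} [R c|j|R y z _ by_ _ bz|R S y z _ by_ _ bz|//].
- exact: balg_const.
- exact: balg_psum.
- exact: balg_add.
exact: balg_mul.
Qed.

End Bubbles.

Lemma level_gt0 (lam : weight) : (exists i : int, lam i <> 0%N) -> (0 < level lam)%N.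
Proof.
case=> i /eqP li; have ilam : i \in finsupp lam by rewrite mem_finsupp.
by rewrite /level (big_rem i) //=; lia.
Qed.

Theorem theorem7p6 (k : fieldType) (char_k : [pchar k]%R =i pred0)
    (lam : weight) (lam_neq0 : exists i : int, lam i <> 0%N) (n : nat)
    (X Y : kobj k lam) (phi : bmor (Fobj n X) (Fobj n Y)) :
  exists f : kmor X Y, Fmor n f = phi.
Proof.
have d_gt0 := level_gt0 lam_neq0.
exact: (full_of_center d_gt0 (@center_balg _ _ d_gt0 char_k)).
Qed.
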